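(* Let $k$ be an even non-negative integer, let $\chi$ be an odd primitive Dirichlet character modulo $q$, and let $a,x>0$. Then \begin{align*} \sum_{n=1}^\infty\sigma_{k,\chi}(n) K_0(a\sqrt{nx})=&\ \delta_k \frac{2}{a^2x} L(1,\chi)- \frac{ L(-k,\chi) }{4}\left( \log \left(\frac{8\pi}{a^2} \right) +\frac{ L'(-k,\chi)}{ L(-k,\chi)} -2\gamma \right)+\frac{ L(-k,\chi) }{4} \log x\\ &+(-1)^{\frac{k}{2}}\frac{i\,k!\,q^k}{2 ({2\pi })^{k+1} } \tau(\chi) \sum_{n=1}^\infty \bar{\sigma}_{k, \bar{\chi}}(n) \left(\frac{1}{n^{k+1}}-\frac{1}{( n+\frac{a^2qx}{16\pi^2} )^{k+1} } \right), \end{align*} where $\delta_k=1$ if $k=0$ and $\delta_k=0$ if $k>0$, and $\gamma$ is Euler's constant.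
   Context: For a Dirichlet character $\chi$ and $z\in\mathbb{C}$: $\sigma_{z,\chi}(n)=\sum_{d\mid n}d^z\chi(d)$ and $\bar{\sigma}_{z,\chi}(n)=\sum_{d\mid n}d^z\chi(n/d)$. $\tau(\chi)=\sum_{h=1}^q\chi(h)e^{2\pi i h/q}$ is the Gauss sum, $L(s,\chi)$ the Dirichlet $L$-function, and $K_0$ the modified Bessel function of the second kind of order $0$. *)

(* Defs.v *)
From Stdlib Require Import Reals Arith.
From Coquelicot Require Import Coquelicot.

Open Scope R_scope.

(* n^{-s} for a positive integer n and complex s:  exp(-s log n). *)
Definition npow_neg (n : nat) (s : C) : C :=
  (exp (- Re s * ln (INR n)) * cos (Im s * ln (INR n)),
   - (exp (- Re s * ln (INR n)) * sin (Im s * ln (INR n))))%R.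

Definition dirichlet_character (q : nat) (chi : nat -> C) : Prop :=
  (1 <= q)%nat /\
  chi 1%nat = RtoC 1 /\
  (forall m n : nat, chi (m * n)%nat = Cmult (chi m) (chi n)) /\
  (forall n : nat, chi (n + q)%nat = chi n) /\
  (forall n : nat, chi n = RtoC 0 <-> Nat.gcd n q <> 1%nat).

Definition induced_modulus (q : nat) (chi : nat -> C) (d : nat) : Prop :=
  forall n : nat, Nat.gcd n q = 1%nat -> n mod d = 1 mod d -> chi n = RtoC 1.

Definition primitive_character (q : nat) (chi : nat -> C) : Prop :=
  dirichlet_character q chi /\
  forall d : nat, (1 <= d)%nat -> Nat.divide d q -> (d < q)%nat ->
    ~ induced_modulus q chi d.

(* odd character: chi(-1) = -1, i.e. chi(q-1) = -1. *)
Definition odd_character (q : nat) (chi : nat -> C) : Prop :=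
  chi (q - 1)%nat = RtoC (-1).

Definition divb (d n : nat) : bool :=
  negb (Nat.eqb d 0) && Nat.eqb (n mod d) 0.

Definition sigma_chi (k : nat) (chi : nat -> C) (n : nat) : C :=
  sum_n (fun d : nat => if divb d n then Cmult (RtoC (INR d ^ k)) (chi d)
                        else RtoC 0) n.

Definition sigma_bar_chi (k : nat) (chi : nat -> C) (n : nat) : C :=
  sum_n (fun d : nat => if divb d n then Cmult (RtoC (INR d ^ k)) (chi (n / d)%nat)
                        else RtoC 0) n.

Definition gauss_sum (q : nat) (chi : nat -> C) : C :=
  sum_n (fun j : nat =>
           let h := S j in
           Cmult (chi h) (cos (2 * PI * INR h / INR q),
                          sin (2 * PI * INR h / INR q))) (q - 1)%nat.

Definition K0 (x : R) : R :=
  RInt_gen (fun t : R => exp (- x * cosh t)) (at_point 0) (Rbar_locally p_infty).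

Definition euler_gamma : R :=
  real (Lim_seq (fun n : nat =>
     sum_f_R0 (fun j : nat => / INR (S j)) n - ln (INR (S n)))).

(* Lf is the L-function L(s,chi): an entire function agreeing with the
   Dirichlet series on Re s > 1 (determined uniquely by analytic continuation). *)
Definition is_L_function (chi : nat -> C) (Lf : C -> C) : Prop :=
  (forall z : C, exists l : C, @is_derive C_AbsRing C_NormedModule Lf z l) /\
  (forall s : C, 1 < Re s ->
     @is_series C_AbsRing C_NormedModule
       (fun n : nat => Cmult (chi (S n)) (npow_neg (S n) s)) (Lf s)).

(* Main.v *)
Require Import Defs.
From Stdlib Require Import Reals Arith Lra Lia Psatz List Permutation Classical.
From Coquelicot Require Import Coquelicot.

(** Put y = a^2 x / 4 and w(t) = sum_d chi(d) d^(k+1) e^(-dt). Since 2 K0(2 sqrt(mdy)) is the integral of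
    e^(-dt - my/t) dt / t, summing over m and integrating by parts turns the Bessel series into the integral
    of w(t) Q(y/t), where Q is the primitive of -1 / (v (e^v - 1)) vanishing at infinity; it equals
    1/v + (log v)/2 + (gamma - log 2 pi)/2 - sum_n arctan(v / (2 pi n)) / (pi n).
    The first three terms of Q give Mellin-type integrals of w, which are L(1, chi), L(-k, chi) and L'(-k, chi)
    by the identity theorem. For the arctangents, an odd primitive chi is a sine sum with coefficients
    proportional to tau(chi) times the conjugate of chi, so the partial fractions of the Poisson kernel write w
    as a series of Im (t - i x)^(-k-2), whose integrals against arctan(b/t) are elementary: this is the dual series.
    The formula contains L'/L(-k, chi), so L(-k, chi) <> 0 is needed. For k > 0 it follows from the
    series for L(k+1). For k = 0, vanishing would make A(t) = sum_n (1 * chi)(n) e^(-nt) of size O(t), hence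
    sum_n b(n) 2 K0(2 sqrt(ny)), the integral of A(t) conj(A(y/t)) dt / t, bounded as y -> 0, where
    b = (1 * chi) * conj(1 * chi) is nonnegative with b(1) = 1; but K0 is unbounded at 0. *)

(** Parity is what makes the splitting of Q possible. Because chi is odd and k even, the partial
    fractions of w contain only Im (t - i x)^(-k-2) with an even exponent, and this vanishes at t =
    0. Hence w = O(t), and every piece of Q(y/t), being dominated by 1 + t + 1/t, can be integrated
    against w on its own. Up to the L-values all identities are linear in chi, so they are proved
    for its real and imaginary parts as real functions, and complex numbers return only for the
    L-values and the final assembly. An L-function is given only as an entire function that agrees
    with the Dirichlet series on a half-plane, so its values at -k require an identity theorem. The
    Mellin transform of w is holomorphic slightly beyond s = -k, which leaves room for the
    derivative there. No functional equation is invoked; the sine expansion of chi does its work.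
    The case k = 0 of the nonvanishing is hard because it amounts to the nonvanishing of the
    conjugate L-function at 1, where its first term no longer dominates; positivity has to replace
    absolute convergence. *)

Open Scope R_scope.

(** * Series *)

(* Coquelicot's canonical structures hide the carrier R from [ring] and [field]. *)
Ltac eqR := match goal with |- @eq _ ?a ?b => change (@eq R a b) end.

Lemma exp_le (a b : R) : a <= b -> exp a <= exp b.
Proof. intros [H| ->]; [left; now apply exp_increasing|lra]. Qed.

Lemma sum_n_S (a : nat -> R) n : sum_n a (S n) = sum_n a n + a (S n).
Proof. now rewrite sum_Sn. Qed.

Lemma is_series_lim (a : nat -> R) (l : R) :
  is_series a l <-> is_lim_seq (sum_n a) l.
Proof. split; intro H; exact H. Qed.

Lemma sum_n_le (a b : nat -> R) n :
  (forall i, (i <= n)%nat -> a i <= b i) -> sum_n a n <= sum_n b n.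
Proof.
  induction n as [|n IH]; intros H.
  - rewrite !sum_O. apply H; lia.
  - rewrite !sum_n_S. assert (a (S n) <= b (S n)) by (apply H; lia).
    assert (sum_n a n <= sum_n b n) by (apply IH; intros; apply H; lia). lra.
Qed.

Lemma sum_n_Rabs (a : nat -> R) n : Rabs (sum_n a n) <= sum_n (fun i => Rabs (a i)) n.
Proof.
  induction n as [|n IH].
  - rewrite !sum_O. lra.
  - rewrite !sum_n_S. pose proof (Rabs_triang (sum_n a n) (a (S n))). lra.
Qed.

Lemma sum_n_Series_le (a : nat -> R) n :
  (forall i, 0 <= a i) -> ex_series a -> sum_n a n <= Series a.
Proof.
  intros Ha He. apply (is_lim_seq_incr_compare (sum_n a)).
  - apply is_series_lim, Series_correct, He.
  - intros m. rewrite sum_n_S. specialize (Ha (S m)). lra.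
Qed.

Lemma Series_pos (a : nat -> R) : (forall i, 0 <= a i) -> ex_series a -> 0 <= Series a.
Proof.
  intros Ha He. apply Rle_trans with (sum_n a 0); [|now apply sum_n_Series_le].
  rewrite sum_O. apply Ha.
Qed.

Lemma Series_abs_le (a b : nat -> R) :
  (forall n, Rabs (a n) <= b n) -> ex_series b -> Rabs (Series a) <= Series b.
Proof.
  intros H He.
  assert (Ha : ex_series (fun n => Rabs (a n))).
  { apply (ex_series_le (fun n => Rabs (a n)) b); [|exact He].
    intros n. change norm with Rabs. rewrite Rabs_Rabsolu. apply H. }
  apply Rle_trans with (Series (fun n => Rabs (a n))).
  - apply Series_Rabs, Ha.
  - apply Series_le; [|exact He]. intros n; split; [apply Rabs_pos|apply H].
Qed.

Lemma ex_series_dom (a b : nat -> R) :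
  (forall n, Rabs (a n) <= b n) -> ex_series b -> ex_series a.
Proof. intros H He. now apply (ex_series_le a b). Qed.

Lemma is_series_finite (a : nat -> R) N :
  (forall n, (N < n)%nat -> a n = 0) -> is_series a (sum_n a N).
Proof.
  intros H. apply is_series_lim.
  apply is_lim_seq_ext_loc with (fun _ => sum_n a N).
  - exists N. intros n Hn. induction Hn as [|n Hn IH]; [reflexivity|].
    rewrite sum_n_S, <- IH, H by lia. lra.
  - apply is_lim_seq_const.
Qed.

Lemma Series_tail_le (u b : nat -> R) N : (forall n, Rabs (u n) <= b n) -> ex_series b ->
  Rabs (Series u - sum_n u N) <= Series b - sum_n b N.
Proof.
  intros Hu Hb. assert (Xu : ex_series u) by now apply ex_series_dom with b.
  rewrite (Series_incr_n u (S N)), (Series_incr_n b (S N)) by (lia || auto). rewrite <- !sum_n_Reals. simpl pred.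
  rewrite !Rplus_minus_l. apply Series_abs_le; [auto|]. now apply (proj1 (ex_series_incr_n b (S N))).
Qed.

Lemma Series_tail_small (b : nat -> R) eps : ex_series b -> 0 < eps ->
  exists N, forall n, (N <= n)%nat -> Series b - sum_n b n < eps.
Proof.
  intros Hb He. assert (L := proj1 (is_series_lim _ _) (Series_correct _ Hb)). apply is_lim_seq_spec in L.
  destruct (L (mkposreal _ He)) as [N HN]. exists N. intros n Hn. specialize (HN n Hn). simpl in HN. apply Rabs_def2 in HN. lra.
Qed.

(** Dominated convergence for series: both tails are controlled by the tail of [al], and the
    finitely many remaining terms converge. It serves the limit X -> infinity in [is_series_divisor]
    and the limit t -> 0 in [Psi_lim_zero]. *)
Lemma tannery (u : nat -> nat -> R) (v al : nat -> R) :
  ex_series al ->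
  (forall n d, Rabs (u n d) <= al d) ->
  (forall d, is_lim_seq (fun n => u n d) (v d)) ->
  ex_series v /\ is_lim_seq (fun n => Series (u n)) (Series v).
Proof.
  intros Hal Hu Hv.
  assert (Hvb : forall d, Rabs (v d) <= al d).
  { intros d. apply (is_lim_seq_le (fun n => Rabs (u n d)) (fun _ => al d) (Rabs (v d)) (al d)).
    - intros n; apply Hu.
    - apply (is_lim_seq_abs _ (v d)), Hv.
    - apply is_lim_seq_const. }
  split; [apply ex_series_dom with al; auto|].
  apply is_lim_seq_spec. intros eps. assert (He : 0 < eps / 4) by (destruct eps; simpl; lra).
  destruct (Series_tail_small al _ Hal He) as [N HN]. specialize (HN N (le_n N)).
  assert (Hfin : is_lim_seq (fun n => sum_n (u n) N) (sum_n v N)).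
  { clear HN. induction N as [|N IH].
    - rewrite sum_O. apply is_lim_seq_ext with (fun n => u n 0%nat); [|apply Hv].
      intros n. now rewrite sum_O.
    - rewrite sum_n_S. apply is_lim_seq_ext with (fun n => sum_n (u n) N + u n (S N)).
      + intros n. now rewrite sum_n_S.
      + apply is_lim_seq_plus'; auto. }
  apply is_lim_seq_spec in Hfin. destruct (Hfin (mkposreal _ He)) as [M HM]. exists M. intros n Hn.
  specialize (HM n Hn). simpl in HM.
  pose proof (Series_tail_le (u n) al N (Hu n) Hal) as H1. pose proof (Series_tail_le v al N Hvb Hal) as H2.
  apply Rabs_le_between in H1. apply Rabs_le_between in H2. apply Rabs_def2 in HM.
  apply Rabs_def1; lra.
Qed.

Lemma ex_series_telescope (a c : nat -> R) :
  (forall n, 0 <= a n) -> (forall n, a n <= c n - c (S n)) -> (forall n, 0 <= c n) -> ex_series a.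
Proof.
  intros Ha Hac Hc.
  assert (Hb : forall n, sum_n a n <= c 0%nat - c (S n)).
  { induction n as [|n IH]; [rewrite sum_O; apply Hac|].
    rewrite sum_n_S. specialize (Hac (S n)). lra. }
  destruct (ex_finite_lim_seq_incr (sum_n a) (c 0%nat)) as [l Hl].
  - intros n. rewrite sum_n_S. specialize (Ha (S n)). lra.
  - intros n. specialize (Hb n). specialize (Hc (S n)). lra.
  - exists l. exact Hl.
Qed.

Lemma INR_S_pos n : 0 < INR (S n).
Proof. apply lt_0_INR; lia. Qed.

Lemma INR_S_ge1 n : 1 <= INR (S n).
Proof. apply (le_INR 1); lia. Qed.

Lemma ex_series_inv_sq : ex_series (fun n => / INR (S n) ^ 2).
Proof.
  apply ex_series_telescope with (fun n => 2 / INR (S n)).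
  - intros n. apply Rlt_le, Rinv_0_lt_compat, pow_lt, INR_S_pos.
  - intros n. rewrite (S_INR (S n)). pose proof (INR_S_ge1 n). set (x := INR (S n)) in *.
    apply Rmult_le_reg_r with (x ^ 2 * (x + 1)); [nra|].
    replace (/ x ^ 2 * (x ^ 2 * (x + 1))) with (x + 1) by (field; lra).
    replace ((2 / x - 2 / (x + 1)) * (x ^ 2 * (x + 1))) with (2 * x) by (field; lra). lra.
  - intros n. apply Rlt_le, Rdiv_lt_0_compat; [lra|apply INR_S_pos].
Qed.

(** The exponent 3/2 is what [V_atan_dom] leaves in the worst case k = 0. *)
Lemma ex_series_inv_three_halves : ex_series (fun n => / (INR (S n) * sqrt (INR (S n)))).
Proof.
  apply ex_series_telescope with (fun n => 4 / sqrt (INR (S n))).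
  - intros n. apply Rlt_le, Rinv_0_lt_compat, Rmult_lt_0_compat; [|apply sqrt_lt_R0]; apply INR_S_pos.
  - intros n. rewrite (S_INR (S n)). pose proof (INR_S_ge1 n). set (x := INR (S n)) in *.
    assert (Hs := sqrt_lt_R0 x ltac:(lra)). assert (Hs1 := sqrt_lt_R0 (x + 1) ltac:(lra)).
    assert (E := sqrt_sqrt x ltac:(lra)). assert (E1 := sqrt_sqrt (x + 1) ltac:(lra)).
    set (s := sqrt x) in *. set (r := sqrt (x + 1)) in *.
    rewrite <- E at 1.
    apply Rmult_le_reg_r with (s * s * s * r); [repeat apply Rmult_lt_0_compat; lra|].
    replace (/ (s * s * s) * (s * s * s * r)) with r by (field; lra).
    replace ((4 / s - 4 / r) * (s * s * s * r)) with (4 * (s * s) * (r - s)) by (field; lra).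
    (* Multiplied by r + s, the goal becomes r^2 + r s <= 4 s^2; both terms are at most 2 s^2
       because s >= 1. *)
    assert (Hrs : (r - s) * (r + s) = 1) by nra.
    assert (s < r) by nra. assert (r <= 2 * s) by nra.
    apply Rmult_le_reg_r with (r + s); [lra|].
    replace (4 * (s * s) * (r - s) * (r + s)) with (4 * (s * s) * ((r - s) * (r + s))) by ring.
    rewrite Hrs. nra.
  - intros n. apply Rlt_le, Rdiv_lt_0_compat; [lra|apply sqrt_lt_R0, INR_S_pos].
Qed.

Lemma sum_n_block (a : nat -> R) q n :
  (1 <= q)%nat ->
  sum_n (fun i => sum_n (fun h => a (i * q + h)%nat) (q - 1)) n = sum_n a (S n * q - 1).
Proof.
  intros Hq. induction n as [|n IH].
  - rewrite sum_O. replace (1 * q - 1)%nat with (q - 1)%nat by lia. now apply sum_n_ext.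
  - rewrite sum_n_S, IH.
    assert (Hg : forall m, sum_n a (S n * q - 1) + sum_n (fun h => a (S n * q + h)%nat) m
                 = sum_n a (S n * q + m)).
    { induction m as [|m IHm].
      - rewrite sum_O. replace (S n * q + 0)%nat with (S (S n * q - 1)) by lia. now rewrite sum_n_S.
      - rewrite sum_n_S. replace (S n * q + S m)%nat with (S (S n * q + m)) by lia.
        rewrite sum_n_S, <- IHm. ring. }
    rewrite Hg. f_equal. lia.
Qed.

(** The partial sums of the blocked series form a subsequence of the original ones. With q = 2 this
    serves the duplication of the Poisson kernel, with q the modulus the regrouping by residue
    classes. *)
Lemma is_series_block (a : nat -> R) q l :
  (1 <= q)%nat -> is_series a l ->
  is_series (fun i => sum_n (fun h => a (i * q + h)%nat) (q - 1)) l.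
Proof.
  intros Hq H. apply is_series_lim. apply is_series_lim in H.
  apply is_lim_seq_ext with (fun n => sum_n a (S n * q - 1)).
  - intros n. symmetry. now apply sum_n_block.
  - apply (is_lim_seq_subseq (sum_n a) l (fun n => (S n * q - 1)%nat)); [|exact H].
    apply eventually_subseq. intros n. nia.
Qed.

(** * Divisor sums of absolutely convergent double series *)

Definition psum (b : nat -> R) (n : nat) : R :=
  match n with O => 0 | S m => sum_n b m end.

Lemma psum_S b n : psum b (S n) = psum b n + b n.
Proof. destruct n; simpl; [rewrite sum_O; ring|apply sum_n_S]. Qed.

Lemma divb_spec d n : divb d n = true <-> (1 <= d)%nat /\ Nat.divide d n.
Proof.
  unfold divb. destruct (Nat.eqb_spec d 0) as [->|Hd]; simpl.
  - split; [discriminate|lia].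
  - rewrite Nat.eqb_eq. split.
    + intros H. split; [lia|]. apply Nat.Lcm0.mod_divide; auto.
    + intros [_ H]. apply Nat.Lcm0.mod_divide; auto.
Qed.

Lemma div_succ d n : (1 <= d)%nat -> (S n / d = if divb d (S n) then S (n / d) else n / d)%nat.
Proof.
  intros Hd. pose proof (Nat.div_mod_eq n d). pose proof (Nat.mod_upper_bound n d ltac:(lia)).
  destruct (divb d (S n)) eqn:E.
  - apply divb_spec in E. destruct E as [_ [c Hc]]. rewrite Hc, Nat.div_mul by lia.
    set (r := (n mod d)%nat) in *. set (k := (n / d)%nat) in *.
    destruct (Nat.lt_trichotomy c (S k)) as [F|[F|F]]; [exfalso|exact F|exfalso].
    + assert (c * d <= k * d)%nat by (apply Nat.mul_le_mono_r; lia). lia.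
    + assert (S (S k) * d <= c * d)%nat by (apply Nat.mul_le_mono_r; lia). lia.
  - assert (n mod d <> d - 1)%nat.
    { intro F. assert (divb d (S n) = true); [|congruence].
      apply divb_spec. split; [lia|]. exists (S (n / d)). nia. }
    symmetry. apply Nat.div_unique with (S (n mod d)); lia.
Qed.

(** By [div_succ] the quotient n / d grows exactly at the multiples of d. It may be 0, which is why
    sums with an empty case are needed. *)
Lemma psum_gap (b : nat -> R) d n :
  (1 <= d)%nat ->
  psum (fun m => if divb d (S m) then b (S m / d)%nat else 0) n = psum (fun j => b (S j)) (n / d).
Proof.
  intros Hd. induction n as [|n IH].
  - rewrite Nat.Div0.div_0_l; reflexivity.
  - rewrite psum_S, IH, (div_succ d n Hd). destruct (divb d (S n)); [now rewrite psum_S|ring].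
Qed.

Lemma divb_gt d n : (n < d)%nat -> (1 <= n)%nat -> divb d n = false.
Proof.
  intros H H1. destruct (divb d n) eqn:E; [|reflexivity].
  apply divb_spec in E. destruct E as [_ E]. apply Nat.divide_pos_le in E; lia.
Qed.

Lemma sum_n_extend_zero (a : nat -> R) n m :
  (n <= m)%nat -> (forall i, (n < i)%nat -> a i = 0) -> sum_n a m = sum_n a n.
Proof.
  intros H Ha. induction H as [|m H IH]; [reflexivity|].
  rewrite sum_n_S, IH, Ha by lia. apply Rplus_0_r.
Qed.

(** Regrouping of a double series by the product of its indices. The partial sum up to X is a sum of
    rows cut off at the hyperbola i j <= X; each row tends to its full sum, and [tannery] passes to
    the limit over all rows. *)
Lemma is_series_divisor (a : nat -> nat -> R) (al be : nat -> R) :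
  ex_series al -> ex_series be -> (forall i, 0 <= al i) -> (forall i, 0 <= be i) ->
  (forall i j, Rabs (a (S i) (S j)) <= al i * be j) ->
  is_series (fun m => sum_n (fun d => if divb d (S m) then a d (S m / d)%nat else 0) (S m))
    (Series (fun i => Series (fun j => a (S i) (S j)))).
Proof.
  intros Hal Hbe Pal Pbe Hab.
  (* Row i cut off at the hyperbola, with all indices shifted by one. *)
  set (u := fun X i => if (i <=? X)%nat then psum (fun j => a (S i) (S j)) (S X / S i) else 0).
  assert (Hpart : forall X, sum_n (fun m => sum_n (fun d => if divb d (S m) then a d (S m / d)%nat else 0) (S m)) X
       = Series (u X)).
  { intros X.
    rewrite (is_series_unique _ _ (is_series_finite (u X) X
       ltac:(intros n Hn; unfold u; destruct (Nat.leb_spec n X); [lia|reflexivity]))).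
    transitivity (sum_n (fun m => sum_n (fun d => if divb d (S m) then a d (S m / d)%nat else 0) (S X)) X).
    { apply sum_n_ext_loc. intros m Hm. symmetry. apply sum_n_extend_zero; [lia|].
      intros i Hi. rewrite divb_gt by lia. reflexivity. }
    rewrite sum_n_switch.
    transitivity (sum_n (fun i => sum_n (fun m => if divb (S i) (S m) then a (S i) (S m / S i)%nat else 0) X) X).
    (* [divb 0] is always false, so the index d = 0 is split off before shifting to d = i + 1. *)
    { unfold sum_n at 1. rewrite sum_Sn_m by lia.
      rewrite <- (sum_n_m_S (fun j => sum_n (fun i => if divb j (S i) then a j (S i / j)%nat else 0) X) 0 X).
      replace (sum_n (fun i => if divb 0 (S i) then a 0%nat (S i / 0)%nat else 0) X) with 0.
      - apply Rplus_0_l.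
      - symmetry. transitivity (sum_n (fun _ : nat => 0) X).
        + apply sum_n_ext. intros; reflexivity.
        + rewrite sum_n_const. ring. }
    apply sum_n_ext_loc. intros i Hi. unfold u.
    destruct (Nat.leb_spec i X); [|lia].
    rewrite <- (psum_gap (a (S i)) (S i) (S X)) by lia. reflexivity. }
  assert (Hps : forall i n, Rabs (psum (fun j => a (S i) (S j)) n) <= al i * Series be).
  { intros i n. destruct n as [|n]; simpl.
    - rewrite Rabs_R0. apply Rmult_le_pos; auto. apply Series_pos; auto.
    - eapply Rle_trans; [apply sum_n_Rabs|].
      apply Rle_trans with (sum_n (fun j => al i * be j) n).
      + apply sum_n_le. intros; apply Hab.
      + change (sum_n (fun j : nat => mult (al i) (be j)) n <= al i * Series be).
        rewrite sum_n_mult_l. apply Rmult_le_compat_l; auto. apply sum_n_Series_le; auto. }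
  destruct (tannery u (fun i => Series (fun j => a (S i) (S j))) (fun i => al i * Series be)) as [_ HT].
  - apply (ex_series_scal_r (Series be) al), Hal.
  - intros n i. unfold u. destruct (Nat.leb_spec i n); [apply Hps|].
    rewrite Rabs_R0. apply Rmult_le_pos; auto. apply Series_pos; auto.
  - intros i.
    assert (He : ex_series (fun j => a (S i) (S j))).
    { apply ex_series_dom with (fun j => al i * be j); auto.
      apply (ex_series_scal_l (al i) be), Hbe. }
    apply Series_correct, is_series_lim in He.
    apply is_lim_seq_ext_loc with (fun n => sum_n (fun j => a (S i) (S j)) (pred (S n / S i))).
    + exists i. intros n Hn. unfold u. destruct (Nat.leb_spec i n); [|lia].
      assert (1 <= S n / S i)%nat by (apply Nat.div_le_lower_bound; lia).
      destruct (S n / S i)%nat; [lia|reflexivity].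
    + apply (filterlim_comp _ _ _ (fun n => pred (S n / S i)) (sum_n (fun j => a (S i) (S j))) eventually eventually); [|exact He].
      intros P [N HN]. exists (S N * S i)%nat. intros n Hn. apply HN.
      assert (S N <= S n / S i)%nat by (apply Nat.div_le_lower_bound; nia). lia.
  - apply is_series_lim. eapply is_lim_seq_ext; [|exact HT]. intros X. now rewrite Hpart.
Qed.

(** * Termwise differentiation *)

(* MVT applied twice gives the quadratic remainder that is summed over the series. *)
Lemma taylor2_bound (F F1 F2 : R -> R) (x y A : R) :
  (forall z, Rmin x y <= z <= Rmax x y -> is_derive F z (F1 z)) ->
  (forall z, Rmin x y <= z <= Rmax x y -> is_derive F1 z (F2 z)) ->
  (forall z, Rmin x y <= z <= Rmax x y -> Rabs (F2 z) <= A) ->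
  Rabs (F y - F x - (y - x) * F1 x) <= A * (y - x) ^ 2.
Proof.
  intros H0 H1 H2.
  assert (Cont : forall (G G' : R -> R) z, is_derive G z (G' z) -> continuity_pt G z).
  { intros G G' z Hz. apply derivable_continuous_pt. exists (G' z). now apply is_derive_Reals. }
  destruct (MVT_gen F x y F1) as [c [Hc Ec]].
  { intros z Hz. apply H0. lra. }
  { intros z Hz. apply Cont with F1. now apply H0. }
  assert (Hxc : forall z, Rmin x c <= z <= Rmax x c -> Rmin x y <= z <= Rmax x y).
  { intros z Hz. revert Hc Hz. unfold Rmin, Rmax.
    destruct (Rle_dec x y), (Rle_dec x c); lra. }
  destruct (MVT_gen F1 x c F2) as [e [He Ee]].
  { intros z Hz. apply H1, Hxc. lra. }
  { intros z Hz. apply Cont with F2. now apply H1, Hxc. }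
  replace (F y - F x - (y - x) * F1 x) with ((F1 c - F1 x) * (y - x)) by (rewrite Ec; ring).
  rewrite Ee. specialize (H2 e (Hxc e He)).
  rewrite !Rabs_mult. rewrite <- (pow2_abs (y - x)).
  assert (Rabs (c - x) <= Rabs (y - x)).
  { revert Hc. unfold Rmin, Rmax, Rabs. destruct (Rle_dec x y), (Rcase_abs (c - x)), (Rcase_abs (y - x)); lra. }
  pose proof (Rabs_pos (F2 e)). pose proof (Rabs_pos (c - x)). pose proof (Rabs_pos (y - x)).
  assert (Rabs (F2 e) * Rabs (c - x) <= A * Rabs (y - x)) by (apply Rmult_le_compat; auto).
  nra.
Qed.

Lemma is_derive_quadratic (F : R -> R) (x l A r : R) :
  0 < r ->
  (forall y, Rabs (y - x) < r -> Rabs (F y - F x - (y - x) * l) <= A * (y - x) ^ 2) ->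
  is_derive F x l.
Proof.
  intros Hr H. apply is_derive_Reals. intros eps Heps.
  set (B := Rabs A + 1).
  assert (HB : 0 < B) by (unfold B; pose proof (Rabs_pos A); lra).
  assert (Hd : 0 < Rmin r (eps / B)) by (apply Rmin_pos; [lra|apply Rdiv_lt_0_compat; lra]).
  exists (mkposreal _ Hd). intros h Hh0 Hh. simpl in Hh.
  assert (Hh1 := Rlt_le_trans _ _ _ Hh (Rmin_l _ _)).
  assert (Hh2 := Rlt_le_trans _ _ _ Hh (Rmin_r _ _)).
  specialize (H (x + h)). replace (x + h - x) with h in H by ring. specialize (H Hh1).
  replace ((F (x + h) - F x) / h - l) with ((F (x + h) - F x - h * l) / h) by (field; auto).
  unfold Rdiv. rewrite Rabs_mult, Rabs_inv.
  assert (Hpos : 0 < Rabs h) by (apply Rabs_pos_lt; auto).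
  apply Rmult_lt_reg_r with (Rabs h); [auto|].
  rewrite Rmult_assoc, Rinv_l, Rmult_1_r by lra.
  apply Rle_lt_trans with (B * Rabs h * Rabs h).
  - eapply Rle_trans; [exact H|]. rewrite <- (pow2_abs h).
    unfold B. pose proof (Rle_abs A). nra.
  - apply Rmult_lt_compat_r; auto.
    apply Rmult_lt_reg_l with (/ B); [now apply Rinv_0_lt_compat|].
    rewrite <- Rmult_assoc, Rinv_l, Rmult_1_l by lra. unfold Rdiv in Hh2. lra.
Qed.

(** The Taylor remainders are at most [a n] (y - x)^2, so their sum is O((y - x)^2) and
    [is_derive_quadratic] applies. Dominating the second derivatives takes the place of uniform
    convergence of the first ones. *)
Lemma is_derive_Series (F F1 F2 : nat -> R -> R) (a : nat -> R) (x r : R) :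
  0 < r ->
  (forall n y, Rabs (y - x) < r -> is_derive (F n) y (F1 n y)) ->
  (forall n y, Rabs (y - x) < r -> is_derive (F1 n) y (F2 n y)) ->
  (forall n y, Rabs (y - x) < r -> Rabs (F2 n y) <= a n) ->
  ex_series a ->
  (forall y, Rabs (y - x) < r -> ex_series (fun n => F n y)) ->
  ex_series (fun n => F1 n x) ->
  is_derive (fun y => Series (fun n => F n y)) x (Series (fun n => F1 n x)).
Proof.
  intros Hr H0 H1 H2 Ha Hex Hex1.
  apply is_derive_quadratic with (Series a) r; [exact Hr|].
  intros y Hy. assert (Hx : Rabs (x - x) < r) by (rewrite Rminus_diag, Rabs_R0; auto).
  rewrite <- Series_minus by auto. rewrite <- Series_scal_l.
  rewrite <- Series_minus.
  2: { apply (ex_series_minus (fun n => F n y) (fun n => F n x)); auto. }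
  2: { apply (ex_series_scal_l (y - x) (fun n => F1 n x)); auto. }
  rewrite <- Series_scal_r. apply Series_abs_le; [|apply (ex_series_scal_r _ a); auto].
  intros n.
  assert (Hz : forall z, Rmin x y <= z <= Rmax x y -> Rabs (z - x) < r).
  { intros z. revert Hy. unfold Rmin, Rmax, Rabs.
    destruct (Rle_dec x y), (Rcase_abs (y - x)), (Rcase_abs (z - x)); lra. }
  apply taylor2_bound with (F2 n); intros z Hzz; auto.
Qed.

(** * Integrals over the half-line *)

(* [wt] is a weight of total mass pi on the half-line: [dom f A] makes [hint f], the integral of f over
   (0, oo), absolutely convergent with the bound A pi; outside [dom] the value of [hint] is junk. *)
Definition wt (t : R) : R := / (sqrt t * (1 + t)).

Definition dom (f : R -> R) (A : R) : Prop :=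
  (forall t, 0 < t -> continuous f t) /\ (forall t, 0 < t -> Rabs (f t) <= A * wt t).

Definition hint (f : R -> R) : R :=
  real (Lim_seq (fun n => RInt f (/ INR (S n)) (INR (S n)))).

Definition wt_prim (t : R) : R := 2 * atan (sqrt t).

Lemma wt_pos t : 0 < t -> 0 < wt t.
Proof.
  intros H. apply Rinv_0_lt_compat, Rmult_lt_0_compat; [now apply sqrt_lt_R0|lra].
Qed.

Lemma is_derive_wt_prim t : 0 < t -> is_derive wt_prim t (wt t).
Proof.
  intros H. unfold wt_prim. assert (Hs := sqrt_lt_R0 t H).
  auto_derive; [exact H|]. unfold wt.
  assert (E := sqrt_sqrt t ltac:(lra)). set (s := sqrt t) in *. rewrite <- E. field.
  repeat split; nra.
Qed.

Lemma continuous_wt t : 0 < t -> continuous wt t.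
Proof.
  intros H. apply (ex_derive_continuous wt). assert (Hs := sqrt_lt_R0 t H). unfold wt. auto_derive.
  split; [exact H|]. split; [nra|exact I].
Qed.

Lemma wt_prim_bounds t : 0 < t -> 0 < wt_prim t < PI.
Proof.
  intros H. unfold wt_prim. assert (Hs := sqrt_lt_R0 t H).
  pose proof (atan_bound (sqrt t)). pose proof (atan_increasing 0 (sqrt t) Hs) as H1.
  rewrite atan_0 in H1. lra.
Qed.

Lemma ex_RInt_pos (f : R -> R) a b :
  (forall t, 0 < t -> continuous f t) -> 0 < a -> 0 < b -> ex_RInt f a b.
Proof.
  intros H Ha Hb. apply (ex_RInt_continuous f). intros z Hz. apply H.
  assert (0 < Rmin a b) by (apply Rmin_pos; auto). lra.
Qed.

Lemma is_RInt_wt a b : 0 < a -> 0 < b -> is_RInt wt a b (wt_prim b - wt_prim a).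
Proof.
  intros Ha Hb. assert (0 < Rmin a b) by (apply Rmin_pos; auto).
  apply (is_RInt_derive wt_prim wt).
  - intros x Hx. apply is_derive_wt_prim. lra.
  - intros x Hx. apply continuous_wt. lra.
Qed.

Lemma RInt_dom f A a b :
  dom f A -> 0 < a -> a <= b -> Rabs (RInt f a b) <= A * (wt_prim b - wt_prim a).
Proof.
  intros [Hc Hb] Ha Hab.
  apply (norm_RInt_le f (fun t => A * wt t) a b).
  - exact Hab.
  - intros x Hx. apply Hb. lra.
  - apply (RInt_correct f). apply ex_RInt_pos; auto; lra.
  - apply (is_RInt_scal wt a b A), is_RInt_wt; lra.
Qed.

Lemma RInt_Chasles_pos (f : R -> R) a b c :
  (forall t, 0 < t -> continuous f t) -> 0 < a -> 0 < b -> 0 < c ->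
  RInt f a b + RInt f b c = RInt f a c.
Proof.
  intros H Ha Hb Hc. apply (RInt_Chasles f a b c); apply ex_RInt_pos; auto.
Qed.

Lemma dom_nonneg f A : dom f A -> 0 <= A.
Proof.
  intros [_ H]. specialize (H 1 Rlt_0_1). pose proof (wt_pos 1 Rlt_0_1).
  pose proof (Rabs_pos (f 1)). nra.
Qed.

Lemma RInt_dom_nested f A a b a' b' :
  dom f A -> 0 < a' -> a' <= a -> a <= b -> b <= b' ->
  Rabs (RInt f a' b' - RInt f a b) <= A * (PI - (wt_prim b - wt_prim a)).
Proof.
  intros H Ha' Haa Hab Hbb. pose proof (dom_nonneg f A H) as HA.
  assert (Hc := proj1 H).
  rewrite <- (RInt_Chasles_pos f a' a b'), <- (RInt_Chasles_pos f a b b') by (auto; lra).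
  assert (H1 := RInt_dom f A a' a H Ha' Haa).
  assert (H2 := RInt_dom f A b b' H ltac:(lra) Hbb).
  pose proof (wt_prim_bounds a' Ha'). pose proof (wt_prim_bounds b' ltac:(lra)).
  replace (RInt f a' a + (RInt f a b + RInt f b b') - RInt f a b)
    with (RInt f a' a + RInt f b b') by ring.
  eapply Rle_trans; [apply Rabs_triang|].
  assert (A * (wt_prim a - wt_prim a') + A * (wt_prim b' - wt_prim b)
          <= A * (PI - (wt_prim b - wt_prim a))); [|lra].
  rewrite <- Rmult_plus_distr_l. apply Rmult_le_compat_l; lra.
Qed.

(** The mass of [wt] outside [a, b], which bounds every truncation error of [hint]. *)
Definition gap (a b : R) : R := PI - (wt_prim b - wt_prim a).

Lemma atan_le_id x : 0 <= x -> atan x <= x.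
Proof.
  intros [H|<-]; [|rewrite atan_0; lra].
  destruct (MVT_gen atan 0 x (fun z => / (1 + z ^ 2))) as [c [Hc E]].
  - intros z _. apply is_derive_Reals, derivable_pt_lim_atan.
  - intros z _. apply derivable_continuous_pt. exists (/ (1 + z ^ 2)). apply derivable_pt_lim_atan.
  - rewrite atan_0 in E.
    assert (0 < / (1 + c ^ 2) <= 1).
    { split; [apply Rinv_0_lt_compat; nra|]. rewrite <- Rinv_1. apply Rinv_le_contravar; nra. }
    nra.
Qed.

Lemma gap_le a b : 0 < a -> 0 < b -> 0 <= gap a b <= 2 * sqrt a + 2 / sqrt b.
Proof.
  intros Ha Hb. split.
  - unfold gap. pose proof (wt_prim_bounds a Ha). pose proof (wt_prim_bounds b Hb). lra.
  - unfold gap, wt_prim. assert (Hs := sqrt_lt_R0 b Hb).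
    pose proof (atan_inv (sqrt b) Hs).
    assert (atan (/ sqrt b) <= / sqrt b) by (apply atan_le_id, Rlt_le, Rinv_0_lt_compat, Hs).
    assert (atan (sqrt a) <= sqrt a) by (apply atan_le_id, sqrt_pos).
    unfold Rdiv. lra.
Qed.

Lemma lim_inv_sqrt_INR : is_lim_seq (fun n => / sqrt (INR (S n))) 0.
Proof.
  apply (is_lim_seq_inv (fun n => sqrt (INR (S n))) p_infty); [|discriminate].
  apply (filterlim_comp _ _ _ (fun n => INR (S n)) sqrt eventually (Rbar_locally p_infty)).
  - apply -> (is_lim_seq_incr_1 INR). apply is_lim_seq_INR.
  - exact filterlim_sqrt_p.
Qed.

Lemma lim_gap : is_lim_seq (fun n => gap (/ INR (S n)) (INR (S n))) 0.
Proof.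
  apply is_lim_seq_le_le with (fun _ => 0) (fun n => 4 * / sqrt (INR (S n))).
  - intros n. pose proof (INR_S_pos n). assert (0 < / INR (S n)) by now apply Rinv_0_lt_compat.
    pose proof (gap_le (/ INR (S n)) (INR (S n)) ltac:(auto) ltac:(auto)) as H1.
    rewrite sqrt_inv in H1. unfold Rdiv in H1. lra.
  - apply is_lim_seq_const.
  - replace (Finite 0) with (Rbar_mult 4 0) by (simpl; f_equal; ring).
    apply is_lim_seq_scal_l, lim_inv_sqrt_INR.
Qed.

Lemma nested_index n m : (n <= m)%nat ->
  0 < / INR (S m) /\ / INR (S m) <= / INR (S n) /\ / INR (S n) <= INR (S n) /\ INR (S n) <= INR (S m).
Proof.
  intros H. pose proof (INR_S_pos n). pose proof (INR_S_ge1 n).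
  assert (INR (S n) <= INR (S m)) by (apply le_INR; lia).
  repeat split; auto.
  - apply Rinv_0_lt_compat; lra.
  - apply Rinv_le_contravar; lra.
  - assert (/ INR (S n) <= 1) by (rewrite <- Rinv_1; apply Rinv_le_contravar; lra). lra.
Qed.

(** Nested intervals with vanishing [gap] give a Cauchy sequence, so under [dom] the value [hint f]
    is a genuine limit. *)
Lemma hint_lim f A : dom f A ->
  is_lim_seq (fun n => RInt f (/ INR (S n)) (INR (S n))) (hint f).
Proof.
  intros H. pose proof (dom_nonneg f A H) as HA. unfold hint. apply Lim_seq_correct'.
  apply ex_lim_seq_cauchy_corr. intros eps.
  assert (HL : is_lim_seq (fun n => A * gap (/ INR (S n)) (INR (S n))) 0).
  { replace (Finite 0) with (Rbar_mult A 0) by (simpl; f_equal; ring).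
    apply is_lim_seq_scal_l, lim_gap. }
  apply is_lim_seq_spec in HL.
  assert (He : 0 < eps / 2) by (destruct eps; simpl; lra).
  destruct (HL (mkposreal _ He)) as [N HN]. exists N.
  assert (K : forall m, (N <= m)%nat ->
    Rabs (RInt f (/ INR (S m)) (INR (S m)) - RInt f (/ INR (S N)) (INR (S N))) < eps / 2).
  { intros m Hm. destruct (nested_index N m Hm) as [H1 [H2 [H3 H4]]].
    eapply Rle_lt_trans; [apply RInt_dom_nested with (A := A); auto|].
    specialize (HN N (le_n N)). cbn [pos] in HN. rewrite Rminus_0_r in HN.
    apply Rabs_def2 in HN. unfold gap in HN. lra. }
  intros n m Hn Hm. pose proof (K n Hn) as H1. pose proof (K m Hm) as H2.
  apply Rabs_def2 in H1. apply Rabs_def2 in H2. apply Rabs_def1; lra.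
Qed.

Lemma hint_approx f A a b : dom f A -> 0 < a -> a <= b ->
  Rabs (hint f - RInt f a b) <= A * gap a b.
Proof.
  intros H Ha Hab.
  apply (is_lim_seq_le_loc (fun n => Rabs (RInt f (/ INR (S n)) (INR (S n)) - RInt f a b))
           (fun _ => A * gap a b) (Rabs (hint f - RInt f a b)) (A * gap a b)).
  - destruct (INR_archimed (1) (Rmax (/ a) b) Rlt_0_1) as [N HN]. exists N. intros n Hn.
    assert (HN' : Rmax (/ a) b <= INR (S n)).
    { assert (INR N <= INR (S n)) by (apply le_INR; lia). lra. }
    pose proof (Rmax_l (/ a) b). pose proof (Rmax_r (/ a) b).
    destruct (nested_index n n (le_n n)) as [G1 [G2 [G3 G4]]].
    apply RInt_dom_nested; auto; try lra.
    rewrite <- (Rinv_inv a). apply Rinv_le_contravar; [now apply Rinv_0_lt_compat|lra].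
  - apply (is_lim_seq_abs _ (hint f - RInt f a b)).
    apply is_lim_seq_minus'; [now apply hint_lim with A|apply is_lim_seq_const].
  - apply is_lim_seq_const.
Qed.

Lemma hint_unique f A (l : R) : dom f A ->
  is_lim_seq (fun n => RInt f (/ INR (S n)) (INR (S n))) l -> hint f = l.
Proof.
  intros H Hl. pose proof (hint_lim f A H) as H1.
  apply is_lim_seq_unique in H1. apply is_lim_seq_unique in Hl.
  rewrite Hl in H1. now injection H1.
Qed.

Lemma hint_ext f g : (forall t, 0 < t -> f t = g t) -> hint f = hint g.
Proof.
  intros H. unfold hint. f_equal. apply Lim_seq_ext. intros n. apply RInt_ext.
  intros x Hx. apply H. destruct (nested_index n n (le_n n)) as [H1 [H2 [H3 H4]]].
  rewrite Rmin_left in Hx by lra. lra.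
Qed.

Lemma dom_ext f g A : (forall t, 0 < t -> f t = g t) -> dom f A -> dom g A.
Proof.
  intros H [H1 H2]. split.
  - intros t Ht. apply (continuous_ext_loc g f t); [|now apply H1].
    exists (mkposreal t Ht). intros s Hs. apply H.
    change (Rabs (s - t) < t) in Hs. apply Rabs_def2 in Hs. lra.
  - intros t Ht. rewrite <- H; auto.
Qed.

Lemma dom_weaken f A B : A <= B -> dom f A -> dom f B.
Proof.
  intros HAB [H1 H2]. split; [exact H1|]. intros t Ht.
  specialize (H2 t Ht). pose proof (wt_pos t Ht). nra.
Qed.

Lemma dom_plus f g A B : dom f A -> dom g B -> dom (fun t => f t + g t) (A + B).
Proof.
  intros [H1 H2] [H3 H4]. split.
  - intros t Ht. apply (continuous_plus f g); auto.
  - intros t Ht. specialize (H2 t Ht). specialize (H4 t Ht).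
    eapply Rle_trans; [apply Rabs_triang|]. lra.
Qed.

Lemma dom_scal f A c : dom f A -> dom (fun t => c * f t) (Rabs c * A).
Proof.
  intros [H1 H2]. split.
  - intros t Ht. apply (continuous_scal_r c f); auto.
  - intros t Ht. rewrite Rabs_mult, Rmult_assoc. apply Rmult_le_compat_l; [apply Rabs_pos|auto].
Qed.

Lemma hint_plus f g A B : dom f A -> dom g B ->
  hint (fun t => f t + g t) = hint f + hint g.
Proof.
  intros Hf Hg. apply hint_unique with (A + B); [now apply dom_plus|].
  apply is_lim_seq_ext with
    (fun n => RInt f (/ INR (S n)) (INR (S n)) + RInt g (/ INR (S n)) (INR (S n))).
  - intros n. destruct (nested_index n n (le_n n)) as [H1 [H2 [H3 H4]]].
    symmetry. apply (RInt_plus f g); apply ex_RInt_pos; (apply Hf || apply Hg || lra).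
  - apply is_lim_seq_plus'; [now apply hint_lim with A|now apply hint_lim with B].
Qed.

Lemma hint_scal f A c : dom f A -> hint (fun t => c * f t) = c * hint f.
Proof.
  intros Hf. apply hint_unique with (Rabs c * A); [now apply dom_scal|].
  apply is_lim_seq_ext with (fun n => c * RInt f (/ INR (S n)) (INR (S n))).
  - intros n. destruct (nested_index n n (le_n n)) as [H1 [H2 [H3 H4]]].
    symmetry. apply (RInt_scal f); apply ex_RInt_pos; (apply Hf || lra).
  - apply (is_lim_seq_scal_l _ c (hint f)). now apply hint_lim with A.
Qed.

Lemma dom_minus f g A B : dom f A -> dom g B -> dom (fun t => f t - g t) (A + B).
Proof.
  intros Hf Hg. apply dom_weaken with (A + Rabs (-1) * B).
  - rewrite (Rabs_left (-1)) by lra. lra.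
  - apply (dom_ext (fun t => f t + (-1) * g t)); [intros; ring|].
    apply dom_plus; [auto|now apply dom_scal].
Qed.

Lemma hint_minus f g A B : dom f A -> dom g B ->
  hint (fun t => f t - g t) = hint f - hint g.
Proof.
  intros Hf Hg. rewrite (hint_ext _ (fun t => f t + (-1) * g t)) by (intros; ring).
  rewrite (hint_plus f (fun t => -1 * g t) A (Rabs (-1) * B)); [|auto|now apply dom_scal].
  rewrite (hint_scal g B) by auto. ring.
Qed.

Lemma hint_bound f A : dom f A -> Rabs (hint f) <= A * PI.
Proof.
  intros H. apply (is_lim_seq_le (fun n => Rabs (RInt f (/ INR (S n)) (INR (S n))))
    (fun _ => A * PI) (Rabs (hint f)) (A * PI)).
  - intros n. destruct (nested_index n n (le_n n)) as [H1 [H2 [H3 H4]]].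
    eapply Rle_trans; [apply RInt_dom with (A := A); auto|].
    apply Rmult_le_compat_l; [now apply (dom_nonneg f)|].
    pose proof (wt_prim_bounds _ H1). pose proof (wt_prim_bounds (INR (S n)) ltac:(lra)). lra.
  - apply (is_lim_seq_abs _ (hint f)). now apply hint_lim with A.
  - apply is_lim_seq_const.
Qed.

Lemma hint_le f g A B : dom f A -> dom g B ->
  (forall t, 0 < t -> f t <= g t) -> hint f <= hint g.
Proof.
  intros Hf Hg H.
  apply (is_lim_seq_le (fun n => RInt f (/ INR (S n)) (INR (S n)))
    (fun n => RInt g (/ INR (S n)) (INR (S n))) (hint f) (hint g)).
  - intros n. destruct (nested_index n n (le_n n)) as [H1 [H2 [H3 H4]]].
    apply RInt_le; try (apply ex_RInt_pos; (apply Hf || apply Hg || lra)); auto.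
    intros x Hx. apply H. lra.
  - now apply hint_lim with A.
  - now apply hint_lim with B.
Qed.

Lemma hint_FTC f F A (l0 l1 : R) : dom f A ->
  (forall t, 0 < t -> is_derive F t (f t)) ->
  is_lim_seq (fun n => F (/ INR (S n))) l0 -> is_lim_seq (fun n => F (INR (S n))) l1 ->
  hint f = l1 - l0.
Proof.
  intros H HF H0 H1. apply hint_unique with A; [exact H|].
  apply is_lim_seq_ext with (fun n => F (INR (S n)) - F (/ INR (S n))).
  - intros n. destruct (nested_index n n (le_n n)) as [G1 [G2 [G3 G4]]].
    symmetry. apply is_RInt_unique. apply (is_RInt_derive F f).
    + intros x Hx. rewrite Rmin_left in Hx by lra. apply HF. lra.
    + intros x Hx. rewrite Rmin_left in Hx by lra. apply H. lra.
  - now apply is_lim_seq_minus'.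
Qed.

(** Weierstrass test on the ball of radius t0 / 2 around t0, where the decreasing weight [wt] is at
    most its value at t0 / 2. *)
Lemma continuous_Series_dom (f : nat -> R -> R) (a : nat -> R) t0 :
  0 < t0 -> ex_series a ->
  (forall n t, 0 < t -> continuous (f n) t) ->
  (forall n t, 0 < t -> Rabs (f n t) <= a n * wt t) ->
  continuous (fun t => Series (fun n => f n t)) t0.
Proof.
  intros Ht0 Ha Hc Hb. apply continuity_pt_filterlim. assert (Hr : 0 < t0 / 2) by lra.
  assert (Pos : forall y, Boule t0 (mkposreal _ Hr) y -> t0 / 2 < y) by (intros y Hy; apply Rabs_def2 in Hy; simpl in Hy; lra).
  apply (CVU_continuity (fun n t => sum_n (fun i => f i t) n) _ t0 (mkposreal _ Hr)).
  - intros eps He. pose proof (wt_pos _ Hr) as HM. set (M := wt (t0 / 2)) in *.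
    destruct (Series_tail_small a (eps / M) Ha ltac:(now apply Rdiv_lt_0_compat)) as [N HN]. exists N. intros n y Hn Hy.
    specialize (Pos y Hy). specialize (HN n Hn).
    eapply Rle_lt_trans; [apply (Series_tail_le _ (fun i => a i * wt y))|].
    + intros i. apply Hb. lra.
    + apply (ex_series_scal_r (wt y) a), Ha.
    + rewrite Series_scal_r. replace (sum_n (fun i => a i * wt y) n) with (sum_n a n * wt y) by (symmetry; apply (sum_n_mult_r (K := R_Ring))).
      rewrite <- Rmult_minus_distr_r.
      assert (Hw : 0 < wt y <= M).
      { split; [apply wt_pos; lra|]. unfold M, wt. pose proof (sqrt_lt_R0 _ Hr). pose proof (sqrt_le_1_alt (t0 / 2) y ltac:(lra)).
        apply Rinv_le_contravar; nra. }
      replace eps with (eps / M * M) by (field; lra).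
      assert (0 <= Series a - sum_n a n).
      { eapply Rle_trans; [apply Rabs_pos|apply (Series_tail_le (fun _ => 0)); [|exact Ha]]. intros i. rewrite Rabs_R0.
        pose proof (Hb i 1 Rlt_0_1). pose proof (Rabs_pos (f i 1)). pose proof (wt_pos 1 Rlt_0_1). nra. }
      nra.
  - intros n y Hy. specialize (Pos y Hy). apply continuity_pt_filterlim. induction n as [|n IH].
    + apply (continuous_ext (fun t => f 0%nat t)); [intros t; now rewrite sum_O|apply Hc; lra].
    + apply (continuous_ext (fun t => sum_n (fun n => f n t) n + f (S n) t)); [intros t; now rewrite sum_n_S|].
      apply (continuous_plus (fun t => sum_n (fun n => f n t) n) (f (S n))); [exact IH|apply Hc; lra].
  - unfold Boule. simpl. rewrite Rminus_diag, Rabs_R0. exact Hr.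
Qed.

Lemma dom_Series (f : nat -> R -> R) (a : nat -> R) :
  ex_series a ->
  (forall n, dom (f n) (a n)) ->
  dom (fun t => Series (fun n => f n t)) (Series a).
Proof.
  intros Ha H. split.
  - intros t Ht. apply continuous_Series_dom with a; auto.
    + intros n s Hs. now apply (H n).
    + intros n s Hs. now apply (H n).
  - intros t Ht. rewrite <- Series_scal_r. apply Series_abs_le.
    + intros n. now apply (H n).
    + apply (ex_series_scal_r (wt t) a), Ha.
Qed.

Lemma hint_zero : hint (fun _ => 0) = 0.
Proof.
  assert (D : dom (fun _ => 0) 0).
  { split; [intros; apply continuous_const|intros; rewrite Rabs_R0; lra]. }
  pose proof (hint_bound _ _ D) as H. rewrite Rmult_0_l in H.
  destruct (Req_dec (hint (fun _ => 0)) 0) as [E|E]; [exact E|].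
  apply Rabs_pos_lt in E. lra.
Qed.

Lemma hint_sum_n (f : nat -> R -> R) (a : nat -> R) N :
  (forall n, dom (f n) (a n)) ->
  dom (fun t => sum_n (fun n => f n t) N) (sum_n a N) /\
  hint (fun t => sum_n (fun n => f n t) N) = sum_n (fun n => hint (f n)) N.
Proof.
  intros H. induction N as [|N [IH1 IH2]].
  - rewrite !sum_O. split.
    + apply (dom_ext (f 0%nat)); [intros; now rewrite sum_O|apply H].
    + apply hint_ext. intros; now rewrite sum_O.
  - rewrite !sum_n_S. split.
    + apply (dom_ext (fun t => sum_n (fun n => f n t) N + f (S N) t)).
      * intros; now rewrite sum_n_S.
      * now apply dom_plus.
    + rewrite <- IH2, <- (hint_plus _ _ _ _ IH1 (H (S N))).
      apply hint_ext. intros; now rewrite sum_n_S.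
Qed.

(** The remainder after N terms is dominated by the tail of [a] times [wt], so its integral is at
    most PI times this tail. *)
Lemma hint_Series (f : nat -> R -> R) (a : nat -> R) :
  ex_series a ->
  (forall n, dom (f n) (a n)) ->
  is_series (fun n => hint (f n)) (hint (fun t => Series (fun n => f n t))).
Proof.
  intros Ha H. apply is_series_lim.
  assert (Hd := dom_Series f a Ha H).
  set (g := fun t => Series (fun n => f n t)) in *.
  assert (K : forall N, Rabs (hint g - sum_n (fun n => hint (f n)) N)
     <= (Series a - sum_n a N) * PI).
  { intros N. destruct (hint_sum_n f a N H) as [D1 <-].
    rewrite <- (hint_minus _ _ _ _ Hd D1). apply hint_bound. split.
    - intros t Ht. apply (continuous_minus g (fun t => sum_n (fun n => f n t) N)).
      + now apply Hd.
      + now apply D1.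
    - intros t Ht. eapply Rle_trans; [apply (Series_tail_le _ (fun n => a n * wt t))|].
      + intros n. now apply H.
      + apply (ex_series_scal_r (wt t) a), Ha.
      + rewrite Series_scal_r. replace (sum_n (fun i => a i * wt t) N) with (sum_n a N * wt t) by (symmetry; apply (sum_n_mult_r (K := R_Ring))).
        right. ring. }
  apply is_lim_seq_spec. intros eps. pose proof PI_RGT_0 as HPI.
  destruct (Series_tail_small a (eps / PI) Ha ltac:(apply Rdiv_lt_0_compat; [apply cond_pos|lra])) as [N HN].
  exists N. intros n Hn. rewrite Rabs_minus_sym. eapply Rle_lt_trans; [apply K|].
  apply Rlt_le_trans with (eps / PI * PI); [|right; field; lra]. apply Rmult_lt_compat_r; [lra|now apply HN].
Qed.

Lemma wt_scale c t : 0 < c -> 0 < t -> wt (c * t) <= (1 + / c) / sqrt c * wt t.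
Proof.
  intros Hc Ht. unfold wt. rewrite sqrt_mult by lra.
  assert (S1 := sqrt_lt_R0 c Hc). assert (S2 := sqrt_lt_R0 t Ht).
  apply Rmult_le_reg_r with (sqrt c * sqrt t * (1 + c * t) * (1 + t) * c).
  { repeat apply Rmult_lt_0_compat; try lra. nra. }
  replace (/ (sqrt c * sqrt t * (1 + c * t)) * (sqrt c * sqrt t * (1 + c * t) * (1 + t) * c))
    with ((1 + t) * c) by (field; repeat split; nra).
  replace ((1 + / c) / sqrt c * / (sqrt t * (1 + t)) * (sqrt c * sqrt t * (1 + c * t) * (1 + t) * c))
    with ((c + 1) * (1 + c * t)) by (field; repeat split; nra). nra.
Qed.

Lemma dom_scale f A c : 0 < c -> dom f A ->
  dom (fun t => f (c * t)) (A * ((1 + / c) / sqrt c)).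
Proof.
  intros Hc H. pose proof (dom_nonneg f A H). destruct H as [H1 H2]. split.
  - intros t Ht. apply (continuous_comp (fun t => c * t) f).
    + apply (ex_derive_continuous (fun t => c * t)). auto_derive. exact I.
    + apply H1. nra.
  - intros t Ht. eapply Rle_trans; [apply H2; nra|]. rewrite Rmult_assoc.
    apply Rmult_le_compat_l; auto. now apply wt_scale.
Qed.

(** Any exhausting sequence of intervals computes [hint]. A change of scale turns the standard
    sequence into another one, hence the use in [hint_scale]. *)
Lemma hint_lim_seq f A (a b : nat -> R) : dom f A ->
  (forall n, 0 < a n <= b n) -> is_lim_seq (fun n => gap (a n) (b n)) 0 ->
  is_lim_seq (fun n => RInt f (a n) (b n)) (hint f).
Proof.
  intros H Hab Hg.
  apply is_lim_seq_le_le with (fun n => hint f - A * gap (a n) (b n)) (fun n => hint f + A * gap (a n) (b n)).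
  - intros n. destruct (Hab n) as [H1 H2].
    pose proof (hint_approx f A (a n) (b n) H H1 H2) as K. apply Rabs_le_between in K. lra.
  - replace (Finite (hint f)) with (Finite (hint f - A * 0)) by (f_equal; ring).
    apply is_lim_seq_minus'; [apply is_lim_seq_const|].
    apply (is_lim_seq_scal_l (fun n => gap (a n) (b n)) A 0), Hg.
  - replace (Finite (hint f)) with (Finite (hint f + A * 0)) by (f_equal; ring).
    apply is_lim_seq_plus'; [apply is_lim_seq_const|].
    apply (is_lim_seq_scal_l (fun n => gap (a n) (b n)) A 0), Hg.
Qed.

Lemma hint_scale f A c : 0 < c -> dom f A -> hint (fun t => f (c * t)) = / c * hint f.
Proof.
  intros Hc H. apply hint_unique with (A * ((1 + / c) / sqrt c)); [now apply dom_scale|].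
  apply is_lim_seq_ext with (fun n => / c * RInt f (c * / INR (S n)) (c * INR (S n))).
  - intros n. destruct (nested_index n n (le_n n)) as [H1 [H2 [H3 H4]]].
    rewrite <- (RInt_comp f (fun t => c * t) (fun _ => c)).
    + rewrite (RInt_scal (fun t => f (c * t)) _ _ c).
      * change scal with Rmult. field. lra.
      * apply ex_RInt_pos; auto; [|lra]. apply (dom_scale f A c Hc H).
    + intros x Hx. rewrite Rmin_left in Hx by lra. apply H. nra.
    + intros x Hx. split; [|apply continuous_const]. auto_derive; [exact I|ring].
  - apply (is_lim_seq_scal_l _ (/ c) (hint f)).
    apply hint_lim_seq with A; auto.
    + intros n. destruct (nested_index n n (le_n n)) as [H1 [H2 [H3 H4]]]. nra.
    + apply is_lim_seq_le_le with (fun _ => 0)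
        (fun n => (2 * sqrt c + 2 * / sqrt c) * / sqrt (INR (S n))).
      * intros n. destruct (nested_index n n (le_n n)) as [H1 [H2 [H3 H4]]].
        pose proof (INR_S_pos n) as Hn.
        pose proof (gap_le (c * / INR (S n)) (c * INR (S n)) ltac:(nra) ltac:(nra)) as G.
        rewrite !sqrt_mult, sqrt_inv in G by lra.
        assert (S1 := sqrt_lt_R0 c Hc). assert (S2 := sqrt_lt_R0 _ Hn).
        replace (2 / (sqrt c * sqrt (INR (S n)))) with (2 * / sqrt c * / sqrt (INR (S n))) in G
          by (field; lra). lra.
      * apply is_lim_seq_const.
      * replace (Finite 0) with (Rbar_mult (2 * sqrt c + 2 * / sqrt c) 0) by (simpl; f_equal; ring).
        apply is_lim_seq_scal_l, lim_inv_sqrt_INR.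
Qed.

(** * Exponential bounds *)

Lemma exp_INR_mult n x : exp (INR n * x) = exp x ^ n.
Proof.
  induction n as [|n IH]; [now rewrite Rmult_0_l, exp_0|].
  rewrite S_INR. simpl pow. rewrite <- IH, <- exp_plus. f_equal. ring.
Qed.

(** The inequality 1 + u <= exp u at u = x / n, raised to the n-th power. With it exponential decay
    is traded for powers in the estimates below. *)
Lemma exp_neg_le n x : 0 < x -> exp (- x) <= (INR n / x) ^ n.
Proof.
  intros Hx. destruct n as [|n].
  - simpl. rewrite <- exp_0. left. apply exp_increasing. lra.
  - pose proof (INR_S_pos n) as Hn. set (N := INR (S n)) in *.
    assert (Hy : 0 < x / N) by (apply Rdiv_lt_0_compat; lra).
    replace (exp (- x)) with (exp (- (x / N)) ^ S n).
    + apply pow_incr. split; [left; apply exp_pos|].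
      rewrite exp_Ropp. replace (N / x) with (/ (x / N)) by (field; lra).
      apply Rinv_le_contravar; [auto|]. pose proof (exp_ineq1_le (x / N)). lra.
    + rewrite <- exp_INR_mult. f_equal. fold N. field. lra.
Qed.

Lemma pow_exp_bound n c t : 0 < c -> 0 <= t -> t ^ n * exp (- (c * t)) <= (INR n / c) ^ n.
Proof.
  intros Hc [Ht|<-].
  - apply Rle_trans with (t ^ n * (INR n / (c * t)) ^ n).
    + apply Rmult_le_compat_l; [apply pow_le; lra|]. apply exp_neg_le. nra.
    + rewrite <- Rpow_mult_distr. right. f_equal. field. lra.
  - rewrite Rmult_0_r, Ropp_0, exp_0, Rmult_1_r. destruct n; [simpl; lra|].
    rewrite pow_i by lia. apply pow_le. apply Rmult_le_pos; [apply pos_INR|].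
    left; now apply Rinv_0_lt_compat.
Qed.

Lemma sqrt_le_1_plus t : 0 < t -> sqrt t <= 1 + t.
Proof.
  intros H. assert (E := sqrt_sqrt t ltac:(lra)). assert (Hs := sqrt_lt_R0 t H). nra.
Qed.

Lemma wt_ge_rational t : 0 < t -> / (2 * (1 + t ^ 2)) <= wt t.
Proof.
  intros H. unfold wt. assert (Hs := sqrt_lt_R0 t H). pose proof (sqrt_le_1_plus t H) as H1.
  apply Rinv_le_contravar; [apply Rmult_lt_0_compat; lra|].
  apply Rle_trans with ((1 + t) * (1 + t)); [apply Rmult_le_compat_r; lra|].
  pose proof (pow2_ge_0 (1 - t)). lra.
Qed.

Lemma exp_le_wt c : 0 < c -> exists A, 0 < A /\ forall t, 0 < t -> exp (- (c * t)) <= A * wt t.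
Proof.
  intros Hc. exists (2 * (1 + (INR 2 / c) ^ 2)).
  assert (0 <= (INR 2 / c) ^ 2) by apply pow2_ge_0.
  split; [lra|]. intros t Ht.
  apply Rle_trans with (2 * (1 + (INR 2 / c) ^ 2) * / (2 * (1 + t ^ 2))).
  - pose proof (pow_exp_bound 2 c t Hc ltac:(lra)).
    assert (exp (- (c * t)) <= 1) by (rewrite <- exp_0; left; apply exp_increasing; nra).
    apply Rmult_le_reg_r with (2 * (1 + t ^ 2)); [nra|].
    rewrite Rmult_assoc, Rinv_l by nra. nra.
  - apply Rmult_le_compat_l; [nra|]. now apply wt_ge_rational.
Qed.

(** * The Poisson kernel and its partial fractions *)

Lemma nonneg_of_derive (f f' : R -> R) (b x : R) :
  0 <= f 0 -> (forall z, 0 <= z <= b -> is_derive f z (f' z)) ->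
  (forall z, 0 <= z <= b -> 0 <= f' z) -> 0 <= x <= b -> 0 <= f x.
Proof.
  intros H0 Hd Hp Hx.
  destruct (MVT_gen f 0 x f') as [c [Hc E]].
  - intros z Hz. rewrite Rmin_left, Rmax_right in Hz by lra. apply Hd. lra.
  - intros z Hz. rewrite Rmin_left, Rmax_right in Hz by lra.
    apply derivable_continuous_pt. exists (f' z). apply is_derive_Reals, Hd. lra.
  - rewrite Rmin_left, Rmax_right in Hc by lra. specialize (Hp c ltac:(lra)).
    assert (0 <= f' c * (x - 0)) by (apply Rmult_le_pos; lra). lra.
Qed.

Lemma cos_lower x : 0 <= x -> 1 - x ^ 2 / 2 <= cos x.
Proof.
  intros Hx.
  assert (H : 0 <= (fun z => cos z - 1 + z ^ 2 / 2) x).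
  { apply (nonneg_of_derive (fun z => cos z - 1 + z ^ 2 / 2) (fun z => z - sin z) x).
    - cbv beta. rewrite cos_0. lra.
    - intros z _. auto_derive; [exact I|field].
    - intros z Hz. destruct (Req_dec z 0) as [->|]; [rewrite sin_0; lra|].
      pose proof (sin_lt_x z ltac:(lra)). lra.
    - lra. }
  simpl in H. simpl. lra.
Qed.

Lemma sin_lower x : 0 <= x -> x - x ^ 3 / 6 <= sin x.
Proof.
  intros Hx.
  assert (H : 0 <= (fun z => sin z - z + z ^ 3 / 6) x).
  { apply (nonneg_of_derive (fun z => sin z - z + z ^ 3 / 6) (fun z => cos z - 1 + z ^ 2 / 2) x).
    - cbv beta. rewrite sin_0. simpl. lra.
    - intros z _. auto_derive; [exact I|field].
    - intros z Hz. pose proof (cos_lower z ltac:(lra)). lra.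
    - lra. }
  simpl in H. simpl. lra.
Qed.

Lemma cos_upper x : 0 <= x -> cos x <= 1 - x ^ 2 / 2 + x ^ 4 / 24.
Proof.
  intros Hx.
  assert (H : 0 <= (fun z => 1 - z ^ 2 / 2 + z ^ 4 / 24 - cos z) x).
  { apply (nonneg_of_derive (fun z => 1 - z ^ 2 / 2 + z ^ 4 / 24 - cos z) (fun z => - z + z ^ 3 / 6 + sin z) x).
    - cbv beta. rewrite cos_0. simpl. lra.
    - intros z _. auto_derive; [exact I|field].
    - intros z Hz. pose proof (sin_lower z ltac:(lra)). lra.
    - lra. }
  simpl in H. simpl. lra.
Qed.

(** Any bound below sqrt 12 keeps x^2 / 2 - x^4 / 24 above a multiple of x^2 on [-PI, PI]. The
    Taylor polynomial of degree 4 is negative at 8 / 5, while cos would be positive there if PI / 2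
    exceeded 8 / 5. *)
Lemma PI_lt_17_5 : PI < 17 / 5.
Proof.
  destruct (Rlt_dec PI (17 / 5)) as [H|H]; [exact H|exfalso].
  pose proof (cos_upper (8 / 5) ltac:(lra)).
  pose proof (cos_gt_0 (8/5) ltac:(lra) ltac:(lra)). lra.
Qed.

Lemma PI_gt_3 : 3 < PI.
Proof. pose proof PI2_3_2. lra. Qed.

(** With x^2 <= 289 / 25 the coefficient 1 / 2 - x^2 / 24 is still at least 1 / 60. *)
Lemma one_minus_cos_ge x : Rabs x <= PI -> x ^ 2 / 60 <= 1 - cos x.
Proof.
  intros H.
  assert (Hc : cos x = cos (Rabs x)).
  { unfold Rabs. destruct (Rcase_abs x); [now rewrite cos_neg|reflexivity]. }
  rewrite Hc. rewrite <- (pow2_abs x). set (y := Rabs x) in *.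
  assert (Hy : 0 <= y) by apply Rabs_pos.
  pose proof (cos_upper y Hy). pose proof PI_lt_17_5.
  assert (y ^ 2 <= 289 / 25) by nra.
  assert (0 <= y ^ 2) by apply pow2_ge_0.
  replace (y ^ 4) with (y ^ 2 * y ^ 2) in * by ring. nra.
Qed.

Lemma cosh_le_3 z : 0 <= z <= 1 -> cosh z <= 3.
Proof.
  intros Hz. unfold cosh.
  assert (exp z <= exp 1). { now apply exp_le. }
  assert (exp (- z) <= 1). { rewrite <- exp_0. apply exp_le. lra. }
  pose proof exp_le_3. lra.
Qed.

Lemma cosh_ge_1 z : 1 <= cosh z.
Proof.
  unfold cosh. pose proof (exp_ineq1_le z). pose proof (exp_pos z). pose proof (exp_pos (- z)).
  assert (E : exp z * exp (- z) = 1) by (rewrite <- exp_plus, Rplus_opp_r; apply exp_0).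
  assert (H2 : 0 <= exp (- z) * (exp z - 1) ^ 2) by (apply Rmult_le_pos; [lra|apply pow2_ge_0]).
  replace (exp (- z) * (exp z - 1) ^ 2)
    with (exp z * (exp z * exp (- z)) - 2 * (exp z * exp (- z)) + exp (- z)) in H2 by ring.
  rewrite E in H2. lra.
Qed.

Lemma sinh_ge_id z : 0 <= z -> z <= sinh z.
Proof.
  intros Hz. assert (H : 0 <= (fun z => sinh z - z) z).
  { apply (nonneg_of_derive (fun z => sinh z - z) (fun z => cosh z - 1) z).
    - cbv beta. rewrite sinh_0. lra.
    - intros y _. unfold sinh, cosh. auto_derive; [exact I|field].
    - intros y _. pose proof (cosh_ge_1 y). lra.
    - lra. }
  lra.
Qed.

Lemma cosh_lower z : 0 <= z -> 1 + z ^ 2 / 2 <= cosh z.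
Proof.
  intros Hz. assert (H : 0 <= (fun z => cosh z - 1 - z ^ 2 / 2) z).
  { apply (nonneg_of_derive (fun z => cosh z - 1 - z ^ 2 / 2) (fun z => sinh z - z) z).
    - cbv beta. rewrite cosh_0. simpl. lra.
    - intros y _. unfold sinh, cosh. auto_derive; [exact I|field].
    - intros y Hy. pose proof (sinh_ge_id y ltac:(lra)). lra.
    - lra. }
  simpl in *. lra.
Qed.

Lemma sinh_cosh_upper z : 0 <= z <= 1 -> sinh z <= z + z ^ 3 /\ cosh z <= 1 + z ^ 2 / 2 + z ^ 4.
Proof.
  intros Hz.
  assert (D1 : forall y, is_derive sinh y (cosh y)).
  { intros y. unfold sinh, cosh. auto_derive; [exact I|field]. }
  assert (D2 : forall y, is_derive cosh y (sinh y)).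
  { intros y. unfold sinh, cosh. auto_derive; [exact I|field]. }
  (* Each bound is obtained by integrating the previous one, starting from cosh <= 3. *)
  assert (S1 : forall y, 0 <= y <= 1 -> sinh y <= 6 * y).
  { intros y Hy. assert (H : 0 <= (fun z => 6 * z - sinh z) y); [|simpl in H; lra].
    apply (nonneg_of_derive (fun z => 6 * z - sinh z) (fun z => 6 - cosh z) 1); auto.
    - cbv beta. rewrite sinh_0. lra.
    - intros w _. apply (is_derive_minus (fun z => 6 * z) sinh); auto. auto_derive; [exact I|ring].
    - intros w Hw. pose proof (cosh_le_3 w Hw). lra. }
  assert (C1 : forall y, 0 <= y <= 1 -> cosh y <= 1 + 3 * y ^ 2).
  { intros y Hy. assert (H : 0 <= (fun z => 1 + 3 * z ^ 2 - cosh z) y); [|simpl in *; lra].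
    apply (nonneg_of_derive (fun z => 1 + 3 * z ^ 2 - cosh z) (fun z => 6 * z - sinh z) 1); auto.
    - cbv beta. rewrite cosh_0. simpl. lra.
    - intros w _. apply (is_derive_minus (fun z => 1 + 3 * z ^ 2) cosh); auto. auto_derive; [exact I|ring].
    - intros w Hw. pose proof (S1 w Hw). lra. }
  assert (S2 : forall y, 0 <= y <= 1 -> sinh y <= y + y ^ 3).
  { intros y Hy. assert (H : 0 <= (fun z => z + z ^ 3 - sinh z) y); [|simpl in *; lra].
    apply (nonneg_of_derive (fun z => z + z ^ 3 - sinh z) (fun z => 1 + 3 * z ^ 2 - cosh z) 1); auto.
    - cbv beta. rewrite sinh_0. simpl. lra.
    - intros w _. apply (is_derive_minus (fun z => z + z ^ 3) sinh); auto. auto_derive; [exact I|ring].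
    - intros w Hw. pose proof (C1 w Hw). lra. }
  split; [now apply S2|].
  assert (H : 0 <= (fun z => 1 + z ^ 2 / 2 + z ^ 4 - cosh z) z); [|simpl in *; lra].
  apply (nonneg_of_derive (fun z => 1 + z ^ 2 / 2 + z ^ 4 - cosh z) (fun z => z + 4 * z ^ 3 - sinh z) 1); auto.
  - cbv beta. rewrite cosh_0. simpl. lra.
  - intros w _. apply (is_derive_minus (fun z => 1 + z ^ 2 / 2 + z ^ 4) cosh); auto. auto_derive; [exact I|field].
  - intros w Hw. pose proof (S2 w Hw). assert (0 <= w ^ 3) by (apply pow_le; lra). lra.
Qed.

(** The real part of 1 / (t - i x), that is, PI times the Poisson kernel of the half-plane. *)
Definition pk (t x : R) : R := t / (t ^ 2 + x ^ 2).

(** Half the Poisson kernel of the disc at radius exp (-t); it equals 1 / 2 + sum_d exp (- d t) cos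
    (d th). *)
Definition poisson (t th : R) : R := sinh t / (2 * (cosh t - cos th)).

(** Pairing the lattice points 2 PI n and - 2 PI (n + 1) enumerates 2 PI Z by natural numbers. *)
Definition poisson_term (t th : R) (n : nat) : R :=
  pk t (th + 2 * PI * INR n) + pk t (th - 2 * PI * INR (S n)).

(** Over the common denominator the lowest-order terms cancel: the numerator is at most 3 t (t^2 +
    x^2)^2. Since cosh t - cos x >= (t^2 + x^2) / 60, the quotient is at most 180 t. *)
Lemma poisson_pk_bound t x : 0 < t <= 1 -> Rabs x <= PI -> Rabs (poisson t x - pk t x) <= 180 * t.
Proof.
  intros Ht Hx. unfold poisson, pk.
  pose proof (one_minus_cos_ge x Hx) as E0.
  pose proof (cosh_lower t ltac:(lra)) as E1.
  destruct (sinh_cosh_upper t ltac:(lra)) as [E2 E3].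
  pose proof (sinh_ge_id t ltac:(lra)) as E4.
  assert (Hc : cos x = cos (Rabs x)).
  { unfold Rabs. destruct (Rcase_abs x); [now rewrite cos_neg|reflexivity]. }
  pose proof (cos_lower (Rabs x) (Rabs_pos x)) as E5.
  pose proof (cos_upper (Rabs x) (Rabs_pos x)) as E6.
  rewrite <- Hc in E5, E6. rewrite pow2_abs in E5, E6.
  replace (Rabs x ^ 4) with (x ^ 4) in E6.
  2:{ replace (x ^ 4) with (x ^ 2 * x ^ 2) by ring. rewrite <- pow2_abs. ring. }
  set (r := t ^ 2 + x ^ 2). assert (0 <= x ^ 2) by apply pow2_ge_0.
  assert (Hr : 0 < r) by (unfold r; nra).
  set (d := cosh t - cos x).
  assert (Hd : r / 60 <= d) by (unfold r, d; nra).
  assert (Hd0 : 0 < d) by nra.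
  set (e1 := cosh t - 1 - t ^ 2 / 2). set (e2 := 1 - cos x - x ^ 2 / 2).
  set (N := (sinh t - t) * r / 2 - t * (e1 + e2)).
  replace (sinh t / (2 * d) - t / r) with (N / (d * r)).
  2:{ unfold N, e1, e2, d, r. field. split; [fold r; lra|fold d; lra]. }
  assert (HN : Rabs N <= 3 * t * (r * r)).
  { assert (T2 : t ^ 2 <= r) by (unfold r; lra). assert (X2 : x ^ 2 <= r) by (unfold r; nra).
    assert (A1 : 0 <= (sinh t - t) * r / 2 <= t * (r * r) / 2).
    { assert (0 <= sinh t - t <= t * t ^ 2) by (split; [lra|]; replace (t * t ^ 2) with (t ^ 3) by ring; lra).
      assert (t * t ^ 2 <= t * r) by (apply Rmult_le_compat_l; lra).
      split; [nra|]. assert ((sinh t - t) * r <= t * r * r) by (apply Rmult_le_compat_r; lra). lra. }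
    assert (A2 : 0 <= e1 <= r * r).
    { unfold e1. split; [lra|]. replace (t ^ 4) with (t ^ 2 * t ^ 2) in E3 by ring.
      assert (t ^ 2 * t ^ 2 <= r * r) by (apply Rmult_le_compat; nra). lra. }
    assert (A3 : - (r * r) <= e2 <= 0).
    { unfold e2. split; [|lra]. replace (x ^ 4) with (x ^ 2 * x ^ 2) in E6 by ring.
      assert (x ^ 2 * x ^ 2 <= r * r) by (apply Rmult_le_compat; nra). nra. }
    assert (A4 : - (r * r) <= e1 + e2 <= r * r) by lra.
    assert (A5 : - (t * (r * r)) <= t * (e1 + e2) <= t * (r * r)).
    { split; [|apply Rmult_le_compat_l; lra].
      replace (- (t * (r * r))) with (t * (- (r * r))) by ring. apply Rmult_le_compat_l; lra. }
    assert (0 <= t * (r * r)) by (apply Rmult_le_pos; nra).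
    unfold N. apply Rabs_le. lra. }
  unfold Rdiv. rewrite Rabs_mult, Rabs_inv, (Rabs_right (d * r)) by nra.
  apply Rmult_le_reg_r with (d * r); [nra|].
  rewrite Rmult_assoc, Rinv_l, Rmult_1_r by nra.
  apply Rle_trans with (1 := HN).
  assert (r / 60 * r <= d * r) by (apply Rmult_le_compat_r; lra). nra.
Qed.

Lemma pk_bounds t x : 0 < t -> x <> 0 -> 0 <= pk t x <= t / x ^ 2.
Proof.
  intros Ht Hx. unfold pk. assert (0 < x ^ 2) by nra. split.
  - apply Rmult_le_pos; [lra|left; apply Rinv_0_lt_compat; nra].
  - apply Rmult_le_compat_l; [lra|]. apply Rinv_le_contravar; nra.
Qed.

Lemma poisson_term_bound t th n : 0 < t -> 0 <= th <= 2 * PI ->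
  0 <= poisson_term t th (S n) <= t * / INR (S n) ^ 2.
Proof.
  intros Ht Hth. unfold poisson_term. pose proof PI_gt_3 as HP.
  pose proof (INR_S_ge1 n) as Hn. rewrite (S_INR (S n)). set (N := INR (S n)) in *.
  assert (K : forall x, 6 * N <= Rabs x -> 0 <= pk t x <= t * / N ^ 2 / 36).
  { intros x Hx. assert (x <> 0) by (intros ->; rewrite Rabs_R0 in Hx; lra).
    destruct (pk_bounds t x Ht ltac:(auto)) as [H1 H2]. split; [exact H1|].
    apply Rle_trans with (1 := H2). rewrite <- (pow2_abs x).
    unfold Rdiv at 1. replace (t * / N ^ 2 / 36) with (t * / (6 * N) ^ 2) by (field; lra).
    apply Rmult_le_compat_l; [lra|]. apply Rinv_le_contravar; [nra|]. apply pow_incr. lra. }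
  assert (K1 := K (th + 2 * PI * N) ltac:(rewrite Rabs_right; nra)).
  assert (K2 := K (th - 2 * PI * (N + 1)) ltac:(rewrite Rabs_left; nra)).
  assert (0 < t * / N ^ 2) by (apply Rmult_lt_0_compat; [lra|apply Rinv_0_lt_compat; nra]). lra.
Qed.

Lemma ex_series_poisson_term t th : 0 < t -> 0 <= th <= 2 * PI -> ex_series (poisson_term t th).
Proof.
  intros Ht Hth. apply (proj2 (ex_series_incr_1 (poisson_term t th))).
  apply ex_series_dom with (fun n => t * / INR (S n) ^ 2).
  - intros n. destruct (poisson_term_bound t th n Ht Hth). rewrite Rabs_right; lra.
  - apply (ex_series_scal_l t (fun n => / INR (S n) ^ 2)), ex_series_inv_sq.
Qed.

Lemma poisson_symm t th : poisson t (2 * PI - th) = poisson t th.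
Proof.
  unfold poisson. rewrite cos_minus, cos_2PI, sin_2PI, Rmult_1_l, Rmult_0_l, Rplus_0_r. reflexivity.
Qed.

Lemma pk_even t x : pk t (- x) = pk t x.
Proof. unfold pk. f_equal. ring. Qed.

Definition poisson_defect (t th : R) : R := poisson t th - Series (poisson_term t th).

(** In the term n = 0 one summand is singular near th = 0, the other near th = 2 PI. On each half of
    the interval [poisson_pk_bound] handles the singular one, directly or by symmetry, and the other
    is O(t), like all further terms. *)
Lemma poisson_defect_small : exists K, 0 < K /\ forall t th, 0 < t <= 1 -> 0 <= th <= 2 * PI ->
  Rabs (poisson_defect t th) <= K * t.
Proof.
  set (Z := Series (fun n => / INR (S n) ^ 2)).
  assert (HZ : 0 <= Z).
  { apply Series_pos; [|apply ex_series_inv_sq]. intros i. left. apply Rinv_0_lt_compat, pow_lt, INR_S_pos. }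
  exists (181 + Z). split; [lra|]. intros t th Ht Hth. pose proof PI_gt_3 as HP.
  unfold poisson_defect. rewrite Series_incr_1 by (apply ex_series_poisson_term; lra).
  assert (HT : 0 <= Series (fun n => poisson_term t th (S n)) <= t * Z).
  { assert (He : ex_series (fun n => poisson_term t th (S n))).
    { apply (proj1 (ex_series_incr_1 (poisson_term t th))), ex_series_poisson_term; lra. }
    split.
    - apply Series_pos; auto. intros i. apply poisson_term_bound; lra.
    - unfold Z. rewrite <- Series_scal_l. apply Series_le.
      + intros n. apply poisson_term_bound; lra.
      + apply (ex_series_scal_l t (fun n => / INR (S n) ^ 2)), ex_series_inv_sq. }
  assert (H0 : Rabs (poisson t th - poisson_term t th 0) <= 181 * t).
  { unfold poisson_term. rewrite INR_0, Rmult_0_r, Rplus_0_r.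
    change (INR 1) with 1. rewrite Rmult_1_r.
    assert (Far : forall x, PI <= Rabs x -> 0 <= pk t x <= t).
    { intros x Hx. assert (x <> 0) by (intros ->; rewrite Rabs_R0 in Hx; lra).
      destruct (pk_bounds t x ltac:(lra) ltac:(auto)) as [H1 H2]. split; [exact H1|].
      apply Rle_trans with (1 := H2). rewrite <- (pow2_abs x).
      rewrite <- (Rmult_1_r t) at 2. unfold Rdiv. apply Rmult_le_compat_l; [lra|].
      rewrite <- Rinv_1. apply Rinv_le_contravar; nra. }
    destruct (Rle_dec th PI) as [H|H].
    - pose proof (poisson_pk_bound t th Ht ltac:(rewrite Rabs_right; lra)) as B.
      pose proof (Far (th - 2 * PI) ltac:(rewrite Rabs_left; lra)) as F.
      apply Rabs_le_between in B. apply Rabs_le. lra.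
    - pose proof (poisson_pk_bound t (2 * PI - th) Ht ltac:(rewrite Rabs_right; lra)) as B.
      pose proof (Far th ltac:(rewrite Rabs_right; lra)) as F.
      rewrite poisson_symm, <- pk_even in B.
      replace (- (2 * PI - th)) with (th - 2 * PI) in B by ring.
      apply Rabs_le_between in B. apply Rabs_le. lra. }
  apply Rabs_le_between in H0. apply Rabs_le. nra.
Qed.

(** Rests on cosh t - cos th = 2 (cosh (t/2) - cos (th/2)) (cosh (t/2) + cos (th/2)) and cos (th/2 +
    PI) = - cos (th/2). *)
Lemma poisson_duplication t th : 0 < t ->
  poisson t th = (poisson (t / 2) (th / 2) + poisson (t / 2) (th / 2 + PI)) / 2.
Proof.
  intros Ht. unfold poisson. rewrite neg_cos.
  assert (Hc : cos th = 2 * cos (th / 2) * cos (th / 2) - 1).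
  { replace th with (2 * (th / 2)) at 1 by field. now rewrite cos_2a_cos. }
  assert (Hch : cosh t = 2 * cosh (t / 2) * cosh (t / 2) - 1 /\ sinh t = 2 * sinh (t / 2) * cosh (t / 2)).
  { assert (Et : t = t / 2 + t / 2) by field. set (h := t / 2) in *. clearbody h. rewrite Et.
    unfold cosh, sinh. rewrite Ropp_plus_distr, !exp_plus.
    assert (H : exp h * exp (- h) = 1) by (rewrite <- exp_plus, Rplus_opp_r; apply exp_0).
    split; [|field]. set (u := exp h) in *. set (v := exp (- h)) in *.
    replace (2 * ((u + v) / 2) * ((u + v) / 2) - 1) with ((u * u + v * v) / 2 + (u * v - 1)) by field.
    rewrite H. field. }
  destruct Hch as [H1 H2]. rewrite Hc, H1, H2.
  assert (C : 1 < cosh (t / 2)) by (pose proof (cosh_lower (t / 2) ltac:(lra)); nra).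
  pose proof (COS_bound (th / 2)) as B. set (c := cos (th / 2)) in *. set (h := cosh (t / 2)) in *.
  field. repeat split; nra.
Qed.

(** After rescaling, th/2 yields the lattice points 2 PI m with m even and th/2 + PI those with m
    odd. *)
Lemma poisson_term_duplication t th n : 0 < t ->
  poisson_term (t / 2) (th / 2) n + poisson_term (t / 2) (th / 2 + PI) n
  = 2 * (poisson_term t th (2 * n) + poisson_term t th (2 * n + 1)).
Proof.
  intros Ht. unfold poisson_term.
  assert (K : forall x, pk (t / 2) (x / 2) = 2 * pk t x).
  { intros x. unfold pk. field. nra. }
  replace (S (2 * n)) with (2 * n + 1)%nat by lia. replace (S (2 * n + 1)) with (2 * n + 2)%nat by lia.
  rewrite !S_INR, !plus_INR, !mult_INR. simpl (INR 2). simpl (INR 1). set (N := INR n).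
  replace (th / 2 + 2 * PI * N) with ((th + 2 * PI * (2 * N)) / 2) by field.
  replace (th / 2 - 2 * PI * (N + 1)) with ((th - 2 * PI * (2 * N + 2)) / 2) by field.
  replace (th / 2 + PI + 2 * PI * N) with ((th + 2 * PI * (2 * N + 1)) / 2) by field.
  replace (th / 2 + PI - 2 * PI * (N + 1)) with ((th - 2 * PI * (2 * N + 1)) / 2) by field.
  rewrite !K. replace (1 + 1) with 2 by ring. ring.
Qed.

Lemma poisson_defect_duplication t th : 0 < t -> 0 <= th <= 2 * PI ->
  poisson_defect t th = (poisson_defect (t / 2) (th / 2) + poisson_defect (t / 2) (th / 2 + PI)) / 2.
Proof.
  intros Ht Hth. pose proof PI_gt_3. unfold poisson_defect. rewrite (poisson_duplication t th Ht).
  assert (E1 := ex_series_poisson_term (t / 2) (th / 2) ltac:(lra) ltac:(lra)).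
  assert (E2 := ex_series_poisson_term (t / 2) (th / 2 + PI) ltac:(lra) ltac:(lra)).
  assert (E : Series (poisson_term (t / 2) (th / 2)) + Series (poisson_term (t / 2) (th / 2 + PI))
          = 2 * Series (poisson_term t th)).
  { rewrite <- Series_plus by auto.
    assert (B := is_series_block (poisson_term t th) 2 _ ltac:(lia)
       (Series_correct _ (ex_series_poisson_term t th Ht Hth))).
    rewrite <- (is_series_unique _ _ B), <- Series_scal_l. apply Series_ext. intros n.
    rewrite poisson_term_duplication by auto. simpl (2 - 1)%nat. rewrite sum_n_S, sum_O.
    replace (n * 2 + 0)%nat with (2 * n)%nat by lia. replace (n * 2 + 1)%nat with (2 * n + 1)%nat by lia.
    reflexivity. }
  lra.
Qed.

(* The defect satisfies the duplication formula and is O(t), hence is halved at each duplication. *)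
Theorem is_series_poisson t th : 0 < t -> 0 <= th <= 2 * PI ->
  is_series (poisson_term t th) (poisson t th).
Proof.
  intros Ht Hth. destruct poisson_defect_small as [K [HK HB]]. pose proof PI_gt_3.
  (* After m halvings the argument is at most 1, where [poisson_defect_small] applies; averaging two
     defects preserves the bound. *)
  assert (P : forall m t th, 0 < t -> 0 <= th <= 2 * PI -> t / 2 ^ m <= 1 ->
     Rabs (poisson_defect t th) <= K * (t / 2 ^ m)).
  { clear t th Ht Hth. induction m as [|m IH]; intros t th Ht Hth H1.
    - unfold Rdiv in *. simpl in *. rewrite Rinv_1, Rmult_1_r in *. apply HB; lra.
    - rewrite poisson_defect_duplication by auto.
      assert (H2 : 0 < 2 ^ m) by (apply pow_lt; lra).
      replace (t / 2 ^ S m) with (t / 2 / 2 ^ m) in * by (simpl; field; lra).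
      pose proof (IH (t / 2) (th / 2) ltac:(lra) ltac:(lra) H1) as A.
      pose proof (IH (t / 2) (th / 2 + PI) ltac:(lra) ltac:(lra) H1) as B.
      apply Rabs_le_between in A. apply Rabs_le_between in B. apply Rabs_le. lra. }
  assert (Z : poisson_defect t th = 0).
  { apply Rabs_eq_0, Rle_antisym; [|apply Rabs_pos].
    assert (L : is_lim_seq (fun m => K * (t / 2 ^ m)) 0).
    { apply is_lim_seq_ext with (fun m => K * t * (/ 2) ^ m).
      - intros n. rewrite pow_inv. unfold Rdiv. ring.
      - replace (Finite 0) with (Rbar_mult (K * t) 0) by (simpl; f_equal; ring).
        apply is_lim_seq_scal_l, is_lim_seq_geom. rewrite Rabs_right; lra. }
    assert (L' : is_lim_seq (fun m => t / 2 ^ m) 0).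
    { apply is_lim_seq_ext with (fun m => t * (/ 2) ^ m).
      - intros n. rewrite pow_inv. reflexivity.
      - replace (Finite 0) with (Rbar_mult t 0) by (simpl; f_equal; ring).
        apply is_lim_seq_scal_l, is_lim_seq_geom. rewrite Rabs_right; lra. }
    apply is_lim_seq_spec in L'. destruct (L' (mkposreal 1 Rlt_0_1)) as [M HM].
    apply (is_lim_seq_le_loc (fun _ => Rabs (poisson_defect t th)) (fun m => K * (t / 2 ^ m))
             (Rabs (poisson_defect t th)) 0); auto.
    - exists M. intros m Hm. apply P; auto. specialize (HM m Hm). simpl in HM.
      rewrite Rminus_0_r in HM. apply Rabs_def2 in HM. lra.
    - apply is_lim_seq_const. }
  unfold poisson_defect in Z. replace (poisson t th) with (Series (poisson_term t th)) by lra.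
  apply Series_correct, ex_series_poisson_term; auto.
Qed.

(* [UV m t x] is the pair (real part, imaginary part) of (t - i x)^(-m). *)
Fixpoint UV (m : nat) (t x : R) : R * R :=
  match m with
  | O => (1, 0)
  | S m' => let p := UV m' t x in
            let u := t / (t ^ 2 + x ^ 2) in let v := x / (t ^ 2 + x ^ 2) in
            (fst p * u - snd p * v, fst p * v + snd p * u)
  end.

Definition U m t x := fst (UV m t x).
Definition V m t x := snd (UV m t x).

Lemma U_S m t x : U (S m) t x = U m t x * (t / (t ^ 2 + x ^ 2)) - V m t x * (x / (t ^ 2 + x ^ 2)).
Proof. reflexivity. Qed.

Lemma V_S m t x : V (S m) t x = U m t x * (x / (t ^ 2 + x ^ 2)) + V m t x * (t / (t ^ 2 + x ^ 2)).
Proof. reflexivity. Qed.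

Lemma UV_norm m t x : t ^ 2 + x ^ 2 <> 0 -> U m t x ^ 2 + V m t x ^ 2 = (/ (t ^ 2 + x ^ 2)) ^ m.
Proof.
  intros H. induction m as [|m IH]; [unfold U, V; simpl; ring|].
  rewrite U_S, V_S. rewrite <- (tech_pow_Rmult (/ (t ^ 2 + x ^ 2)) m), <- IH. field. exact H.
Qed.

Lemma UV_le m t x B : t ^ 2 + x ^ 2 <> 0 -> 0 <= B -> (/ (t ^ 2 + x ^ 2)) ^ m <= B ^ 2 ->
  Rabs (U m t x) <= B /\ Rabs (V m t x) <= B.
Proof.
  intros H HB Hle. pose proof (UV_norm m t x H) as E.
  assert (forall y, y ^ 2 <= B ^ 2 -> Rabs y <= B).
  { intros y Hy. rewrite <- pow2_abs in Hy. pose proof (Rabs_pos y). nra. }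
  split; apply H0; pose proof (pow2_ge_0 (U m t x)); pose proof (pow2_ge_0 (V m t x)); lra.
Qed.

Lemma UV_le_x m t x c : 0 < c <= Rabs x ->
  Rabs (U m t x) <= (/ c) ^ m /\ Rabs (V m t x) <= (/ c) ^ m.
Proof.
  intros [Hc Hx]. assert (Hx2 : c ^ 2 <= x ^ 2) by (rewrite <- (pow2_abs x); apply pow_incr; lra).
  pose proof (pow2_ge_0 t). assert (0 < c ^ 2) by nra. assert (0 < / c) by now apply Rinv_0_lt_compat.
  apply UV_le; [lra|apply pow_le; lra|].
  rewrite <- pow_mult, Nat.mul_comm, pow_mult. apply pow_incr. split.
  - left. apply Rinv_0_lt_compat; lra.
  - rewrite pow_inv. apply Rinv_le_contravar; lra.
Qed.

(** Of the m + 2 factors, m are bounded by 1 / c and the other two keep the full 1 / (t^2 + c^2):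
    the result is integrable in t and still gains powers of x. *)
Lemma UV_le_mixed m t x c : 0 < c <= Rabs x ->
  Rabs (U (m + 2) t x) <= (/ c) ^ m * / (t ^ 2 + c ^ 2) /\
  Rabs (V (m + 2) t x) <= (/ c) ^ m * / (t ^ 2 + c ^ 2).
Proof.
  intros [Hc Hx]. assert (Hx2 : c ^ 2 <= x ^ 2) by (rewrite <- (pow2_abs x); apply pow_incr; lra).
  pose proof (pow2_ge_0 t). assert (0 < c ^ 2) by nra. assert (0 < / c) by now apply Rinv_0_lt_compat.
  assert (0 < / (t ^ 2 + c ^ 2)) by (apply Rinv_0_lt_compat; lra).
  apply UV_le; [lra|apply Rmult_le_pos; [apply pow_le|]; lra|].
  rewrite Rpow_mult_distr, pow_add.
  assert (0 < / (t ^ 2 + x ^ 2)) by (apply Rinv_0_lt_compat; lra).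
  assert (/ (t ^ 2 + x ^ 2) <= / (t ^ 2 + c ^ 2)) by (apply Rinv_le_contravar; lra).
  apply Rmult_le_compat; [apply pow_le; lra|apply pow_le; lra| |apply pow_incr; lra].
  rewrite <- pow_mult, Nat.mul_comm, pow_mult. apply pow_incr. split; [lra|].
  rewrite pow_inv. apply Rinv_le_contravar; lra.
Qed.

Lemma is_derive_UV_t m t x : t ^ 2 + x ^ 2 <> 0 ->
  is_derive (fun s => U m s x) t (- INR m * U (S m) t x) /\
  is_derive (fun s => V m s x) t (- INR m * V (S m) t x).
Proof.
  intros H. induction m as [|m [IH1 IH2]].
  - split; unfold U, V; simpl; auto_derive; auto; ring.
  - assert (D1 : is_derive (fun s => s / (s ^ 2 + x ^ 2)) t
       ((x ^ 2 - t ^ 2) / (t ^ 2 + x ^ 2) ^ 2)) by (auto_derive; [exact H|field; exact H]).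
    assert (D2 : is_derive (fun s => x / (s ^ 2 + x ^ 2)) t
       (- (2 * t * x) / (t ^ 2 + x ^ 2) ^ 2)) by (auto_derive; [exact H|field; exact H]).
    split.
    + apply (is_derive_ext (fun s => U m s x * (s / (s ^ 2 + x ^ 2)) - V m s x * (x / (s ^ 2 + x ^ 2)))).
      { intros s. now rewrite U_S. }
      evar_last.
      { apply (is_derive_minus (fun s => U m s x * (s / (s ^ 2 + x ^ 2))) (fun s => V m s x * (x / (s ^ 2 + x ^ 2)))).
        - apply (is_derive_mult (fun s => U m s x)); [exact IH1|exact D1|intros; apply Rmult_comm].
        - apply (is_derive_mult (fun s => V m s x)); [exact IH2|exact D2|intros; apply Rmult_comm]. }
      unfold minus, plus, opp, mult; simpl (AbelianGroup.sort _). cbn -[INR U V pow].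
      rewrite S_INR, (U_S (S m)), !U_S, !V_S. field. exact H.
    + apply (is_derive_ext (fun s => U m s x * (x / (s ^ 2 + x ^ 2)) + V m s x * (s / (s ^ 2 + x ^ 2)))).
      { intros s. now rewrite V_S. }
      evar_last.
      { apply (is_derive_plus (fun s => U m s x * (x / (s ^ 2 + x ^ 2))) (fun s => V m s x * (s / (s ^ 2 + x ^ 2)))).
        - apply (is_derive_mult (fun s => U m s x)); [exact IH1|exact D2|intros; apply Rmult_comm].
        - apply (is_derive_mult (fun s => V m s x)); [exact IH2|exact D1|intros; apply Rmult_comm]. }
      cbn -[INR U V pow].
      rewrite S_INR, (V_S (S m)), !U_S, !V_S. field. exact H.
Qed.

Lemma is_derive_UV_x m t x : t ^ 2 + x ^ 2 <> 0 ->
  is_derive (fun y => U m t y) x (- INR m * V (S m) t x) /\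
  is_derive (fun y => V m t y) x (INR m * U (S m) t x).
Proof.
  intros H. induction m as [|m [IH1 IH2]].
  - split; unfold U, V; simpl; auto_derive; auto; ring.
  - assert (D1 : is_derive (fun y => t / (t ^ 2 + y ^ 2)) x
       (- (2 * t * x) / (t ^ 2 + x ^ 2) ^ 2)) by (auto_derive; [exact H|field; exact H]).
    assert (D2 : is_derive (fun y => y / (t ^ 2 + y ^ 2)) x
       ((t ^ 2 - x ^ 2) / (t ^ 2 + x ^ 2) ^ 2)) by (auto_derive; [exact H|field; exact H]).
    split.
    + apply (is_derive_ext (fun y => U m t y * (t / (t ^ 2 + y ^ 2)) - V m t y * (y / (t ^ 2 + y ^ 2)))).
      { intros s. now rewrite U_S. }
      evar_last.
      { apply (is_derive_minus (fun y => U m t y * (t / (t ^ 2 + y ^ 2))) (fun y => V m t y * (y / (t ^ 2 + y ^ 2)))).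
        - apply (is_derive_mult (fun y => U m t y)); [exact IH1|exact D1|intros; apply Rmult_comm].
        - apply (is_derive_mult (fun y => V m t y)); [exact IH2|exact D2|intros; apply Rmult_comm]. }
      cbn -[INR U V pow].
      rewrite S_INR, (V_S (S m)), !U_S, !V_S. field. exact H.
    + apply (is_derive_ext (fun y => U m t y * (y / (t ^ 2 + y ^ 2)) + V m t y * (t / (t ^ 2 + y ^ 2)))).
      { intros s. now rewrite V_S. }
      evar_last.
      { apply (is_derive_plus (fun y => U m t y * (y / (t ^ 2 + y ^ 2))) (fun y => V m t y * (t / (t ^ 2 + y ^ 2)))).
        - apply (is_derive_mult (fun y => U m t y)); [exact IH1|exact D2|intros; apply Rmult_comm].
        - apply (is_derive_mult (fun y => V m t y)); [exact IH2|exact D1|intros; apply Rmult_comm]. }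
      cbn -[INR U V pow].
      rewrite S_INR, (U_S (S m)), !U_S, !V_S. field. exact H.
Qed.

Lemma UV_opp m t x : U m t (- x) = U m t x /\ V m t (- x) = - V m t x.
Proof.
  induction m as [|m [IH1 IH2]]; [unfold U, V; simpl; split; ring|].
  rewrite !U_S, !V_S, IH1, IH2. replace ((- x) ^ 2) with (x ^ 2) by ring.
  unfold Rdiv. split; ring.
Qed.

(** At t = 0 the complex number is (- i x)^(-2m) = (-1)^m x^(-2m), which is real. *)
Lemma UV_zero m x : x <> 0 ->
  U (2 * m) 0 x = (-1) ^ m * (/ x) ^ (2 * m) /\ V (2 * m) 0 x = 0.
Proof.
  intros Hx. induction m as [|m [IH1 IH2]]; [unfold U, V; simpl; split; ring|].
  replace (2 * S m)%nat with (S (S (2 * m))) by lia.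
  rewrite ?U_S, ?V_S, ?U_S, ?V_S, IH1, IH2. simpl pow.
  split; field; auto.
Qed.

(** Mean value theorem from t = 0, where an even power has no imaginary part. The factor t gained
    here is the place where parity enters the estimates. *)
Lemma V_even_le m t x c : 0 <= t -> 0 < c <= Rabs x ->
  Rabs (V (2 * m) t x) <= INR (2 * m) * t * (/ c) ^ (S (2 * m)).
Proof.
  intros Ht Hc. assert (Hx : x <> 0) by (intros ->; rewrite Rabs_R0 in Hc; lra).
  assert (Hr : forall s, s ^ 2 + x ^ 2 <> 0).
  { intros s. pose proof (pow2_ge_0 s). assert (0 < x ^ 2) by nra. lra. }
  destruct (MVT_gen (fun s => V (2 * m) s x) 0 t (fun s => - INR (2 * m) * V (S (2 * m)) s x)) as [z [Hz E]].
  - intros s _. apply is_derive_UV_t, Hr.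
  - intros s _. apply derivable_continuous_pt. exists (- INR (2 * m) * V (S (2 * m)) s x).
    apply is_derive_Reals, is_derive_UV_t, Hr.
  - cbv beta in E. rewrite (proj2 (UV_zero m x Hx)) in E. rewrite !Rminus_0_r in E. rewrite E.
    rewrite !Rabs_mult, Rabs_Ropp, (Rabs_right (INR (2 * m))), (Rabs_right t) by (try apply Rle_ge, pos_INR; lra).
    destruct (UV_le_x (S (2 * m)) z x c Hc) as [_ B].
    replace (INR (2 * m) * t * (/ c) ^ S (2 * m)) with (INR (2 * m) * (/ c) ^ S (2 * m) * t) by ring.
    apply Rmult_le_compat_r; [lra|]. apply Rmult_le_compat_l; [apply pos_INR|exact B].
Qed.

(** * Sine series and their partial fractions *)

Definition Dsin (m : nat) (t th : R) : R :=
  Series (fun d => INR (S d) ^ m * exp (- (INR (S d) * t)) * sin (INR (S d) * th)).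

Definition Vpair (m : nat) (t th : R) (n : nat) : R :=
  V m t (th + 2 * PI * INR n) + V m t (th - 2 * PI * INR (S n)).

Lemma lattice_far th c n : 0 < c <= 1 -> c <= th -> c <= 2 * PI - th ->
  c * INR (S n) <= Rabs (th + 2 * PI * INR n) /\ c * INR (S n) <= Rabs (th - 2 * PI * INR (S n)).
Proof.
  intros Hc H1 H2. pose proof PI_gt_3. pose proof (pos_INR n). rewrite S_INR.
  rewrite Rabs_right, Rabs_left by nra. nra.
Qed.

Lemma ex_series_pow_inv m c : 0 < c ->
  ex_series (fun n => (/ (c * INR (S n))) ^ (m + 2)).
Proof.
  intros Hc. apply ex_series_dom with (fun n => (/ c) ^ (m + 2) * / INR (S n) ^ 2).
  - intros n. pose proof (INR_S_ge1 n). assert (0 < / c) by now apply Rinv_0_lt_compat.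
    assert (0 < / INR (S n) <= 1).
    { split; [apply Rinv_0_lt_compat; lra|]. rewrite <- Rinv_1. apply Rinv_le_contravar; lra. }
    rewrite Rinv_mult. rewrite Rabs_right by (apply Rle_ge, pow_le; nra).
    rewrite Rpow_mult_distr. apply Rmult_le_compat_l; [apply pow_le; lra|].
    rewrite <- pow_inv, pow_add. rewrite <- (Rmult_1_l ((/ INR (S n)) ^ 2)) at 2.
    apply Rmult_le_compat_r; [apply pow_le; lra|]. rewrite <- (pow1 m). apply pow_incr. lra.
  - apply (ex_series_scal_l _ (fun n => / INR (S n) ^ 2)), ex_series_inv_sq.
Qed.

Lemma UVpair_le m t th c n : 0 < c <= 1 -> c <= th -> c <= 2 * PI - th ->
  Rabs (U m t (th + 2 * PI * INR n) + U m t (th - 2 * PI * INR (S n))) <= 2 * (/ (c * INR (S n))) ^ m /\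
  Rabs (Vpair m t th n) <= 2 * (/ (c * INR (S n))) ^ m.
Proof.
  intros Hc H1 H2. destruct (lattice_far th c n Hc H1 H2) as [F1 F2].
  pose proof (INR_S_pos n). assert (0 < c * INR (S n)) by nra.
  destruct (UV_le_x m t _ _ (conj H0 F1)) as [A1 A2].
  destruct (UV_le_x m t _ _ (conj H0 F2)) as [B1 B2].
  unfold Vpair. split; (eapply Rle_trans; [apply Rabs_triang|]); lra.
Qed.

Lemma ex_series_Vpair m t th : 0 < th < 2 * PI -> ex_series (Vpair (m + 2) t th).
Proof.
  intros H. set (c := Rmin 1 (Rmin th (2 * PI - th))).
  assert (Hc : 0 < c <= 1) by (split; [repeat apply Rmin_pos; lra|apply Rmin_l]).
  assert (H1 : c <= th) by (eapply Rle_trans; [apply Rmin_r|apply Rmin_l]).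
  assert (H2 : c <= 2 * PI - th) by (eapply Rle_trans; [apply Rmin_r|apply Rmin_r]).
  apply ex_series_dom with (fun n => 2 * (/ (c * INR (S n))) ^ (m + 2)).
  - intros n. apply (UVpair_le (m + 2) t th c n Hc H1 H2).
  - apply (ex_series_scal_l 2 (fun n => (/ (c * INR (S n))) ^ (m + 2))), ex_series_pow_inv. lra.
Qed.

Lemma pow_exp_le_inv_sq m c : 0 < c -> exists A, 0 < A /\
  forall d, INR (S d) ^ m * exp (- (INR (S d) * c)) <= A * / INR (S d) ^ 2.
Proof.
  intros Hc. exists ((INR (m + 2) / c) ^ (m + 2) + 1). split.
  - assert (0 <= (INR (m + 2) / c) ^ (m + 2)); [|lra]. apply pow_le.
    apply Rmult_le_pos; [apply pos_INR|left; now apply Rinv_0_lt_compat].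
  - intros d. pose proof (INR_S_pos d).
    pose proof (pow_exp_bound (m + 2) c (INR (S d)) Hc ltac:(lra)) as B.
    rewrite pow_add in B. rewrite (Rmult_comm (INR (S d)) c).
    assert (0 < INR (S d) ^ 2) by (apply pow_lt; lra).
    apply Rmult_le_reg_r with (INR (S d) ^ 2); [auto|].
    rewrite Rmult_assoc, (Rmult_assoc _ (/ _)), Rinv_l by lra. nra.
Qed.

Lemma ex_series_pow_exp m t (b : nat -> R) : 0 < t -> (forall d, Rabs (b d) <= 1) ->
  ex_series (fun d => INR (S d) ^ m * exp (- (INR (S d) * t)) * b d).
Proof.
  intros Ht Hb. destruct (pow_exp_le_inv_sq m t Ht) as [A [HA H]].
  apply ex_series_dom with (fun d => A * / INR (S d) ^ 2).
  - intros d. pose proof (exp_pos (- (INR (S d) * t))).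
    assert (0 < INR (S d) ^ m) by apply pow_lt, INR_S_pos.
    rewrite Rabs_mult, Rabs_right by nra.
    apply Rle_trans with (2 := H d). rewrite <- (Rmult_1_r (_ * exp _)) at 2.
    apply Rmult_le_compat_l; [nra|apply Hb].
  - apply (ex_series_scal_l A (fun d => / INR (S d) ^ 2)), ex_series_inv_sq.
Qed.

Lemma Rabs_sin_le x : Rabs (sin x) <= 1.
Proof. apply Rabs_le. pose proof (SIN_bound x). lra. Qed.

Lemma Rabs_cos_le x : Rabs (cos x) <= 1.
Proof. apply Rabs_le. pose proof (COS_bound x). lra. Qed.

(** Sine and cosine of the multiples of th obey the same two-term recurrence. Multiplying the series
    by 1 - 2 z cos th + z^2 therefore leaves only the initial terms, and one computation gives both
    sums. *)
Lemma is_series_trig_geometric (f : R -> R) t th : 0 < t -> (forall u, Rabs (f u) <= 1) ->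
  (forall u, f (u + th + th) = 2 * cos th * f (u + th) - f u) ->
  let z := exp (- t) in
  is_series (fun d => exp (- (INR (S d) * t)) * f (INR (S d) * th)) ((z * f th - z ^ 2 * f 0) / (1 - 2 * cos th * z + z ^ 2)).
Proof.
  intros Ht Hf Rf z. set (a := fun d => exp (- (INR d * t)) * f (INR d * th)).
  assert (X1 : ex_series (fun d => a (S d))).
  { apply (ex_series_ext (fun d => INR (S d) ^ 0 * exp (- (INR (S d) * t)) * f (INR (S d) * th))).
    - intros d. unfold a. eqR. ring.
    - apply (ex_series_pow_exp 0 t (fun d => f (INR (S d) * th))); auto. }
  assert (X0 : ex_series a) by (apply ex_series_incr_1; exact X1).
  assert (E1 := Series_incr_1 a X0). assert (E2 := Series_incr_1 (fun d => a (S d)) X1). cbv beta in E2.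
  assert (Rec : forall d, a (S (S d)) = 2 * cos th * z * a (S d) - z ^ 2 * a d).
  { intros d. unfold a, z. rewrite !S_INR. set (N := INR d).
    replace (- ((N + 1 + 1) * t)) with (- t + (- t + - (N * t))) by ring. replace (- ((N + 1) * t)) with (- t + - (N * t)) by ring.
    rewrite !exp_plus. replace ((N + 1 + 1) * th) with (N * th + th + th) by ring. replace ((N + 1) * th) with (N * th + th) by ring.
    rewrite Rf. ring. }
  rewrite (Series_ext _ _ Rec), Series_minus, !Series_scal_l in E2 by first [exact (ex_series_scal_l _ _ X1)|exact (ex_series_scal_l _ _ X0)].
  set (S1 := Series (fun d => a (S d))) in *.
  assert (Hz : 0 < z < 1) by (unfold z; split; [apply exp_pos|rewrite <- exp_0; apply exp_increasing; lra]).
  assert (Den : 0 < 1 - 2 * cos th * z + z ^ 2) by (pose proof (COS_bound th); nra).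
  assert (A0 : a 0%nat = f 0) by (unfold a; simpl INR; rewrite !Rmult_0_l, Ropp_0, exp_0; ring).
  assert (A1 : a 1%nat = z * f th) by (unfold a, z; simpl INR; rewrite !Rmult_1_l; reflexivity).
  rewrite E1, A0, A1 in E2.
  replace ((z * f th - z ^ 2 * f 0) / (1 - 2 * cos th * z + z ^ 2)) with S1; [exact (Series_correct _ X1)|].
  apply Rmult_eq_reg_r with (1 - 2 * cos th * z + z ^ 2); [|lra].
  replace ((z * f th - z ^ 2 * f 0) / (1 - 2 * cos th * z + z ^ 2) * (1 - 2 * cos th * z + z ^ 2)) with (z * f th - z ^ 2 * f 0) by (field; lra).
  lra.
Qed.

Lemma is_series_poisson_fourier t th : 0 < t ->
  is_series (fun d => exp (- (INR (S d) * t)) * cos (INR (S d) * th)) (poisson t th - / 2).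
Proof.
  intros Ht. replace (poisson t th - / 2) with ((exp (- t) * cos th - exp (- t) ^ 2 * cos 0) / (1 - 2 * cos th * exp (- t) + exp (- t) ^ 2)).
  - apply is_series_trig_geometric; [exact Ht|apply Rabs_cos_le|].
    intros u. replace u with (u + th - th) at 3 by ring. rewrite (cos_plus (u + th) th), (cos_minus (u + th) th). ring.
  - unfold poisson, sinh, cosh. assert (Hz : 0 < exp (- t) < 1) by (split; [apply exp_pos|rewrite <- exp_0; apply exp_increasing; lra]).
    replace (exp t) with (/ exp (- t)) by (rewrite exp_Ropp; apply Rinv_inv). set (z := exp (- t)) in *. rewrite cos_0.
    assert (0 < 1 - 2 * cos th * z + z ^ 2) by (pose proof (COS_bound th); nra). field. repeat split; lra.
Qed.

Lemma is_derive_pow_exp_Series m t (b : nat -> R) : 0 < t -> (forall d, Rabs (b d) <= 1) ->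
  is_derive (fun s => Series (fun d => INR (S d) ^ m * exp (- (INR (S d) * s)) * b d)) t
    (- Series (fun d => INR (S d) ^ (S m) * exp (- (INR (S d) * t)) * b d)).
Proof.
  intros Ht Hb. rewrite <- Series_opp.
  destruct (pow_exp_le_inv_sq (S (S m)) (t / 2) ltac:(lra)) as [A [HA HB]].
  apply (is_derive_Series (fun d s => INR (S d) ^ m * exp (- (INR (S d) * s)) * b d)
    (fun d s => - (INR (S d) ^ (S m) * exp (- (INR (S d) * s)) * b d))
    (fun d s => INR (S d) ^ (S (S m)) * exp (- (INR (S d) * s)) * b d)
    (fun d => A * / INR (S d) ^ 2) t (t / 2)).
  - lra.
  - intros n y _. generalize (INR (S n)). intros N. auto_derive; [exact I|]. rewrite <- ?tech_pow_Rmult. ring.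
  - intros n y _. generalize (INR (S n)). intros N. auto_derive; [exact I|]. rewrite <- ?tech_pow_Rmult. ring.
  - intros n y Hy. apply Rabs_def2 in Hy.
    pose proof (exp_pos (- (INR (S n) * y))). pose proof (INR_S_pos n).
    assert (0 < INR (S n) ^ S (S m)) by (apply pow_lt; lra).
    rewrite Rabs_mult, Rabs_right by nra. specialize (Hb n).
    pose proof (Rabs_pos (b n)).
    apply Rle_trans with (INR (S n) ^ S (S m) * exp (- (INR (S n) * y))).
    { rewrite <- (Rmult_1_r (_ * exp _)) at 2. apply Rmult_le_compat_l; nra. }
    apply Rle_trans with (2 := HB n). apply Rmult_le_compat_l; [lra|].
    left. apply exp_increasing. nra.
  - apply (ex_series_scal_l A (fun d => / INR (S d) ^ 2)), ex_series_inv_sq.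
  - intros y Hy. apply Rabs_def2 in Hy. apply ex_series_pow_exp; [lra|exact Hb].
  - apply (ex_series_opp (fun d => INR (S d) ^ S m * exp (- (INR (S d) * t)) * b d)).
    now apply ex_series_pow_exp.
Qed.

Lemma is_derive_Series_Vpair m t th : 0 < th < 2 * PI ->
  is_derive (fun s => Series (Vpair (m + 2) s th)) t (- INR (m + 2) * Series (Vpair (m + 3) t th)).
Proof.
  intros H. set (c := Rmin 1 (Rmin th (2 * PI - th))).
  assert (Hc : 0 < c <= 1) by (split; [repeat apply Rmin_pos; lra|apply Rmin_l]).
  assert (H1 : c <= th) by (eapply Rle_trans; [apply Rmin_r|apply Rmin_l]).
  assert (H2 : c <= 2 * PI - th) by (eapply Rle_trans; [apply Rmin_r|apply Rmin_r]).
  assert (NZ : forall n, th + 2 * PI * INR n <> 0 /\ th - 2 * PI * INR (S n) <> 0).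
  { intros n. destruct (lattice_far th c n Hc H1 H2) as [F1 F2]. pose proof (INR_S_pos n).
    assert (0 < c * INR (S n)) by nra. split; intros E; rewrite E, Rabs_R0 in *; lra. }
  assert (NZ2 : forall s x, x <> 0 -> s ^ 2 + x ^ 2 <> 0).
  { intros s x Hx. pose proof (pow2_ge_0 s). assert (0 < x ^ 2) by nra. lra. }
  assert (DV : forall m n y, is_derive (fun s => Vpair m s th n) y (- INR m * Vpair (S m) y th n)).
  { intros k n y. destruct (NZ n) as [Z1 Z2]. unfold Vpair.
    evar_last.
    - apply (is_derive_plus (fun s => V k s (th + 2 * PI * INR n)) (fun s => V k s (th - 2 * PI * INR (S n)))).
      + apply is_derive_UV_t, NZ2, Z1.
      + apply is_derive_UV_t, NZ2, Z2.
    - unfold plus. cbn -[INR V]. ring. }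
  rewrite <- Series_scal_l.
  apply (is_derive_Series (fun n s => Vpair (m + 2) s th n)
    (fun n s => - INR (m + 2) * Vpair (m + 3) s th n)
    (fun n s => - INR (m + 2) * (- INR (m + 3) * Vpair (m + 4) s th n))
    (fun n => INR (m + 2) * INR (m + 3) * (2 * (/ (c * INR (S n))) ^ ((m + 2) + 2))) t 1).
  - lra.
  - intros n y _. replace (m + 3)%nat with (S (m + 2)) by lia. apply DV.
  - intros n y _. apply (is_derive_scal (fun s => Vpair (m + 3) s th n)).
    replace (m + 4)%nat with (S (m + 3)) by lia. apply DV.
  - intros n y _. rewrite <- Rmult_assoc, Rabs_mult.
    replace (Rabs (- INR (m + 2) * - INR (m + 3))) with (INR (m + 2) * INR (m + 3)).
    + apply Rmult_le_compat_l; [apply Rmult_le_pos; apply pos_INR|].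
      replace (m + 2 + 2)%nat with (m + 4)%nat by lia. now apply UVpair_le.
    + rewrite Rmult_opp_opp, Rabs_right; [reflexivity|]. apply Rle_ge, Rmult_le_pos; apply pos_INR.
  - apply (ex_series_scal_l _ (fun n => 2 * (/ (c * INR (S n))) ^ ((m + 2) + 2))).
    apply (ex_series_scal_l 2 (fun n => (/ (c * INR (S n))) ^ ((m + 2) + 2))), ex_series_pow_inv. lra.
  - intros y _. now apply ex_series_Vpair.
  - apply (ex_series_scal_l _ (Vpair (m + 3) t th)). replace (m + 3)%nat with (S m + 2)%nat by lia.
    now apply ex_series_Vpair.
Qed.

Lemma U_1_pk t x : U 1 t x = pk t x.
Proof. rewrite U_S. unfold U, V, pk; simpl. ring. Qed.

(** The Fourier series and the partial fractions of [poisson] are both differentiated in th, and the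
    two derivatives agree. *)
Lemma Dsin_1 t th : 0 < t -> 0 < th < 2 * PI -> Dsin 1 t th = Series (Vpair 2 t th).
Proof.
  intros Ht Hth.
  assert (NZ2 : forall x, t ^ 2 + x ^ 2 <> 0).
  { intros x. pose proof (pow2_ge_0 x). assert (0 < t ^ 2) by nra. lra. }
  assert (D1 : is_derive (fun y => poisson t y) th (- Dsin 1 t th)).
  { apply (is_derive_ext (fun y => / 2 + Series (fun d => exp (- (INR (S d) * t)) * cos (INR (S d) * y)))).
    { intros y. rewrite (is_series_unique _ _ (is_series_poisson_fourier t y Ht)). apply Rplus_minus. }
    replace (- Dsin 1 t th) with (0 + - Dsin 1 t th) by ring.
    apply (is_derive_plus (fun _ => / 2) (fun y => Series (fun d => exp (- (INR (S d) * t)) * cos (INR (S d) * y))));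
      [auto_derive; auto|].
    unfold Dsin. rewrite <- Series_opp.
    rewrite (Series_ext _ (fun d => - (INR (S d) * exp (- (INR (S d) * t)) * sin (INR (S d) * th))))
      by (intros; rewrite pow_1; reflexivity).
    destruct (pow_exp_le_inv_sq 2 t Ht) as [A [HA HB]].
    apply (is_derive_Series (fun d y => exp (- (INR (S d) * t)) * cos (INR (S d) * y))
      (fun d y => - (INR (S d) * exp (- (INR (S d) * t)) * sin (INR (S d) * y)))
      (fun d y => - (INR (S d) ^ 2 * exp (- (INR (S d) * t)) * cos (INR (S d) * y)))
      (fun d => A * / INR (S d) ^ 2) th 1).
    - lra.
    - intros n y _. generalize (INR (S n)). intros N. auto_derive; [exact I|ring].
    - intros n y _. generalize (INR (S n)). intros N. auto_derive; [exact I|ring].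
    - intros n y _. pose proof (exp_pos (- (INR (S n) * t))). pose proof (pow2_ge_0 (INR (S n))).
      rewrite Rabs_Ropp, Rabs_mult, Rabs_right by nra. pose proof (Rabs_cos_le (INR (S n) * y)).
      pose proof (Rabs_pos (cos (INR (S n) * y))). specialize (HB n).
      assert (0 <= INR (S n) ^ 2 * exp (- (INR (S n) * t))) by nra. nra.
    - apply (ex_series_scal_l A (fun d => / INR (S d) ^ 2)), ex_series_inv_sq.
    - intros y _. eexists. apply is_series_poisson_fourier, Ht.
    - apply (ex_series_opp (fun d => INR (S d) * exp (- (INR (S d) * t)) * sin (INR (S d) * th))).
      apply (ex_series_ext (fun d => INR (S d) ^ 1 * exp (- (INR (S d) * t)) * sin (INR (S d) * th))).
      + intros n. now rewrite pow_1.
      + apply ex_series_pow_exp; auto. intros; apply Rabs_sin_le. }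
  assert (D2 : is_derive (fun y => poisson t y) th (- Series (Vpair 2 t th))).
  (* Half the distance of th to 0 and 2 PI, capped at 1 before halving, so that every y within c of
     th is itself at distance at least c from both. *)
  { set (c := Rmin 1 (Rmin th (2 * PI - th)) / 2).
    assert (Hc : 0 < c <= 1 / 2).
    { unfold c. pose proof (Rmin_l 1 (Rmin th (2 * PI - th))).
      assert (0 < Rmin 1 (Rmin th (2 * PI - th))) by (repeat apply Rmin_pos; lra). lra. }
    assert (H1 : 2 * c <= th).
    { unfold c. replace (2 * (Rmin 1 (Rmin th (2 * PI - th)) / 2)) with (Rmin 1 (Rmin th (2 * PI - th))) by field.
      eapply Rle_trans; [apply Rmin_r|apply Rmin_l]. }
    assert (H2 : 2 * c <= 2 * PI - th).
    { unfold c. replace (2 * (Rmin 1 (Rmin th (2 * PI - th)) / 2)) with (Rmin 1 (Rmin th (2 * PI - th))) by field.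
      eapply Rle_trans; [apply Rmin_r|apply Rmin_r]. }
    assert (Ep : forall y, Rabs (y - th) < c -> Series (poisson_term t y) = poisson t y).
    { intros y Hy. apply is_series_unique, is_series_poisson; [exact Ht|]. apply Rabs_def2 in Hy. lra. }
    apply (is_derive_ext_loc (fun y => Series (poisson_term t y))).
    { exists (mkposreal c (proj1 Hc)). intros y Hy. apply Ep, Hy. }
    rewrite <- Series_opp.
    assert (DU : forall m k y, is_derive (fun y => U m t (y + k)) y (- INR m * V (S m) t (y + k))).
    { intros m k y. evar_last.
      - apply (is_derive_comp (fun y => U m t y) (fun y => y + k)).
        + exact (proj1 (is_derive_UV_x m t (y + k) (NZ2 _))).
        + auto_derive; [exact I|reflexivity].
      - cbn -[INR V]. unfold scal, mult; cbn -[INR V]. ring. }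
    assert (DV : forall m k y, is_derive (fun y => V m t (y + k)) y (INR m * U (S m) t (y + k))).
    { intros m k y. evar_last.
      - apply (is_derive_comp (fun y => V m t y) (fun y => y + k)).
        + exact (proj2 (is_derive_UV_x m t (y + k) (NZ2 _))).
        + auto_derive; [exact I|reflexivity].
      - unfold scal, mult; cbn -[INR U]. ring. }
    apply (is_derive_Series (fun n y => poisson_term t y n) (fun n y => - Vpair 2 t y n)
      (fun n y => - 2 * (U 3 t (y + 2 * PI * INR n) + U 3 t (y - 2 * PI * INR (S n))))
      (fun n => 2 * (2 * (/ (c * INR (S n))) ^ (1 + 2))) th c).
    - lra.
    - intros n y _. unfold poisson_term, Vpair.
      apply (is_derive_ext (fun y => U 1 t (y + 2 * PI * INR n) + U 1 t (y + - (2 * PI * INR (S n))))).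
      { intros z. now rewrite !U_1_pk. }
      evar_last; [apply (is_derive_plus (fun y => U 1 t (y + 2 * PI * INR n)) (fun y => U 1 t (y + - (2 * PI * INR (S n))))); apply DU|].
      cbn -[INR V]. unfold Rminus. simpl (INR 1). ring.
    - intros n y _. unfold Vpair.
      apply (is_derive_ext (fun y => - (V 2 t (y + 2 * PI * INR n) + V 2 t (y + - (2 * PI * INR (S n)))))).
      { intros z. reflexivity. }
      evar_last.
      { apply (is_derive_opp (fun y => V 2 t (y + 2 * PI * INR n) + V 2 t (y + - (2 * PI * INR (S n))))).
        apply (is_derive_plus (fun y => V 2 t (y + 2 * PI * INR n)) (fun y => V 2 t (y + - (2 * PI * INR (S n))))); apply DV. }
      unfold opp, plus. cbn -[INR U]. unfold Rminus. simpl (INR 2). ring.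
    - intros n y Hy. apply Rabs_def2 in Hy. rewrite Rabs_mult.
      replace (Rabs (-2)) with 2 by (rewrite Rabs_left; lra).
      apply Rmult_le_compat_l; [lra|]. apply UVpair_le; lra.
    - apply (ex_series_scal_l 2 (fun n => 2 * (/ (c * INR (S n))) ^ (1 + 2))).
      apply (ex_series_scal_l 2 (fun n => (/ (c * INR (S n))) ^ (1 + 2))), ex_series_pow_inv. lra.
    - intros y Hy. apply Rabs_def2 in Hy. apply ex_series_poisson_term; lra.
    - apply (ex_series_opp (Vpair 2 t th)), (ex_series_Vpair 0). lra. }
  pose proof (is_derive_unique _ _ _ D1) as E1. pose proof (is_derive_unique _ _ _ D2) as E2.
  rewrite E1 in E2. lra.
Qed.

(** Each derivative in t raises the power of d on one side and the order of the pole on the other;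
    the factors brought down by the poles make up the factorial. *)
Theorem Dsin_partial_fractions m t th : 0 < t -> 0 < th < 2 * PI ->
  Dsin (S m) t th = INR (fact (S m)) * Series (Vpair (m + 2) t th).
Proof.
  intros Ht Hth. revert t Ht. induction m as [|m IH]; intros t Ht.
  - rewrite Dsin_1 by auto. simpl. ring.
  - assert (D1 : is_derive (fun s => Dsin (S m) s th) t (- Dsin (S (S m)) t th)).
    { unfold Dsin. apply (is_derive_pow_exp_Series (S m) t (fun d => sin (INR (S d) * th)) Ht).
      intros; apply Rabs_sin_le. }
    assert (D2 : is_derive (fun s => Dsin (S m) s th) t
       (INR (fact (S m)) * (- INR (m + 2) * Series (Vpair (m + 3) t th)))).
    { apply (is_derive_ext_loc (fun s => INR (fact (S m)) * Series (Vpair (m + 2) s th))).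
      - exists (mkposreal t Ht). intros s Hs. symmetry. apply IH.
        change (Rabs (s - t) < t) in Hs. apply Rabs_def2 in Hs. lra.
      - apply (is_derive_scal (fun s => Series (Vpair (m + 2) s th))).
        now apply is_derive_Series_Vpair. }
    pose proof (is_derive_unique _ _ _ D1) as E1. pose proof (is_derive_unique _ _ _ D2) as E2.
    rewrite E1 in E2.
    replace (fact (S (S m))) with ((m + 2) * fact (S m))%nat by (simpl; lia).
    rewrite mult_INR. replace (S m + 2)%nat with (m + 3)%nat by lia. lra.
Qed.

(** * The primitive of the Bose function *)

(** The harmonic number H_(n+1). *)
Definition harm (n : nat) : R := sum_n (fun j => / INR (S j)) n.

Lemma ln_le_sub1 x : 0 < x -> ln x <= x - 1.
Proof.
  intros H. pose proof (exp_ineq1_le (ln x)) as E. rewrite exp_ln in E by exact H. lra.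
Qed.

Lemma ln_ge_1_sub_inv x : 0 < x -> 1 - / x <= ln x.
Proof.
  intros H. pose proof (ln_le_sub1 (/ x) (Rinv_0_lt_compat x H)) as E. rewrite ln_Rinv in E by exact H. lra.
Qed.

Lemma ln_succ_bounds n :
  / INR (S (S n)) <= ln (INR (S (S n))) - ln (INR (S n)) <= / INR (S n).
Proof.
  pose proof (INR_S_pos n) as Hn. pose proof (INR_S_pos (S n)) as Hs.
  assert (E : ln (INR (S (S n))) - ln (INR (S n)) = ln (INR (S (S n)) / INR (S n))).
  { unfold Rdiv. rewrite ln_mult, ln_Rinv by (auto; now apply Rinv_0_lt_compat). ring. }
  assert (Hq : 0 < INR (S (S n)) / INR (S n)) by (apply Rdiv_lt_0_compat; auto).
  rewrite E. rewrite (S_INR (S n)) in *. split.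
  - apply Rle_trans with (2 := ln_ge_1_sub_inv _ Hq). right. field. lra.
  - apply Rle_trans with (1 := ln_le_sub1 _ Hq). right. field. lra.
Qed.

(** The sequence decreases and is nonnegative, so the limit in [euler_gamma] is finite and [real]
    returns it rather than a default value. *)
Lemma euler_gamma_lim : is_lim_seq (fun n => harm n - ln (INR (S n))) euler_gamma.
Proof.
  assert (E : forall n, sum_f_R0 (fun j => / INR (S j)) n - ln (INR (S n)) = harm n - ln (INR (S n))).
  { intros n. unfold harm. now rewrite sum_n_Reals. }
  unfold euler_gamma. rewrite (Lim_seq_ext _ _ E). apply Lim_seq_correct'.
  apply ex_finite_lim_seq_decr with 0.
  - intros n. unfold harm. rewrite sum_n_S. pose proof (ln_succ_bounds n). lra.
  - intros n. assert (H : ln (INR (S (S n))) <= harm n).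
    { induction n as [|n IH].
      - unfold harm. rewrite sum_O. pose proof (ln_succ_bounds 0) as H. simpl in *. rewrite ln_1 in H. lra.
      - unfold harm in *. rewrite sum_n_S. pose proof (ln_succ_bounds (S n)). lra. }
    pose proof (ln_succ_bounds n) as B. pose proof (Rinv_0_lt_compat _ (INR_S_pos (S n))). lra.
Qed.

Lemma atan_ge u : 0 <= u -> u / (1 + u ^ 2) <= atan u.
Proof.
  intros Hu.
  assert (H : 0 <= (fun z => atan z - z / (1 + z ^ 2)) u).
  { apply (nonneg_of_derive (fun z => atan z - z / (1 + z ^ 2)) (fun z => 2 * z ^ 2 / (1 + z ^ 2) ^ 2) u).
    - rewrite atan_0. unfold Rdiv. rewrite Rmult_0_l. lra.
    - intros z _. assert (1 + z ^ 2 <> 0) by (pose proof (pow2_ge_0 z); lra).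
      evar_last.
      + apply (is_derive_minus atan (fun z => z / (1 + z ^ 2))); [apply is_derive_atan|].
        auto_derive; [exact H|reflexivity].
      + unfold minus, plus, opp; cbn -[pow]. unfold Rsqr. replace (1 + z * z) with (1 + z ^ 2) by ring. field. exact H.
    - intros z _. apply Rmult_le_pos; [pose proof (pow2_ge_0 z); lra|].
      left. apply Rinv_0_lt_compat. pose proof (pow2_ge_0 z). nra.
    - lra. }
  lra.
Qed.

(** The value 1 at 0 makes the quotient continuous, hence [atan_int], the inverse tangent integral,
    differentiable on the whole line. *)
Definition atan_quot (u : R) : R := if Req_EM_T u 0 then 1 else atan u / u.

Lemma continuous_atan_quot u : continuous atan_quot u.
Proof.
  destruct (Req_dec u 0) as [->|Hu].
  - apply continuity_pt_filterlim. intros eps Heps.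
    destruct (derivable_pt_lim_atan 0 eps Heps) as [d Hd].
    exists d. split; [apply cond_pos|]. intros x [[_ Hx] Hx2]. simpl in Hx2. unfold Rdist in Hx2.
    simpl. unfold Rdist, atan_quot. destruct (Req_EM_T 0 0) as [_|F]; [|lra].
    destruct (Req_EM_T x 0) as [F|_]; [lra|].
    specialize (Hd x ltac:(lra) ltac:(rewrite Rminus_0_r in Hx2; exact Hx2)).
    rewrite Rplus_0_l, atan_0, Rminus_0_r in Hd. replace (/ (1 + 0 ^ 2)) with 1 in Hd by field. exact Hd.
  - apply (continuous_ext_loc atan_quot (fun z => atan z / z)).
    + assert (Hp : 0 < Rabs u) by now apply Rabs_pos_lt.
      exists (mkposreal _ Hp). intros z Hz. change (Rabs (z - u) < Rabs u) in Hz.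
      unfold atan_quot. destruct (Req_EM_T z 0) as [->|_]; [|reflexivity].
      rewrite Rminus_0_l, Rabs_Ropp in Hz. lra.
    + apply (ex_derive_continuous (fun z => atan z / z)). auto_derive. exact Hu.
Qed.

Definition atan_int (x : R) : R := RInt atan_quot 0 x.

Lemma is_derive_atan_int x : is_derive atan_int x (atan_quot x).
Proof.
  apply (is_derive_RInt atan_quot atan_int 0 x); [|apply continuous_atan_quot].
  exists (mkposreal 1 Rlt_0_1). intros y _. apply (RInt_correct atan_quot).
  apply (ex_RInt_continuous atan_quot). intros z _. apply continuous_atan_quot.
Qed.

Lemma atan_quot_decr x y : 0 <= x <= y -> atan_quot y <= atan_quot x.
Proof.
  intros H. unfold atan_quot. destruct (Req_EM_T y 0) as [Hy|Hy].
  - destruct (Req_EM_T x 0) as [Hx|Hx]; lra.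
  - destruct (Req_EM_T x 0) as [Hx|Hx].
    + apply Rmult_le_reg_r with y; [lra|]. unfold Rdiv. rewrite Rmult_assoc, Rinv_l, Rmult_1_r, Rmult_1_l by lra.
      apply atan_le_id. lra.
    + destruct (MVT_gen (fun z => atan z / z) x y (fun z => (z / (1 + z ^ 2) - atan z) / z ^ 2)) as [c [Hc E]].
      * intros z Hz. rewrite Rmin_left, Rmax_right in Hz by lra.
        auto_derive; [lra|]. field. pose proof (pow2_ge_0 z). split; lra.
      * intros z Hz. rewrite Rmin_left, Rmax_right in Hz by lra.
        apply derivable_continuous_pt. exists ((z / (1 + z ^ 2) - atan z) / z ^ 2).
        apply is_derive_Reals. auto_derive; [lra|]. field. pose proof (pow2_ge_0 z). split; lra.
      * cbv beta in E. rewrite Rmin_left, Rmax_right in Hc by lra.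
        pose proof (atan_ge c ltac:(lra)).
        assert ((c / (1 + c ^ 2) - atan c) / c ^ 2 <= 0).
        { unfold Rdiv at 1. assert (0 < / c ^ 2) by (apply Rinv_0_lt_compat; nra). nra. }
        nra.
Qed.

(** The integral test on unit intervals in both directions, with F in the role of the integral of
    g. *)
Lemma sum_decr_le (F g : R -> R) (a : R) (n : nat) :
  0 <= a ->
  (forall z, a <= z -> is_derive F z (g z)) ->
  (forall y z, a <= y <= z -> g z <= g y) ->
  F (a + INR (S n)) - F a <= sum_n (fun j => g (a + INR j)) n /\
  sum_n (fun j => g (a + INR (S j))) n <= F (a + INR (S n)) - F a.
Proof.
  intros Ha HD Hg.
  assert (K : forall j, g (a + INR (S j)) <= F (a + INR (S j)) - F (a + INR j) <= g (a + INR j)).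
  { intros j. pose proof (pos_INR j). rewrite S_INR.
    destruct (MVT_gen F (a + INR j) (a + (INR j + 1)) g) as [c [Hc E]].
    - intros z Hz. rewrite Rmin_left in Hz by lra. apply HD. lra.
    - intros z Hz. rewrite Rmin_left in Hz by lra.
      apply derivable_continuous_pt. exists (g z). apply is_derive_Reals, HD. lra.
    - rewrite Rmin_left, Rmax_right in Hc by lra. rewrite E.
      replace (a + (INR j + 1) - (a + INR j)) with 1 by ring. rewrite Rmult_1_r.
      split; apply Hg; lra. }
  induction n as [|n [IH1 IH2]].
  - rewrite !sum_O. specialize (K 0%nat). simpl INR in *. rewrite Rplus_0_r in *. lra.
  - rewrite !sum_n_S. specialize (K (S n)). lra.
Qed.

Definition atan_term (v : R) (n : nat) : R := atan (v / (2 * PI * INR (S n))) / (PI * INR (S n)).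

Lemma atan_term_bounds v n : 0 <= v -> 0 <= atan_term v n <= v * / INR (S n) ^ 2.
Proof.
  intros Hv. unfold atan_term. pose proof PI_gt_3 as HP. pose proof (INR_S_ge1 n).
  set (N := INR (S n)) in *.
  assert (0 < 2 * PI * N) by nra.
  assert (Hq : 0 <= v / (2 * PI * N)) by (apply Rmult_le_pos; [lra|left; now apply Rinv_0_lt_compat]).
  assert (0 < PI * N) by nra. assert (0 < / (PI * N)) by now apply Rinv_0_lt_compat.
  split.
  - apply Rmult_le_pos; [|lra]. destruct Hq as [Hq|<-]; [|rewrite atan_0; lra].
    rewrite <- atan_0. left. now apply atan_increasing.
  - apply Rle_trans with (v / (2 * PI * N) * / (PI * N)).
    + apply Rmult_le_compat_r; [lra|]. now apply atan_le_id.
    + replace (v / (2 * PI * N) * / (PI * N)) with (v * (/ N ^ 2 * / (2 * PI ^ 2))) by (field; lra).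
      apply Rmult_le_compat_l; [lra|]. rewrite <- (Rmult_1_r (/ N ^ 2)) at 2.
      apply Rmult_le_compat_l; [left; apply Rinv_0_lt_compat; nra|].
      rewrite <- Rinv_1. apply Rinv_le_contravar; nra.
Qed.

Lemma ex_series_atan_term v : 0 <= v -> ex_series (atan_term v).
Proof.
  intros Hv. apply ex_series_dom with (fun n => v * / INR (S n) ^ 2).
  - intros n. destruct (atan_term_bounds v n Hv). rewrite Rabs_right; lra.
  - apply (ex_series_scal_l v (fun n => / INR (S n) ^ 2)), ex_series_inv_sq.
Qed.

(** At v = 2 PI x with x = N + 1 the terms are atan (x / n) / n. For n <= x the reflection of the
    arctangent gives the harmonic sum minus a Riemann sum for [atan_int 1]; for n > x the terms are
    a Riemann sum for the same integral after w -> x / w. The two integrals cancel up to the stated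
    errors. *)
Lemma atan_series_bounds N :
  let x := INR (S N) in
  PI / 2 * harm N + (atan_int (x / (x + 1)) - atan_int 1) <= PI * Series (atan_term (2 * PI * x)) /\
  PI * Series (atan_term (2 * PI * x)) <=
    PI / 2 * harm N + (atan_int 1 - atan_int (1 + / x) + atan_int (/ x)).
Proof.
  intros x. pose proof PI_gt_3 as HP. pose proof (INR_S_ge1 N) as Hx. fold x in Hx.
  assert (Tm : forall n, PI * atan_term (2 * PI * x) n = atan (x / INR (S n)) / INR (S n)).
  { intros n. pose proof (INR_S_pos n). unfold atan_term.
    replace (2 * PI * x / (2 * PI * INR (S n))) with (x / INR (S n)) by (field; lra). field. lra. }
  assert (He : ex_series (fun n => PI * atan_term (2 * PI * x) n)).
  { apply (ex_series_scal_l PI (atan_term (2 * PI * x))), ex_series_atan_term. nra. }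
  rewrite <- Series_scal_l, (Series_incr_n _ (S N) ltac:(lia) He). simpl pred. rewrite <- sum_n_Reals.
  (* the terms n <= N, by atan (x/n) = pi/2 - atan (n/x) *)
  assert (A1 : sum_n (fun n => PI * atan_term (2 * PI * x) n) N
      = PI / 2 * harm N - sum_n (fun j => (fun w => / x * atan_quot (w / x)) (0 + INR (S j))) N).
  { clear He. generalize N at 1 2 3. intros M. induction M as [|M IH].
    - unfold harm. rewrite !sum_O. rewrite Tm. unfold atan_quot.
      destruct (Req_EM_T ((0 + INR 1) / x) 0) as [F|_].
      { exfalso. simpl in F. assert (0 < (0 + 1) / x) by (apply Rdiv_lt_0_compat; lra). lra. }
      replace (x / INR 1) with (/ ((0 + INR 1) / x)) by (simpl; field; lra).
      rewrite atan_inv by (simpl; apply Rdiv_lt_0_compat; lra). simpl. field. lra.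
    - unfold harm in *. rewrite !sum_n_S, IH, Tm. unfold atan_quot at 3. pose proof (INR_S_pos (S M)).
      destruct (Req_EM_T ((0 + INR (S (S M))) / x) 0) as [F|_].
      { exfalso. assert (0 < (0 + INR (S (S M))) / x) by (apply Rdiv_lt_0_compat; lra). lra. }
      replace (x / INR (S (S M))) with (/ ((0 + INR (S (S M))) / x)) by (field; lra).
      rewrite atan_inv by (apply Rdiv_lt_0_compat; lra). eqR. field. lra. }
  rewrite A1.
  assert (D1 : forall z, is_derive (fun w => atan_int (w / x)) z (/ x * atan_quot (z / x))).
  { clear - Hx. clearbody x. intros z. evar_last.
    - apply (is_derive_comp atan_int (fun w => w / x)); [apply is_derive_atan_int|].
      auto_derive; [exact I|reflexivity].
    - unfold scal, mult; cbn. field. lra. }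
  assert (G1 : forall y z, 0 <= y <= z -> / x * atan_quot (z / x) <= / x * atan_quot (y / x)).
  { intros y z Hyz. assert (0 < / x) by (apply Rinv_0_lt_compat; lra).
    apply Rmult_le_compat_l; [lra|]. apply atan_quot_decr. unfold Rdiv. nra. }
  destruct (sum_decr_le (fun w => atan_int (w / x)) (fun w => / x * atan_quot (w / x)) 0 N ltac:(lra)
     ltac:(intros; apply D1) G1) as [_ B1].
  destruct (sum_decr_le (fun w => atan_int (w / x)) (fun w => / x * atan_quot (w / x)) 1 N ltac:(lra)
     ltac:(intros; apply D1) ltac:(intros; apply G1; lra)) as [B2 _].
  cbv beta in B1, B2 |- *.
  assert (E12 : sum_n (fun j => / x * atan_quot ((1 + INR j) / x)) N = sum_n (fun j => / x * atan_quot ((0 + INR (S j)) / x)) N).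
  { apply sum_n_ext. intros j. rewrite S_INR. do 3 f_equal. ring. }
  rewrite E12 in B2. fold x in B1, B2.
  replace (atan_int (0 / x)) with 0 in B1.
  2:{ unfold Rdiv. rewrite Rmult_0_l. unfold atan_int. now rewrite RInt_point. }
  replace ((0 + x) / x) with 1 in B1 by (field; lra).
  replace ((1 + x) / x) with (1 + / x) in B2 by (field; lra).
  replace (1 / x) with (/ x) in B2 by (field; lra).
  set (Sm1 := sum_n (fun j => / x * atan_quot ((0 + INR (S j)) / x)) N) in *.
  assert (D2 : forall z, x <= z -> is_derive (fun w => - atan_int (x / w)) z (atan (x / z) / z)).
  { clear - Hx. clearbody x. intros z Hz. evar_last.
    - apply (is_derive_opp (fun w => atan_int (x / w))).
      apply (is_derive_comp atan_int (fun w => x / w)); [apply is_derive_atan_int|].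
      auto_derive; [lra|reflexivity].
    - unfold opp, scal, mult; cbn. unfold atan_quot. destruct (Req_EM_T (x / z) 0) as [F|_].
      { exfalso. assert (0 < x / z) by (apply Rdiv_lt_0_compat; lra). lra. }
      field. lra. }
  assert (G2 : forall y z, x <= y <= z -> atan (x / z) / z <= atan (x / y) / y).
  { intros y z Hyz. assert (0 < / z) by (apply Rinv_0_lt_compat; lra).
    assert (/ z <= / y) by (apply Rinv_le_contravar; lra).
    assert (Hq : 0 < x / z <= x / y) by (unfold Rdiv; split; nra).
    assert (0 < atan (x / z)) by (rewrite <- atan_0; apply atan_increasing; lra).
    assert (atan (x / z) <= atan (x / y)).
    { destruct (proj2 Hq) as [L| ->]; [left; now apply atan_increasing|lra]. }
    unfold Rdiv. apply Rmult_le_compat; unfold Rdiv in *; lra. }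
  assert (Htl : ex_series (fun k => PI * atan_term (2 * PI * x) (S N + k)%nat)).
  { apply (proj1 (ex_series_incr_n (fun n => PI * atan_term (2 * PI * x) n) (S N))), He. }
  assert (TP : forall k, PI * atan_term (2 * PI * x) (S N + k)%nat = (fun w => atan (x / w) / w) (x + INR (S k))).
  { intros k. rewrite Tm. cbv beta. replace (x + INR (S k)) with (INR (S (S N + k))); [reflexivity|].
    unfold x. rewrite <- plus_INR. f_equal. lia. }
  assert (T2 : Series (fun k => PI * atan_term (2 * PI * x) (S N + k)%nat) <= atan_int 1).
  { apply (is_lim_seq_le (sum_n (fun k => PI * atan_term (2 * PI * x) (S N + k)%nat)) (fun _ => atan_int 1)
      (Series (fun k => PI * atan_term (2 * PI * x) (S N + k)%nat)) (atan_int 1)).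
    - intros M. destruct (sum_decr_le (fun w => - atan_int (x / w)) (fun w => atan (x / w) / w) x M ltac:(lra) D2 G2) as [_ B].
      rewrite (sum_n_ext _ (fun k => (fun w => atan (x / w) / w) (x + INR (S k)))) by (intros; apply TP).
      apply Rle_trans with (1 := B). replace (x / x) with 1 by (field; lra).
      assert (0 <= atan_int (x / (x + INR (S M)))); [|lra].
      pose proof (INR_S_pos M).
      assert (0 < x / (x + INR (S M))) by (apply Rdiv_lt_0_compat; lra).
      apply RInt_ge_0; [lra| |].
      + apply (ex_RInt_continuous atan_quot). intros z _. apply continuous_atan_quot.
      + intros z Hz. unfold atan_quot. destruct (Req_EM_T z 0); [lra|].
        apply Rmult_le_pos; [|left; apply Rinv_0_lt_compat; lra].
        rewrite <- atan_0. left. apply atan_increasing. lra.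
    - apply is_series_lim, Series_correct, Htl.
    - apply is_lim_seq_const. }
  (* The comparison integral starts at x + 1, where the tail begins; its boundary term at infinity
     tends to [atan_int 0], which is 0. *)
  assert (T1 : atan_int (x / (x + 1)) <= Series (fun k => PI * atan_term (2 * PI * x) (S N + k)%nat)).
  { apply (is_lim_seq_le (fun M => atan_int (x / (x + 1)) - atan_int (x / (x + 1 + INR (S M))))
      (sum_n (fun k => PI * atan_term (2 * PI * x) (S N + k)%nat))
      (atan_int (x / (x + 1))) (Series (fun k => PI * atan_term (2 * PI * x) (S N + k)%nat))).
    - intros M. destruct (sum_decr_le (fun w => - atan_int (x / w)) (fun w => atan (x / w) / w) (x + 1) M ltac:(lra)
        ltac:(intros; apply D2; lra) ltac:(intros; apply G2; lra)) as [B _].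
      rewrite (sum_n_ext _ (fun k => atan (x / (x + 1 + INR k)) / (x + 1 + INR k))).
      + lra.
      + intros k. rewrite TP. cbv beta. rewrite S_INR. replace (x + (INR k + 1)) with (x + 1 + INR k) by ring. reflexivity.
    - replace (Finite (atan_int (x / (x + 1)))) with (Finite (atan_int (x / (x + 1)) - atan_int 0)).
      2:{ unfold atan_int at 2. rewrite RInt_point. f_equal. unfold zero; simpl. ring. }
      apply is_lim_seq_minus'; [apply is_lim_seq_const|].
      apply is_lim_seq_continuous.
      + apply derivable_continuous_pt. exists (atan_quot 0). apply is_derive_Reals, is_derive_atan_int.
      + replace (Finite 0) with (Rbar_mult x 0) by (simpl; f_equal; ring).
        apply is_lim_seq_scal_l. apply (is_lim_seq_inv _ p_infty); [|discriminate].
        apply is_lim_seq_le_p_loc with (fun n => INR (S n)).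
        * exists 0%nat. intros n _. lra.
        * apply -> (is_lim_seq_incr_1 INR). apply is_lim_seq_INR.
    - apply is_series_lim, Series_correct, Htl. }
  lra.
Qed.

Definition bose (v : R) : R := / (exp v - 1).

(* The primitive of - bose(v) / v that vanishes at infinity; the constant is fixed by [lim_Qf_2PI]. *)
Definition Qf (v : R) : R :=
  / v + ln v / 2 + (euler_gamma - ln (2 * PI)) / 2 - Series (atan_term v).

(** The harmonic sum of [atan_series_bounds] combines with the logarithm to [euler_gamma], which
    forces the constant in [Qf]. A limit along this sequence is enough, because [Qf] is then handled
    by monotonicity. *)
Lemma lim_Qf_2PI : is_lim_seq (fun N => Qf (2 * PI * INR (S N))) 0.
Proof.
  pose proof PI_gt_3 as HP.
  assert (Hinf : is_lim_seq (fun n => INR (S n)) p_infty).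
  { apply -> (is_lim_seq_incr_1 INR). apply is_lim_seq_INR. }
  assert (Hinv : is_lim_seq (fun n => / INR (S n)) 0).
  { apply (is_lim_seq_inv _ p_infty); [exact Hinf|discriminate]. }
  assert (HC : forall z, continuity_pt atan_int z).
  { intros z. apply derivable_continuous_pt. exists (atan_quot z). apply is_derive_Reals, is_derive_atan_int. }
  assert (T0 : atan_int 0 = 0) by (unfold atan_int; now rewrite RInt_point).
  set (lo := fun N => let x := INR (S N) in / (2 * PI * x) - (harm N - ln x - euler_gamma) / 2
       - / PI * (atan_int 1 - atan_int (1 + / x) + atan_int (/ x))).
  set (hi := fun N => let x := INR (S N) in / (2 * PI * x) - (harm N - ln x - euler_gamma) / 2
       - / PI * (atan_int (x / (x + 1)) - atan_int 1)).
  assert (Hcom : is_lim_seq (fun N => / (2 * PI * INR (S N)) - (harm N - ln (INR (S N)) - euler_gamma) / 2) 0).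
  { replace (Finite 0) with (Finite (/ (2 * PI) * 0 - (euler_gamma - euler_gamma) / 2)) by (f_equal; field; lra).
    apply is_lim_seq_minus'.
    - apply is_lim_seq_ext with (fun n => / (2 * PI) * / INR (S n)).
      + intros n. pose proof (INR_S_pos n). field. lra.
      + apply (is_lim_seq_scal_l _ (/ (2 * PI)) 0), Hinv.
    - apply is_lim_seq_mult'; [|apply is_lim_seq_const].
      apply is_lim_seq_minus'; [apply euler_gamma_lim|apply is_lim_seq_const]. }
  apply is_lim_seq_le_le with lo hi.
  - intros N. destruct (atan_series_bounds N) as [B1 B2]. unfold lo, hi, Qf. cbv zeta in *.
    pose proof (INR_S_pos N). set (x := INR (S N)) in *.
    rewrite (ln_mult (2 * PI) x) by nra. set (Se := Series (atan_term (2 * PI * x))) in *.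
    assert (Hp : 0 < / PI) by (apply Rinv_0_lt_compat; lra).
    apply (Rmult_le_compat_l (/ PI)) in B1; [|lra]. apply (Rmult_le_compat_l (/ PI)) in B2; [|lra].
    rewrite <- Rmult_assoc, Rinv_l, Rmult_1_l in B1, B2 by lra.
    rewrite Rmult_plus_distr_l in B1, B2.
    replace (/ PI * (PI / 2 * harm N)) with (harm N / 2) in B1, B2 by (field; lra). split; lra.
  - unfold lo. cbv zeta. replace (Finite 0) with (Finite (0 - / PI * (atan_int 1 - atan_int (1 + 0) + atan_int 0))).
    2:{ rewrite T0, !Rplus_0_r. f_equal. ring. }
    apply is_lim_seq_minus'; [exact Hcom|]. apply (is_lim_seq_scal_l _ (/ PI) (Finite _)).
    apply is_lim_seq_plus'; [apply is_lim_seq_minus'; [apply is_lim_seq_const|]|].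
    + apply is_lim_seq_continuous; [apply HC|]. apply is_lim_seq_plus'; [apply is_lim_seq_const|exact Hinv].
    + apply is_lim_seq_continuous; [apply HC|exact Hinv].
  - unfold hi. cbv zeta. replace (Finite 0) with (Finite (0 - / PI * (atan_int 1 - atan_int 1))) by (f_equal; ring).
    apply is_lim_seq_minus'; [exact Hcom|]. apply (is_lim_seq_scal_l _ (/ PI) (Finite _)).
    apply is_lim_seq_minus'; [|apply is_lim_seq_const].
    apply is_lim_seq_continuous; [apply HC|].
    apply is_lim_seq_ext with (fun N => 1 - / INR (S (S N))).
    + intros N. rewrite (S_INR (S N)). pose proof (INR_S_pos N). field. lra.
    + replace (Finite 1) with (Finite (1 - 0)) by (f_equal; ring).
      apply is_lim_seq_minus'; [apply is_lim_seq_const|].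
      apply (is_lim_seq_incr_1 (fun N => / INR (S N))), Hinv.
Qed.

Lemma exp_gt_1 v : 0 < v -> 1 < exp v.
Proof. intros H. rewrite <- exp_0. now apply exp_increasing. Qed.

(** The expansion of [poisson] at th = 0, where it equals 1 / 2 + [bose t]. The lattice point 0
    contributes 1 / t and the others occur in equal pairs. *)
Lemma is_series_pk_lattice t : 0 < t ->
  is_series (fun n => pk t (2 * PI * INR (S n))) ((/ 2 + bose t - / t) / 2).
Proof.
  intros Ht. pose proof PI_gt_3 as HP.
  assert (E := is_series_poisson t 0 Ht ltac:(lra)).
  assert (Ex : ex_series (fun n => pk t (2 * PI * INR (S n)))).
  { apply ex_series_dom with (fun n => t * / INR (S n) ^ 2).
    - intros n. pose proof (INR_S_ge1 n). destruct (pk_bounds t (2 * PI * INR (S n)) Ht ltac:(nra)) as [B1 B2].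
      rewrite Rabs_right by lra. apply Rle_trans with (1 := B2). apply Rmult_le_compat_l; [lra|].
      apply Rinv_le_contravar; [nra|]. apply pow_incr. nra.
    - apply (ex_series_scal_l t (fun n => / INR (S n) ^ 2)), ex_series_inv_sq. }
  assert (Ex0 : ex_series (fun n => pk t (2 * PI * INR n))).
  { apply (proj2 (ex_series_incr_1 (fun n => pk t (2 * PI * INR n)))), Ex. }
  assert (Sm : Series (poisson_term t 0) = / t + 2 * Series (fun n => pk t (2 * PI * INR (S n)))).
  { rewrite (Series_ext (poisson_term t 0) (fun n => pk t (2 * PI * INR n) + pk t (2 * PI * INR (S n)))).
    - rewrite Series_plus by auto. rewrite (Series_incr_1 (fun n => pk t (2 * PI * INR n))) by auto.
      replace (pk t (2 * PI * INR 0)) with (/ t) by (unfold pk; simpl; field; lra). ring.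
    - intros n. unfold poisson_term. rewrite Rplus_0_l. f_equal.
      rewrite Rminus_0_l. apply pk_even. }
  rewrite (is_series_unique _ _ E) in Sm.
  replace ((/ 2 + bose t - / t) / 2) with (Series (fun n => pk t (2 * PI * INR (S n)))).
  - apply Series_correct, Ex.
  - assert (Hp : poisson t 0 = / 2 + bose t).
    { unfold poisson, bose, sinh, cosh. rewrite cos_0, exp_Ropp.
      pose proof (exp_gt_1 t Ht). set (u := exp t) in *. field. repeat split; nra. }
    lra.
Qed.

(** Termwise, [atan_term] has derivative 2 / v times [pk] at 2 PI n. By [is_series_pk_lattice] these
    sum to an expression whose rational part cancels the derivatives of 1 / v and (ln v) / 2. *)
Lemma is_derive_Qf v : 0 < v -> is_derive Qf v (- (bose v / v)).
Proof.
  intros Hv. pose proof PI_gt_3 as HP.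
  assert (D : is_derive (fun y => Series (atan_term y)) v (Series (fun n => 2 / v * pk v (2 * PI * INR (S n))))).
  { apply (is_derive_Series (fun n y => atan_term y n)
      (fun n y => 2 / y * pk y (2 * PI * INR (S n)))
      (fun n y => - (4 * y) / (y ^ 2 + (2 * PI * INR (S n)) ^ 2) ^ 2)
      (fun n => 8 / v * / INR (S n) ^ 2) v (v / 2)).
    - lra.
    - intros n y Hy. apply Rabs_def2 in Hy. unfold atan_term, pk.
      pose proof (INR_S_pos n). set (N := INR (S n)) in *. clearbody N.
      auto_derive; [nra|]. field. assert (0 < PI * N) by nra. repeat split; nra.
    - intros n y Hy. apply Rabs_def2 in Hy. unfold pk.
      pose proof (INR_S_pos n). set (N := INR (S n)) in *. clearbody N.
      apply (is_derive_ext_loc (fun y => 2 / (y ^ 2 + (2 * PI * N) ^ 2))).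
      { exists (mkposreal (v / 4) ltac:(lra)). intros z Hz. change (Rabs (z - y) < v / 4) in Hz.
        apply Rabs_def2 in Hz. eqR. field. split; nra. }
      auto_derive; [nra|]. field. nra.
    - intros n y Hy. apply Rabs_def2 in Hy. pose proof (INR_S_ge1 n). set (N := INR (S n)) in *. clearbody N.
      unfold Rdiv. rewrite Rabs_mult, Rabs_inv, Rabs_Ropp, !Rabs_right by (try apply Rle_ge, pow2_ge_0; lra).
      assert (M1 : y * y * N ^ 2 <= (y ^ 2 + (2 * PI * N) ^ 2) ^ 2).
      { assert (y * y <= y ^ 2 + (2 * PI * N) ^ 2) by nra.
        assert (N ^ 2 <= (2 * PI * N) ^ 2) by (apply pow_incr; nra).
        assert (N ^ 2 <= y ^ 2 + (2 * PI * N) ^ 2) by (pose proof (pow2_ge_0 y); lra).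
        assert (0 <= N ^ 2) by nra.
        replace ((y ^ 2 + (2 * PI * N) ^ 2) ^ 2) with ((y ^ 2 + (2 * PI * N) ^ 2) * (y ^ 2 + (2 * PI * N) ^ 2)) by ring.
        apply Rmult_le_compat; nra. }
      apply Rle_trans with (4 * y * / (y * y * N ^ 2)).
      + apply Rmult_le_compat_l; [lra|]. apply Rinv_le_contravar; [|exact M1]. apply Rmult_lt_0_compat; nra.
      + replace (4 * y * / (y * y * N ^ 2)) with (4 * / y * / N ^ 2) by (field; lra).
        apply Rmult_le_compat_r; [left; apply Rinv_0_lt_compat; nra|].
        replace (8 * / v) with (4 * / (v / 2)) by (field; lra).
        apply Rmult_le_compat_l; [lra|]. apply Rinv_le_contravar; lra.
    - apply (ex_series_scal_l _ (fun n => / INR (S n) ^ 2)), ex_series_inv_sq.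
    - intros y Hy. apply Rabs_def2 in Hy. apply ex_series_atan_term. lra.
    - apply (ex_series_scal_l _ (fun n => pk v (2 * PI * INR (S n)))).
      eexists. now apply is_series_pk_lattice. }
  rewrite Series_scal_l, (is_series_unique _ _ (is_series_pk_lattice v Hv)) in D.
  unfold Qf. evar_last.
  - apply (is_derive_minus (fun v => / v + ln v / 2 + (euler_gamma - ln (2 * PI)) / 2) (fun v => Series (atan_term v))).
    + auto_derive; [|reflexivity]. split; [lra|]. split; [exact Hv|exact I].
    + exact D.
  - unfold minus, plus, opp; cbn -[pow]. unfold bose. pose proof (exp_gt_1 v Hv). field. lra.
Qed.

Lemma bose_pos v : 0 < v -> 0 < bose v.
Proof. intros H. apply Rinv_0_lt_compat. pose proof (exp_gt_1 v H). lra. Qed.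

(** exp v - 1 = 2 exp (v / 2) sinh (v / 2) >= v exp (v / 2). *)
Lemma bose_le v : 0 < v -> bose v <= / v * exp (- (v / 2)).
Proof.
  intros H. unfold bose. rewrite exp_Ropp, <- Rinv_mult. pose proof (exp_pos (v / 2)).
  apply Rinv_le_contravar; [nra|].
  pose proof (sinh_ge_id (v / 2) ltac:(lra)) as S1. unfold sinh in S1.
  assert (E : exp (v / 2) * exp (- (v / 2)) = 1) by (rewrite <- exp_plus, Rplus_opp_r; apply exp_0).
  assert (E2 : exp v = exp (v / 2) * exp (v / 2)) by (rewrite <- exp_plus; f_equal; field).
  rewrite E2. nra.
Qed.

Lemma monotone_of_derive_pos (f f' : R -> R) x y :
  (forall z, 0 < z -> is_derive f z (f' z)) -> (forall z, 0 < z -> 0 <= f' z) ->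
  0 < x <= y -> f x <= f y.
Proof.
  intros Hd Hp H.
  destruct (MVT_gen f x y f') as [c [Hc E]].
  - intros z Hz. rewrite Rmin_left in Hz by lra. apply Hd. lra.
  - intros z Hz. rewrite Rmin_left in Hz by lra.
    apply derivable_continuous_pt. exists (f' z). apply is_derive_Reals, Hd. lra.
  - rewrite Rmin_left in Hc by lra. specialize (Hp c ltac:(lra)). nra.
Qed.

Lemma le_lim_2PI (f : R -> R) v : 0 < v -> (forall y, v <= y -> f v <= f y) ->
  is_lim_seq (fun N => f (2 * PI * INR (S N))) 0 -> f v <= 0.
Proof.
  intros Hv Hm Hl. pose proof PI_gt_3.
  apply (is_lim_seq_le_loc (fun _ => f v) (fun N => f (2 * PI * INR (S N))) (f v) 0); auto.
  - destruct (INR_archimed 1 v Rlt_0_1) as [M HM]. exists M. intros n Hn. apply Hm.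
    assert (INR M <= INR (S n)) by (apply le_INR; lia). pose proof (INR_S_pos n). nra.
  - apply is_lim_seq_const.
Qed.

(** Both - Qf and Qf - K v^(-p-1) increase and tend to 0 along multiples of 2 PI, hence are
    nonpositive. K is chosen so that exp (- v / 2) <= K v^(-p). *)
Lemma Qf_rapid_decay p : exists K, 0 < K /\ forall v, 0 < v -> 0 <= Qf v <= K * (/ v) ^ (S p).
Proof.
  set (K := (INR p / (/ 2)) ^ p + 1).
  assert (HK0 : 0 <= (INR p / (/ 2)) ^ p).
  { apply pow_le. apply Rmult_le_pos; [apply pos_INR|left; apply Rinv_0_lt_compat; lra]. }
  assert (HK : 0 < K) by (unfold K; lra).
  exists K. split; [exact HK|]. pose proof PI_gt_3 as HP. intros v Hv. split.
  - assert (- Qf v <= 0); [|lra].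
    apply (le_lim_2PI (fun z => - Qf z) v Hv).
    + intros y Hy. apply (monotone_of_derive_pos (fun z => - Qf z) (fun z => bose z / z)); [| |lra].
      * intros z Hz. evar_last; [apply (is_derive_opp Qf), is_derive_Qf, Hz|]. unfold opp; cbn. ring.
      * intros z Hz. apply Rmult_le_pos; [left; now apply bose_pos|left; now apply Rinv_0_lt_compat].
    + replace (Finite 0) with (Finite (- 0)) by (f_equal; ring). apply (is_lim_seq_opp _ 0), lim_Qf_2PI.
  - assert (Qf v - K * (/ v) ^ S p <= 0); [|lra].
    apply (le_lim_2PI (fun z => Qf z - K * (/ z) ^ S p) v Hv).
    + intros y Hy. apply (monotone_of_derive_pos (fun z => Qf z - K * (/ z) ^ S p)
        (fun z => - (bose z / z) + K * INR (S p) * (/ z) ^ (S (S p)))); [| |lra].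
      * intros z Hz. evar_last.
        { apply (is_derive_minus Qf (fun z => K * (/ z) ^ S p)); [now apply is_derive_Qf|].
          apply (is_derive_scal (fun z => (/ z) ^ S p)). apply (is_derive_pow (fun z => / z) (S p)).
          auto_derive; [lra|reflexivity]. }
        unfold minus, plus, opp; cbn -[pow INR bose]. rewrite <- !tech_pow_Rmult. field. lra.
      * intros z Hz. pose proof (bose_le z Hz) as B. pose proof (INR_S_ge1 p).
        assert (Hi : 0 < / z) by now apply Rinv_0_lt_compat.
        assert (Bz : exp (- (z / 2)) <= K * (/ z) ^ p).
        { pose proof (pow_exp_bound p (/ 2) z ltac:(lra) ltac:(lra)) as PB.
          replace (/ 2 * z) with (z / 2) in PB by field.
          assert (0 < z ^ p) by (apply pow_lt; lra).
          rewrite pow_inv. apply Rmult_le_reg_r with (z ^ p); [auto|].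
          rewrite Rmult_assoc, Rinv_l by lra. unfold K. lra. }
        assert (bose z <= / z * (K * (/ z) ^ p)) by nra.
        assert (bose z / z <= / z * (K * (/ z) ^ p) * / z) by (apply Rmult_le_compat_r; lra).
        rewrite <- !tech_pow_Rmult.
        assert (0 < K * (/ z * (/ z * (/ z) ^ p))) by (repeat apply Rmult_lt_0_compat; auto; now apply pow_lt).
        nra.
    + replace (Finite 0) with (Finite (0 - K * 0)) by (f_equal; ring).
      apply is_lim_seq_minus'; [apply lim_Qf_2PI|].
      apply (is_lim_seq_scal_l _ K 0).
      assert (Hinv : is_lim_seq (fun n => / INR (S n)) 0).
      { apply (is_lim_seq_inv _ p_infty); [|discriminate]. apply -> (is_lim_seq_incr_1 INR). apply is_lim_seq_INR. }
      apply is_lim_seq_le_le with (fun _ => 0) (fun n => / INR (S n)); auto.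
      * intros n. pose proof (INR_S_ge1 n). assert (1 <= 2 * PI * INR (S n)) by nra.
        assert (Hi : 0 < / (2 * PI * INR (S n)) <= 1).
        { split; [apply Rinv_0_lt_compat; lra|rewrite <- Rinv_1; apply Rinv_le_contravar; lra]. }
        split; [apply pow_le; lra|]. rewrite <- tech_pow_Rmult.
        assert (Hp1 : (/ (2 * PI * INR (S n))) ^ p <= 1) by (rewrite <- (pow1 p); apply pow_incr; lra).
        apply Rle_trans with (/ (2 * PI * INR (S n))).
        -- rewrite <- Rmult_1_r. apply Rmult_le_compat_l; lra.
        -- apply Rinv_le_contravar; nra.
      * apply is_lim_seq_const.
Qed.

(** * The Bessel function K0 *)

(** The integrand of 2 K0 (2 sqrt (al be)) in a variable that separates al from be, so that sums
    over either can be taken under the integral. *)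
Definition kb (al be t : R) : R := exp (- (al * t)) * exp (- (be / t)) / t.

Lemma continuous_kb al be t : 0 < t -> continuous (kb al be) t.
Proof.
  intros H. apply (ex_derive_continuous (kb al be)). unfold kb. auto_derive. repeat split; lra.
Qed.

Lemma kb_le p r al be t : 0 < al -> 0 < be -> 0 < t -> (p <= r)%nat ->
  kb al be t <= (INR p * / al * / t * 2) ^ p * ((INR (S r) * / be) * t) ^ (S r) * / t * exp (- (al / 2 * t)).
Proof.
  intros Ha Hb Ht Hpr. unfold kb.
  assert (E1 : exp (- (al * t)) <= (INR p * / al * / t * 2) ^ p * exp (- (al / 2 * t))).
  { replace (- (al * t)) with (- (al / 2 * t) + - (al / 2 * t)) by field. rewrite exp_plus.
    apply Rmult_le_compat_r; [left; apply exp_pos|].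
    eapply Rle_trans; [apply (exp_neg_le p); nra|]. right. f_equal. field. lra. }
  assert (E2 : exp (- (be / t)) <= ((INR (S r) * / be) * t) ^ (S r)).
  { eapply Rle_trans; [apply (exp_neg_le (S r)); apply Rdiv_lt_0_compat; lra|]. right. f_equal. field. lra. }
  assert (0 < / t) by now apply Rinv_0_lt_compat. unfold Rdiv.
  pose proof (exp_pos (- (al * t))). pose proof (exp_pos (- (be / t))).
  replace ((INR p * / al * / t * 2) ^ p * (INR (S r) * / be * t) ^ S r * / t * exp (- (al * / 2 * t)))
    with ((INR p * / al * / t * 2) ^ p * exp (- (al / 2 * t)) * (INR (S r) * / be * t) ^ S r * / t)
    by (unfold Rdiv; ring).
  apply Rmult_le_compat_r; [lra|]. apply Rmult_le_compat; unfold Rdiv in *; lra.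
Qed.

Lemma kb_bound p : exists A, 0 < A /\ forall al be t, 1 <= al -> 0 < be -> 0 < t ->
  0 <= kb al be t <= A * (/ al) ^ p * (/ be) ^ (S p) * wt t.
Proof.
  destruct (exp_le_wt (/ 2) ltac:(lra)) as [A [HA H]].
  set (B := (INR p * 2) ^ p * INR (S p) ^ (S p)).
  assert (HB : 0 <= B).
  { unfold B. apply Rmult_le_pos; apply pow_le; [|apply pos_INR]. pose proof (pos_INR p). lra. }
  exists ((B + 1) * A). split; [nra|]. intros al be t Hal Hbe Ht.
  assert (Hit : 0 < / t) by now apply Rinv_0_lt_compat.
  split.
  - unfold kb. apply Rmult_le_pos; [|lra]. apply Rmult_le_pos; left; apply exp_pos.
  - eapply Rle_trans; [apply (kb_le p p); auto; lra|].
    assert (0 < (/ al) ^ p) by (apply pow_lt, Rinv_0_lt_compat; lra).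
    assert (0 < (/ be) ^ S p) by (apply pow_lt, Rinv_0_lt_compat; lra).
    pose proof (wt_pos t Ht).
    replace ((INR p * / al * / t * 2) ^ p * (INR (S p) * / be * t) ^ S p * / t * exp (- (al / 2 * t)))
      with (B * (/ al) ^ p * (/ be) ^ (S p) * exp (- (al / 2 * t))).
    2:{ unfold B. rewrite !Rpow_mult_distr. rewrite <- (tech_pow_Rmult t p).
        assert (E : (/ t) ^ p * t ^ p = 1) by (rewrite <- Rpow_mult_distr, Rinv_l by lra; apply pow1).
        transitivity (INR p ^ p * 2 ^ p * INR (S p) ^ S p * (/ al) ^ p * (/ be) ^ S p * exp (- (al / 2 * t))
          * ((/ t) ^ p * t ^ p) * (t * / t)); [|ring].
        rewrite E, Rinv_r by lra. ring. }
    assert (Ee : exp (- (al / 2 * t)) <= A * wt t).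
    { apply Rle_trans with (exp (- (/ 2 * t))); [|now apply H].
      apply exp_le. nra. }
    pose proof (exp_pos (- (al / 2 * t))).
    replace ((B + 1) * A * (/ al) ^ p * (/ be) ^ S p * wt t)
      with ((B + 1) * (/ al) ^ p * (/ be) ^ S p * (A * wt t)) by ring.
    apply Rmult_le_compat; try lra.
    + apply Rmult_le_pos; [apply Rmult_le_pos|]; lra.
    + apply Rmult_le_compat_r; [lra|]. apply Rmult_le_compat_r; lra.
Qed.

Lemma dom_kb_exists al be : 0 < al -> 0 < be -> exists A, dom (kb al be) A.
Proof.
  intros Ha Hb. destruct (exp_le_wt (al / 2) ltac:(lra)) as [A [HA H]].
  exists (1 * / be * A). split; [intros; now apply continuous_kb|].
  intros t Ht. assert (Hit : 0 < / t) by now apply Rinv_0_lt_compat.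
  rewrite Rabs_right.
  - eapply Rle_trans; [apply (kb_le 0 0); auto|]. simpl. specialize (H t Ht).
    replace (1 * (1 * / be * t * 1) * / t) with (1 * / be) by (field; lra).
    replace (1 * / be * A * wt t) with (1 * / be * (A * wt t)) by ring.
    apply Rmult_le_compat_l; [|lra].
    apply Rmult_le_pos; [lra|left; now apply Rinv_0_lt_compat].
  - apply Rle_ge. unfold kb. apply Rmult_le_pos; [|lra]. apply Rmult_le_pos; left; apply exp_pos.
Qed.

Lemma RInt_even_cosh x b : RInt (fun u => exp (- x * cosh u)) (- b) b = 2 * RInt (fun u => exp (- x * cosh u)) 0 b.
Proof.
  set (f := fun u => exp (- x * cosh u)).
  assert (Cf : forall u, continuous f u).
  { intros u. apply (ex_derive_continuous f). unfold f, cosh. auto_derive. exact I. }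
  assert (Ex : forall a c, ex_RInt f a c) by (intros; apply (ex_RInt_continuous f); auto).
  rewrite <- (RInt_Chasles f (- b) 0 b) by auto.
  assert (E : RInt f 0 (- b) = - RInt f 0 b).
  { pose proof (RInt_comp f Ropp (fun _ => -1) 0 b) as H. rewrite Ropp_0 in H.
    rewrite <- H.
    - rewrite <- (RInt_opp f) by auto. apply RInt_ext. intros u _.
      change (-1 * f (- u) = - f u). unfold f, cosh. rewrite Ropp_involutive.
      rewrite (Rplus_comm (exp (- u))). ring.
    - intros; apply Cf.
    - intros u _. split; [|apply continuous_const]. auto_derive; [exact I|ring]. }
  assert (E2 : RInt f (- b) 0 = RInt f 0 b).
  { rewrite <- (opp_RInt_swap f 0 (- b)) by auto. rewrite E. apply Ropp_involutive. }
  rewrite E2. unfold plus; simpl. ring.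
Qed.

(** The substitution t = l exp u with l = sqrt (be / al) balances the two exponents: al t + be / t =
    2 sqrt (al be) cosh u. *)
Lemma RInt_kb al be b : 0 < al -> 0 < be -> 0 <= b ->
  let l := sqrt (be / al) in
  RInt (kb al be) (l * exp (- b)) (l * exp b) = 2 * RInt (fun u => exp (- (2 * sqrt (al * be)) * cosh u)) 0 b.
Proof.
  intros Ha Hb Hbb l. rewrite <- RInt_even_cosh.
  assert (Hq : 0 < be / al) by now apply Rdiv_lt_0_compat.
  assert (Hl : 0 < l) by now apply sqrt_lt_R0.
  assert (L2 : l * l = be / al) by (apply sqrt_sqrt; lra).
  assert (Ls : sqrt (al * be) = al * l).
  { replace (al * be) with ((al * al) * (be / al)) by (field; lra).
    rewrite sqrt_mult, sqrt_square by nra. reflexivity. }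
  rewrite <- (RInt_comp (kb al be) (fun u => l * exp u) (fun u => l * exp u) (- b) b).
  - apply RInt_ext. intros u _.
    change (l * exp u * kb al be (l * exp u) = exp (- (2 * sqrt (al * be)) * cosh u)). unfold kb, cosh.
    pose proof (exp_pos u) as Hu. rewrite Ls.
    replace (be / (l * exp u)) with (al * l * exp (- u)).
    2:{ rewrite exp_Ropp. replace be with (al * (l * l)) by (rewrite L2; field; lra). field. lra. }
    rewrite <- exp_plus. replace (- (al * (l * exp u)) + - (al * l * exp (- u)))
      with (- (2 * (al * l)) * ((exp u + exp (- u)) / 2)) by field.
    field. split; lra.
  - intros u _. apply continuous_kb. apply Rmult_lt_0_compat; [exact Hl|apply exp_pos].
  - intros u _. split; [auto_derive; [exact I|ring]|].
    apply (ex_derive_continuous (fun u => l * exp u)). auto_derive. exact I.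
Qed.

(** By [gap_le], truncation to [l exp (-b), l exp b] costs at most a multiple of exp (- b / 2). The
    same estimate proves that the improper integral in [K0] converges. *)
Theorem hint_kb al be : 0 < al -> 0 < be -> hint (kb al be) = 2 * K0 (2 * sqrt (al * be)).
Proof.
  intros Ha Hb. set (x := 2 * sqrt (al * be)). set (f := fun u => exp (- x * cosh u)).
  destruct (dom_kb_exists al be Ha Hb) as [A HA]. pose proof (dom_nonneg _ _ HA) as HA0.
  set (l := sqrt (be / al)).
  assert (Hl : 0 < l) by (apply sqrt_lt_R0, Rdiv_lt_0_compat; lra).
  assert (Cf : forall u, continuous f u).
  { intros u. apply (ex_derive_continuous f). unfold f, cosh. auto_derive. exact I. }
  assert (Ex : forall a c, ex_RInt f a c) by (intros; apply (ex_RInt_continuous f); auto).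
  assert (Hap : forall b, 0 <= b -> Rabs (hint (kb al be) - 2 * RInt f 0 b) <= A * (2 * sqrt l + 2 / sqrt l) * exp (- (b / 2))).
  { intros b Hbb. unfold f, x. rewrite <- RInt_kb by auto. fold l.
    pose proof (exp_pos b). pose proof (exp_pos (- b)).
    assert (exp (- b) <= exp b).
    { apply exp_le. lra. }
    eapply Rle_trans; [apply hint_approx with (A := A); auto; nra|].
    rewrite Rmult_assoc. apply Rmult_le_compat_l; [exact HA0|].
    eapply Rle_trans; [apply gap_le; nra|]. rewrite !sqrt_mult by lra.
    assert (S1 : sqrt (exp (- b)) = exp (- (b / 2))).
    { rewrite <- (sqrt_square (exp (- (b / 2)))) by (left; apply exp_pos). rewrite <- exp_plus. do 2 f_equal. field. }
    assert (S2 : sqrt (exp b) = exp (b / 2)).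
    { rewrite <- (sqrt_square (exp (b / 2))) by (left; apply exp_pos). rewrite <- exp_plus. do 2 f_equal. field. }
    rewrite S1, S2. pose proof (sqrt_lt_R0 l Hl). right. rewrite exp_Ropp. pose proof (exp_pos (b / 2)). field. lra. }
  replace (K0 x) with (hint (kb al be) / 2); [field|]. symmetry. unfold K0. fold f.
  apply (is_RInt_gen_unique f).
  intros P [eps HP].
  set (M := A * (2 * sqrt l + 2 / sqrt l)).
  assert (HM : 0 <= M).
  { unfold M. pose proof (sqrt_lt_R0 l Hl). assert (0 < 2 / sqrt l) by (apply Rdiv_lt_0_compat; lra).
    apply Rmult_le_pos; lra. }
  assert (He := cond_pos eps).
  apply Filter_prod with (fun a => a = 0) (fun b => Rmax 0 (2 * M / eps) < b).
  - reflexivity.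
  - exists (Rmax 0 (2 * M / eps)). auto.
  - intros a b -> Hbb. exists (RInt f 0 b). split; [apply (RInt_correct f); auto|].
    apply HP. pose proof (Rmax_l 0 (2 * M / eps)). pose proof (Rmax_r 0 (2 * M / eps)).
    change (Rabs (RInt f 0 b - hint (kb al be) / 2) < eps).
    specialize (Hap b ltac:(lra)). fold M in Hap.
    assert (M * exp (- (b / 2)) < 2 * eps).
    { rewrite exp_Ropp. pose proof (exp_pos (b / 2)). pose proof (exp_ineq1_le (b / 2)).
      apply Rmult_lt_reg_r with (exp (b / 2)); [auto|]. rewrite Rmult_assoc, Rinv_l, Rmult_1_r by lra.
      assert (2 * M < b * eps).
      { apply Rmult_lt_reg_r with (/ eps); [now apply Rinv_0_lt_compat|].
        replace (b * eps * / eps) with b by (field; lra). unfold Rdiv in *. lra. }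
      nra. }
    apply Rabs_le_between in Hap. apply Rabs_def1; lra.
Qed.

Lemma RInt_le_hint f A a b : dom f A -> (forall t, 0 < t -> 0 <= f t) -> 0 < a <= b ->
  RInt f a b <= hint f.
Proof.
  intros H Hp Hab.
  apply (is_lim_seq_le_loc (fun _ => RInt f a b) (fun n => RInt f (/ INR (S n)) (INR (S n)))
     (RInt f a b) (hint f)).
  - destruct (INR_archimed 1 (Rmax (/ a) b) Rlt_0_1) as [N HN]. exists N. intros n Hn.
    assert (HN' : Rmax (/ a) b <= INR (S n)).
    { assert (INR N <= INR (S n)) by (apply le_INR; lia). lra. }
    pose proof (Rmax_l (/ a) b). pose proof (Rmax_r (/ a) b).
    destruct (nested_index n n (le_n n)) as [G1 [G2 [G3 G4]]].
    assert (/ INR (S n) <= a).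
    { rewrite <- (Rinv_inv a). apply Rinv_le_contravar; [apply Rinv_0_lt_compat; lra|lra]. }
    destruct H as [Hc _].
    rewrite <- (RInt_Chasles_pos f (/ INR (S n)) a (INR (S n))), <- (RInt_Chasles_pos f a b (INR (S n))) by (auto; lra).
    assert (0 <= RInt f (/ INR (S n)) a).
    { apply RInt_ge_0; [lra|apply ex_RInt_pos; auto; lra|]. intros; apply Hp; lra. }
    assert (0 <= RInt f b (INR (S n))).
    { apply RInt_ge_0; [lra|apply ex_RInt_pos; auto; lra|]. intros; apply Hp; lra. }
    lra.
  - apply is_lim_seq_const.
  - now apply hint_lim with A.
Qed.

(** On [y, 1] both t and y / t are at most 1, so the integrand is at least exp (-2) / t. This
    logarithmic growth yields the contradiction in the nonvanishing at 0. *)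
Lemma hint_kb_lower y : 0 < y <= 1 -> exp (-2) * - ln y <= hint (kb 1 y).
Proof.
  intros Hy. destruct (dom_kb_exists 1 y Rlt_0_1 ltac:(lra)) as [A HA].
  apply Rle_trans with (RInt (kb 1 y) y 1).
  - assert (I : is_RInt (fun t => exp (-2) * / t) y 1 (exp (-2) * - ln y)).
    { replace (exp (-2) * - ln y) with (minus (exp (-2) * ln 1) (exp (-2) * ln y))
        by (rewrite ln_1; unfold minus, plus, opp; simpl; ring).
      apply (is_RInt_derive (fun t => exp (-2) * ln t) (fun t => exp (-2) * / t)).
      - intros t Ht. rewrite Rmin_left in Ht by lra. auto_derive; [lra|field; lra].
      - intros t Ht. rewrite Rmin_left in Ht by lra.
        apply (ex_derive_continuous (fun t => exp (-2) * / t)). auto_derive. lra. }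
    rewrite <- (is_RInt_unique _ _ _ _ I). apply RInt_le; [lra|eexists; exact I| |].
    + apply ex_RInt_pos; [apply HA|lra|lra].
    + intros t Ht. unfold kb, Rdiv. rewrite <- exp_plus.
      apply Rmult_le_compat_r; [left; apply Rinv_0_lt_compat; lra|].
      assert (y * / t <= 1).
      { apply Rmult_le_reg_r with t; [lra|]. rewrite Rmult_assoc, Rinv_l by lra. lra. }
      apply exp_le. lra.
  - apply RInt_le_hint with A; auto. intros t Ht. unfold kb.
    apply Rmult_le_pos; [|left; now apply Rinv_0_lt_compat]. apply Rmult_le_pos; left; apply exp_pos.
Qed.

(** * Arctangent integrals *)

Lemma lim_INR_S : is_lim_seq (fun n => INR (S n)) p_infty.
Proof. apply -> (is_lim_seq_incr_1 INR). apply is_lim_seq_INR. Qed.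

Lemma lim_inv_INR_S : is_lim_seq (fun n => / INR (S n)) 0.
Proof. apply (is_lim_seq_inv _ p_infty); [exact lim_INR_S|discriminate]. Qed.

Lemma lim_atan_scale c : 0 < c -> is_lim_seq (fun n => atan (c * INR (S n))) (PI / 2).
Proof.
  intros Hc. apply is_lim_seq_ext with (fun n => PI / 2 - atan (/ c * / INR (S n))).
  - intros n. pose proof (INR_S_pos n). rewrite <- Rinv_mult, atan_inv by nra. ring.
  - replace (Finite (PI / 2)) with (Finite (PI / 2 - atan (/ c * 0))) by (f_equal; rewrite Rmult_0_r, atan_0; ring).
    apply is_lim_seq_minus'; [apply is_lim_seq_const|].
    apply is_lim_seq_continuous.
    + apply derivable_continuous_pt, derivable_pt_atan.
    + apply (is_lim_seq_scal_l _ (/ c) 0), lim_inv_INR_S.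
Qed.

Lemma inv_quad_le_wt c t : 0 < c -> 0 < t -> / (t ^ 2 + c ^ 2) <= 2 * (1 + / c ^ 2) * wt t.
Proof.
  intros Hc Ht. apply Rle_trans with (2 * (1 + / c ^ 2) * / (2 * (1 + t ^ 2))).
  - assert (0 < c ^ 2) by nra. assert (0 < t ^ 2) by nra.
    assert (0 < / c ^ 2) by now apply Rinv_0_lt_compat.
    replace (2 * (1 + / c ^ 2) * / (2 * (1 + t ^ 2))) with ((1 + / c ^ 2) * / (1 + t ^ 2)) by (field; lra).
    apply Rmult_le_reg_r with ((t ^ 2 + c ^ 2) * (1 + t ^ 2)); [nra|].
    replace (/ (t ^ 2 + c ^ 2) * ((t ^ 2 + c ^ 2) * (1 + t ^ 2))) with (1 + t ^ 2) by (field; lra).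
    replace ((1 + / c ^ 2) * / (1 + t ^ 2) * ((t ^ 2 + c ^ 2) * (1 + t ^ 2)))
      with (t ^ 2 + c ^ 2 + t ^ 2 * / c ^ 2 + 1) by (field; lra). nra.
  - apply Rmult_le_compat_l; [|now apply wt_ge_rational].
    assert (0 < / c ^ 2) by (apply Rinv_0_lt_compat; nra). lra.
Qed.

Lemma atan_inv_arg_bounds b t : 0 < b -> 0 < t -> 0 < atan (b / t) < PI / 2.
Proof.
  intros Hb Ht. split; [|apply atan_bound].
  rewrite <- atan_0. apply atan_increasing. now apply Rdiv_lt_0_compat.
Qed.

Lemma sum_sq_neq_0 t x : x <> 0 -> t ^ 2 + x ^ 2 <> 0.
Proof. intros H. pose proof (pow2_ge_0 t). assert (0 < x ^ 2) by nra. lra. Qed.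

Lemma continuous_UV_atan m b x t : x <> 0 -> 0 < t ->
  continuous (fun t => U m t x * atan (b / t)) t /\ continuous (fun t => V m t x * atan (b / t)) t.
Proof.
  intros Hx Ht. destruct (is_derive_UV_t m t x (sum_sq_neq_0 t x Hx)) as [D1 D2].
  assert (Ca : continuous (fun t => atan (b / t)) t).
  { apply (ex_derive_continuous (fun t => atan (b / t))). auto_derive. lra. }
  split.
  - apply (continuous_mult (fun t => U m t x) (fun t => atan (b / t))); [|exact Ca].
    apply (ex_derive_continuous (fun t => U m t x)). eexists; exact D1.
  - apply (continuous_mult (fun t => V m t x) (fun t => atan (b / t))); [|exact Ca].
    apply (ex_derive_continuous (fun t => V m t x)). eexists; exact D2.
Qed.

Lemma dom_UV_atan m b x : 0 < b -> 0 < x -> exists A,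
  dom (fun t => U (m + 2) t x * atan (b / t)) A /\ dom (fun t => V (m + 2) t x * atan (b / t)) A.
Proof.
  intros Hb Hx. exists ((/ x) ^ m * (2 * (1 + / x ^ 2)) * (PI / 2)).
  assert (K : forall t w, 0 < t -> Rabs w <= (/ x) ^ m * / (t ^ 2 + x ^ 2) ->
     Rabs (w * atan (b / t)) <= (/ x) ^ m * (2 * (1 + / x ^ 2)) * (PI / 2) * wt t).
  { intros t w Ht Hw. pose proof (atan_inv_arg_bounds b t Hb Ht).
    rewrite Rabs_mult, (Rabs_right (atan (b / t))) by lra.
    pose proof (inv_quad_le_wt x t Hx Ht).
    assert (0 < (/ x) ^ m) by (apply pow_lt, Rinv_0_lt_compat, Hx).
    replace ((/ x) ^ m * (2 * (1 + / x ^ 2)) * (PI / 2) * wt t)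
      with ((/ x) ^ m * (2 * (1 + / x ^ 2) * wt t) * (PI / 2)) by ring.
    apply Rmult_le_compat; [apply Rabs_pos|lra| |lra].
    apply Rle_trans with (1 := Hw). apply Rmult_le_compat_l; lra. }
  assert (Hax : 0 < x <= Rabs x) by (rewrite Rabs_right; lra).
  split; split; intros t Ht.
  - apply continuous_UV_atan; lra.
  - apply K; auto. now apply UV_le_mixed.
  - apply continuous_UV_atan; lra.
  - apply K; auto. now apply UV_le_mixed.
Qed.

Definition XV m b x := hint (fun t => V m t x * atan (b / t)).
Definition XU m b x := hint (fun t => U m t x * atan (b / t)).

(** Differentiation under the integral sign through a quadratic remainder. Increments smaller than x
    / 2 keep y above x / 2, where the second derivative has an integrable bound in t. *)
Lemma hint_param_derive (F F1 F2 : R -> R -> R) b x A m :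
  0 < b -> 0 < x ->
  (forall y, 0 < y -> exists A, dom (fun t => F t y * atan (b / t)) A) ->
  dom (fun t => F1 t x * atan (b / t)) A ->
  (forall t y, 0 < t -> 0 < y -> is_derive (F t) y (F1 t y)) ->
  (forall t y, 0 < t -> 0 < y -> is_derive (F1 t) y (F2 t y)) ->
  (forall t y, 0 < t -> x / 2 <= y -> Rabs (F2 t y) <= m * / (t ^ 2 + (x / 2) ^ 2)) ->
  is_derive (fun y => hint (fun t => F t y * atan (b / t))) x (hint (fun t => F1 t x * atan (b / t))).
Proof.
  intros Hb Hx HF HF1 D1 D2 B.
  set (M := m * (2 * (1 + / (x / 2) ^ 2)) * (PI / 2)).
  assert (Hm : 0 <= m).
  { specialize (B 1 x Rlt_0_1 ltac:(lra)). pose proof (Rabs_pos (F2 1 x)).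
    assert (0 < / (1 ^ 2 + (x / 2) ^ 2)) by (apply Rinv_0_lt_compat; nra). nra. }
  apply is_derive_quadratic with (M * PI) (x / 2); [lra|].
  intros y Hy. apply Rabs_def2 in Hy.
  destruct (HF y ltac:(lra)) as [Ay Hdy]. destruct (HF x Hx) as [Ax Hdx].
  rewrite <- (hint_minus _ _ _ _ Hdy Hdx), <- (hint_scal _ _ (y - x) HF1).
  rewrite <- (hint_minus _ _ _ _ (dom_minus _ _ _ _ Hdy Hdx) (dom_scal _ _ (y - x) HF1)).
  replace (M * PI * (y - x) ^ 2) with (M * (y - x) ^ 2 * PI) by ring.
  apply hint_bound. split.
  - apply (dom_minus _ _ _ _ (dom_minus _ _ _ _ Hdy Hdx) (dom_scal _ _ (y - x) HF1)).
  - intros t Ht. pose proof (atan_inv_arg_bounds b t Hb Ht) as Ha.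
    replace (F t y * atan (b / t) - F t x * atan (b / t) - (y - x) * (F1 t x * atan (b / t)))
      with ((F t y - F t x - (y - x) * F1 t x) * atan (b / t)) by ring.
    rewrite Rabs_mult, (Rabs_right (atan (b / t))) by lra.
    assert (HT : Rabs (F t y - F t x - (y - x) * F1 t x) <= m * / (t ^ 2 + (x / 2) ^ 2) * (y - x) ^ 2).
    { apply taylor2_bound with (F2 t).
      - intros z Hz. apply D1; auto. revert Hz. unfold Rmin, Rmax. destruct (Rle_dec x y); lra.
      - intros z Hz. apply D2; auto. revert Hz. unfold Rmin, Rmax. destruct (Rle_dec x y); lra.
      - intros z Hz. apply B; auto. revert Hz. unfold Rmin, Rmax. destruct (Rle_dec x y); lra. }
    unfold M. pose proof (inv_quad_le_wt (x / 2) t ltac:(lra) Ht) as Hq.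
    replace (m * (2 * (1 + / (x / 2) ^ 2)) * (PI / 2) * (y - x) ^ 2 * wt t)
      with (m * (2 * (1 + / (x / 2) ^ 2) * wt t) * (y - x) ^ 2 * (PI / 2)) by ring.
    apply Rmult_le_compat; [apply Rabs_pos|lra| |lra].
    apply Rle_trans with (1 := HT). apply Rmult_le_compat_r; [apply pow2_ge_0|].
    apply Rmult_le_compat_l; lra.
Qed.

Lemma is_derive_XV m b x : 0 < b -> 0 < x ->
  is_derive (XV (m + 2) b) x (INR (m + 2) * XU (m + 3) b x) /\
  is_derive (XU (m + 2) b) x (- INR (m + 2) * XV (m + 3) b x).
Proof.
  intros Hb Hx.
  assert (DU : forall n t y, 0 < y -> is_derive (fun z => U n t z) y (- INR n * V (S n) t y)).
  { intros n t y Hy. apply (proj1 (is_derive_UV_x n t y (sum_sq_neq_0 t y ltac:(lra)))). }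
  assert (DV : forall n t y, 0 < y -> is_derive (fun z => V n t z) y (INR n * U (S n) t y)).
  { intros n t y Hy. apply (proj2 (is_derive_UV_x n t y (sum_sq_neq_0 t y ltac:(lra)))). }
  destruct (dom_UV_atan (S m) b x Hb Hx) as [A [HA1 HA2]].
  replace (S m + 2)%nat with (m + 3)%nat in HA1, HA2 by lia.
  assert (BD : forall t y, x / 2 <= y ->
     Rabs (U (m + 4) t y) <= (/ (x / 2)) ^ (m + 2) * / (t ^ 2 + (x / 2) ^ 2) /\
     Rabs (V (m + 4) t y) <= (/ (x / 2)) ^ (m + 2) * / (t ^ 2 + (x / 2) ^ 2)).
  { intros t y Hy. replace (m + 4)%nat with (m + 2 + 2)%nat by lia.
    apply UV_le_mixed. rewrite Rabs_right; lra. }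
  assert (Pm : 0 <= INR (m + 2) * INR (m + 3)) by (apply Rmult_le_pos; apply pos_INR).
  split.
  - replace (INR (m + 2) * XU (m + 3) b x) with (hint (fun t => (INR (m + 2) * U (m + 3) t x) * atan (b / t))).
    2:{ unfold XU. rewrite <- (hint_scal _ A) by exact HA1. apply hint_ext. intros; ring. }
    unfold XV. apply (hint_param_derive (fun t y => V (m + 2) t y) (fun t y => INR (m + 2) * U (m + 3) t y)
      (fun t y => INR (m + 2) * (- INR (m + 3) * V (m + 4) t y)) b x (Rabs (INR (m + 2)) * A)
      (INR (m + 2) * INR (m + 3) * (/ (x / 2)) ^ (m + 2))); auto.
    + intros y Hy. destruct (dom_UV_atan m b y Hb Hy) as [B [_ HB]]. exists B. exact HB.
    + apply (dom_ext (fun t => INR (m + 2) * (U (m + 3) t x * atan (b / t)))); [intros; ring|]. now apply dom_scal.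
    + intros t y _ Hy. replace (m + 3)%nat with (S (m + 2)) by lia. now apply DV.
    + intros t y _ Hy. apply (is_derive_scal (fun z => U (m + 3) t z)).
      replace (m + 4)%nat with (S (m + 3)) by lia. now apply DU.
    + intros t y _ Hy. rewrite <- Rmult_assoc, Rabs_mult.
      replace (Rabs (INR (m + 2) * - INR (m + 3))) with (INR (m + 2) * INR (m + 3))
        by (rewrite <- Ropp_mult_distr_r, Rabs_Ropp, Rabs_right; lra).
      rewrite (Rmult_assoc (INR (m + 2) * INR (m + 3)) ((/ (x / 2)) ^ (m + 2))).
      apply Rmult_le_compat_l; [lra|]. now apply BD.
  - replace (- INR (m + 2) * XV (m + 3) b x) with (hint (fun t => (- INR (m + 2) * V (m + 3) t x) * atan (b / t))).
    2:{ unfold XV. rewrite <- (hint_scal _ A) by exact HA2. apply hint_ext. intros; ring. }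
    unfold XU. apply (hint_param_derive (fun t y => U (m + 2) t y) (fun t y => - INR (m + 2) * V (m + 3) t y)
      (fun t y => - INR (m + 2) * (INR (m + 3) * U (m + 4) t y)) b x (Rabs (- INR (m + 2)) * A)
      (INR (m + 2) * INR (m + 3) * (/ (x / 2)) ^ (m + 2))); auto.
    + intros y Hy. destruct (dom_UV_atan m b y Hb Hy) as [B [HB _]]. exists B. exact HB.
    + apply (dom_ext (fun t => - INR (m + 2) * (V (m + 3) t x * atan (b / t)))); [intros; ring|]. now apply dom_scal.
    + intros t y _ Hy. replace (m + 3)%nat with (S (m + 2)) by lia. now apply DU.
    + intros t y _ Hy. apply (is_derive_scal (fun z => V (m + 3) t z)).
      replace (m + 4)%nat with (S (m + 3)) by lia. now apply DV.
    + intros t y _ Hy. rewrite <- Rmult_assoc, Rabs_mult.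
      replace (Rabs (- INR (m + 2) * INR (m + 3))) with (INR (m + 2) * INR (m + 3))
        by (rewrite <- Ropp_mult_distr_l, Rabs_Ropp, Rabs_right; lra).
      rewrite (Rmult_assoc (INR (m + 2) * INR (m + 3)) ((/ (x / 2)) ^ (m + 2))).
      apply Rmult_le_compat_l; [lra|]. now apply BD.
Qed.

Lemma V_2 t x : t ^ 2 + x ^ 2 <> 0 -> V 2 t x = 2 * t * x / (t ^ 2 + x ^ 2) ^ 2.
Proof. intros H. rewrite V_S, U_S, V_S. unfold U, V; simpl UV; simpl fst; simpl snd. field. exact H. Qed.

(** Since V 2 = - d/dt (x / (t^2 + x^2)), integration by parts leaves x b / ((t^2 + x^2) (t^2 +
    b^2)), and its partial fractions give the primitive F. They degenerate at x = b. *)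
Lemma XV_2_off b x : 0 < b -> 0 < x -> x <> b -> XV 2 b x = PI / 2 * (/ x - / (x + b)).
Proof.
  intros Hb Hx Hxb. destruct (dom_UV_atan 0 b x Hb Hx) as [A [_ HA]]. simpl Nat.add in HA.
  assert (Hd : b ^ 2 - x ^ 2 <> 0).
  { replace (b ^ 2 - x ^ 2) with ((b - x) * (b + x)) by ring. apply Rmult_integral_contrapositive_currified; lra. }
  set (F := fun t => - (x / (t ^ 2 + x ^ 2)) * atan (b / t)
     - x * b / (b ^ 2 - x ^ 2) * (atan (t / x) / x - atan (t / b) / b)).
  unfold XV. rewrite (hint_FTC _ F A (- (PI / 2 * / x)) (- (PI / 2 * / (x + b)))); [ring|exact HA| | |].
  - intros t Ht. rewrite (V_2 t x (sum_sq_neq_0 t x ltac:(lra))). unfold F.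
    assert (0 < t ^ 2) by nra. assert (0 < x ^ 2) by nra. assert (0 < b ^ 2) by nra.
    auto_derive.
    + repeat split; lra.
    + unfold Rdiv. generalize (atan (b * / t)). intros z. field. repeat split; try lra; nra.
  - assert (C : forall n, F (/ INR (S n)) = (fun s => - (x / (s ^ 2 + x ^ 2))) (/ INR (S n)) * atan (b * INR (S n))
       - (fun s => x * b / (b ^ 2 - x ^ 2) * (atan (s / x) / x - atan (s / b) / b)) (/ INR (S n))).
    { intros n. unfold F. pose proof (INR_S_pos n). replace (b / / INR (S n)) with (b * INR (S n)) by (field; lra). reflexivity. }
    apply is_lim_seq_ext with (1 := fun n => eq_sym (C n)).
    replace (Finite (- (PI / 2 * / x))) with (Finite (- (x / (0 ^ 2 + x ^ 2)) * (PI / 2)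
       - x * b / (b ^ 2 - x ^ 2) * (atan (0 / x) / x - atan (0 / b) / b))).
    2:{ f_equal. unfold Rdiv. rewrite !Rmult_0_l, atan_0. field. split; [|lra]. unfold Rdiv. nra. }
    apply is_lim_seq_minus'.
    + apply is_lim_seq_mult'; [|now apply lim_atan_scale].
      apply (is_lim_seq_continuous (fun s => - (x / (s ^ 2 + x ^ 2))) _ 0); [|exact lim_inv_INR_S].
      apply continuity_pt_filterlim, (ex_derive_continuous (fun s => - (x / (s ^ 2 + x ^ 2)))). auto_derive. nra.
    + apply (is_lim_seq_continuous (fun s => x * b / (b ^ 2 - x ^ 2) * (atan (s / x) / x - atan (s / b) / b)) _ 0);
        [|exact lim_inv_INR_S].
      apply continuity_pt_filterlim, (ex_derive_continuous (fun s => x * b / (b ^ 2 - x ^ 2) * (atan (s / x) / x - atan (s / b) / b))).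
      auto_derive. exact I.
  (* In the variable s = 1 / t the first summand extends continuously to s = 0, which gives its
     limit at infinity. *)
  - assert (C : forall n, F (INR (S n)) = (fun s => - (x * s ^ 2 / (1 + x ^ 2 * s ^ 2)) * atan (b * s)) (/ INR (S n))
       - x * b / (b ^ 2 - x ^ 2) * (atan (/ x * INR (S n)) / x - atan (/ b * INR (S n)) / b)).
    { intros n. unfold F. pose proof (INR_S_pos n). set (N := INR (S n)) in *.
      replace (N / x) with (/ x * N) by (unfold Rdiv; ring). replace (N / b) with (/ b * N) by (unfold Rdiv; ring).
      f_equal. unfold Rdiv at 2. f_equal. field. repeat split; nra. }
    apply is_lim_seq_ext with (1 := fun n => eq_sym (C n)).
    replace (Finite (- (PI / 2 * / (x + b)))) with (Finite (- (x * 0 ^ 2 / (1 + x ^ 2 * 0 ^ 2)) * atan (b * 0)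
       - x * b / (b ^ 2 - x ^ 2) * (PI / 2 / x - PI / 2 / b))).
    2:{ f_equal. rewrite Rmult_0_r, atan_0. field. repeat split; lra. }
    apply is_lim_seq_minus'.
    + apply (is_lim_seq_continuous (fun s => - (x * s ^ 2 / (1 + x ^ 2 * s ^ 2)) * atan (b * s)) _ 0); [|exact lim_inv_INR_S].
      apply continuity_pt_filterlim, (ex_derive_continuous (fun s => - (x * s ^ 2 / (1 + x ^ 2 * s ^ 2)) * atan (b * s))).
      auto_derive. lra.
    + apply (is_lim_seq_scal_l _ _ (Finite _)). apply is_lim_seq_minus'; (apply is_lim_seq_mult'; [|apply is_lim_seq_const]).
      * apply lim_atan_scale, Rinv_0_lt_compat, Hx.
      * apply lim_atan_scale, Rinv_0_lt_compat, Hb.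
Qed.

(** The exceptional value x = b follows by continuity in x, a consequence of [is_derive_XV]. *)
Lemma XV_2 b x : 0 < b -> 0 < x -> XV 2 b x = PI / 2 * (/ x - / (x + b)).
Proof.
  intros Hb Hx. destruct (Req_dec x b) as [->|H]; [|now apply XV_2_off].
  assert (L1 : is_lim_seq (fun n => XV 2 b (b + / INR (S n))) (XV 2 b b)).
  { apply is_lim_seq_continuous.
    - apply continuity_pt_filterlim, (ex_derive_continuous (XV 2 b)). eexists.
      apply (proj1 (is_derive_XV 0 b b Hb Hb)).
    - replace (Finite b) with (Finite (b + 0)) by (f_equal; ring).
      apply is_lim_seq_plus'; [apply is_lim_seq_const|exact lim_inv_INR_S]. }
  assert (L2 : is_lim_seq (fun n => XV 2 b (b + / INR (S n))) (PI / 2 * (/ b - / (b + b)))).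
  { apply is_lim_seq_ext with (fun n => PI / 2 * (/ (b + / INR (S n)) - / (b + / INR (S n) + b))).
    - intros n. pose proof (Rinv_0_lt_compat _ (INR_S_pos n)). rewrite XV_2_off by lra. reflexivity.
    - apply (is_lim_seq_continuous (fun s => PI / 2 * (/ s - / (s + b))) (fun n => b + / INR (S n)) b).
      + apply continuity_pt_filterlim, (ex_derive_continuous (fun s => PI / 2 * (/ s - / (s + b)))). auto_derive. lra.
      + replace (Finite b) with (Finite (b + 0)) by (f_equal; ring).
        apply is_lim_seq_plus'; [apply is_lim_seq_const|exact lim_inv_INR_S]. }
  apply is_lim_seq_unique in L1. apply is_lim_seq_unique in L2. rewrite L1 in L2. now injection L2.
Qed.

(** d/dx (t - i x)^(-m) = i m (t - i x)^(-m-1), so a derivative in x raises the order by one and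
    exchanges [XV] with [XU]. Two steps lead from one even order to the next and change the sign. *)
Theorem XV_even m b x : 0 < b -> 0 < x ->
  XV (2 * m + 2) b x = (-1) ^ m * (PI / (2 * INR (2 * m + 1))) * ((/ x) ^ (2 * m + 1) - (/ (x + b)) ^ (2 * m + 1)).
Proof.
  intros Hb. revert x. induction m as [|m IH]; intros x Hx.
  - simpl Nat.add. rewrite XV_2 by auto. simpl. field. lra.
  - assert (DE : forall j c y, 0 < y -> is_derive (fun y => c * ((/ y) ^ j - (/ (y + b)) ^ j)) y
        (c * - INR j * ((/ y) ^ (S j) - (/ (y + b)) ^ (S j)))).
    { intros j c y Hy. destruct j as [|j]; [simpl; auto_derive; [auto|ring]|].
      evar_last.
      - apply (is_derive_scal (fun y => (/ y) ^ (S j) - (/ (y + b)) ^ (S j))).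
        apply (is_derive_minus (fun y => (/ y) ^ (S j)) (fun y => (/ (y + b)) ^ (S j))).
        + apply (is_derive_pow (fun y => / y) (S j)). auto_derive; [lra|reflexivity].
        + apply (is_derive_pow (fun y => / (y + b)) (S j)). auto_derive; [lra|reflexivity].
      - unfold minus, plus, opp; cbn -[INR pow]. rewrite <- !tech_pow_Rmult. field. lra. }
    assert (EY : forall y, 0 < y -> XU (2 * m + 3) b y
        = (-1) ^ (S m) * (PI / (2 * INR (2 * m + 2))) * ((/ y) ^ (2 * m + 2) - (/ (y + b)) ^ (2 * m + 2))).
    { intros y Hy. destruct (is_derive_XV (2 * m) b y Hb Hy) as [D _].
      assert (D' := DE (2 * m + 1)%nat ((-1) ^ m * (PI / (2 * INR (2 * m + 1)))) y Hy).
      assert (D2 : is_derive (XV (2 * m + 2) b) y ((-1) ^ m * (PI / (2 * INR (2 * m + 1))) * - INR (2 * m + 1) *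
           ((/ y) ^ S (2 * m + 1) - (/ (y + b)) ^ S (2 * m + 1)))).
      { apply (is_derive_ext_loc (fun y => (-1) ^ m * (PI / (2 * INR (2 * m + 1))) * ((/ y) ^ (2 * m + 1) - (/ (y + b)) ^ (2 * m + 1)))); [|exact D'].
        exists (mkposreal y Hy). intros z Hz. change (Rabs (z - y) < y) in Hz. apply Rabs_def2 in Hz.
        symmetry. apply IH. lra. }
      pose proof (is_derive_unique _ _ _ D) as E1. pose proof (is_derive_unique _ _ _ D2) as E2.
      rewrite E1 in E2. replace (S (2 * m + 1)) with (2 * m + 2)%nat in E2 by lia.
      assert (P1 : 0 < INR (2 * m + 1)) by (apply lt_0_INR; lia).
      assert (P2 : 0 < INR (2 * m + 2)) by (apply lt_0_INR; lia).
      apply Rmult_eq_reg_l with (INR (2 * m + 2)); [|lra]. rewrite E2. simpl pow. field. lra. }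
    replace (2 * S m + 2)%nat with (2 * m + 4)%nat by lia. replace (2 * S m + 1)%nat with (2 * m + 3)%nat by lia.
    destruct (is_derive_XV (2 * m + 1) b x Hb Hx) as [_ D].
    replace (2 * m + 1 + 2)%nat with (2 * m + 3)%nat in D by lia.
    replace (2 * m + 1 + 3)%nat with (2 * m + 4)%nat in D by lia.
    assert (D' := DE (2 * m + 2)%nat ((-1) ^ (S m) * (PI / (2 * INR (2 * m + 2)))) x Hx).
    assert (D2 : is_derive (XU (2 * m + 3) b) x ((-1) ^ (S m) * (PI / (2 * INR (2 * m + 2))) * - INR (2 * m + 2) *
         ((/ x) ^ S (2 * m + 2) - (/ (x + b)) ^ S (2 * m + 2)))).
    { apply (is_derive_ext_loc (fun y => (-1) ^ (S m) * (PI / (2 * INR (2 * m + 2))) * ((/ y) ^ (2 * m + 2) - (/ (y + b)) ^ (2 * m + 2)))); [|exact D'].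
      exists (mkposreal x Hx). intros z Hz. change (Rabs (z - x) < x) in Hz. apply Rabs_def2 in Hz.
      symmetry. apply EY. lra. }
    pose proof (is_derive_unique _ _ _ D) as E1. pose proof (is_derive_unique _ _ _ D2) as E2.
    rewrite E1 in E2. replace (S (2 * m + 2)) with (2 * m + 3)%nat in E2 by lia.
    assert (P1 : 0 < INR (2 * m + 3)) by (apply lt_0_INR; lia).
    assert (P2 : 0 < INR (2 * m + 2)) by (apply lt_0_INR; lia).
    apply Rmult_eq_reg_l with (- INR (2 * m + 3)); [|lra]. rewrite E2. field. lra.
Qed.

(** * Lambert-type sums over an odd periodic function *)

Lemma sum_n_shift (F : nat -> R) n : sum_n F (S n) = F 0%nat + sum_n (fun i => F (S i)) n.
Proof.
  induction n as [|n IH]; [rewrite sum_n_S, !sum_O; reflexivity|].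
  rewrite sum_n_S, IH, (sum_n_S (fun i => F (S i))). eqR. ring.
Qed.

Lemma sum_n_rev (F : nat -> R) n : sum_n (fun i => F (n - i)%nat) n = sum_n F n.
Proof.
  induction n as [|n IH]; [rewrite !sum_O; reflexivity|].
  rewrite sum_n_shift, (sum_n_S F). simpl Nat.sub. rewrite IH. eqR. ring.
Qed.

(** The index 0 is excepted because q - 0 lies outside the range of summation. *)
Lemma sum_n_reflect (F : nat -> R) q : (2 <= q)%nat -> F 0%nat = 0 ->
  sum_n (fun h => if (h =? 0)%nat then 0 else F (q - h)%nat) (q - 1) = sum_n F (q - 1).
Proof.
  intros Hq H0. replace (q - 1)%nat with (S (q - 2)) by lia.
  rewrite !sum_n_shift, H0. simpl (0 =? 0)%nat. f_equal.
  rewrite <- (sum_n_rev (fun i => F (S i))). apply sum_n_ext_loc. intros i Hi.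
  simpl. f_equal. lia.
Qed.

Lemma sum_n_scal (c : R) (F : nat -> R) n : sum_n (fun i => c * F i) n = c * sum_n F n.
Proof. apply (sum_n_mult_l (K := R_Ring) c F n). Qed.

Lemma sum_n_add (F G : nat -> R) n : sum_n (fun i => F i + G i) n = sum_n F n + sum_n G n.
Proof. apply (sum_n_plus (G := R_AbelianMonoid) F G n). Qed.

Lemma is_series_sum_n (u : nat -> nat -> R) (l : nat -> R) N :
  (forall h, (h <= N)%nat -> is_series (u h) (l h)) ->
  is_series (fun n => sum_n (fun h => u h n) N) (sum_n l N).
Proof.
  induction N as [|N IH]; intros H.
  - rewrite sum_O. apply is_series_ext with (u 0%nat); [intros n; now rewrite sum_O|apply H; lia].
  - rewrite sum_n_S. apply is_series_ext with (fun n => sum_n (fun h => u h n) N + u (S N) n).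
    + intros n. now rewrite sum_n_S.
    + apply (is_series_plus (fun n => sum_n (fun h => u h n) N) (u (S N))); [apply IH; intros; apply H; lia|apply H; lia].
Qed.

Definition om (q j : nat) : R := 2 * PI * INR j / INR q.

(** What the transformation formula uses of an odd primitive character: f is bounded by 1 and is a
    finite sine transform of an odd periodic g. The functions are real so that the real and
    imaginary parts of the character are treated alike. *)
Definition sine_pair (q : nat) (f g : nat -> R) : Prop :=
  (2 <= q)%nat /\
  (forall d, Rabs (f d) <= 1) /\
  (forall d, f d = sum_n (fun h => g h * sin (INR d * om q h)) (q - 1)) /\
  (forall j, g (j + q)%nat = g j) /\
  (forall h, (h <= q)%nat -> g (q - h)%nat = - g h).

Lemma sine_pair_zero q f g : sine_pair q f g -> g 0%nat = 0.
Proof.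
  intros [Hq [_ [_ [H1 H2]]]]. pose proof (H2 0%nat ltac:(lia)) as H. rewrite Nat.sub_0_r in H.
  specialize (H1 0%nat). simpl in H1. rewrite H1 in H. lra.
Qed.

Lemma periodic_mul (g : nat -> R) q : (forall j, g (j + q)%nat = g j) -> forall n h, g (n * q + h)%nat = g h.
Proof.
  intros H n h. induction n as [|n IH]; [reflexivity|].
  replace (S n * q + h)%nat with (n * q + h + q)%nat by lia. now rewrite H.
Qed.

Lemma periodic_bounded (g : nat -> R) q : (1 <= q)%nat -> (forall j, g (j + q)%nat = g j) ->
  exists B, 0 < B /\ forall j, Rabs (g j) <= B.
Proof.
  intros Hq H. exists (sum_n (fun h => Rabs (g h)) (q - 1) + 1).
  assert (K : forall n, 0 <= sum_n (fun h => Rabs (g h)) n /\ forall h, (h <= n)%nat -> Rabs (g h) <= sum_n (fun h => Rabs (g h)) n).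
  { induction n as [|n [IH1 IH2]].
    - rewrite sum_O. split; [apply Rabs_pos|]. intros h Hh. replace h with 0%nat by lia. lra.
    - rewrite sum_n_S. pose proof (Rabs_pos (g (S n))). split; [lra|]. intros h Hh.
      destruct (Nat.eq_dec h (S n)) as [->|]; [lra|]. specialize (IH2 h ltac:(lia)). lra. }
  destruct (K (q - 1)%nat) as [K1 K2]. split; [lra|]. intros j.
  rewrite (Nat.div_mod_eq j q), Nat.mul_comm, periodic_mul by exact H.
  pose proof (Nat.mod_upper_bound j q ltac:(lia)). specialize (K2 (j mod q)%nat ltac:(lia)). lra.
Qed.

(** With m = k + 1 and f a component of the character, this is that component of w. *)
Definition Psi (m : nat) (f : nat -> R) (t : R) : R :=
  Series (fun d => INR (S d) ^ m * exp (- (INR (S d) * t)) * f (S d)).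

Lemma om_pos q j : (1 <= q)%nat -> 0 < om q (S j).
Proof.
  intros Hq. unfold om. pose proof PI_RGT_0. pose proof (INR_S_pos j).
  assert (0 < INR q) by (apply lt_0_INR; lia). apply Rdiv_lt_0_compat; nra.
Qed.

Lemma om_S q j : (1 <= q)%nat -> om q (S j) = om q 1 * INR (S j).
Proof.
  intros Hq. unfold om. assert (0 < INR q) by (apply lt_0_INR; lia). simpl (INR 1). field. lra.
Qed.

Lemma ex_series_gV q g B m t : (1 <= q)%nat -> (forall j, Rabs (g j) <= B) ->
  ex_series (fun j => g (S j) * V (m + 2) t (om q (S j))).
Proof.
  intros Hq HB.
  assert (H1 := om_pos q 0 Hq).
  apply ex_series_dom with (fun j => B * (/ (om q 1 * INR (S j))) ^ (m + 2)).
  - intros j. rewrite Rabs_mult. apply Rmult_le_compat; try apply Rabs_pos; [apply HB|].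
    rewrite <- om_S by auto. apply UV_le_x. pose proof (om_pos q j Hq). rewrite Rabs_right; lra.
  - apply (ex_series_scal_l B (fun j => (/ (om q 1 * INR (S j))) ^ (m + 2))), ex_series_pow_inv, H1.
Qed.

(** The sine expansion of f produces a sum over residues h and lattice shifts n, which merges into
    one sum over j = n q + h. The negative lattice points give the same sum again, hence the factor
    2. *)
Theorem Psi_partial_fractions q f g m t : sine_pair q f g -> 0 < t ->
  Psi (S m) f t = 2 * INR (fact (S m)) * Series (fun j => g (S j) * V (m + 2) t (om q (S j))).
Proof.
  intros HS Ht. pose proof (sine_pair_zero _ _ _ HS) as G0.
  destruct HS as [Hq [Hf1 [Hf [Hper Hodd]]]].
  destruct (periodic_bounded g q ltac:(lia) Hper) as [B [HB0 HB]].
  assert (Hq0 : 0 < INR q) by (apply lt_0_INR; lia). pose proof PI_RGT_0 as HP.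
  assert (Hth : forall h, (1 <= h <= q - 1)%nat -> 0 < om q h < 2 * PI).
  { intros h Hh. unfold om. assert (0 < INR h) by (apply lt_0_INR; lia).
    assert (INR h < INR q) by (apply lt_INR; lia). split; [apply Rdiv_lt_0_compat; nra|].
    apply Rmult_lt_reg_r with (INR q); [lra|]. unfold Rdiv. rewrite Rmult_assoc, Rinv_l by lra. nra. }
  assert (E1 : Psi (S m) f t = sum_n (fun h => g h * Dsin (S m) t (om q h)) (q - 1)).
  { unfold Psi. apply is_series_unique.
    apply is_series_ext with (fun d => sum_n (fun h => g h * (INR (S d) ^ S m * exp (- (INR (S d) * t)) * sin (INR (S d) * om q h))) (q - 1)).
    - intros d. rewrite Hf, <- sum_n_scal. apply sum_n_ext. intros h. eqR. ring.
    - apply (is_series_sum_n (fun h d => g h * (INR (S d) ^ S m * exp (- (INR (S d) * t)) * sin (INR (S d) * om q h)))).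
      intros h _. apply (is_series_scal_l (g h) (fun d => INR (S d) ^ S m * exp (- (INR (S d) * t)) * sin (INR (S d) * om q h))).
      apply Series_correct, ex_series_pow_exp; auto. intros; apply Rabs_sin_le. }
  set (a := fun j => g j * V (m + 2) t (om q j)).
  assert (Ea1 : ex_series (fun j => a (S j))) by (apply (ex_series_gV q g B); auto; lia).
  assert (Ea : ex_series a) by (apply (proj2 (ex_series_incr_1 a)), Ea1).
  assert (a0 : a 0%nat = 0) by (unfold a; rewrite G0; ring).
  assert (E2 : is_series (fun n => sum_n (fun h => g h * Vpair (m + 2) t (om q h) n) (q - 1))
      (sum_n (fun h => g h * Series (Vpair (m + 2) t (om q h))) (q - 1))).
  { apply (is_series_sum_n (fun h n => g h * Vpair (m + 2) t (om q h) n)). intros h Hh.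
    destruct h as [|h].
    - rewrite G0, Rmult_0_l. apply is_series_ext with (fun _ : nat => 0); [intros; eqR; ring|].
      apply is_series_lim. apply is_lim_seq_ext with (fun _ => 0); [|apply is_lim_seq_const].
      intros n. rewrite sum_n_const. ring.
    - apply (is_series_scal_l (g (S h)) (Vpair (m + 2) t (om q (S h)))).
      apply Series_correct, ex_series_Vpair, Hth. lia. }
  assert (E3 : forall n, sum_n (fun h => g h * Vpair (m + 2) t (om q h) n) (q - 1)
       = 2 * sum_n (fun h => a (n * q + h)%nat) (q - 1)).
  { intros n. unfold Vpair.
    rewrite (sum_n_ext _ (fun h => g h * V (m + 2) t (om q h + 2 * PI * INR n)
        + g h * V (m + 2) t (om q h - 2 * PI * INR (S n)))) by (intros; eqR; ring).
    rewrite sum_n_add.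
    assert (P1 : sum_n (fun h => g h * V (m + 2) t (om q h + 2 * PI * INR n)) (q - 1)
        = sum_n (fun h => a (n * q + h)%nat) (q - 1)).
    { apply sum_n_ext. intros h. unfold a. rewrite periodic_mul by exact Hper. f_equal. f_equal.
      unfold om. rewrite plus_INR, mult_INR. field. lra. }
    (* Replacing h by q - h turns om h - 2 PI (n + 1) into - om (n q + h). Both g and V are odd, so
       this half equals the first. *)
    assert (P2 : sum_n (fun h => g h * V (m + 2) t (om q h - 2 * PI * INR (S n))) (q - 1)
        = sum_n (fun h => a (n * q + h)%nat) (q - 1)).
    { rewrite <- sum_n_reflect by (auto; rewrite G0; ring).
      apply sum_n_ext_loc. intros h Hh. destruct h as [|h].
      - simpl. unfold a. rewrite periodic_mul, G0 by exact Hper. eqR. ring.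
      - simpl (S h =? 0)%nat. cbv iota. unfold a. rewrite periodic_mul by exact Hper. rewrite Hodd by lia.
        replace (om q (q - S h) - 2 * PI * INR (S n)) with (- om q (n * q + S h)).
        2:{ unfold om. rewrite minus_INR, plus_INR, mult_INR, (S_INR n) by lia. field. lra. }
        rewrite (proj2 (UV_opp (m + 2) t (om q (n * q + S h)))). eqR. ring. }
    rewrite P1, P2. eqR. ring. }
  assert (E4 := is_series_block a q _ ltac:(lia) (Series_correct a Ea)).
  assert (E5 : sum_n (fun h => g h * Series (Vpair (m + 2) t (om q h))) (q - 1) = 2 * Series a).
  { rewrite <- (is_series_unique _ _ E2), <- (is_series_unique _ _ E4), <- Series_scal_l.
    apply Series_ext. exact E3. }
  rewrite (Series_incr_1 a Ea), a0, Rplus_0_l in E5.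
  rewrite E1. transitivity (sum_n (fun h => INR (fact (S m)) * (g h * Series (Vpair (m + 2) t (om q h)))) (q - 1)).
  - apply sum_n_ext_loc. intros h Hh. destruct h as [|h]; [rewrite G0; eqR; ring|].
    rewrite Dsin_partial_fractions by (auto; apply Hth; lia). eqR. ring.
  - rewrite sum_n_scal, E5. unfold a. eqR. ring.
Qed.

Lemma ex_series_Psi m f t : 0 < t -> (forall d, Rabs (f d) <= 1) ->
  ex_series (fun d => INR (S d) ^ m * exp (- (INR (S d) * t)) * f (S d)).
Proof. intros Ht Hf. apply (ex_series_pow_exp m t (fun d => f (S d))); auto. Qed.

Lemma is_derive_Psi m f t : 0 < t -> (forall d, Rabs (f d) <= 1) ->
  is_derive (Psi m f) t (- Psi (S m) f t).
Proof. intros Ht Hf. apply (is_derive_pow_exp_Series m t (fun d => f (S d))); auto. Qed.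

Lemma continuous_Psi m f t : 0 < t -> (forall d, Rabs (f d) <= 1) -> continuous (Psi m f) t.
Proof. intros Ht Hf. apply (ex_derive_continuous (Psi m f)). eexists. now apply is_derive_Psi. Qed.

Lemma Psi_decay m : exists A, 0 < A /\ forall f t, (forall d, Rabs (f d) <= 1) -> 1 <= t ->
  Rabs (Psi m f t) <= A * exp (- (t / 2)).
Proof.
  destruct (pow_exp_le_inv_sq m (/ 2) ltac:(lra)) as [A [HA HB]].
  set (Z := Series (fun d => A * / INR (S d) ^ 2)).
  assert (HZe : ex_series (fun d => A * / INR (S d) ^ 2)).
  { apply (ex_series_scal_l A (fun d => / INR (S d) ^ 2)), ex_series_inv_sq. }
  exists (Z + 1). split.
  - assert (0 <= Z); [|lra]. apply Series_pos; auto. intros i.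
    apply Rmult_le_pos; [lra|left; apply Rinv_0_lt_compat, pow_lt, INR_S_pos].
  - intros f t Hf Ht. apply Rle_trans with (Z * exp (- (t / 2))).
    + unfold Psi, Z. rewrite <- Series_scal_r. apply Series_abs_le; [|apply (ex_series_scal_r _ _ HZe)].
      intros d. pose proof (INR_S_ge1 d). set (N := INR (S d)) in *.
      pose proof (exp_pos (- (N * t))). assert (0 < N ^ m) by (apply pow_lt; lra).
      rewrite Rabs_mult, Rabs_right by nra.
      apply Rle_trans with (N ^ m * exp (- (N * t)) * 1).
      * apply Rmult_le_compat_l; [nra|apply Hf].
      * rewrite Rmult_1_r. apply Rle_trans with (N ^ m * exp (- (N * / 2)) * exp (- (t / 2))).
        -- rewrite Rmult_assoc. apply Rmult_le_compat_l; [lra|]. rewrite <- exp_plus.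
           apply exp_le. nra.
        -- apply Rmult_le_compat_r; [left; apply exp_pos|apply HB].
    + apply Rmult_le_compat_r; [left; apply exp_pos|lra].
Qed.

Lemma near_far_bound (F s : R -> R) M A : 0 <= M -> 0 < A ->
  (forall t, 0 < t -> 0 <= s t) -> (forall t, 1 <= t -> 1 <= s t) ->
  (forall t, 0 < t <= 1 -> Rabs (F t) <= M * s t) -> (forall t, 1 <= t -> Rabs (F t) <= A * exp (- (t / 2))) ->
  exists C, 0 < C /\ forall t, 0 < t -> Rabs (F t) <= C * s t * exp (- (t / 2)).
Proof.
  (* The factor exp (1/2) compensates exp (- t / 2) on (0, 1]. *)
  intros HM HA S0 S1 HN HF. pose proof (exp_pos (/ 2)). exists (M * exp (/ 2) + A). split; [nra|].
  intros t Ht. pose proof (exp_pos (- (t / 2))). specialize (S0 t Ht).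
  assert (0 <= A * s t * exp (- (t / 2))) by (repeat apply Rmult_le_pos; lra).
  assert (0 <= M * s t) by nra.
  replace ((M * exp (/ 2) + A) * s t * exp (- (t / 2)))
    with (M * s t * (exp (/ 2) * exp (- (t / 2))) + A * s t * exp (- (t / 2))) by ring.
  destruct (Rle_dec t 1) as [Ht1|Ht1].
  - apply Rle_trans with (1 := HN t ltac:(lra)).
    assert (1 <= exp (/ 2) * exp (- (t / 2))) by (rewrite <- exp_plus; pose proof (exp_ineq1_le (/ 2 + - (t / 2))); lra). nra.
  - apply Rle_trans with (1 := HF t ltac:(lra)). specialize (S1 t ltac:(lra)).
    assert (0 <= M * s t * (exp (/ 2) * exp (- (t / 2)))) by (apply Rmult_le_pos; nra).
    assert (A * exp (- (t / 2)) <= A * s t * exp (- (t / 2))) by (apply Rmult_le_compat_r; nra). lra.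
Qed.

(** For an odd index the partial fractions contain [V] of even order, and [V_even_le] supplies the
    factor t near 0; far away [Psi_decay] takes over. *)
Lemma Psi_odd_bound q f g k : sine_pair q f g ->
  exists A, 0 < A /\ forall t, 0 < t -> Rabs (Psi (2 * k + 1) f t) <= A * t * exp (- (t / 2)).
Proof.
  intros HS. assert (HS' := HS). destruct HS' as [Hq [Hf1 [Hf [Hper Hodd]]]].
  destruct (periodic_bounded g q ltac:(lia) Hper) as [B [HB0 HB]].
  destruct (Psi_decay (2 * k + 1)) as [A [HA HD]].
  set (c := om q 1). assert (Hc : 0 < c) by (apply om_pos; lia).
  set (sz := fun j => B * (INR (2 * (k + 1)) * (/ (c * INR (S j))) ^ (2 * k + 1 + 2))).
  assert (Hex : ex_series sz).
  { apply (ex_series_scal_l B (fun j => INR (2 * (k + 1)) * (/ (c * INR (S j))) ^ (2 * k + 1 + 2))).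
    apply (ex_series_scal_l _ (fun j => (/ (c * INR (S j))) ^ (2 * k + 1 + 2))), ex_series_pow_inv, Hc. }
  set (M := 2 * INR (fact (2 * k + 1)) * Series sz).
  assert (HM : 0 <= M).
  { unfold M. apply Rmult_le_pos; [pose proof (pos_INR (fact (2 * k + 1))); lra|]. apply Series_pos; auto.
    intros j. unfold sz. apply Rmult_le_pos; [lra|]. apply Rmult_le_pos; [apply pos_INR|].
    apply pow_le. left. apply Rinv_0_lt_compat. pose proof (INR_S_pos j). nra. }
  assert (Hsm : forall t, 0 < t -> Rabs (Psi (2 * k + 1) f t) <= M * t).
  { intros t Ht. replace (2 * k + 1)%nat with (S (2 * k)) by lia.
    rewrite (Psi_partial_fractions q f g _ t HS Ht). unfold M. replace (S (2 * k)) with (2 * k + 1)%nat by lia.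
    rewrite Rabs_mult, Rabs_right by (pose proof (pos_INR (fact (2 * k + 1))); lra).
    rewrite (Rmult_assoc (2 * INR (fact (2 * k + 1)))). apply Rmult_le_compat_l; [pose proof (pos_INR (fact (2 * k + 1))); lra|].
    rewrite <- Series_scal_r. apply Series_abs_le; [|apply (ex_series_scal_r _ _ Hex)].
    intros j. rewrite Rabs_mult. unfold sz. rewrite Rmult_assoc.
    apply Rmult_le_compat; try apply Rabs_pos; [apply HB|].
    replace (2 * k + 2)%nat with (2 * (k + 1))%nat by lia.
    assert (Hw := om_pos q j ltac:(lia)).
    eapply Rle_trans; [apply (V_even_le (k + 1) t _ (om q (S j))); [lra|rewrite Rabs_right; lra]|].
    rewrite om_S by lia. fold c. replace (S (2 * (k + 1))) with (2 * k + 1 + 2)%nat by lia. right. ring. }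
  apply (near_far_bound _ (fun t => t) M A); auto; try lra; intros t Ht; [lra|apply Hsm; lra].
Qed.

(** * The Bessel series as an integral *)

Lemma is_series_bose v : 0 < v -> is_series (fun j => exp (- (INR (S j) * v))) (bose v).
Proof.
  intros Hv. set (r := exp (- v)).
  assert (Hr : 0 < r < 1).
  { unfold r. split; [apply exp_pos|]. rewrite <- exp_0. apply exp_increasing. lra. }
  replace (bose v) with (r * / (1 - r)).
  - apply is_series_ext with (fun j => r * r ^ j).
    + intros j. rewrite tech_pow_Rmult. unfold r. rewrite <- exp_INR_mult. f_equal. ring.
    + apply (is_series_scal_l r (fun j => r ^ j)), is_series_geom. rewrite Rabs_right; lra.
  - unfold bose. replace (exp v) with (/ r) by (unfold r; rewrite exp_Ropp, Rinv_inv; reflexivity).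
    field. split; [|lra]. lra.
Qed.

Lemma dom_kb al be A : 1 <= al -> 0 < be ->
  (forall t, 0 < t -> kb al be t <= A * wt t) -> dom (kb al be) A.
Proof.
  intros Ha Hb H. split; [intros; now apply continuous_kb|]. intros t Ht.
  rewrite Rabs_right; [now apply H|]. apply Rle_ge. unfold kb.
  apply Rmult_le_pos; [|left; now apply Rinv_0_lt_compat]. apply Rmult_le_pos; left; apply exp_pos.
Qed.

(** The geometric series in exp (- y / t), summed under the integral. *)
Lemma is_series_hint_bose al y : 1 <= al -> 0 < y ->
  is_series (fun j => hint (kb al (INR (S j) * y))) (hint (fun t => exp (- (al * t)) * bose (y / t) / t)).
Proof.
  intros Ha Hy. destruct (kb_bound 1) as [A [HA HB]].
  rewrite (hint_ext _ (fun t => Series (fun j => kb al (INR (S j) * y) t))).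
  - apply hint_Series with (fun j => A * (/ al) ^ 1 * (/ y) ^ 2 * / INR (S j) ^ 2).
    + apply (ex_series_scal_l _ (fun j => / INR (S j) ^ 2)), ex_series_inv_sq.
    + intros j. pose proof (INR_S_pos j). apply dom_kb; auto; [nra|].
      intros t Ht. apply Rle_trans with (A * (/ al) ^ 1 * (/ (INR (S j) * y)) ^ 2 * wt t).
      * apply HB; auto. nra.
      * right. field. lra.
  - intros t Ht. symmetry. apply is_series_unique.
    assert (Hq : 0 < y / t) by now apply Rdiv_lt_0_compat.
    apply is_series_ext with (fun j => exp (- (al * t)) / t * exp (- (INR (S j) * (y / t)))).
    + intros j. unfold kb. replace (INR (S j) * y / t) with (INR (S j) * (y / t)) by (field; lra). eqR. field. lra.
    + replace (exp (- (al * t)) * bose (y / t) / t) with (exp (- (al * t)) / t * bose (y / t)) by (field; lra).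
      apply (is_series_scal_l (exp (- (al * t)) / t) (fun j => exp (- (INR (S j) * (y / t))))), is_series_bose, Hq.
Qed.

Lemma continuous_Qf_inv y t : 0 < y -> 0 < t -> continuous (fun t => Qf (y / t)) t.
Proof.
  intros Hy Ht. apply (continuous_comp (fun t => y / t) Qf).
  - apply (ex_derive_continuous (fun t => y / t)). auto_derive. lra.
  - apply (ex_derive_continuous Qf). eexists. apply is_derive_Qf. now apply Rdiv_lt_0_compat.
Qed.

Lemma dom_exp_Qf al y : 1 <= al -> 0 < y -> exists A, dom (fun t => exp (- (al * t)) * Qf (y / t)) A.
Proof.
  intros Ha Hy. destruct (Qf_rapid_decay 0) as [K [HK HQ]].
  destruct (exp_le_wt (/ 2) ltac:(lra)) as [A [HA HE]].
  exists (K / y * (2 * A)). split.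
  - intros t Ht. apply (continuous_mult (fun t => exp (- (al * t))) (fun t => Qf (y / t))).
    + apply (ex_derive_continuous (fun t => exp (- (al * t)))). auto_derive. exact I.
    + now apply continuous_Qf_inv.
  - intros t Ht. assert (Hq : 0 < y / t) by now apply Rdiv_lt_0_compat.
    destruct (HQ (y / t) Hq) as [Q1 Q2]. pose proof (exp_pos (- (al * t))).
    rewrite Rabs_right by (apply Rle_ge, Rmult_le_pos; lra).
    replace ((/ (y / t)) ^ 1) with (t / y) in Q2 by (rewrite pow_1; field; lra).
    assert (E1 : t * exp (- (al * t)) <= 2 * (A * wt t)).
    { apply Rle_trans with (2 * exp (- (/ 2 * t))); [|specialize (HE t Ht); lra].
      pose proof (pow_exp_bound 1 (/ 2) t ltac:(lra) ltac:(lra)) as PB.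
      replace ((INR 1 / / 2) ^ 1) with 2 in PB by (simpl; field). rewrite pow_1 in PB.
      apply Rle_trans with (t * exp (- (/ 2 * t)) * exp (- (/ 2 * t))).
      - rewrite Rmult_assoc. apply Rmult_le_compat_l; [lra|]. rewrite <- exp_plus.
        apply exp_le. nra.
      - apply Rmult_le_compat_r; [left; apply exp_pos|exact PB]. }
    apply Rle_trans with (exp (- (al * t)) * (K * (t / y))); [apply Rmult_le_compat_l; lra|].
    replace (exp (- (al * t)) * (K * (t / y))) with (K / y * (t * exp (- (al * t)))) by (field; lra).
    rewrite Rmult_assoc. apply Rmult_le_compat_l; [|lra].
    left. apply Rdiv_lt_0_compat; lra.
Qed.

Lemma dom_exp_bose al y : 1 <= al -> 0 < y -> exists A, dom (fun t => exp (- (al * t)) * bose (y / t) / t) A.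
Proof.
  intros Ha Hy. destruct (exp_le_wt 1 ltac:(lra)) as [A [HA HE]].
  exists (/ y * A). split.
  - intros t Ht. assert (Hq : 0 < y / t) by now apply Rdiv_lt_0_compat. pose proof (exp_gt_1 (y / t) Hq).
    apply (ex_derive_continuous (fun t => exp (- (al * t)) * bose (y / t) / t)). unfold bose.
    auto_derive. unfold Rdiv in *. repeat split; lra.
  - intros t Ht. assert (Hq : 0 < y / t) by now apply Rdiv_lt_0_compat.
    pose proof (bose_pos _ Hq). pose proof (bose_le _ Hq) as B. pose proof (exp_pos (- (al * t))).
    assert (Hit : 0 < / t) by now apply Rinv_0_lt_compat.
    assert (Hiy : 0 < / y) by now apply Rinv_0_lt_compat.
    rewrite Rabs_right by (apply Rle_ge; unfold Rdiv; apply Rmult_le_pos; [apply Rmult_le_pos|]; lra).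
    assert (E1 : exp (- (y / t / 2)) <= 1) by (rewrite <- exp_0; left; apply exp_increasing; lra).
    assert (B2 : bose (y / t) <= t / y).
    { replace (/ (y / t)) with (t / y) in B by (field; lra).
      assert (0 < t / y) by now apply Rdiv_lt_0_compat. nra. }
    assert (E2 : exp (- (al * t)) <= A * wt t).
    { apply Rle_trans with (exp (- (1 * t))); [|now apply HE].
      apply exp_le. nra. }
    apply Rle_trans with (exp (- (al * t)) * (t / y) / t).
    + unfold Rdiv at 1 3. apply Rmult_le_compat_r; [lra|]. apply Rmult_le_compat_l; lra.
    + replace (exp (- (al * t)) * (t / y) / t) with (/ y * exp (- (al * t))) by (field; lra).
      rewrite Rmult_assoc. apply Rmult_le_compat_l; lra.
Qed.

(** The derivative of Qf (y / t) in t is bose (y / t) / t, so the difference of the two integrands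
    is the derivative of exp (- al t) Qf (y / t), which vanishes at both ends. The factor al is what
    turns d^k into d^(k+1). *)
Lemma hint_bose_parts al y : 1 <= al -> 0 < y ->
  hint (fun t => exp (- (al * t)) * bose (y / t) / t) = al * hint (fun t => exp (- (al * t)) * Qf (y / t)).
Proof.
  intros Ha Hy. destruct (dom_exp_Qf al y Ha Hy) as [A HA]. destruct (dom_exp_bose al y Ha Hy) as [B HB].
  rewrite <- (hint_scal _ A) by exact HA.
  apply Rminus_diag_uniq. rewrite <- (hint_minus _ _ _ _ HB (dom_scal _ _ al HA)).
  destruct (Qf_rapid_decay 0) as [K [HK HQ]].
  rewrite (hint_FTC _ (fun t => exp (- (al * t)) * Qf (y / t)) _ 0 0 (dom_minus _ _ _ _ HB (dom_scal _ _ al HA))).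
  - ring.
  - intros t Ht. assert (Hq : 0 < y / t) by now apply Rdiv_lt_0_compat. evar_last.
    + apply (is_derive_mult (fun t => exp (- (al * t))) (fun t => Qf (y / t)));
        [auto_derive; [exact I|reflexivity]| |intros; apply Rmult_comm].
      apply (is_derive_comp Qf (fun t => y / t)); [apply is_derive_Qf, Hq|].
      auto_derive; [lra|reflexivity].
    + unfold plus, mult, scal; cbn -[bose Qf]. unfold mult; cbn -[bose Qf]. field. lra.
  - apply is_lim_seq_le_le with (fun _ => 0) (fun n => K / y * / INR (S n)).
    + intros n. pose proof (INR_S_pos n) as Hn. assert (Hi := Rinv_0_lt_compat _ Hn).
      assert (Hq : 0 < y / / INR (S n)) by now apply Rdiv_lt_0_compat.
      destruct (HQ _ Hq) as [Q1 Q2]. pose proof (exp_pos (- (al * / INR (S n)))).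
      assert (exp (- (al * / INR (S n))) <= 1) by (rewrite <- exp_0; left; apply exp_increasing; nra).
      replace (K * (/ (y / / INR (S n))) ^ 1) with (K / y * / INR (S n)) in Q2 by (rewrite pow_1; field; lra). nra.
    + apply is_lim_seq_const.
    + replace (Finite 0) with (Rbar_mult (K / y) 0) by (simpl; f_equal; ring). apply is_lim_seq_scal_l, lim_inv_INR_S.
  - apply is_lim_seq_le_le with (fun _ => 0) (fun n => 4 * K / y * / INR (S n)).
    + intros n. pose proof (INR_S_pos n) as Hn. assert (Hi := Rinv_0_lt_compat _ Hn).
      assert (Hq : 0 < y / INR (S n)) by now apply Rdiv_lt_0_compat.
      destruct (HQ _ Hq) as [Q1 Q2]. pose proof (exp_pos (- (al * INR (S n)))).
      replace (K * (/ (y / INR (S n))) ^ 1) with (K / y * INR (S n)) in Q2 by (rewrite pow_1; field; lra).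
      assert (E : exp (- (al * INR (S n))) <= 4 * / INR (S n) ^ 2).
      { apply Rle_trans with (exp (- (INR (S n)))).
        - apply exp_le. nra.
        - eapply Rle_trans; [apply (exp_neg_le 2); auto|]. right. simpl (INR 2). field. lra. }
      split; [nra|].
      apply Rle_trans with (4 * / INR (S n) ^ 2 * (K / y * INR (S n))).
      * apply Rmult_le_compat; lra.
      * right. field. lra.
    + apply is_lim_seq_const.
    + replace (Finite 0) with (Rbar_mult (4 * K / y) 0) by (simpl; f_equal; ring). apply is_lim_seq_scal_l, lim_inv_INR_S.
Qed.

(** Half of exp (- d t) is traded for (d t)^(-k-2). The resulting singularity at t = 0 is cancelled
    by decay of [Qf] of the same order at infinity, and d^k leaves the summable d^(-2). *)
Lemma dom_pow_exp_Qf k y : 0 < y -> exists A, 0 < A /\ forall d,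
  dom (fun t => INR (S d) ^ k * (exp (- (INR (S d) * t)) * Qf (y / t))) (A * / INR (S d) ^ 2).
Proof.
  intros Hy. destruct (Qf_rapid_decay (S k)) as [K [HK HQ]].
  destruct (exp_le_wt (/ 2) ltac:(lra)) as [A [HA HE]].
  set (p := (k + 2)%nat). set (M := (INR p * 2) ^ p).
  assert (HM : 0 < M) by (unfold M; apply pow_lt; assert (0 < INR p) by (apply lt_0_INR; unfold p; lia); lra).
  exists (K * (/ y) ^ p * M * A). split.
  { repeat apply Rmult_lt_0_compat; auto. apply pow_lt. now apply Rinv_0_lt_compat. }
  intros d. pose proof (INR_S_ge1 d) as HN. set (N := INR (S d)) in *. split.
  - intros t Ht. apply (continuous_scal_r (N ^ k) (fun t => exp (- (N * t)) * Qf (y / t))).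
    destruct (dom_exp_Qf N y HN Hy) as [A' HA']. now apply HA'.
  - intros t Ht. assert (Hq : 0 < y / t) by now apply Rdiv_lt_0_compat.
    destruct (HQ (y / t) Hq) as [Q1 Q2]. pose proof (exp_pos (- (N * t))).
    assert (0 < N ^ k) by (apply pow_lt; lra).
    rewrite Rabs_right by (apply Rle_ge; apply Rmult_le_pos; [lra|apply Rmult_le_pos; lra]).
    replace (S (S k)) with p in Q2 by (unfold p; lia).
    replace (/ (y / t)) with (t * / y) in Q2 by (field; lra). rewrite Rpow_mult_distr in Q2.
    assert (E : exp (- (N * t)) <= M * (/ N) ^ p * (/ t) ^ p * exp (- (/ 2 * t))).
    { apply Rle_trans with (exp (- (N / 2 * t)) * exp (- (/ 2 * t))).
      - rewrite <- exp_plus. apply exp_le. nra.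
      - apply Rmult_le_compat_r; [left; apply exp_pos|].
        eapply Rle_trans; [apply (exp_neg_le p); nra|]. right. unfold M.
        rewrite <- !Rpow_mult_distr. f_equal. field. lra. }
    assert (Ept : (/ t) ^ p * t ^ p = 1) by (rewrite <- Rpow_mult_distr, Rinv_l by lra; apply pow1).
    apply Rle_trans with (N ^ k * (M * (/ N) ^ p * (/ t) ^ p * exp (- (/ 2 * t)) * (K * (t ^ p * (/ y) ^ p)))).
    + apply Rmult_le_compat_l; [lra|]. apply Rmult_le_compat; lra.
    + replace (N ^ k * (M * (/ N) ^ p * (/ t) ^ p * exp (- (/ 2 * t)) * (K * (t ^ p * (/ y) ^ p))))
        with (K * (/ y) ^ p * M * (N ^ k * (/ N) ^ p) * ((/ t) ^ p * t ^ p) * exp (- (/ 2 * t))) by ring.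
      rewrite Ept, Rmult_1_r.
      assert (EN : N ^ k * (/ N) ^ p = / N ^ 2).
      { unfold p. rewrite pow_add, pow_inv, pow_inv. field. split; [lra|]. apply pow_nonzero. lra. }
      rewrite EN. replace (K * (/ y) ^ p * M * A * / N ^ 2 * wt t) with (K * (/ y) ^ p * M * / N ^ 2 * (A * wt t)) by ring.
      apply Rmult_le_compat_l; [|now apply HE].
      repeat apply Rmult_le_pos; try lra; [apply pow_le; left; now apply Rinv_0_lt_compat|].
      left. apply Rinv_0_lt_compat. nra.
Qed.

Lemma hint_kb_bound k y : 0 < y -> exists A, 0 < A /\ forall i j,
  INR (S i) ^ k * Rabs (hint (kb (INR (S i)) (INR (S j) * y))) <= A * / INR (S i) ^ 2 * / INR (S j) ^ 2.
Proof.
  intros Hy. destruct (kb_bound (k + 2)) as [A [HA HB]]. pose proof PI_RGT_0 as HP.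
  assert (Hyp : 0 < (/ y) ^ (S (k + 2))) by (apply pow_lt; now apply Rinv_0_lt_compat).
  assert (HAy : 0 < A * (/ y) ^ (S (k + 2)) * PI) by (apply Rmult_lt_0_compat; [apply Rmult_lt_0_compat|]; lra).
  exists (A * (/ y) ^ (S (k + 2)) * PI). split; [exact HAy|].
  intros i j. pose proof (INR_S_ge1 i). pose proof (INR_S_ge1 j).
  set (N := INR (S i)) in *. set (M := INR (S j)) in *.
  assert (HD : dom (kb N (M * y)) (A * (/ N) ^ (k + 2) * (/ (M * y)) ^ (S (k + 2)))).
  { apply dom_kb; auto; [nra|]. intros t Ht. apply HB; auto. nra. }
  pose proof (hint_bound _ _ HD) as B.
  assert (0 < N ^ k) by (apply pow_lt; lra).
  apply Rle_trans with (N ^ k * (A * (/ N) ^ (k + 2) * (/ (M * y)) ^ S (k + 2) * PI)); [apply Rmult_le_compat_l; lra|].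
  rewrite Rinv_mult, Rpow_mult_distr.
  assert (EN : N ^ k * (/ N) ^ (k + 2) = / N ^ 2).
  { rewrite pow_add, pow_inv, pow_inv. field. split; [lra|]. apply pow_nonzero. lra. }
  replace (N ^ k * (A * (/ N) ^ (k + 2) * ((/ M) ^ S (k + 2) * (/ y) ^ S (k + 2)) * PI))
    with (A * (/ y) ^ S (k + 2) * PI * (N ^ k * (/ N) ^ (k + 2)) * (/ M) ^ S (k + 2)) by ring.
  rewrite EN. assert (0 < / M <= 1).
  { split; [apply Rinv_0_lt_compat; lra|rewrite <- Rinv_1; apply Rinv_le_contravar; lra]. }
  apply Rmult_le_compat_l.
  - apply Rmult_le_pos; [lra|]. left; apply Rinv_0_lt_compat; nra.
  - replace (S (k + 2)) with (S k + 2)%nat by lia. rewrite pow_add, (pow_inv M 2).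
    rewrite <- (Rmult_1_l (/ M ^ 2)) at 2. apply Rmult_le_compat_r; [left; apply Rinv_0_lt_compat; nra|].
    rewrite <- (pow1 (S k)). apply pow_incr. lra.
Qed.

Lemma divb_mul_div d n : divb d n = true -> (d * (n / d) = n)%nat.
Proof.
  intros H. apply divb_spec in H. destruct H as [H1 [c Hc]]. rewrite Hc, Nat.div_mul by lia. lia.
Qed.

(** For fixed d the sum over m gives [bose] and, by parts, [Qf]; the sum over d then assembles
    [Psi]. The bound [hint_kb_bound] makes the double series absolutely convergent and allows
    grouping by n = d m. *)
Theorem is_series_bessel_sum f k y : (forall d, Rabs (f d) <= 1) -> 0 < y ->
  is_series (fun m => sum_n (fun d => if divb d (S m) then INR d ^ k * f d else 0) (S m)
                      * (2 * K0 (2 * sqrt (INR (S m) * y))))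
    (hint (fun t => Psi (k + 1) f t * Qf (y / t))).
Proof.
  intros Hf Hy. destruct (hint_kb_bound k y Hy) as [A [HA HB]].
  assert (HD := is_series_divisor (fun d m => INR d ^ k * f d * hint (kb (INR d) (INR m * y)))
    (fun i => A * / INR (S i) ^ 2) (fun j => / INR (S j) ^ 2)
    (ex_series_scal_l A (fun i => / INR (S i) ^ 2) ex_series_inv_sq) ex_series_inv_sq).
  assert (P : forall i, 0 <= / INR (S i) ^ 2) by (intros i; left; apply Rinv_0_lt_compat, pow_lt, INR_S_pos).
  specialize (HD ltac:(intros i; apply Rmult_le_pos; [lra|apply P]) P).
  match type of HD with ?X -> _ => assert (HX : X) end.
  { intros i j. rewrite !Rabs_mult. apply Rle_trans with (2 := HB i j).
    apply Rmult_le_compat_r; [apply Rabs_pos|].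
    rewrite (Rabs_right (INR (S i) ^ k)) by (apply Rle_ge, pow_le, pos_INR).
    rewrite <- (Rmult_1_r (INR (S i) ^ k)) at 2. apply Rmult_le_compat_l; [apply pow_le, pos_INR|apply Hf]. }
  specialize (HD HX).
  eapply is_series_ext in HD.
  2:{ intros m. transitivity (sum_n (fun d => (if divb d (S m) then INR d ^ k * f d else 0) * (2 * K0 (2 * sqrt (INR (S m) * y)))) (S m)).
      - apply sum_n_ext. intros d. destruct (divb d (S m)) eqn:E; [|eqR; ring].
        assert (Hd := E). apply divb_spec in Hd. destruct Hd as [Hd _].
        pose proof (divb_mul_div _ _ E) as Em.
        assert (Hn : (1 <= S m / d)%nat) by (destruct (S m / d)%nat; lia).
        assert (0 < INR d) by (apply lt_0_INR; lia). assert (0 < INR (S m / d)) by (apply lt_0_INR; lia).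
        rewrite hint_kb by nra. rewrite <- (Rmult_assoc (INR d)), <- mult_INR, Em. reflexivity.
      - apply (sum_n_mult_r (K := R_Ring)). }
  replace (hint (fun t => Psi (k + 1) f t * Qf (y / t)))
    with (Series (fun i => Series (fun j => INR (S i) ^ k * f (S i) * hint (kb (INR (S i)) (INR (S j) * y))))); [exact HD|].
  clear HD HX. apply is_series_unique.
  apply is_series_ext with (fun d => hint (fun t => f (S d) * (INR (S d) ^ (k + 1) * (exp (- (INR (S d) * t)) * Qf (y / t))))).
  - intros d. pose proof (INR_S_ge1 d) as HN.
    destruct (dom_exp_Qf (INR (S d)) y HN Hy) as [A' HA'].
    rewrite Series_scal_l, (is_series_unique _ _ (is_series_hint_bose (INR (S d)) y HN Hy)).
    rewrite hint_bose_parts by auto.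
    rewrite (hint_ext _ (fun t => f (S d) * INR (S d) ^ (k + 1) * (exp (- (INR (S d) * t)) * Qf (y / t)))) by (intros; ring).
    rewrite (hint_scal _ A') by exact HA'. eqR. rewrite pow_add. ring.
  - destruct (dom_pow_exp_Qf (k + 1) y Hy) as [A2 [HA2 HD2]].
    rewrite (hint_ext (fun t => Psi (k + 1) f t * Qf (y / t))
      (fun t => Series (fun d => f (S d) * (INR (S d) ^ (k + 1) * (exp (- (INR (S d) * t)) * Qf (y / t)))))).
    + apply hint_Series with (fun d => A2 * / INR (S d) ^ 2).
      * apply (ex_series_scal_l A2 (fun i => / INR (S i) ^ 2)), ex_series_inv_sq.
      * intros d. apply dom_weaken with (Rabs (f (S d)) * (A2 * / INR (S d) ^ 2)).
        -- rewrite <- (Rmult_1_l (A2 * / INR (S d) ^ 2)) at 2.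
           apply Rmult_le_compat_r; [apply Rmult_le_pos; [lra|apply P]|apply Hf].
        -- apply dom_scal, HD2.
    + intros t Ht. unfold Psi. rewrite <- Series_scal_r. apply Series_ext. intros d. ring.
Qed.

(** * The transformation formula *)

Lemma poly_exp_le_wt n : exists A, 0 < A /\ forall t, 0 < t -> (1 + t) ^ n * exp (- (t / 2)) <= A * wt t.
Proof.
  destruct (exp_le_wt (/ 4) ltac:(lra)) as [A [HA HE]].
  set (M := (INR n / / 4) ^ n * exp (/ 4)).
  assert (HM : 0 <= M).
  { unfold M. apply Rmult_le_pos; [|left; apply exp_pos]. apply pow_le.
    apply Rmult_le_pos; [apply pos_INR|lra]. }
  exists ((M + 1) * A). split; [nra|]. intros t Ht.
  pose proof (pow_exp_bound n (/ 4) (1 + t) ltac:(lra) ltac:(lra)) as B.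
  pose proof (exp_pos (/ 4)). pose proof (exp_pos (- (/ 4 * t))).
  assert (E : (1 + t) ^ n * exp (- (t / 2)) <= M * exp (- (/ 4 * t))).
  { replace (- (t / 2)) with (- (/ 4 * (1 + t)) + / 4 + - (/ 4 * t)) by field. rewrite !exp_plus.
    rewrite <- !Rmult_assoc. apply Rmult_le_compat_r; [lra|]. unfold M. apply Rmult_le_compat_r; lra. }
  apply Rle_trans with (1 := E). specialize (HE t Ht). nra.
Qed.

Lemma dom_of_poly_exp n : exists A, 0 < A /\ forall h C, 0 <= C ->
  (forall t, 0 < t -> continuous h t) ->
  (forall t, 0 < t -> Rabs (h t) <= C * ((1 + t) ^ n * exp (- (t / 2)))) -> dom h (C * A).
Proof.
  destruct (poly_exp_le_wt n) as [A [HA H]]. exists A. split; [exact HA|].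
  intros h C HC Hc Hb. split; [exact Hc|]. intros t Ht. apply Rle_trans with (1 := Hb t Ht).
  rewrite Rmult_assoc. apply Rmult_le_compat_l; auto.
Qed.

Lemma Rabs_ln_le t : 0 < t -> Rabs (ln t) <= t + / t.
Proof.
  intros Ht. pose proof (Rinv_0_lt_compat t Ht).
  pose proof (ln_le_sub1 t Ht). pose proof (ln_ge_1_sub_inv t Ht). apply Rabs_le. lra.
Qed.

Lemma one_minus_pow_le r n : 0 <= r <= 1 -> 1 - r ^ n <= INR n * (1 - r).
Proof.
  intros Hr. induction n as [|n IH]; [simpl; lra|].
  rewrite S_INR. rewrite <- tech_pow_Rmult.
  assert (0 <= r ^ n <= 1) by (split; [apply pow_le; lra|rewrite <- (pow1 n); apply pow_incr; lra]). nra.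
Qed.

(** The difference is smaller than 1 / z^n by a factor of order Y / z; this gain makes the dual
    series converge absolutely. *)
Lemma inv_pow_diff z Y n : 0 < z -> 0 <= Y ->
  0 <= / z ^ n - / (z + Y) ^ n <= INR n * Y * / z ^ (S n).
Proof.
  intros Hz HY. set (r := z / (z + Y)).
  assert (Hr : 0 <= r <= 1).
  { unfold r. split; [apply Rmult_le_pos; [lra|left; apply Rinv_0_lt_compat; lra]|].
    apply Rmult_le_reg_r with (z + Y); [lra|]. unfold Rdiv. rewrite Rmult_assoc, Rinv_l by lra. lra. }
  assert (Hzn : 0 < z ^ n) by (apply pow_lt; lra). assert (0 < (z + Y) ^ n) by (apply pow_lt; lra).
  assert (E : / z ^ n - / (z + Y) ^ n = / z ^ n * (1 - r ^ n)).
  { unfold r, Rdiv. rewrite Rpow_mult_distr, pow_inv. field. lra. }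
  assert (r ^ n <= 1) by (rewrite <- (pow1 n); apply pow_incr; lra).
  assert (0 < / z ^ n) by now apply Rinv_0_lt_compat.
  rewrite E. split; [nra|].
  apply Rle_trans with (/ z ^ n * (INR n * (1 - r))); [apply Rmult_le_compat_l; [lra|now apply one_minus_pow_le]|].
  replace (INR n * Y * / z ^ S n) with (/ z ^ n * (INR n * (Y * / z))) by (rewrite <- tech_pow_Rmult; field; lra).
  apply Rmult_le_compat_l; [lra|]. apply Rmult_le_compat_l; [apply pos_INR|].
  replace (1 - r) with (Y * / (z + Y)) by (unfold r; field; lra).
  apply Rmult_le_compat_l; [lra|]. apply Rinv_le_contravar; lra.
Qed.

(** It splits the decay of 1 / (t^2 + x^2) between the variables: x^(-3/2) is summable over the
    frequencies, and t^(-1/2) together with atan (b / t) <= b / t gives t^(-3/2), integrable at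
    infinity. *)
Lemma sqrt_mul_le_sum_sq t x : 0 < t -> 0 < x -> x * sqrt x * sqrt t <= t ^ 2 + x ^ 2.
Proof.
  intros Ht Hx. assert (S1 := sqrt_lt_R0 t Ht). assert (S2 := sqrt_lt_R0 x Hx).
  assert (E1 := sqrt_sqrt t ltac:(lra)). assert (E2 := sqrt_sqrt x ltac:(lra)).
  set (a := sqrt t) in *. set (b := sqrt x) in *. rewrite <- E1, <- E2.
  destruct (Rle_dec a b) as [H|H].
  - assert (b * b * b * a <= b * b * b * b) by (apply Rmult_le_compat_l; [repeat apply Rmult_le_pos; lra|lra]).
    assert (0 <= (a * a) ^ 2) by apply pow2_ge_0. nra.
  - assert (b * b * b * a <= a * a * a * a).
    { apply Rmult_le_compat_r; [lra|]. assert (b * b <= a * a) by nra.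
      apply Rmult_le_compat; try nra. }
    assert (0 <= (b * b) ^ 2) by apply pow2_ge_0. nra.
Qed.

(** For t <= 1 the factor t of [V_even_le] cancels the pole of b / t, which bounds the arctangent.
    For t > 1 the decay is split by [sqrt_mul_le_sum_sq]. Both constants are summable over x = c n,
    even for k = 0. *)
Lemma V_atan_dom k b x : 0 < b -> 0 < x ->
  dom (fun t => V (2 * k + 2) t x * atan (b / t))
    (2 * b * (INR (2 * (k + 1)) * (/ x) ^ (2 * k + 1 + 2) + (/ x) ^ (2 * k) * / (x * sqrt x))).
Proof.
  intros Hb Hx. assert (Hax : 0 < x <= Rabs x) by (rewrite Rabs_right; lra).
  assert (Hi : 0 < / x) by now apply Rinv_0_lt_compat.
  assert (Sx := sqrt_lt_R0 x Hx).
  assert (P1 : 0 <= INR (2 * (k + 1)) * (/ x) ^ (2 * k + 1 + 2)) by (apply Rmult_le_pos; [apply pos_INR|apply pow_le; lra]).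
  assert (P2 : 0 <= (/ x) ^ (2 * k) * / (x * sqrt x)).
  { apply Rmult_le_pos; [apply pow_le; lra|left; apply Rinv_0_lt_compat; nra]. }
  set (p1 := INR (2 * (k + 1)) * (/ x) ^ (2 * k + 1 + 2)) in *. set (p2 := (/ x) ^ (2 * k) * / (x * sqrt x)) in *.
  split; [intros t Ht; apply continuous_UV_atan; lra|].
  intros t Ht. pose proof (atan_inv_arg_bounds b t Hb Ht). pose proof (wt_pos t Ht).
  assert (Hbt : 0 < b / t) by now apply Rdiv_lt_0_compat.
  assert (Ha : atan (b / t) <= b / t) by (apply atan_le_id; lra).
  assert (Hit : 0 < / t) by now apply Rinv_0_lt_compat.
  rewrite Rabs_mult, (Rabs_right (atan (b / t))) by lra.
  pose proof (Rabs_pos (V (2 * k + 2) t x)).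
  apply Rle_trans with (Rabs (V (2 * k + 2) t x) * (b / t)); [apply Rmult_le_compat_l; lra|].
  destruct (Rle_dec t 1) as [Ht1|Ht1].
  - pose proof (V_even_le (k + 1) t x x ltac:(lra) Hax) as B.
    replace (2 * (k + 1))%nat with (2 * k + 2)%nat in B at 1 by lia.
    replace (S (2 * (k + 1))) with (2 * k + 1 + 2)%nat in B by lia.
    apply Rle_trans with (p1 * b).
    + apply Rle_trans with (p1 * t * (b / t)).
      * apply Rmult_le_compat_r; [lra|]. apply Rle_trans with (1 := B). unfold p1. right. ring.
      * right. field. lra.
    + assert (Hw : / 2 <= wt t).
      { unfold wt. assert (S0 := sqrt_lt_R0 t Ht). assert (sqrt t <= 1).
        { rewrite <- sqrt_1. apply sqrt_le_1; lra. }
        apply Rinv_le_contravar; nra. }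
      assert (p1 * b * / 2 <= p1 * b * wt t) by (apply Rmult_le_compat_l; nra).
      assert (0 <= p2 * b * wt t) by (apply Rmult_le_pos; nra). nra.
  - destruct (UV_le_mixed (2 * k) t x x Hax) as [_ B].
    assert (S0 := sqrt_lt_R0 t Ht).
    assert (Q := sqrt_mul_le_sum_sq t x Ht Hx).
    assert (Hpp : 0 < x * sqrt x * sqrt t) by (repeat apply Rmult_lt_0_compat; lra).
    assert (B2 : Rabs (V (2 * k + 2) t x) <= p2 * / sqrt t).
    { apply Rle_trans with (1 := B). unfold p2. rewrite Rmult_assoc. apply Rmult_le_compat_l; [apply pow_le; lra|].
      rewrite <- Rinv_mult. apply Rinv_le_contravar; lra. }
    assert (Hw : / sqrt t * / t <= 2 * wt t).
    { unfold wt. replace (/ sqrt t * / t) with (2 * / (sqrt t * (2 * t))) by (field; lra).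
      apply Rmult_le_compat_l; [lra|]. apply Rinv_le_contravar; nra. }
    apply Rle_trans with (p2 * / sqrt t * (b / t)); [apply Rmult_le_compat_r; lra|].
    replace (p2 * / sqrt t * (b / t)) with (p2 * b * (/ sqrt t * / t)) by (unfold Rdiv; ring).
    apply Rle_trans with (p2 * b * (2 * wt t)); [apply Rmult_le_compat_l; nra|].
    assert (0 <= p1 * b * wt t) by (apply Rmult_le_pos; nra). nra.
Qed.

Lemma ex_series_V_atan_dom k b c : 0 < c ->
  ex_series (fun j => let x := c * INR (S j) in
    2 * b * (INR (2 * (k + 1)) * (/ x) ^ (2 * k + 1 + 2) + (/ x) ^ (2 * k) * / (x * sqrt x))).
Proof.
  intros Hc. cbv zeta.
  apply (ex_series_scal_l (2 * b) (fun j => INR (2 * (k + 1)) * (/ (c * INR (S j))) ^ (2 * k + 1 + 2)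
     + (/ (c * INR (S j))) ^ (2 * k) * / (c * INR (S j) * sqrt (c * INR (S j))))).
  apply (ex_series_plus (fun j => INR (2 * (k + 1)) * (/ (c * INR (S j))) ^ (2 * k + 1 + 2))
     (fun j => (/ (c * INR (S j))) ^ (2 * k) * / (c * INR (S j) * sqrt (c * INR (S j))))).
  - apply (ex_series_scal_l _ (fun j => (/ (c * INR (S j))) ^ (2 * k + 1 + 2))), ex_series_pow_inv, Hc.
  - apply ex_series_dom with (fun j => (/ c) ^ (2 * k) * / (c * sqrt c) * / (INR (S j) * sqrt (INR (S j)))).
    + intros j. pose proof (INR_S_ge1 j). assert (0 < / c) by now apply Rinv_0_lt_compat.
      set (N := INR (S j)) in *. assert (0 < / N <= 1).
      { split; [apply Rinv_0_lt_compat; lra|rewrite <- Rinv_1; apply Rinv_le_contravar; lra]. }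
      assert (S1 := sqrt_lt_R0 c Hc). assert (S2 := sqrt_lt_R0 N ltac:(lra)).
      rewrite sqrt_mult by lra. rewrite Rinv_mult, Rpow_mult_distr.
      assert (P0 : 0 < / (c * N * (sqrt c * sqrt N))) by (apply Rinv_0_lt_compat; repeat apply Rmult_lt_0_compat; lra).
      assert (P1 : 0 < (/ c) ^ (2 * k)) by now apply pow_lt.
      assert (P2 : 0 < (/ N) ^ (2 * k) <= 1) by (split; [now apply pow_lt|rewrite <- (pow1 (2 * k)); apply pow_incr; lra]).
      rewrite Rabs_right by (apply Rle_ge; repeat apply Rmult_le_pos; lra).
      replace (/ (c * N * (sqrt c * sqrt N))) with (/ (c * sqrt c) * / (N * sqrt N)) in * by (field; lra).
      replace ((/ c) ^ (2 * k) * / (c * sqrt c) * / (N * sqrt N)) with ((/ c) ^ (2 * k) * (/ (c * sqrt c) * / (N * sqrt N))) by ring.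
      apply Rmult_le_compat_r; [lra|]. rewrite <- (Rmult_1_r ((/ c) ^ (2 * k))) at 2. apply Rmult_le_compat_l; lra.
    + apply (ex_series_scal_l _ (fun j => / (INR (S j) * sqrt (INR (S j))))), ex_series_inv_three_halves.
Qed.

Definition dual_term (k : nat) (Y : R) (n : nat) : R := / INR n ^ (k + 1) - / (INR n + Y) ^ (k + 1).

(** The partial fractions are integrated term by term with [XV_even]; the constant 2 (2k+1)! PI / (2
    (2k+1)) reduces to (2k)! PI. *)
Lemma hint_Psi_atan q f g k b : sine_pair q f g -> 0 < b ->
  hint (fun t => Psi (2 * k + 1) f t * atan (b / t)) =
  (-1) ^ k * INR (fact (2 * k)) * PI *
    Series (fun j => g (S j) * ((/ om q (S j)) ^ (2 * k + 1) - (/ (om q (S j) + b)) ^ (2 * k + 1))).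
Proof.
  intros HS Hb. assert (HS' := HS). destruct HS' as [Hq [_ [_ [Hper _]]]].
  destruct (periodic_bounded g q ltac:(lia) Hper) as [B [HB0 HB]].
  assert (Hc := om_pos q 0 ltac:(lia)). set (c := om q 1) in *.
  set (F := fun j t => 2 * INR (fact (2 * k + 1)) * g (S j) * (V (2 * k + 2) t (om q (S j)) * atan (b / t))).
  set (a := fun j => Rabs (2 * INR (fact (2 * k + 1)) * B) *
     (let x := c * INR (S j) in 2 * b * (INR (2 * (k + 1)) * (/ x) ^ (2 * k + 1 + 2) + (/ x) ^ (2 * k) * / (x * sqrt x)))).
  assert (HD : forall j, dom (F j) (a j)).
  { intros j. unfold F, a. assert (Hx := om_pos q j ltac:(lia)).
    pose proof (V_atan_dom k b _ Hb Hx) as D0.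
    assert (Ec : c * INR (S j) = om q (S j)) by (symmetry; apply om_S; lia).
    rewrite Ec. cbv zeta. eapply dom_weaken; [|apply dom_scal, D0].
    apply Rmult_le_compat_r; [exact (dom_nonneg _ _ D0)|]. rewrite !Rabs_mult.
    apply Rmult_le_compat_l; [apply Rmult_le_pos; apply Rabs_pos|]. rewrite (Rabs_right B) by lra. apply HB. }
  assert (Ha : ex_series a).
  { unfold a. apply (ex_series_scal_l _ (fun j => let x := c * INR (S j) in
      2 * b * (INR (2 * (k + 1)) * (/ x) ^ (2 * k + 1 + 2) + (/ x) ^ (2 * k) * / (x * sqrt x)))), ex_series_V_atan_dom, Hc. }
  rewrite (hint_ext _ (fun t => Series (fun j => F j t))).
  - rewrite <- (is_series_unique _ _ (hint_Series F a Ha HD)), <- Series_scal_l. apply Series_ext. intros j.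
    unfold F. assert (Hx := om_pos q j ltac:(lia)).
    rewrite (hint_scal _ _ _ (V_atan_dom k b _ Hb Hx)). fold (XV (2 * k + 2) b (om q (S j))).
    rewrite XV_even by auto. replace (2 * k + 1)%nat with (S (2 * k)) by lia.
    change (fact (S (2 * k))) with (S (2 * k) * fact (2 * k))%nat. rewrite mult_INR.
    pose proof (INR_S_pos (2 * k)). field. lra.
  - intros t Ht. unfold F. replace (2 * k + 1)%nat with (S (2 * k)) at 1 by lia.
    rewrite (Psi_partial_fractions q f g (2 * k) t HS Ht).
    replace (S (2 * k)) with (2 * k + 1)%nat by lia.
    rewrite <- Series_scal_l, <- Series_scal_r. apply Series_ext. intros j. ring.
Qed.

(** Scaling by 2 PI n / q makes the summand depend on n and j mainly through n j; only the power n^k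
    stays apart. This is why the dual series is a divisor sum. *)
Lemma dual_term_rescale q k y n j : (1 <= q)%nat -> 0 < y ->
  / INR (S n) * ((/ om q (S j)) ^ (k + 1) - (/ (om q (S j) + y / (2 * PI * INR (S n)))) ^ (k + 1))
  = (INR q / (2 * PI)) ^ (k + 1) * (INR (S n) ^ k * dual_term k (INR q * y / (4 * PI ^ 2)) (S n * S j)).
Proof.
  intros Hq Hy. unfold dual_term, om. rewrite mult_INR. pose proof PI_RGT_0.
  assert (0 < INR q) by (apply lt_0_INR; lia). pose proof (INR_S_pos n). pose proof (INR_S_pos j).
  set (Q := INR q) in *. set (N := INR (S n)) in *. set (J := INR (S j)) in *.
  assert (0 < Q * y / (4 * PI ^ 2)) by (apply Rdiv_lt_0_compat; nra).
  assert (HNJ : 0 < N * J) by nra.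
  replace (/ (2 * PI * J / Q)) with (Q / (2 * PI) * N * / (N * J)) by (field; lra).
  replace (/ (2 * PI * J / Q + y / (2 * PI * N))) with (Q / (2 * PI) * N * / (N * J + Q * y / (4 * PI ^ 2))).
  2:{ assert (0 < PI * N) by nra. field. repeat split; try lra; nra. }
  rewrite !(Rpow_mult_distr (Q / (2 * PI) * N)), (Rpow_mult_distr (Q / (2 * PI)) N), !pow_inv.
  replace (k + 1)%nat with (S k) by lia. rewrite <- (tech_pow_Rmult N k).
  generalize ((Q / (2 * PI)) ^ S k), (/ (N * J) ^ S k), (/ (N * J + Q * y / (4 * PI ^ 2)) ^ S k), (N ^ k).
  intros a b c e. field. lra.
Qed.

(** By [inv_pow_diff] the array is bounded by a multiple of i^(-2) j^(-2), so it may be grouped by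
    the product i j. *)
Theorem dual_series q g B k y : (1 <= q)%nat -> (forall j, Rabs (g j) <= B) -> 0 < y ->
  let Y := INR q * y / (4 * PI ^ 2) in
  is_series (fun m => sum_n (fun d => if divb d (S m) then INR d ^ k * g (S m / d)%nat else 0) (S m)
                      * dual_term k Y (S m))
    (Series (fun i => Series (fun j => INR (S i) ^ k * g (S j) * dual_term k Y (S i * S j)))).
Proof.
  intros Hq HB Hy Y. pose proof PI_RGT_0. assert (Hq0 : 0 < INR q) by (apply lt_0_INR; lia).
  assert (HY : 0 < Y) by (apply Rdiv_lt_0_compat; nra).
  assert (HB0 : 0 <= B) by (pose proof (HB 0%nat); pose proof (Rabs_pos (g 0%nat)); lra).
  assert (P : forall i, 0 <= / INR (S i) ^ 2) by (intros i; left; apply Rinv_0_lt_compat, pow_lt, INR_S_pos).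
  set (A := B * (INR (k + 1) * Y)).
  assert (HA : 0 <= A) by (unfold A; apply Rmult_le_pos; [lra|apply Rmult_le_pos; [apply pos_INR|lra]]).
  assert (HD := is_series_divisor (fun d j => INR d ^ k * g j * dual_term k Y (d * j))
    (fun i => A * / INR (S i) ^ 2) (fun j => / INR (S j) ^ 2)
    (ex_series_scal_l A (fun i => / INR (S i) ^ 2) ex_series_inv_sq) ex_series_inv_sq
    ltac:(intros i; apply Rmult_le_pos; [lra|apply P]) P).
  match type of HD with ?X -> _ => assert (HX : X) end.
  { intros i j. unfold dual_term. rewrite mult_INR. pose proof (INR_S_ge1 i). pose proof (INR_S_ge1 j).
    set (N := INR (S i)) in *. set (J := INR (S j)) in *.
    destruct (inv_pow_diff (N * J) Y (k + 1) ltac:(nra) ltac:(lra)) as [D1 D2].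
    assert (0 < N ^ k) by (apply pow_lt; lra).
    rewrite !Rabs_mult, (Rabs_right (N ^ k)), (Rabs_right (_ - _)) by lra.
    apply Rle_trans with (N ^ k * B * (INR (k + 1) * Y * / (N * J) ^ S (k + 1))).
    - apply Rmult_le_compat; try lra.
      + apply Rmult_le_pos; [lra|apply Rabs_pos].
      + apply Rmult_le_compat_l; [lra|apply HB].
    - replace (N ^ k * B * (INR (k + 1) * Y * / (N * J) ^ S (k + 1)))
        with (A * (N ^ k * (/ N) ^ (k + 2)) * (/ J) ^ (k + 2)).
      2:{ replace (S (k + 1)) with (k + 2)%nat by lia. rewrite <- pow_inv, Rinv_mult, Rpow_mult_distr. unfold A. ring. }
      assert (EN : N ^ k * (/ N) ^ (k + 2) = / N ^ 2).
      { rewrite pow_add, pow_inv, pow_inv. field. split; [lra|]. apply pow_nonzero. lra. }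
      rewrite EN. assert (0 < / J <= 1).
      { split; [apply Rinv_0_lt_compat; lra|rewrite <- Rinv_1; apply Rinv_le_contravar; lra]. }
      apply Rmult_le_compat_l; [apply Rmult_le_pos; [lra|left; apply Rinv_0_lt_compat; nra]|].
      rewrite pow_add, (pow_inv J 2). rewrite <- (Rmult_1_l (/ J ^ 2)) at 2.
      apply Rmult_le_compat_r; [left; apply Rinv_0_lt_compat; nra|].
      rewrite <- (pow1 k). apply pow_incr. lra. }
  specialize (HD HX). eapply is_series_ext; [|exact HD].
  intros m. cbv beta.
  transitivity (sum_n (fun d => (if divb d (S m) then INR d ^ k * g (S m / d)%nat else 0) * dual_term k Y (S m)) (S m)).
  - apply sum_n_ext. intros d. destruct (divb d (S m)) eqn:E; [|eqR; ring].
    rewrite (divb_mul_div _ _ E). reflexivity.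
  - apply (sum_n_mult_r (K := R_Ring)).
Qed.

(** Being O(t) at 0, [Psi] of odd index tolerates multipliers with a simple pole there. This covers
    t, ln t and the arctangent terms at once. *)
Lemma dom_mul_Psi_odd q f g k : sine_pair q f g -> exists A, 0 < A /\ forall h c, 0 <= c ->
  (forall t, 0 < t -> continuous h t) -> (forall t, 0 < t -> Rabs (h t) <= c * (1 + t + / t)) ->
  dom (fun t => h t * Psi (2 * k + 1) f t) (c * A).
Proof.
  intros HS. assert (HS' := HS). destruct HS' as [_ [Hf _]].
  destruct (Psi_odd_bound q f g k HS) as [A [HA HB]]. destruct (dom_of_poly_exp 2) as [M [HM HD]].
  exists (3 * A * M). split; [nra|]. intros h c Hc Ch Bh. rewrite <- Rmult_assoc. apply HD; [nra| |].
  - intros t Ht. apply (continuous_mult h (Psi (2 * k + 1) f)); [auto|now apply continuous_Psi].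
  - intros t Ht. rewrite Rabs_mult. assert (Hit := Rinv_0_lt_compat t Ht). pose proof (exp_pos (- (t / 2))).
    apply Rle_trans with (c * (1 + t + / t) * (A * t * exp (- (t / 2)))); [apply Rmult_le_compat; auto; apply Rabs_pos|].
    replace (c * (1 + t + / t) * (A * t * exp (- (t / 2)))) with (c * A * exp (- (t / 2)) * (t + t ^ 2 + 1)) by (field; lra).
    replace (c * (3 * A) * ((1 + t) ^ 2 * exp (- (t / 2)))) with (c * A * exp (- (t / 2)) * (3 * (1 + t) ^ 2)) by ring.
    apply Rmult_le_compat_l; [repeat apply Rmult_le_pos; lra|nra].
Qed.

Lemma dom_Psi_odd q f g k : sine_pair q f g -> exists A,
  dom (Psi (2 * k + 1) f) A /\ dom (fun t => t * Psi (2 * k + 1) f t) A /\ dom (fun t => ln t * Psi (2 * k + 1) f t) A.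
Proof.
  intros HS. destruct (dom_mul_Psi_odd q f g k HS) as [A [HA HD]]. exists (1 * A).
  split; [apply (dom_ext (fun t => 1 * Psi (2 * k + 1) f t)); [intros; ring|apply (HD (fun _ => 1))]|split];
    try apply HD; try lra; try (intros; apply continuous_const); try (intros; apply continuous_id);
    intros t Ht; try (assert (Hit := Rinv_0_lt_compat t Ht)).
  - rewrite Rabs_R1. lra.
  - rewrite Rabs_right; lra.
  - apply (ex_derive_continuous ln). auto_derive. exact Ht.
  - pose proof (Rabs_ln_le t Ht). lra.
Qed.

Theorem hint_Psi_Qf q f g k y : sine_pair q f g -> 0 < y ->
  hint (fun t => Psi (2 * k + 1) f t * Qf (y / t)) =
  hint (fun t => t * Psi (2 * k + 1) f t) / y
  + (ln y + euler_gamma - ln (2 * PI)) / 2 * hint (Psi (2 * k + 1) f)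
  - hint (fun t => ln t * Psi (2 * k + 1) f t) / 2
  - (-1) ^ k * INR (fact (2 * k)) * (INR q / (2 * PI)) ^ (2 * k + 1) *
    Series (fun i => Series (fun j => INR (S i) ^ (2 * k) * g (S j) * dual_term (2 * k) (INR q * y / (4 * PI ^ 2)) (S i * S j))).
Proof.
  intros HS Hy. assert (HS' := HS). destruct HS' as [Hq _].
  destruct (dom_Psi_odd q f g k HS) as [A [D1 [D2 D3]]]. destruct (dom_mul_Psi_odd q f g k HS) as [M [HM HD]].
  set (w := Psi (2 * k + 1) f) in *. pose proof PI_gt_3 as HP.
  set (an := fun n => y * M * / INR (S n) ^ 2).
  assert (Han : ex_series an).
  { apply (ex_series_scal_l _ (fun n => / INR (S n) ^ 2)), ex_series_inv_sq. }
  (* At y / t the n-th arctangent term is at most y / (t n^2): w absorbs the pole and 1 / n^2 makes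
     the constants summable. *)
  assert (D4 : forall n, dom (fun t => w t * atan_term (y / t) n) (an n)).
  { intros n. pose proof (INR_S_pos n) as HN. assert (0 < / INR (S n) ^ 2) by (apply Rinv_0_lt_compat; nra).
    apply (dom_ext (fun t => atan_term (y / t) n * w t)); [intros; ring|].
    apply dom_weaken with (y * / INR (S n) ^ 2 * M); [unfold an; right; ring|].
    apply HD.
    - nra.
    - intros t Ht. apply (ex_derive_continuous (fun t => atan_term (y / t) n)). unfold atan_term.
      set (N := INR (S n)) in *. clearbody N. auto_derive. lra.
    - intros t Ht. assert (Hyt : 0 < y / t) by now apply Rdiv_lt_0_compat.
      destruct (atan_term_bounds (y / t) n ltac:(lra)) as [T1 T2]. rewrite Rabs_right by lra.
      apply Rle_trans with (1 := T2). replace (y / t * / INR (S n) ^ 2) with (y * / INR (S n) ^ 2 * / t) by (field; lra).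
      apply Rmult_le_compat_l; [nra|lra]. }
  assert (D5 := dom_Series _ _ Han D4).
  assert (S5 := hint_Series _ _ Han D4).
  rewrite (hint_ext (fun t => w t * Qf (y / t)) (fun t => / y * (t * w t) + ((ln y + euler_gamma - ln (2 * PI)) / 2 * w t
     - / 2 * (ln t * w t)) - Series (fun n => w t * atan_term (y / t) n))).
  2:{ intros t Ht. unfold Qf. rewrite Series_scal_l. replace (ln (y / t)) with (ln y - ln t).
      - field. lra.
      - unfold Rdiv. rewrite ln_mult, ln_Rinv by (auto; now apply Rinv_0_lt_compat). ring. }
  set (c0 := (ln y + euler_gamma - ln (2 * PI)) / 2).
  assert (E1 := dom_scal _ _ (/ y) D2). assert (E2 := dom_scal _ _ c0 D1). assert (E3 := dom_scal _ _ (/ 2) D3).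
  assert (E23 := dom_minus _ _ _ _ E2 E3). assert (E123 := dom_plus _ _ _ _ E1 E23).
  rewrite (hint_minus _ _ _ _ E123 D5), (hint_plus _ _ _ _ E1 E23), (hint_minus _ _ _ _ E2 E3).
  rewrite (hint_scal _ _ _ D2), (hint_scal _ _ _ D1), (hint_scal _ _ _ D3).
  rewrite <- (is_series_unique _ _ S5).
  replace (Series (fun n => hint (fun t => w t * atan_term (y / t) n)))
    with ((-1) ^ k * INR (fact (2 * k)) * (INR q / (2 * PI)) ^ (2 * k + 1) *
    Series (fun i => Series (fun j => INR (S i) ^ (2 * k) * g (S j) * dual_term (2 * k) (INR q * y / (4 * PI ^ 2)) (S i * S j)))).
  { field. lra. }
  rewrite <- Series_scal_l. apply Series_ext. intros n. pose proof (INR_S_pos n) as HN.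
  set (b := y / (2 * PI * INR (S n))).
  assert (Hb : 0 < b) by (apply Rdiv_lt_0_compat; nra).
  assert (Hpn : 0 < PI * INR (S n)) by nra.
  rewrite (hint_ext _ (fun t => / (PI * INR (S n)) * (w t * atan (b / t)))).
  2:{ intros t Ht. unfold atan_term, b. replace (y / t / (2 * PI * INR (S n))) with (y / (2 * PI * INR (S n)) / t) by (field; lra).
      unfold Rdiv. ring. }
  assert (D6 : dom (fun t => w t * atan (b / t)) (Rabs (PI * INR (S n)) * an n)).
  { apply (dom_ext (fun t => PI * INR (S n) * (w t * atan_term (y / t) n))); [|apply dom_scal, D4].
    intros t Ht. unfold atan_term, b. replace (y / t / (2 * PI * INR (S n))) with (y / (2 * PI * INR (S n)) / t) by (field; lra).
    field. lra. }
  rewrite (hint_scal _ _ _ D6). unfold w. rewrite (hint_Psi_atan q f g k b HS Hb).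
  rewrite <- !Series_scal_l. apply Series_ext. intros j.
  pose proof (dual_term_rescale q (2 * k) y n j ltac:(lia) Hy) as R. fold b in R.
  replace (/ (PI * INR (S n)) * ((-1) ^ k * INR (fact (2 * k)) * PI *
     (g (S j) * ((/ om q (S j)) ^ (2 * k + 1) - (/ (om q (S j) + b)) ^ (2 * k + 1)))))
    with ((-1) ^ k * INR (fact (2 * k)) * g (S j) * (/ INR (S n) * ((/ om q (S j)) ^ (2 * k + 1) - (/ (om q (S j) + b)) ^ (2 * k + 1))))
    by (field; lra).
  rewrite R. ring.
Qed.

(** * Goursat's lemma and the identity theorem *)

(** Complex differentiability with explicit increments, the form that the subdivision argument
    consumes; [cdiff_iff] relates it to [is_derive]. *)
Definition cdiff (f : C -> C) (z l : C) : Prop :=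
  forall eps, 0 < eps -> exists d, 0 < d /\ forall w, Cmod (w - z) < d ->
    Cmod (f w - f z - (w - z) * l) <= eps * Cmod (w - z).

Lemma Rabs_Re_le z : Rabs (Re z) <= Cmod z.
Proof. eapply Rle_trans; [|apply Rmax_Cmod]. apply Rmax_l. Qed.

Lemma Rabs_Im_le z : Rabs (Im z) <= Cmod z.
Proof. eapply Rle_trans; [|apply Rmax_Cmod]. apply Rmax_r. Qed.

Lemma Cmod_le_sum z : Cmod z <= Rabs (Re z) + Rabs (Im z).
Proof.
  unfold Cmod. destruct z as [a b]. simpl (fst _). simpl (snd _). unfold Re, Im; simpl (fst _); simpl (snd _).
  pose proof (Rabs_pos a). pose proof (Rabs_pos b).
  rewrite <- (sqrt_square (Rabs a + Rabs b)) by lra. apply sqrt_le_1_alt.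
  rewrite <- (pow2_abs a), <- (pow2_abs b). nra.
Qed.

Lemma cdiff_of_is_derive f z l : @is_derive C_AbsRing C_NormedModule f z l -> cdiff f z l.
Proof.
  intros [_ H] eps Heps.
  assert (L : is_filter_lim (locally z) z) by (intros P HP; exact HP).
  specialize (H z L (mkposreal eps Heps)). destruct H as [d Hd].
  exists d. split; [apply cond_pos|]. intros w Hw.
  exact (Hd w Hw).
Qed.

(** The real part of the integral of u + i v counterclockwise around the rectangle. One part
    suffices, since the function may be multiplied by a constant beforehand. *)
Definition rect_int (u v : R -> R -> R) (a b c d : R) : R :=
  RInt (fun x => u x c - u x d) a b - RInt (fun y => v b y - v a y) c d.

(* Real form of complex differentiability of u + i v at (x, y) with derivative al + i be. *)
Definition rdiff (u v : R -> R -> R) (x y al be : R) : Prop :=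
  forall eps, 0 < eps -> exists d, 0 < d /\ forall x' y', Rabs (x' - x) < d -> Rabs (y' - y) < d ->
    Rabs (u x' y' - u x y - (al * (x' - x) - be * (y' - y))) <= eps * (Rabs (x' - x) + Rabs (y' - y)) /\
    Rabs (v x' y' - v x y - (be * (x' - x) + al * (y' - y))) <= eps * (Rabs (x' - x) + Rabs (y' - y)).

Lemma rdiff_continuous u v x y al be : rdiff u v x y al be ->
  continuous (fun x => u x y) x /\ continuous (fun y => v x y) y.
Proof.
  intros H. destruct (H 1 Rlt_0_1) as [d [Hd HB]].
  pose proof (Rabs_pos al) as Pa. pose proof (Rabs_pos be) as Pb.
  set (M := 1 + Rabs al + Rabs be).
  assert (K : forall eps, 0 < eps -> 0 < Rmin d (eps / M)).
  { intros eps He. apply Rmin_pos; [exact Hd|]. apply Rdiv_lt_0_compat; unfold M; lra. }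
  split; apply continuity_pt_filterlim; intros eps He; exists (Rmin d (eps / M));
    (split; [now apply K|]); intros z [_ Hz]; simpl in Hz |- *; unfold Rdist in *;
    assert (Hz1 := Rlt_le_trans _ _ _ Hz (Rmin_l _ _)); assert (Hz2 := Rlt_le_trans _ _ _ Hz (Rmin_r _ _));
    assert (HM : M * (eps / M) = eps) by (unfold M; field; lra).
  - destruct (HB z y Hz1 ltac:(rewrite Rminus_diag, Rabs_R0; lra)) as [B _].
    rewrite Rminus_diag, Rabs_R0, Rmult_0_r, Rplus_0_r, Rminus_0_r, Rmult_1_l in B.
    assert (Rabs (al * (z - x)) <= Rabs al * Rabs (z - x)) by (rewrite Rabs_mult; lra).
    assert (Rabs (u z y - u x y) <= M * Rabs (z - x)).
    { replace (u z y - u x y) with ((u z y - u x y - al * (z - x)) + al * (z - x)) by ring.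
      eapply Rle_trans; [apply Rabs_triang|]. unfold M. pose proof (Rabs_pos (z - x)). nra. }
    assert (0 < M) by (unfold M; lra). nra.
  - destruct (HB x z ltac:(rewrite Rminus_diag, Rabs_R0; lra) Hz1) as [_ B].
    rewrite Rminus_diag, Rabs_R0, Rmult_0_r, !Rplus_0_l, Rmult_1_l in B.
    assert (Rabs (al * (z - y)) <= Rabs al * Rabs (z - y)) by (rewrite Rabs_mult; lra).
    assert (Rabs (v x z - v x y) <= M * Rabs (z - y)).
    { replace (v x z - v x y) with ((v x z - v x y - al * (z - y)) + al * (z - y)) by ring.
      eapply Rle_trans; [apply Rabs_triang|]. unfold M. pose proof (Rabs_pos (z - y)). nra. }
    assert (0 < M) by (unfold M; lra). nra.
Qed.

Definition holo (u v : R -> R -> R) (m : R) : Prop :=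
  forall x y, m < x -> exists al be, rdiff u v x y al be.

Lemma holo_ex_RInt_u u v m a b c : holo u v m -> m < a -> m < b -> ex_RInt (fun x => u x c) a b.
Proof.
  intros H Ha Hb. apply (ex_RInt_continuous (fun x => u x c)). intros z Hz.
  assert (m < z) by (assert (m < Rmin a b) by (apply Rmin_glb_lt; auto); lra).
  destruct (H z c ltac:(auto)) as [al [be D]]. apply (rdiff_continuous _ _ _ _ _ _ D).
Qed.

Lemma holo_ex_RInt_v u v m x c d : holo u v m -> m < x -> ex_RInt (fun y => v x y) c d.
Proof.
  intros H Hx. apply (ex_RInt_continuous (fun y => v x y)). intros z Hz.
  destruct (H x z Hx) as [al [be D]]. apply (rdiff_continuous _ _ _ _ _ _ D).
Qed.

Lemma rect_int_split u v m a b b' c d d' : holo u v m -> m < a -> m < b -> m < b' ->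
  rect_int u v a b c d + rect_int u v b b' c d + rect_int u v a b d d' + rect_int u v b b' d d'
  = rect_int u v a b' c d'.
Proof.
  intros H Ha Hb Hb'. unfold rect_int.
  assert (Eu : forall p r s1 s2, m < p -> m < r -> RInt (fun x => u x s1 - u x s2) p r
      = RInt (fun x => u x s1) p r - RInt (fun x => u x s2) p r).
  { intros. apply (RInt_minus (fun x => u x s1) (fun x => u x s2)); now apply (holo_ex_RInt_u u v m). }
  assert (Ev : forall p r s1 s2, m < s1 -> m < s2 -> RInt (fun y => v s1 y - v s2 y) p r
      = RInt (fun y => v s1 y) p r - RInt (fun y => v s2 y) p r).
  { intros. apply (RInt_minus (fun y => v s1 y) (fun y => v s2 y)); now apply (holo_ex_RInt_v u v m). }
  rewrite !Eu, !Ev by auto.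
  assert (Cu : forall s, RInt (fun x => u x s) a b + RInt (fun x => u x s) b b' = RInt (fun x => u x s) a b').
  { intros s. apply (RInt_Chasles (fun x => u x s)); now apply (holo_ex_RInt_u u v m). }
  assert (Cv : forall s, m < s -> RInt (fun y => v s y) c d + RInt (fun y => v s y) d d' = RInt (fun y => v s y) c d').
  { intros s Hs. apply (RInt_Chasles (fun y => v s y)); now apply (holo_ex_RInt_v u v m). }
  pose proof (Cu c). pose proof (Cu d'). pose proof (Cv a Ha). pose proof (Cv b' Hb'). lra.
Qed.

(** The affine approximation integrates to zero: its contributions l (be h) and h (be l) from the
    two pairs of sides cancel, and only the errors remain. *)
Lemma rect_int_small u v m a c l h x y al be eps :
  holo u v m -> m < a -> 0 <= l -> 0 <= h -> a <= x <= a + l -> c <= y <= c + h ->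
  (forall x' y', a <= x' <= a + l -> c <= y' <= c + h ->
    Rabs (u x' y' - u x y - (al * (x' - x) - be * (y' - y))) <= eps * (Rabs (x' - x) + Rabs (y' - y)) /\
    Rabs (v x' y' - v x y - (be * (x' - x) + al * (y' - y))) <= eps * (Rabs (x' - x) + Rabs (y' - y))) ->
  0 <= eps ->
  Rabs (rect_int u v a (a + l) c (c + h)) <= 2 * eps * (l + h) ^ 2.
Proof.
  intros H Ha Hl Hh Hx Hy HB He. unfold rect_int.
  assert (Near : forall x' y', a <= x' <= a + l -> c <= y' <= c + h -> Rabs (x' - x) + Rabs (y' - y) <= l + h).
  { intros x' y' H1 H2. assert (Rabs (x' - x) <= l) by (apply Rabs_le; lra).
    assert (Rabs (y' - y) <= h) by (apply Rabs_le; lra). lra. }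
  assert (Bu : Rabs (RInt (fun x' => u x' c - u x' (c + h)) a (a + l) - l * (be * h)) <= l * (2 * eps * (l + h))).
  { assert (Ex : ex_RInt (fun x' => u x' c - u x' (c + h)) a (a + l)).
    { apply (ex_RInt_minus (fun x' => u x' c) (fun x' => u x' (c + h))); apply (holo_ex_RInt_u u v m); auto; lra. }
    assert (Ec : RInt (fun _ => be * h) a (a + l) = l * (be * h)).
    { rewrite RInt_const. change scal with Rmult. replace (a + l - a) with l by ring. reflexivity. }
    rewrite <- Ec, <- (RInt_minus (fun x' => u x' c - u x' (c + h)) (fun _ => be * h)) by (auto; apply ex_RInt_const).
    replace (l * (2 * eps * (l + h))) with ((a + l - a) * (2 * eps * (l + h))) by ring.
    apply abs_RInt_le_const; [lra| |].
    - apply (ex_RInt_minus (fun x' => u x' c - u x' (c + h)) (fun _ => be * h)); [exact Ex|apply ex_RInt_const].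
    - intros t Ht. change (Rabs (u t c - u t (c + h) - be * h) <= 2 * eps * (l + h)).
      destruct (HB t c ltac:(lra) ltac:(lra)) as [B1 _]. destruct (HB t (c + h) ltac:(lra) ltac:(lra)) as [B2 _].
      pose proof (Near t c ltac:(lra) ltac:(lra)) as N1. pose proof (Near t (c + h) ltac:(lra) ltac:(lra)) as N2.
      assert (B1' := Rle_trans _ _ _ B1 (Rmult_le_compat_l _ _ _ He N1)).
      assert (B2' := Rle_trans _ _ _ B2 (Rmult_le_compat_l _ _ _ He N2)).
      apply Rabs_le_between in B1'. apply Rabs_le_between in B2'. apply Rabs_le. lra. }
  assert (Bv : Rabs (RInt (fun y' => v (a + l) y' - v a y') c (c + h) - h * (be * l)) <= h * (2 * eps * (l + h))).
  { assert (Ex : ex_RInt (fun y' => v (a + l) y' - v a y') c (c + h)).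
    { apply (ex_RInt_minus (fun y' => v (a + l) y') (fun y' => v a y')); apply (holo_ex_RInt_v u v m); auto; lra. }
    assert (Ec : RInt (fun _ => be * l) c (c + h) = h * (be * l)).
    { rewrite RInt_const. change scal with Rmult. replace (c + h - c) with h by ring. reflexivity. }
    rewrite <- Ec, <- (RInt_minus (fun y' => v (a + l) y' - v a y') (fun _ => be * l)) by (auto; apply ex_RInt_const).
    replace (h * (2 * eps * (l + h))) with ((c + h - c) * (2 * eps * (l + h))) by ring.
    apply abs_RInt_le_const; [lra| |].
    - apply (ex_RInt_minus (fun y' => v (a + l) y' - v a y') (fun _ => be * l)); [exact Ex|apply ex_RInt_const].
    - intros t Ht. change (Rabs (v (a + l) t - v a t - be * l) <= 2 * eps * (l + h)).
      destruct (HB (a + l) t ltac:(lra) ltac:(lra)) as [_ B1]. destruct (HB a t ltac:(lra) ltac:(lra)) as [_ B2].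
      pose proof (Near (a + l) t ltac:(lra) ltac:(lra)) as N1. pose proof (Near a t ltac:(lra) ltac:(lra)) as N2.
      assert (B1' := Rle_trans _ _ _ B1 (Rmult_le_compat_l _ _ _ He N1)).
      assert (B2' := Rle_trans _ _ _ B2 (Rmult_le_compat_l _ _ _ He N2)).
      apply Rabs_le_between in B1'. apply Rabs_le_between in B2'. apply Rabs_le. lra. }
  apply Rabs_le_between in Bu. apply Rabs_le_between in Bv. apply Rabs_le. nra.
Qed.

(** The corner of a quarter that carries at least a fourth of the integral in absolute value. The
    last quarter is the default; [goursat] shows that it qualifies when the other three fail. *)
Definition quarter (u v : R -> R -> R) (L H : R) (n : nat) (p : R * R) : R * R :=
  let a := fst p in let c := snd p in
  let l := L / 2 ^ S n in let h := H / 2 ^ S n in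
  let P := fun a c => 4 * Rabs (rect_int u v a (a + l) c (c + h)) in
  let W := Rabs (rect_int u v a (a + 2 * l) c (c + 2 * h)) in
  if Rle_dec W (P a c) then (a, c)
  else if Rle_dec W (P (a + l) c) then (a + l, c)
  else if Rle_dec W (P a (c + h)) then (a, c + h)
  else (a + l, c + h).

Fixpoint corner (u v : R -> R -> R) (L H : R) (p : R * R) (n : nat) : R * R :=
  match n with O => p | S n' => quarter u v L H n' (corner u v L H p n') end.

Lemma nested_limit (x : nat -> R) (L : R) : 0 <= L ->
  (forall n, x n <= x (S n) <= x n + L / 2 ^ S n) ->
  exists z, forall n, x n <= z <= x n + L / 2 ^ n.
Proof.
  intros HL H.
  assert (P : forall n, 0 < 2 ^ n) by (intros; apply pow_lt; lra).
  assert (Hw : forall n, x (S n) + L / 2 ^ S n <= x n + L / 2 ^ n).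
  { intros n. specialize (H n). specialize (P n). replace (L / 2 ^ n) with (L / 2 ^ S n + L / 2 ^ S n) by (simpl; field; lra). lra. }
  assert (Hpos : forall n, 0 <= L / 2 ^ n) by (intros n; apply Rmult_le_pos; [lra|left; apply Rinv_0_lt_compat, P]).
  assert (Hub : forall n j, x (n + j)%nat + L / 2 ^ (n + j) <= x n + L / 2 ^ n).
  { intros n. induction j as [|j IH]; [rewrite Nat.add_0_r; lra|].
    replace (n + S j)%nat with (S (n + j)) by lia. specialize (Hw (n + j)%nat). lra. }
  destruct (ex_finite_lim_seq_incr x (x 0%nat + L)) as [z Hz].
  - intros n. apply H.
  - intros n. specialize (Hub 0%nat n). simpl in Hub. specialize (Hpos n). unfold Rdiv in *. rewrite Rinv_1, Rmult_1_r in Hub. lra.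
  - exists z. intros n. split.
    + apply (is_lim_seq_incr_compare x z); auto. intros m. apply H.
    + apply (is_lim_seq_le_loc x (fun _ => x n + L / 2 ^ n) z (x n + L / 2 ^ n)); auto.
      * exists n. intros j Hj. specialize (Hub n (j - n)%nat). replace (n + (j - n))%nat with j in Hub by lia.
        specialize (Hpos j). lra.
      * apply is_lim_seq_const.
Qed.

Theorem goursat u v m a c L H : holo u v m -> m < a -> 0 <= L -> 0 <= H ->
  rect_int u v a (a + L) c (c + H) = 0.
Proof.
  intros Hol Ha HL HH.
  assert (P2 : forall n, 0 < 2 ^ n) by (intros; apply pow_lt; lra).
  set (p := corner u v L H (a, c)).
  set (l := fun n => L / 2 ^ n). set (h := fun n => H / 2 ^ n).
  assert (Pl : forall n, 0 <= l n) by (intros n; apply Rmult_le_pos; [lra|left; apply Rinv_0_lt_compat, P2]).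
  assert (Ph : forall n, 0 <= h n) by (intros n; apply Rmult_le_pos; [lra|left; apply Rinv_0_lt_compat, P2]).
  assert (Dl : forall n, l n = 2 * l (S n)) by (intros n; unfold l; specialize (P2 n); simpl; field; lra).
  assert (Dh : forall n, h n = 2 * h (S n)) by (intros n; unfold h; specialize (P2 n); simpl; field; lra).
  assert (Step : forall n, fst (p n) <= fst (p (S n)) <= fst (p n) + l (S n) /\
                           snd (p n) <= snd (p (S n)) <= snd (p n) + h (S n)).
  { intros n. unfold p. simpl corner. fold p. unfold quarter. fold (l (S n)) (h (S n)).
    pose proof (Pl (S n)). pose proof (Ph (S n)).
    repeat destruct Rle_dec; simpl; lra. }
  assert (Ga : forall n, a <= fst (p n)).
  { induction n as [|n IH]; [simpl; lra|]. destruct (Step n). lra. }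
  assert (Big : forall n, Rabs (rect_int u v a (a + L) c (c + H))
     <= 4 ^ n * Rabs (rect_int u v (fst (p n)) (fst (p n) + l n) (snd (p n)) (snd (p n) + h n))).
  { induction n as [|n IH].
    - unfold l, h. simpl. unfold Rdiv. rewrite Rinv_1, !Rmult_1_r. lra.
    - apply Rle_trans with (1 := IH). replace (4 ^ S n) with (4 ^ n * 4) by (simpl; ring).
      rewrite Rmult_assoc. apply Rmult_le_compat_l; [apply pow_le; lra|].
      rewrite (Dl n), (Dh n). specialize (Ga n). pose proof (Pl (S n)). pose proof (Ph (S n)).
      unfold p at 5 6 7 8. simpl corner. fold p. unfold quarter. fold (l (S n)) (h (S n)).
      set (x := fst (p n)) in *. set (y := snd (p n)). set (r := l (S n)) in *. set (s := h (S n)) in *.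
      destruct Rle_dec as [T1|T1]; [exact T1|].
      destruct Rle_dec as [T2|T2]; [exact T2|].
      destruct Rle_dec as [T3|T3]; [exact T3|].
      simpl fst; simpl snd.
      (* By the triangle inequality the fourth quarter must carry its share once the other three
         fall short. *)
      pose proof (rect_int_split u v m x (x + r) (x + r + r) y (y + s) (y + s + s) Hol ltac:(lra) ltac:(lra) ltac:(lra)) as Sp.
      replace (x + r + r) with (x + 2 * r) in * by ring. replace (y + s + s) with (y + 2 * s) in * by ring.
      apply Rnot_le_lt in T1. apply Rnot_le_lt in T2. apply Rnot_le_lt in T3.
      replace (x + r + r) with (x + 2 * r) in * by ring. replace (y + s + s) with (y + 2 * s) in * by ring.
      pose proof (Rabs_triang (rect_int u v x (x + r) y (y + s) + rect_int u v (x + r) (x + 2 * r) y (y + s)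
         + rect_int u v x (x + r) (y + s) (y + 2 * s)) (rect_int u v (x + r) (x + 2 * r) (y + s) (y + 2 * s))) as A1.
      pose proof (Rabs_triang (rect_int u v x (x + r) y (y + s) + rect_int u v (x + r) (x + 2 * r) y (y + s))
         (rect_int u v x (x + r) (y + s) (y + 2 * s))) as A2.
      pose proof (Rabs_triang (rect_int u v x (x + r) y (y + s)) (rect_int u v (x + r) (x + 2 * r) y (y + s))) as A3.
      rewrite Sp in A1. lra. }
  destruct (nested_limit (fun n => fst (p n)) L HL ltac:(intros n; apply (Step n))) as [x Hx].
  destruct (nested_limit (fun n => snd (p n)) H HH ltac:(intros n; apply (Step n))) as [y Hy].
  assert (Hmx : m < x) by (specialize (Hx 0%nat); specialize (Ga 0%nat); lra).
  destruct (Hol x y Hmx) as [al [be D]].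
  (* The factor 4^n is offset by the square of the side lengths, so the bound does not depend on n
     and eps is arbitrary. *)
  assert (Z : forall eps, 0 < eps -> Rabs (rect_int u v a (a + L) c (c + H)) <= 2 * eps * (L + H) ^ 2).
  { intros eps He. destruct (D eps He) as [d [Hd HB]].
    assert (Hn : exists n, L / 2 ^ n + H / 2 ^ n < d).
    { assert (Lm : is_lim_seq (fun n => (L + H) * (/ 2) ^ n) 0).
      { replace (Finite 0) with (Rbar_mult (L + H) 0) by (simpl; f_equal; ring).
        apply is_lim_seq_scal_l, is_lim_seq_geom. rewrite Rabs_right; lra. }
      apply is_lim_seq_spec in Lm. destruct (Lm (mkposreal d Hd)) as [n Hn]. exists n.
      specialize (Hn n (le_n n)). cbn [pos] in Hn. rewrite Rminus_0_r, pow_inv in Hn.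
      apply Rabs_def2 in Hn. unfold Rdiv. lra. }
    destruct Hn as [n Hn]. apply Rle_trans with (1 := Big n).
    assert (S4 : 4 ^ n = 2 ^ n * 2 ^ n) by (rewrite <- Rpow_mult_distr; f_equal; ring).
    pose proof (P2 n). fold (l n) in Hn. fold (h n) in Hn. specialize (Pl n). specialize (Ph n).
    assert (Hs := rect_int_small u v m (fst (p n)) (snd (p n)) (l n) (h n) x y al be eps Hol
       ltac:(specialize (Ga n); lra) Pl Ph (Hx n) (Hy n)).
    apply Rle_trans with (4 ^ n * (2 * eps * (l n + h n) ^ 2)).
    - apply Rmult_le_compat_l; [apply pow_le; lra|]. apply Hs; [|lra].
      intros x' y' Hx' Hy'. specialize (Hx n). specialize (Hy n). fold (l n) in Hx. fold (h n) in Hy. cbv beta in Hx, Hy.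
      apply HB; apply Rabs_def1; lra.
    - right. rewrite S4. unfold l, h. field. lra. }
  destruct (Req_dec (rect_int u v a (a + L) c (c + H)) 0) as [E|E]; [exact E|exfalso].
  apply Rabs_pos_lt in E. set (X := Rabs (rect_int u v a (a + L) c (c + H))) in *.
  pose proof (pow2_ge_0 (L + H)) as Hq.
  specialize (Z (X / (4 * ((L + H) ^ 2 + 1))) ltac:(apply Rdiv_lt_0_compat; lra)).
  assert (X / (4 * ((L + H) ^ 2 + 1)) * (4 * ((L + H) ^ 2 + 1)) = X) by (field; lra).
  assert (0 < X / (4 * ((L + H) ^ 2 + 1))) by (apply Rdiv_lt_0_compat; lra). nra.
Qed.

(** * The complex exponential and rules for complex derivatives *)

Definition Cexp (z : C) : C := (exp (Re z) * cos (Im z), exp (Re z) * sin (Im z)).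

Lemma Cexp_plus z w : Cexp (z + w) = (Cexp z * Cexp w)%C.
Proof.
  destruct z as [a b], w as [c d]. unfold Cexp, Cplus, Cmult, Re, Im. simpl.
  rewrite exp_plus, cos_plus, sin_plus. apply injective_projections; simpl; ring.
Qed.

Lemma Cmod_Cexp z : Cmod (Cexp z) = exp (Re z).
Proof.
  unfold Cmod. cbn [Cexp fst snd]. pose proof (sin2_cos2 (Im z)) as E. unfold Rsqr in E.
  replace ((exp (Re z) * cos (Im z)) ^ 2 + (exp (Re z) * sin (Im z)) ^ 2)
    with (exp (Re z) * exp (Re z) * (sin (Im z) * sin (Im z) + cos (Im z) * cos (Im z))) by ring.
  rewrite E, Rmult_1_r. apply sqrt_square. left; apply exp_pos.
Qed.

Lemma Cexp_quad w : Cmod (Cexp w - 1 - w) <= 4 * Cmod w ^ 2 * exp (Cmod w).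
Proof.
  destruct w as [x y]. set (r := Cmod (x, y)).
  assert (Hx : Rabs x <= r) by apply (Rabs_Re_le (x, y)). assert (Hy : Rabs y <= r) by apply (Rabs_Im_le (x, y)).
  assert (B : forall a b z, 0 <= z <= 1 -> Rabs a <= 1 -> Rabs b <= 1 ->
    Rabs (exp (z * x) * ((x ^ 2 - y ^ 2) * a + 2 * x * y * b)) <= 2 * r ^ 2 * exp r).
  { intros a b z Hz Ha Hb. rewrite Rabs_mult, (Rabs_right (exp (z * x))), Rmult_comm by (left; apply exp_pos).
    apply Rmult_le_compat; try apply Rabs_pos; [left; apply exp_pos| |apply exp_le; pose proof (Rle_abs x); pose proof (Rabs_pos x); nra].
    assert (E : x ^ 2 + y ^ 2 = r ^ 2) by (unfold r, Cmod; rewrite pow2_sqrt; simpl fst; simpl snd; nra).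
    eapply Rle_trans; [apply Rabs_triang|]. rewrite !Rabs_mult, (Rabs_right 2) by lra.
    assert (Rabs (x ^ 2 - y ^ 2) <= r ^ 2) by (apply Rabs_le; nra).
    assert (2 * Rabs x * Rabs y <= r ^ 2) by (rewrite <- E, <- (pow2_abs x), <- (pow2_abs y); pose proof (pow2_ge_0 (Rabs x - Rabs y)); lra).
    pose proof (Rabs_pos (x ^ 2 - y ^ 2)). pose proof (Rabs_pos a). pose proof (Rabs_pos b).
    assert (0 <= 2 * Rabs x * Rabs y) by (pose proof (Rabs_pos x); pose proof (Rabs_pos y); nra). nra. }
  eapply Rle_trans; [apply Cmod_le_sum|]. unfold Re, Im, Cexp, Cminus, Cplus, Copp, RtoC; simpl fst; simpl snd. fold r.
  (* Taylor's formula on [0, 1] along the segment from 0 to w *)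
  pose proof (taylor2_bound (fun z => exp (z * x) * cos (z * y)) (fun z => exp (z * x) * (x * cos (z * y) - y * sin (z * y)))
    (fun z => exp (z * x) * ((x ^ 2 - y ^ 2) * cos (z * y) + 2 * x * y * - sin (z * y))) 0 1 (2 * r ^ 2 * exp r)) as T1.
  pose proof (taylor2_bound (fun z => exp (z * x) * sin (z * y)) (fun z => exp (z * x) * (x * sin (z * y) + y * cos (z * y)))
    (fun z => exp (z * x) * ((x ^ 2 - y ^ 2) * sin (z * y) + 2 * x * y * cos (z * y))) 0 1 (2 * r ^ 2 * exp r)) as T2.
  rewrite Rmin_left, Rmax_right in T1, T2 by lra.
  specialize (T1 ltac:(intros; auto_derive; [exact I|ring]) ltac:(intros; auto_derive; [exact I|ring])
    ltac:(intros z Hz; apply B; [exact Hz|apply Rabs_cos_le|rewrite Rabs_Ropp; apply Rabs_sin_le])).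
  specialize (T2 ltac:(intros; auto_derive; [exact I|ring]) ltac:(intros; auto_derive; [exact I|ring])
    ltac:(intros z Hz; apply B; [exact Hz|apply Rabs_sin_le|apply Rabs_cos_le])).
  rewrite !Rmult_0_l, exp_0, cos_0, sin_0, !Rmult_1_l in T1, T2.
  replace (exp x * cos y + - (1) + - x) with (exp x * cos y - 1 - (1 - 0) * (x * 1 - y * 0)) by ring.
  replace (exp x * sin y + - 0 + - y) with (exp x * sin y - 0 - (1 - 0) * (x * 0 + y * 1)) by ring.
  lra.
Qed.

Lemma cdiff_continuous f z l : cdiff f z l -> forall eps, 0 < eps -> exists d, 0 < d /\
  forall w, Cmod (w - z) < d -> Cmod (f w - f z) < eps.
Proof.
  intros H eps He. destruct (H 1 Rlt_0_1) as [d [Hd HB]].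
  set (M := Cmod l + 1). assert (HM : 0 < M) by (unfold M; pose proof (Cmod_ge_0 l); lra).
  exists (Rmin d (eps / M)). split; [apply Rmin_pos; [auto|apply Rdiv_lt_0_compat; lra]|].
  intros w Hw. assert (W1 := Rlt_le_trans _ _ _ Hw (Rmin_l _ _)). assert (W2 := Rlt_le_trans _ _ _ Hw (Rmin_r _ _)).
  specialize (HB w W1).
  replace (f w - f z)%C with ((f w - f z - (w - z) * l) + (w - z) * l)%C by ring.
  eapply Rle_lt_trans; [apply Cmod_triangle|]. rewrite Cmod_mult.
  assert (M * (eps / M) = eps) by (field; lra). unfold M in *. pose proof (Cmod_ge_0 (w - z)). nra.
Qed.

(** Through this equivalence sums, products and compositions inherit the general rules for
    derivatives. *)
Lemma cdiff_iff f z l : cdiff f z l <-> @is_derive C_AbsRing (AbsRing_NormedModule C_AbsRing) f z l.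
Proof.
  split.
  - intros H. split; [apply is_linear_scal_l|]. intros x Hx eps. apply (is_filter_lim_locally_unique (K := C_AbsRing) (V := AbsRing_NormedModule C_AbsRing)) in Hx. subst x.
    destruct (H eps (cond_pos eps)) as [d [Hd HB]]. exists (mkposreal d Hd). exact HB.
  - intros [_ H] eps He. destruct (H z (fun P HP => HP) (mkposreal eps He)) as [d Hd].
    exists d. split; [apply cond_pos|exact Hd].
Qed.

Lemma cdiff_quadratic (f : C -> C) (z l : C) K r : 0 < r -> 0 < K ->
  (forall h, Cmod h < r -> Cmod (f (z + h)%C - f z - h * l) <= K * Cmod h ^ 2) -> cdiff f z l.
Proof.
  intros Hr HK H eps He. exists (Rmin r (eps / K)). split; [apply Rmin_pos; [auto|now apply Rdiv_lt_0_compat]|].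
  intros w Hw. assert (W1 := Rlt_le_trans _ _ _ Hw (Rmin_l _ _)). assert (W2 := Rlt_le_trans _ _ _ Hw (Rmin_r _ _)).
  specialize (H (w - z)%C W1). replace (z + (w - z))%C with w in H by ring.
  apply Rle_trans with (1 := H). pose proof (Cmod_ge_0 (w - z)) as P. set (x := Cmod (w - z)) in *.
  simpl. rewrite Rmult_1_r, <- Rmult_assoc. apply Rmult_le_compat_r; [lra|].
  apply Rle_trans with (K * (eps / K)); [apply Rmult_le_compat_l; lra|right; field; lra].
Qed.

Lemma cdiff_const c z : cdiff (fun _ => c) z 0.
Proof. apply cdiff_iff, (is_derive_const (V := AbsRing_NormedModule C_AbsRing)). Qed.

Lemma cdiff_plus f g z l m : cdiff f z l -> cdiff g z m -> cdiff (fun w => f w + g w)%C z (l + m)%C.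
Proof. rewrite !cdiff_iff. apply (is_derive_plus (V := AbsRing_NormedModule C_AbsRing)). Qed.

Lemma cdiff_minus f g z l m : cdiff f z l -> cdiff g z m -> cdiff (fun w => f w - g w)%C z (l - m)%C.
Proof. rewrite !cdiff_iff. apply (is_derive_minus (V := AbsRing_NormedModule C_AbsRing)). Qed.

Lemma cdiff_mult f g z l m : cdiff f z l -> cdiff g z m ->
  cdiff (fun w => f w * g w)%C z (l * g z + f z * m)%C.
Proof. rewrite !cdiff_iff. intros Hf Hg. apply (is_derive_mult (K := C_AbsRing) f g z l m Hf Hg), Cmult_comm. Qed.

Lemma cdiff_id_shift c z : cdiff (fun w => w - c)%C z 1.
Proof.
  apply (cdiff_quadratic _ _ _ 1 1); try lra. intros h _.
  replace (z + h - c - (z - c) - h * 1)%C with (RtoC 0) by ring. rewrite Cmod_0, Rmult_1_l. apply pow2_ge_0.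
Qed.

Lemma cdiff_Cexp g z m : cdiff g z m -> cdiff (fun w => Cexp (g w)) z (Cexp (g z) * m)%C.
Proof.
  intros Hg. rewrite Cmult_comm. apply cdiff_iff.
  apply (is_derive_comp (V := AbsRing_NormedModule C_AbsRing) Cexp g); apply cdiff_iff; [|exact Hg].
  set (E := Cmod (Cexp (g z))). pose proof (Cmod_ge_0 (Cexp (g z))) as HE. fold E in HE. pose proof (exp_pos 1).
  apply (cdiff_quadratic _ _ _ (E * (4 * exp 1) + 1) 1); [lra|nra|]. intros h Hh.
  rewrite Cexp_plus. replace (Cexp (g z) * Cexp h - Cexp (g z) - h * Cexp (g z))%C with (Cexp (g z) * (Cexp h - 1 - h))%C by ring.
  rewrite Cmod_mult. fold E. pose proof (Cexp_quad h) as Q. pose proof (exp_le (Cmod h) 1 ltac:(lra)).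
  assert (0 <= Cmod h ^ 2) by apply pow2_ge_0. assert (Cmod (Cexp h - 1 - h) <= 4 * Cmod h ^ 2 * exp 1) by nra. nra.
Qed.

Lemma rdiff_of_cdiff f x y l : cdiff f (x, y) l ->
  rdiff (fun x y => Re (f (x, y))) (fun x y => Im (f (x, y))) x y (Re l) (Im l).
Proof.
  intros H eps He. destruct (H eps He) as [d [Hd HB]].
  exists (d / 2). split; [lra|]. intros x' y' Hx Hy.
  assert (Hm : Cmod ((x', y') - (x, y)) <= Rabs (x' - x) + Rabs (y' - y)).
  { eapply Rle_trans; [apply Cmod_le_sum|]. unfold Re, Im; simpl. apply Rle_refl. }
  specialize (HB (x', y') ltac:(lra)).
  assert (B' := Rle_trans _ _ _ HB (Rmult_le_compat_l _ _ _ (Rlt_le _ _ He) Hm)).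
  split; eapply Rle_trans; [|exact B'| |exact B'].
  - eapply Rle_trans; [|apply Rabs_Re_le]. right. f_equal. destruct l as [a b].
    unfold Re, Im, Cminus, Cmult, Cplus, Copp; simpl. ring.
  - eapply Rle_trans; [|apply Rabs_Im_le]. right. f_equal. destruct l as [a b].
    unfold Re, Im, Cminus, Cmult, Cplus, Copp; simpl. ring.
Qed.

Lemma RInt_ge_const f a b k : a <= b -> ex_RInt f a b -> (forall t, a < t < b -> k <= f t) ->
  (b - a) * k <= RInt f a b.
Proof.
  intros Hab Hex H. replace ((b - a) * k) with (RInt (fun _ => k) a b).
  - apply RInt_le; auto. apply ex_RInt_const.
  - rewrite RInt_const. reflexivity.
Qed.

Lemma continuity_pt_horizontal f x y l : cdiff f (x, y) l -> continuity_pt (fun t => Cmod (f (t, y))) x.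
Proof.
  intros D eps He. destruct (cdiff_continuous f (x, y) l D eps He) as [d [Hd HB]].
  exists d. split; [exact Hd|]. intros t [_ Ht]. simpl in *. unfold Rdist in *.
  assert (E : Cmod ((t, y) - (x, y)) < d).
  { replace ((t, y) - (x, y))%C with (RtoC (t - x)).
    - rewrite Cmod_R. exact Ht.
    - apply injective_projections; simpl; ring. }
  specialize (HB _ E). eapply Rle_lt_trans; [|exact HB]. apply Rabs_le.
  pose proof (Cmod_triangle (f (t, y) - f (x, y)) (f (x, y))) as T1.
  pose proof (Cmod_triangle (f (x, y) - f (t, y)) (f (t, y))) as T2.
  replace (f (t, y) - f (x, y) + f (x, y))%C with (f (t, y)) in T1 by ring.
  replace (f (x, y) - f (t, y) + f (t, y))%C with (f (x, y)) in T2 by ring.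
  replace (Cmod (f (x, y) - f (t, y))) with (Cmod (f (t, y) - f (x, y))) in T2.
  - lra.
  - rewrite <- Cmod_opp. f_equal. ring.
Qed.

Lemma continuity_pt_vertical f x y l : cdiff f (x, y) l -> forall K,
  continuity_pt (fun t => Re (K * f (x, t))) y.
Proof.
  intros D K eps He. pose proof (Cmod_ge_0 K) as PK.
  destruct (cdiff_continuous f (x, y) l D (eps / (Cmod K + 1)) ltac:(apply Rdiv_lt_0_compat; lra)) as [d [Hd HB]].
  exists d. split; [exact Hd|]. intros t [_ Ht]. change (Rabs (t - y) < d) in Ht. change (Rabs (Re (K * f (x, t)) - Re (K * f (x, y))) < eps).
  assert (E : Cmod ((x, t) - (x, y)) < d).
  { eapply Rle_lt_trans; [apply Cmod_le_sum|]. unfold Re, Im; simpl.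
    replace (x + - x) with 0 by ring. rewrite Rabs_R0, Rplus_0_l. exact Ht. }
  specialize (HB _ E).
  replace (Re (K * f (x, t)) - Re (K * f (x, y))) with (Re (K * (f (x, t) - f (x, y)))).
  2:{ unfold Re, Cmult, Cminus, Cplus, Copp; simpl. ring. }
  eapply Rle_lt_trans; [apply Rabs_Re_le|]. rewrite Cmod_mult.
  apply Rle_lt_trans with ((Cmod K) * (eps / (Cmod K + 1))); [apply Rmult_le_compat_l; lra|].
  apply Rmult_lt_reg_r with (Cmod K + 1); [lra|].
  replace (Cmod K * (eps / (Cmod K + 1)) * (Cmod K + 1)) with (Cmod K * eps) by (field; lra). nra.
Qed.

(* On the left edge exp(nu (s-z0)^2) is a narrow bump at z0, on the horizontal edges it is
   exponentially smaller, and the right edge lies where D vanishes. *)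
Theorem identity_theorem (D : C -> C) (m s1 : R) :
  (forall z, m < Re z -> exists l, cdiff D z l) -> (forall z, s1 <= Re z -> D z = 0%C) ->
  forall z0, m < Re z0 -> D z0 = 0%C.
Proof.
  intros HD HZ z0 Hz0. destruct (Rle_dec s1 (Re z0)) as [Hs|Hs]; [now apply HZ|]. apply Rnot_le_lt in Hs.
  destruct z0 as [x0 y0]. unfold Re in Hz0, Hs; simpl in Hz0, Hs.
  destruct (Ceq_dec (D (x0, y0)) 0) as [E|E]; [exact E|exfalso].
  (* With T = L + 1, Re (s - z0)^2 <= L^2 - T^2 <= -1 on the horizontal edges. *)
  set (L := s1 - x0). set (T := L + 1). assert (HL : 0 < L) by (unfold L; lra).
  set (D0 := D (x0, y0)) in *. set (r0 := Cmod D0 ^ 2).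
  assert (Hr0 : 0 < r0) by (unfold r0; apply pow_lt, Cmod_gt_0, E).
  (* The conjugate of D (z0) makes the value at z0 real and positive, so r stays above r0 / 2 near
     y0. *)
  set (r := fun y => Re (Cconj D0 * D (x0, y))).
  assert (Hr : r y0 = r0).
  { unfold r, r0. fold D0. rewrite Cmod2_alt. unfold Re, Cmult, Cconj; simpl. unfold Im. ring. }
  assert (Cr : forall y, continuity_pt r y).
  { intros y. destruct (HD (x0, y) Hz0) as [l Hl]. apply (continuity_pt_vertical D x0 y l Hl). }
  destruct (Cr y0 (r0 / 2) ltac:(lra)) as [d1 [Hd1 Bd1]].
  set (dl := Rmin 1 (d1 / 2)). assert (Hdl : 0 < dl <= 1) by (split; [apply Rmin_pos; lra|apply Rmin_l]).
  assert (Hdl2 : dl < d1) by (unfold dl; pose proof (Rmin_r 1 (d1 / 2)); lra).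
  assert (Rnear : forall y, Rabs (y - y0) <= dl -> r0 / 2 <= r y).
  { intros y Hy. destruct (Req_dec y y0) as [->|Hne]; [rewrite Hr; lra|].
    assert (B := Bd1 y ltac:(split; [split; [exact I|auto]|simpl; unfold Rdist; lra])).
    simpl in B. unfold Rdist in B. rewrite Hr in B. apply Rabs_def2 in B. lra. }
  destruct (continuity_ab_maj (fun y => Rabs (r y)) (y0 - T) (y0 + T) ltac:(unfold T; lra)) as [ym [Bym _]].
  { intros y _. apply (continuity_pt_comp r Rabs); [apply Cr|apply Rcontinuity_abs]. }
  set (M1 := Rabs (r ym)). assert (HM1 : 0 <= M1) by apply Rabs_pos.
  assert (Hhor : forall y, exists M, 0 <= M /\ forall x, x0 <= x <= s1 -> Cmod (D (x, y)) <= M).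
  { intros y. destruct (continuity_ab_maj (fun x => Cmod (D (x, y))) x0 s1 ltac:(lra)) as [xm [B _]].
    - intros x Hx. destruct (HD (x, y) ltac:(simpl; lra)) as [l Hl]. apply (continuity_pt_horizontal D x y l Hl).
    - exists (Cmod (D (xm, y))). split; [apply Cmod_ge_0|]. exact B. }
  destruct (Hhor (y0 - T)) as [Ma [HMa BMa]]. destruct (Hhor (y0 + T)) as [Mb [HMb BMb]].
  set (Q := 2 * T * M1 + L * (Cmod D0 * (Ma + Mb))).
  assert (HQ : 0 <= Q).
  { unfold Q, T. pose proof (Cmod_ge_0 D0). assert (0 <= Cmod D0 * (Ma + Mb)) by nra. nra. }
  (* The left side comes from |y - y0| <= dl / 2 on the left edge; the right side collects the part
     with |y - y0| >= dl and the horizontal edges. In between the integrand is nonnegative. *)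
  assert (Key : forall nu, 0 < nu -> r0 / 2 * dl * exp (- (nu * dl ^ 2 / 4)) <= Q * exp (- (nu * dl ^ 2))).
  { intros nu Hnu.
    set (Ex := fun s : C => Cexp (RtoC nu * (s - (x0, y0)) * (s - (x0, y0)))).
    (* The factor i moves the real part of interest into the imaginary part, the one that [rect_int]
       integrates along vertical sides. *)
    set (F := fun s : C => (Ci * Cconj D0 * D s * Ex s)%C).
    assert (DF : forall z, m < Re z -> exists l, cdiff F z l).
    { intros z Hz. destruct (HD z Hz) as [l Hl]. eexists. unfold F, Ex.
      apply (cdiff_mult (fun s => Ci * Cconj D0 * D s)%C).
      - apply (cdiff_mult (fun _ => (Ci * Cconj D0)%C) D); [apply cdiff_const|exact Hl].
      - apply cdiff_Cexp. apply (cdiff_mult (fun s => RtoC nu * (s - (x0, y0)))%C).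
        + apply (cdiff_mult (fun _ => RtoC nu)); [apply cdiff_const|apply cdiff_id_shift].
        + apply cdiff_id_shift. }
    set (u := fun x y => Re (F (x, y))). set (v := fun x y => Im (F (x, y))).
    assert (Hol : holo u v m).
    { intros x y Hx. destruct (DF (x, y) Hx) as [l Hl]. exists (Re l), (Im l). now apply rdiff_of_cdiff. }
    assert (Go := goursat u v m x0 (y0 - T) L (2 * T) Hol Hz0 ltac:(lra) ltac:(unfold T; lra)).
    unfold rect_int in Go. replace (x0 + L) with s1 in Go by (unfold L; ring).
    replace (y0 - T + 2 * T) with (y0 + T) in Go by ring.
    assert (Vr : forall y, v s1 y - v x0 y = - (r y * exp (- (nu * (y - y0) ^ 2)))).
    { intros y. unfold v, F. rewrite (HZ (s1, y)) by (unfold Re; simpl; lra).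
      assert (Eexp : Ex (x0, y) = RtoC (exp (- (nu * (y - y0) ^ 2)))).
      { unfold Ex. replace (RtoC nu * ((x0, y) - (x0, y0)) * ((x0, y) - (x0, y0)))%C with (RtoC (- (nu * (y - y0) ^ 2)))
          by (apply injective_projections; simpl; ring).
        unfold Cexp, RtoC, Re, Im. simpl fst; simpl snd. rewrite cos_0, sin_0, Rmult_1_r, Rmult_0_r. reflexivity. }
      rewrite Eexp. unfold r. destruct (D (x0, y)) as [p s]. destruct D0 as [p0 q0].
      unfold Re, Im, Cmult, Cconj, RtoC, Ci; simpl. ring. }
    set (b := fun y => r y * exp (- (nu * (y - y0) ^ 2))) in *.
    assert (Cb : forall y, continuous b y).
    { intros y. apply (continuous_mult r (fun y => exp (- (nu * (y - y0) ^ 2)))).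
      - apply continuity_pt_filterlim, Cr.
      - apply (ex_derive_continuous (fun y => exp (- (nu * (y - y0) ^ 2)))). auto_derive. exact I. }
    assert (Exb : forall p s, ex_RInt b p s) by (intros; apply (ex_RInt_continuous b); auto).
    assert (Eo : RInt (fun y => v s1 y - v x0 y) (y0 - T) (y0 + T) = - RInt b (y0 - T) (y0 + T)).
    { rewrite (RInt_ext _ (fun y => - b y)) by (intros; apply Vr). exact (RInt_opp b _ _ (Exb _ _)). }
    rewrite Eo in Go.
    assert (Up : Rabs (RInt (fun x => u x (y0 - T) - u x (y0 + T)) x0 s1) <= (s1 - x0) * (Cmod D0 * (Ma + Mb) * exp (- nu))).
    { apply abs_RInt_le_const; [lra| |].
      - apply (ex_RInt_minus (fun x => u x (y0 - T)) (fun x => u x (y0 + T))); apply (holo_ex_RInt_u u v m); auto; lra.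
      - intros x Hx.
        assert (Hb : forall y, (y - y0) ^ 2 = T ^ 2 -> Rabs (u x y) <= Cmod D0 * Cmod (D (x, y)) * exp (- nu)).
        { intros y Hy. unfold u. eapply Rle_trans; [apply Rabs_Re_le|]. unfold F. rewrite !Cmod_mult.
          replace (Cmod Ci) with 1.
          2:{ unfold Cmod, Ci; simpl. replace (0 * (0 * 1) + 1 * (1 * 1)) with 1 by ring. now rewrite sqrt_1. }
          rewrite Rmult_1_l. replace (Cmod (Cconj D0)) with (Cmod D0).
          2:{ unfold Cmod, Cconj; simpl. f_equal. ring. }
          apply Rmult_le_compat_l; [apply Rmult_le_pos; apply Cmod_ge_0|].
          unfold Ex. rewrite Cmod_Cexp.
          replace (Re (RtoC nu * ((x, y) - (x0, y0)) * ((x, y) - (x0, y0)))) with (nu * ((x - x0) ^ 2 - (y - y0) ^ 2)).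
          2:{ unfold Re, Cmult, Cminus, Cplus, Copp, RtoC; simpl. ring. }
          rewrite Hy. assert (nu * ((x - x0) ^ 2 - T ^ 2) <= - nu).
          { assert ((x - x0) ^ 2 <= L ^ 2) by (apply pow_incr; unfold L; lra).
            assert ((x - x0) ^ 2 - T ^ 2 <= -1) by (unfold T; nra). nra. }
          now apply exp_le. }
        pose proof (Hb (y0 - T) ltac:(ring)) as U1. pose proof (Hb (y0 + T) ltac:(ring)) as U2.
        pose proof (BMa x Hx) as B1. pose proof (BMb x Hx) as B2.
        pose proof (exp_pos (- nu)). pose proof (Cmod_ge_0 D0).
        assert (Cmod D0 * Cmod (D (x, y0 - T)) * exp (- nu) <= Cmod D0 * Ma * exp (- nu)).
        { apply Rmult_le_compat_r; [lra|]. apply Rmult_le_compat_l; lra. }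
        assert (Cmod D0 * Cmod (D (x, y0 + T)) * exp (- nu) <= Cmod D0 * Mb * exp (- nu)).
        { apply Rmult_le_compat_r; [lra|]. apply Rmult_le_compat_l; lra. }
        replace (Cmod D0 * (Ma + Mb) * exp (- nu)) with (Cmod D0 * Ma * exp (- nu) + Cmod D0 * Mb * exp (- nu)) by ring.
        apply Rabs_le_between in U1. apply Rabs_le_between in U2. apply Rabs_le. lra. }
    assert (Eb : RInt b (y0 - T) (y0 + T) <= L * (Cmod D0 * (Ma + Mb) * exp (- nu))).
    { apply Rabs_le_between in Up. unfold L. lra. }
    set (e1 := exp (- (nu * dl ^ 2))). set (e2 := exp (- (nu * dl ^ 2 / 4))).
    assert (He1 : 0 < e1) by apply exp_pos. assert (He2 : 0 < e2) by apply exp_pos.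
    assert (Far : forall y, y0 - T <= y <= y0 + T -> dl <= Rabs (y - y0) -> - M1 * e1 <= b y).
    { intros y Hy Hf. unfold b. pose proof (Bym y Hy) as B. fold M1 in B.
      assert (exp (- (nu * (y - y0) ^ 2)) <= e1).
      { unfold e1. rewrite <- (pow2_abs (y - y0)). assert (dl ^ 2 <= Rabs (y - y0) ^ 2) by (apply pow_incr; lra).
        apply exp_le. nra. }
      pose proof (exp_pos (- (nu * (y - y0) ^ 2))). apply Rabs_le_between in B. nra. }
    assert (Nonneg : forall y, Rabs (y - y0) <= dl -> 0 <= b y).
    { intros y Hy. unfold b. apply Rmult_le_pos; [pose proof (Rnear y Hy); lra|left; apply exp_pos]. }
    assert (Core : forall y, Rabs (y - y0) <= dl / 2 -> r0 / 2 * e2 <= b y).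
    { intros y Hy. unfold b. pose proof (Rnear y ltac:(lra)).
      assert (e2 <= exp (- (nu * (y - y0) ^ 2))).
      { unfold e2. rewrite <- (pow2_abs (y - y0)). assert (Rabs (y - y0) ^ 2 <= (dl / 2) ^ 2) by (apply pow_incr; split; [apply Rabs_pos|lra]).
        apply exp_le. nra. }
      apply Rmult_le_compat; lra. }
    assert (HT : dl <= T) by (unfold T; lra).
    assert (I1 := RInt_ge_const b (y0 - T) (y0 - dl) (- M1 * e1) ltac:(lra) ltac:(auto)
       ltac:(intros t Ht; apply Far; [lra|rewrite Rabs_left; lra])).
    assert (I2 := RInt_ge_const b (y0 - dl) (y0 - dl / 2) 0 ltac:(lra) ltac:(auto)
       ltac:(intros t Ht; apply Nonneg; apply Rabs_le; lra)).
    assert (I3 := RInt_ge_const b (y0 - dl / 2) (y0 + dl / 2) (r0 / 2 * e2) ltac:(lra) ltac:(auto)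
       ltac:(intros t Ht; apply Core; apply Rabs_le; lra)).
    assert (I4 := RInt_ge_const b (y0 + dl / 2) (y0 + dl) 0 ltac:(lra) ltac:(auto)
       ltac:(intros t Ht; apply Nonneg; apply Rabs_le; lra)).
    assert (I5 := RInt_ge_const b (y0 + dl) (y0 + T) (- M1 * e1) ltac:(lra) ltac:(auto)
       ltac:(intros t Ht; apply Far; [lra|rewrite Rabs_right; lra])).
    assert (Ch : forall p s t, RInt b p s + RInt b s t = RInt b p t) by (intros; apply (RInt_Chasles b); auto).
    pose proof (Ch (y0 - T) (y0 - dl) (y0 - dl / 2)). pose proof (Ch (y0 - T) (y0 - dl / 2) (y0 + dl / 2)).
    pose proof (Ch (y0 - T) (y0 + dl / 2) (y0 + dl)). pose proof (Ch (y0 - T) (y0 + dl) (y0 + T)).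
    assert (En : exp (- nu) <= e1).
    { unfold e1. assert (dl ^ 2 <= 1) by nra. apply exp_le. nra. }
    assert (L * (Cmod D0 * (Ma + Mb) * exp (- nu)) <= L * (Cmod D0 * (Ma + Mb)) * e1).
    { rewrite (Rmult_assoc L). apply Rmult_le_compat_l; [lra|]. apply Rmult_le_compat_l; [|lra].
      pose proof (Cmod_ge_0 D0). nra. }
    unfold Q. assert (0 <= M1 * e1) by nra. nra. }
  (* th is the difference of the exponents dl^2 and dl^2 / 4, and nu makes r0 / 2 * dl * (1 + nu *
     th) exceed Q. *)
  set (th := 3 / 4 * dl ^ 2). assert (Hth : 0 < th) by (unfold th; nra).
  set (nu := (Q / (r0 / 2 * dl) + 1) / th).
  assert (Hc : 0 < r0 / 2 * dl) by nra.
  assert (HQc : 0 <= Q / (r0 / 2 * dl)) by (apply Rmult_le_pos; [lra|left; now apply Rinv_0_lt_compat]).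
  assert (Hnu : 0 < nu) by (apply Rdiv_lt_0_compat; lra).
  specialize (Key nu Hnu).
  assert (K2 : r0 / 2 * dl * exp (nu * th) <= Q).
  { apply Rmult_le_reg_r with (exp (- (nu * dl ^ 2))); [apply exp_pos|]. apply Rle_trans with (2 := Key).
    rewrite Rmult_assoc, <- exp_plus. right. do 2 f_equal. unfold th. field. }
  pose proof (exp_ineq1_le (nu * th)) as K3.
  assert (E3 : nu * th = Q / (r0 / 2 * dl) + 1) by (unfold nu; field; lra).
  assert (E4 : r0 / 2 * dl * (Q / (r0 / 2 * dl)) = Q) by (field; lra).
  assert (r0 / 2 * dl * (1 + nu * th) <= r0 / 2 * dl * exp (nu * th)) by (apply Rmult_le_compat_l; lra).
  rewrite E3 in *. nra.
Qed.

(** * Mellin transforms *)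

Definition hintC (F : R -> C) : C := (hint (fun t => Re (F t)), hint (fun t => Im (F t))).

Definition domC (F : R -> C) (A : R) : Prop := dom (fun t => Re (F t)) A /\ dom (fun t => Im (F t)) A.

Lemma hintC_minus F G A B : domC F A -> domC G B ->
  domC (fun t => F t - G t)%C (A + B) /\ hintC (fun t => F t - G t)%C = (hintC F - hintC G)%C.
Proof.
  intros [F1 F2] [G1 G2]. split; [split|].
  - apply (dom_ext (fun t => Re (F t) - Re (G t))); [reflexivity|now apply dom_minus].
  - apply (dom_ext (fun t => Im (F t) - Im (G t))); [reflexivity|now apply dom_minus].
  - unfold hintC. apply injective_projections; simpl.
    + rewrite (hint_ext _ (fun t => Re (F t) - Re (G t))) by reflexivity. now apply (hint_minus _ _ A B).
    + rewrite (hint_ext _ (fun t => Im (F t) - Im (G t))) by reflexivity. now apply (hint_minus _ _ A B).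
Qed.

Lemma hintC_scal F A c : domC F A ->
  domC (fun t => c * F t)%C ((Rabs (Re c) + Rabs (Im c)) * A) /\ hintC (fun t => c * F t)%C = (c * hintC F)%C.
Proof.
  intros [F1 F2]. split; [split|].
  - apply (dom_ext (fun t => Re c * Re (F t) - Im c * Im (F t))); [reflexivity|].
    rewrite Rmult_plus_distr_r. apply dom_minus; now apply dom_scal.
  - apply (dom_ext (fun t => Im c * Re (F t) + Re c * Im (F t))); [intros; unfold Re, Im, Cmult; simpl; ring|].
    rewrite Rplus_comm, Rmult_plus_distr_r. apply dom_plus; now apply dom_scal.
  - unfold hintC. apply injective_projections; simpl.
    + rewrite (hint_ext _ (fun t => Re c * Re (F t) - Im c * Im (F t))) by reflexivity.
      rewrite (hint_minus _ _ _ _ (dom_scal _ _ (Re c) F1) (dom_scal _ _ (Im c) F2)).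
      now rewrite (hint_scal _ _ _ F1), (hint_scal _ _ _ F2).
    + rewrite (hint_ext _ (fun t => Re c * Im (F t) + Im c * Re (F t))) by reflexivity.
      rewrite (hint_plus _ _ _ _ (dom_scal _ _ (Re c) F2) (dom_scal _ _ (Im c) F1)).
      now rewrite (hint_scal _ _ _ F1), (hint_scal _ _ _ F2).
Qed.

Lemma hintC_bound F A : domC F A -> Cmod (hintC F) <= 2 * A * PI.
Proof.
  intros [F1 F2]. eapply Rle_trans; [apply Cmod_le_sum|]. change (Rabs (hint (fun t => Re (F t))) + Rabs (hint (fun t => Im (F t))) <= 2 * A * PI).
  pose proof (hint_bound _ _ F1). pose proof (hint_bound _ _ F2). lra.
Qed.

Lemma domC_of_Cmod F A :
  (forall t, 0 < t -> continuous (fun t => Re (F t)) t) -> (forall t, 0 < t -> continuous (fun t => Im (F t)) t) ->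
  (forall t, 0 < t -> Cmod (F t) <= A * wt t) -> domC F A.
Proof.
  intros H1 H2 H. split; split; auto; intros t Ht.
  - eapply Rle_trans; [apply Rabs_Re_le|auto].
  - eapply Rle_trans; [apply Rabs_Im_le|auto].
Qed.

Definition tpow (z : C) (t : R) : C :=
  (exp (Re z * ln t) * cos (Im z * ln t), exp (Re z * ln t) * sin (Im z * ln t)).

Lemma tpow_Cexp z t : tpow z t = Cexp (z * RtoC (ln t)).
Proof.
  unfold tpow, Cexp. destruct z as [a b]. unfold Re, Im, Cmult, RtoC; simpl.
  replace (a * ln t - b * 0) with (a * ln t) by ring. replace (a * 0 + b * ln t) with (b * ln t) by ring. reflexivity.
Qed.

Lemma Cmod_tpow z t : Cmod (tpow z t) = exp (Re z * ln t).
Proof.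
  rewrite tpow_Cexp, Cmod_Cexp. f_equal. destruct z as [a b]. unfold Re, Cmult, RtoC; simpl. ring.
Qed.

Lemma tpow_mult z s t : 0 < s -> 0 < t -> tpow z (s * t) = (tpow z s * tpow z t)%C.
Proof.
  intros Hs Ht. rewrite !tpow_Cexp, ln_mult, <- Cexp_plus by auto. f_equal. rewrite RtoC_plus. ring.
Qed.

Lemma tpow_plus z w t : tpow (z + w) t = (tpow z t * tpow w t)%C.
Proof. rewrite !tpow_Cexp, <- Cexp_plus. f_equal. ring. Qed.

Lemma continuous_tpow (w : R -> R) z t : 0 < t -> continuous w t ->
  continuous (fun t => Re (RtoC (w t) * tpow z t)) t /\ continuous (fun t => Im (RtoC (w t) * tpow z t)) t.
Proof.
  intros Ht Hw. split.
  - apply (continuous_ext (fun t => w t * (exp (Re z * ln t) * cos (Im z * ln t)))).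
    { intros s. unfold tpow, Cmult, RtoC, Re, Im; simpl. eqR. ring. }
    apply (continuous_mult w (fun t => exp (Re z * ln t) * cos (Im z * ln t))); [exact Hw|].
    apply (ex_derive_continuous (fun t => exp (Re z * ln t) * cos (Im z * ln t))). auto_derive. repeat split; auto.
  - apply (continuous_ext (fun t => w t * (exp (Re z * ln t) * sin (Im z * ln t)))).
    { intros s. unfold tpow, Cmult, RtoC, Re, Im; simpl. eqR. ring. }
    apply (continuous_mult w (fun t => exp (Re z * ln t) * sin (Im z * ln t))); [exact Hw|].
    apply (ex_derive_continuous (fun t => exp (Re z * ln t) * sin (Im z * ln t))). auto_derive. repeat split; auto.
Qed.

Lemma exp_ln_half t : 0 < t -> exp (- (/ 2) * ln t) = / sqrt t.
Proof.
  intros Ht. pose proof (sqrt_lt_R0 t Ht) as S0.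
  replace t with (sqrt t * sqrt t) at 1 by (apply sqrt_sqrt; lra).
  rewrite ln_mult by auto. replace (- / 2 * (ln (sqrt t) + ln (sqrt t))) with (- ln (sqrt t)) by field.
  rewrite exp_Ropp, exp_ln by auto. reflexivity.
Qed.

Lemma exp_ln_nat n t : 0 < t -> exp (INR n * ln t) = t ^ n.
Proof. intros Ht. now rewrite exp_INR_mult, exp_ln. Qed.

(** [wt] allows t^(-1/2) at the origin, so a real part of at least -1/4 leaves the margin exp (|ln
    t| / 8), which absorbs logarithms and small shifts of z. The strip left of 0 makes z = 0, that
    is s = -k, an interior point. *)
Lemma mellin_weight sg : -1 / 4 <= sg -> exists A, 0 < A /\ forall t, 0 < t ->
  exp (sg * ln t + Rabs (ln t) / 8) * exp (- (t / 4)) <= A * wt t.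
Proof.
  intros Hsg. destruct (INR_archimed 1 (sg + 1) Rlt_0_1) as [N HN]. rewrite Rmult_1_r in HN.
  destruct (exp_le_wt (/ 8) ltac:(lra)) as [A [HA HE]].
  set (M := (INR N / / 8) ^ N).
  assert (HM : 0 <= M) by (apply pow_le; apply Rmult_le_pos; [apply pos_INR|lra]).
  assert (E4 : forall t, 0 < t -> (1 + t) * exp (- (t / 4)) <= 5).
  { intros t Ht. pose proof (pow_exp_bound 1 (/ 4) t ltac:(lra) ltac:(lra)) as B.
    rewrite pow_1 in B. replace ((INR 1 / / 4) ^ 1) with 4 in B by (simpl; field). replace (/ 4 * t) with (t / 4) in B by field.
    assert (exp (- (t / 4)) <= 1) by (rewrite <- exp_0; left; apply exp_increasing; lra). lra. }
  exists (5 + A + M * A). split; [nra|]. intros t Ht. pose proof (sqrt_lt_R0 t Ht) as S0.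
  pose proof (exp_pos (- (t / 4))) as P4. pose proof (wt_pos t Ht) as Pw.
  assert (B1 : exp (sg * ln t + Rabs (ln t) / 8) <= / sqrt t + 1 + t ^ N).
  { assert (0 < / sqrt t) by now apply Rinv_0_lt_compat. assert (0 < t ^ N) by now apply pow_lt.
    destruct (Rle_dec 0 (ln t)) as [Hl|Hl].
    - rewrite Rabs_right by lra. apply Rle_trans with (t ^ N); [|lra]. rewrite <- exp_ln_nat by auto.
      apply exp_le. nra.
    - rewrite Rabs_left by lra. apply Rle_trans with (/ sqrt t); [|lra]. rewrite <- exp_ln_half by auto.
      apply exp_le. nra. }
  assert (B2 : / sqrt t * exp (- (t / 4)) <= 5 * wt t).
  { unfold wt. replace (/ (sqrt t * (1 + t))) with (/ sqrt t * / (1 + t)) by (field; lra).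
    replace (5 * (/ sqrt t * / (1 + t))) with (/ sqrt t * (5 * / (1 + t))) by ring.
    apply Rmult_le_compat_l; [left; now apply Rinv_0_lt_compat|].
    apply Rmult_le_reg_r with (1 + t); [lra|]. rewrite Rmult_assoc, Rinv_l by lra. specialize (E4 t Ht). lra. }
  assert (Es : exp (- (t / 4)) = exp (- (/ 8 * t)) * exp (- (/ 8 * t))) by (rewrite <- exp_plus; f_equal; field).
  pose proof (exp_pos (- (/ 8 * t))) as P8.
  assert (L8 : exp (- (/ 8 * t)) <= 1) by (rewrite <- exp_0; left; apply exp_increasing; lra).
  specialize (HE t Ht).
  assert (B3 : exp (- (t / 4)) <= A * wt t) by (rewrite Es; nra).
  assert (B4 : t ^ N * exp (- (t / 4)) <= M * (A * wt t)).
  { rewrite Es, <- Rmult_assoc. apply Rmult_le_compat; try lra.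
    - apply Rmult_le_pos; [apply pow_le; lra|lra].
    - apply pow_exp_bound; lra. }
  apply Rle_trans with ((/ sqrt t + 1 + t ^ N) * exp (- (t / 4))); [apply Rmult_le_compat_r; lra|]. nra.
Qed.

(** The Mellin transform with t^z in place of t^(z-1): for exp (-t) it is Gamma (z + 1). *)
Definition Mel (w : R -> R) (z : C) : C := hintC (fun t => RtoC (w t) * tpow z t)%C.

Definition mellinable (w : R -> R) : Prop :=
  (forall t, 0 < t -> continuous w t) /\ exists A, 0 <= A /\ forall t, 0 < t -> Rabs (w t) <= A * exp (- (t / 4)).

Lemma mellin_dom w z : mellinable w -> -1 / 4 <= Re z ->
  (exists A, domC (fun t => RtoC (w t) * tpow z t)%C A) /\ (exists A, domC (fun t => RtoC (w t * ln t) * tpow z t)%C A).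
Proof.
  intros [Hc [A [HA HB]]] Hz. destruct (mellin_weight (Re z) Hz) as [K [HK HW]].
  split; [exists (A * K)|exists (8 * A * K)]; apply domC_of_Cmod.
  - intros t Ht. apply continuous_tpow; auto.
  - intros t Ht. apply continuous_tpow; auto.
  - intros t Ht. rewrite Cmod_mult, Cmod_R, Cmod_tpow. specialize (HB t Ht). specialize (HW t Ht).
    pose proof (exp_pos (- (t / 4))). rewrite exp_plus in HW.
    assert (1 <= exp (Rabs (ln t) / 8)).
    { pose proof (exp_ineq1_le (Rabs (ln t) / 8)). pose proof (Rabs_pos (ln t)). lra. }
    pose proof (exp_pos (Re z * ln t)).
    apply Rle_trans with (A * exp (- (t / 4)) * exp (Re z * ln t)); [apply Rmult_le_compat_r; lra|].
    rewrite !Rmult_assoc. apply Rmult_le_compat_l; [lra|]. apply Rle_trans with (2 := HW).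
    rewrite (Rmult_comm (exp (- (t / 4)))). apply Rmult_le_compat_r; [lra|]. nra.
  - intros t Ht. apply (continuous_tpow (fun t => w t * ln t)); auto.
    apply (continuous_mult w ln); auto. apply (ex_derive_continuous ln). auto_derive. exact Ht.
  - intros t Ht. apply (continuous_tpow (fun t => w t * ln t)); auto.
    apply (continuous_mult w ln); auto. apply (ex_derive_continuous ln). auto_derive. exact Ht.
  - intros t Ht. rewrite Cmod_mult, Cmod_R, Cmod_tpow, Rabs_mult. specialize (HB t Ht). specialize (HW t Ht).
    pose proof (exp_pos (- (t / 4))). rewrite exp_plus in HW.
    assert (Rabs (ln t) <= 8 * exp (Rabs (ln t) / 8)).
    { pose proof (exp_ineq1_le (Rabs (ln t) / 8)). lra. }
    pose proof (exp_pos (Re z * ln t)). pose proof (Rabs_pos (w t)). pose proof (Rabs_pos (ln t)).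
    apply Rle_trans with (A * exp (- (t / 4)) * (8 * exp (Rabs (ln t) / 8)) * exp (Re z * ln t)).
    + apply Rmult_le_compat_r; [lra|]. apply Rmult_le_compat; lra.
    + replace (A * exp (- (t / 4)) * (8 * exp (Rabs (ln t) / 8)) * exp (Re z * ln t))
        with (8 * A * (exp (Re z * ln t) * exp (Rabs (ln t) / 8) * exp (- (t / 4)))) by ring.
      rewrite (Rmult_assoc (8 * A)). apply Rmult_le_compat_l; lra.
Qed.

(** The remainder of exp (h ln t) is at most 4 |h|^2 (ln t)^2 exp (|h| |ln t|). For |h| < 1 / 16 the
    last factor uses half of the margin exp (|ln t| / 8) and the squared logarithm the other
    half. *)
Theorem cdiff_Mel w (z : C) : mellinable w -> -1 / 4 < Re z -> cdiff (Mel w) z (Mel (fun t => w t * ln t) z).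
Proof.
  intros Hw Hz. assert (Hw' := Hw). destruct Hw' as [Hc [A [HA HB]]].
  destruct (mellin_weight (Re z) ltac:(lra)) as [K [HK HW]].
  set (M := 2 * (A * (4 * 1024) * K) * PI + 1).
  pose proof PI_RGT_0 as HP.
  assert (HM : 0 < M).
  { unfold M. assert (0 <= A * (4 * 1024) * K) by (apply Rmult_le_pos; lra). nra. }
  apply cdiff_quadratic with M (Rmin (/ 16) (Re z + 1 / 4)); [apply Rmin_pos; lra|exact HM|].
  intros h Hh. assert (H1 := Rlt_le_trans _ _ _ Hh (Rmin_l _ _)). assert (H2 := Rlt_le_trans _ _ _ Hh (Rmin_r _ _)).
  assert (Hzh : -1 / 4 <= Re (z + h)%C).
  { pose proof (Rabs_Re_le h) as B. apply Rabs_le_between in B. unfold Re, Cplus in *; simpl in *. lra. }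
  destruct (mellin_dom w z Hw ltac:(lra)) as [[A0 D0] [A1 D1]].
  destruct (mellin_dom w (z + h)%C Hw Hzh) as [[A2 D2] _].
  destruct (hintC_scal _ _ h D1) as [E1 F1]. destruct (hintC_minus _ _ _ _ D2 D0) as [E2 F2].
  destruct (hintC_minus _ _ _ _ E2 E1) as [E3 F3].
  unfold Mel. rewrite <- F1, <- F2, <- F3.
  pose proof (Cmod_ge_0 h) as Ph.
  apply Rle_trans with (2 * (A * (4 * 1024) * K * Cmod h ^ 2) * PI).
  - apply hintC_bound. destruct E3 as [E3a E3b]. apply domC_of_Cmod; [apply E3a|apply E3b|].
    intros t Ht.
    replace (RtoC (w t) * tpow (z + h) t - RtoC (w t) * tpow z t - h * (RtoC (w t * ln t) * tpow z t))%C
      with (RtoC (w t) * tpow z t * (Cexp (h * RtoC (ln t)) - 1 - h * RtoC (ln t)))%C.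
    2:{ rewrite tpow_plus, (tpow_Cexp h), RtoC_mult. ring. }
    rewrite !Cmod_mult, Cmod_R, Cmod_tpow.
    specialize (HB t Ht). specialize (HW t Ht). rewrite exp_plus in HW.
    assert (Q : Cmod (Cexp (h * RtoC (ln t)) - 1 - h * RtoC (ln t)) <= 4 * 1024 * Cmod h ^ 2 * exp (Rabs (ln t) / 8)).
    { eapply Rle_trans; [apply Cexp_quad|]. rewrite Cmod_mult, Cmod_R. set (y := Rabs (ln t)).
      assert (Hy : 0 <= y) by apply Rabs_pos.
      (* The square of y <= 32 exp (y / 32). *)
      assert (Y2 : y ^ 2 <= 1024 * exp (y / 16)).
      { pose proof (exp_ineq1_le (y / 32)) as B. assert (E : exp (y / 16) = exp (y / 32) * exp (y / 32)) by (rewrite <- exp_plus; f_equal; field).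
        rewrite E. assert ((1 + y / 32) * (1 + y / 32) <= exp (y / 32) * exp (y / 32)) by (apply Rmult_le_compat; lra). nra. }
      assert (X : exp (Cmod h * y) <= exp (y / 16)).
      { apply exp_le. nra. }
      assert (E : exp (y / 8) = exp (y / 16) * exp (y / 16)) by (rewrite <- exp_plus; f_equal; field).
      rewrite Rpow_mult_distr, E. pose proof (exp_pos (y / 16)). pose proof (exp_pos (Cmod h * y)).
      assert (0 <= Cmod h ^ 2) by nra.
      assert (y ^ 2 * exp (Cmod h * y) <= 1024 * exp (y / 16) * exp (y / 16)) by (apply Rmult_le_compat; nra).
      replace (4 * (Cmod h ^ 2 * y ^ 2) * exp (Cmod h * y)) with (4 * Cmod h ^ 2 * (y ^ 2 * exp (Cmod h * y))) by ring.
      replace (4 * 1024 * Cmod h ^ 2 * (exp (y / 16) * exp (y / 16))) with (4 * Cmod h ^ 2 * (1024 * exp (y / 16) * exp (y / 16))) by ring.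
      apply Rmult_le_compat_l; lra. }
    pose proof (exp_pos (Re z * ln t)). pose proof (Rabs_pos (w t)). pose proof (exp_pos (- (t / 4))).
    apply Rle_trans with (A * exp (- (t / 4)) * exp (Re z * ln t) * (4 * 1024 * Cmod h ^ 2 * exp (Rabs (ln t) / 8))).
    + apply Rmult_le_compat; [apply Rmult_le_pos; lra|apply Cmod_ge_0|apply Rmult_le_compat_r; lra|exact Q].
    + replace (A * exp (- (t / 4)) * exp (Re z * ln t) * (4 * 1024 * Cmod h ^ 2 * exp (Rabs (ln t) / 8)))
        with (A * (4 * 1024) * Cmod h ^ 2 * (exp (Re z * ln t) * exp (Rabs (ln t) / 8) * exp (- (t / 4)))) by ring.
      replace (A * (4 * 1024) * K * Cmod h ^ 2 * wt t) with (A * (4 * 1024) * Cmod h ^ 2 * (K * wt t)) by ring.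
      apply Rmult_le_compat_l; [|lra]. apply Rmult_le_pos; [lra|nra].
  - unfold M. assert (0 <= Cmod h ^ 2) by nra. nra.
Qed.

Lemma Mel_real w (n : nat) : mellinable w -> Mel w (RtoC (INR n)) = RtoC (hint (fun t => t ^ n * w t)).
Proof.
  intros Hw. unfold Mel, hintC, RtoC. apply injective_projections; simpl.
  - apply hint_ext. intros t Ht. unfold tpow, Cmult, Re, Im; simpl fst; simpl snd.
    rewrite exp_ln_nat by auto. rewrite !Rmult_0_l, cos_0, ?sin_0. ring.
  - transitivity (hint (fun _ => 0)); [|apply hint_zero]. apply hint_ext. intros t Ht. unfold tpow, Cmult, Re, Im; simpl.
    rewrite !Rmult_0_l, sin_0. ring.
Qed.

(** * Moments of exp (-t), with and without a logarithm *)

Lemma mellinable_exp : mellinable (fun t => exp (- t)).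
Proof.
  split.
  - intros t _. apply (ex_derive_continuous (fun t => exp (- t))). auto_derive. exact I.
  - exists 1. split; [lra|]. intros t Ht. rewrite Rabs_right by (left; apply exp_pos).
    rewrite Rmult_1_l. left. apply exp_increasing. lra.
Qed.

Lemma dom_mono_exp n : exists A, dom (fun t => t ^ n * exp (- t)) A.
Proof.
  destruct (mellin_dom _ (RtoC (INR n)) mellinable_exp) as [[A [D _]] _].
  { unfold Re, RtoC; simpl. pose proof (pos_INR n). lra. }
  exists A. apply (dom_ext _ _ _ ) with (2 := D). intros t Ht. unfold tpow, Cmult, RtoC, Re, Im; simpl.
  rewrite exp_ln_nat by auto. rewrite !Rmult_0_l, cos_0, ?sin_0. ring.
Qed.

Lemma dom_mono_exp_ln n : exists A, dom (fun t => t ^ n * exp (- t) * ln t) A.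
Proof.
  destruct (mellin_dom _ (RtoC (INR n)) mellinable_exp) as [_ [A [D _]]].
  { unfold Re, RtoC; simpl. pose proof (pos_INR n). lra. }
  exists A. apply (dom_ext _ _ _ ) with (2 := D). intros t Ht. unfold tpow, Cmult, RtoC, Re, Im; simpl.
  rewrite exp_ln_nat by auto. rewrite !Rmult_0_l, cos_0, ?sin_0. ring.
Qed.

Lemma lim_pow_exp n : is_lim_seq (fun m => INR (S m) ^ n * exp (- INR (S m))) 0.
Proof.
  apply is_lim_seq_le_le with (fun _ => 0) (fun m => (INR (S n)) ^ (S n) * / INR (S m)).
  - intros m. pose proof (INR_S_pos m) as H. split.
    + apply Rmult_le_pos; [apply pow_le; lra|left; apply exp_pos].
    + pose proof (pow_exp_bound (S n) 1 (INR (S m)) Rlt_0_1 ltac:(lra)) as B.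
      rewrite Rmult_1_l, <- tech_pow_Rmult in B. unfold Rdiv in B. rewrite Rinv_1, Rmult_1_r in B.
      apply Rmult_le_reg_r with (INR (S m)); [lra|]. rewrite Rmult_assoc, (Rmult_assoc _ (/ _)), Rinv_l, Rmult_1_r by lra. lra.
  - apply is_lim_seq_const.
  - replace (Finite 0) with (Rbar_mult ((INR (S n)) ^ (S n)) 0) by (simpl; f_equal; ring).
    apply is_lim_seq_scal_l, lim_inv_INR_S.
Qed.

Lemma lim_inv_continuous (f : R -> R) : continuity_pt f 0 -> is_lim_seq (fun m => f (/ INR (S m))) (f 0).
Proof. intros H. apply is_lim_seq_continuous; [exact H|exact lim_inv_INR_S]. Qed.

Lemma hint_exp : hint (fun t => exp (- t)) = 1.
Proof.
  destruct (dom_mono_exp 0) as [A D].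
  assert (D' : dom (fun t => exp (- t)) A) by (apply (dom_ext _ _ _) with (2 := D); intros; simpl; ring).
  rewrite (hint_FTC _ (fun t => - exp (- t)) A (- exp (- 0)) (- 0) D').
  - rewrite Ropp_0, exp_0. ring.
  - intros t _. auto_derive; [exact I|ring].
  - apply (lim_inv_continuous (fun t => - exp (- t))).
    apply continuity_pt_filterlim, (ex_derive_continuous (fun t => - exp (- t))). auto_derive. exact I.
  - apply (is_lim_seq_opp _ 0). apply is_lim_seq_ext with (fun m => INR (S m) ^ 0 * exp (- INR (S m))); [|apply lim_pow_exp].
    intros n. rewrite pow_O. ring.
Qed.

Lemma hint_mono_exp_step n : hint (fun t => t ^ (S n) * exp (- t)) = INR (S n) * hint (fun t => t ^ n * exp (- t)).
Proof.
  destruct (dom_mono_exp n) as [A D]. destruct (dom_mono_exp (S n)) as [B E].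
  apply Rminus_diag_uniq. rewrite <- (hint_scal _ _ _ D), <- (hint_minus _ _ _ _ E (dom_scal _ _ _ D)).
  rewrite (hint_FTC _ (fun t => - (t ^ S n * exp (- t))) _ (- (0 ^ S n * exp (- 0))) (- 0) (dom_minus _ _ _ _ E (dom_scal _ _ _ D))).
  - rewrite pow_i by lia. ring.
  - intros t _. evar_last.
    + apply (is_derive_opp (fun t => t ^ S n * exp (- t))).
      apply (is_derive_mult (fun t => t ^ S n) (fun t => exp (- t))).
      * apply (is_derive_pow (fun t => t) (S n)). apply is_derive_id.
      * auto_derive; [exact I|reflexivity].
      * intros; apply Rmult_comm.
    + unfold opp, plus, mult, one; cbn -[INR pow]. unfold one; cbn -[INR pow]. simpl Init.Nat.pred. ring.
  - apply (lim_inv_continuous (fun t => - (t ^ S n * exp (- t)))).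
    apply continuity_pt_filterlim, (ex_derive_continuous (fun t => - (t ^ S n * exp (- t)))). auto_derive. exact I.
  - apply (is_lim_seq_opp _ 0), lim_pow_exp.
Qed.

Lemma hint_mono_exp n : hint (fun t => t ^ n * exp (- t)) = INR (fact n).
Proof.
  induction n as [|n IH].
  - rewrite (hint_ext _ (fun t => exp (- t))) by (intros; simpl; ring). rewrite hint_exp. reflexivity.
  - rewrite hint_mono_exp_step, IH. change (fact (S n)) with (S n * fact n)%nat. now rewrite mult_INR.
Qed.

Lemma lim_x_ln n : is_lim_seq (fun m => (/ INR (S m)) ^ (S n) * exp (- / INR (S m)) * ln (/ INR (S m))) 0.
Proof.
  apply is_lim_seq_abs_0.
  apply is_lim_seq_le_le with (fun _ => 0) (fun m => 2 * / sqrt (INR (S m))).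
  - intros m. split; [apply Rabs_pos|]. pose proof (INR_S_ge1 m) as H. set (N := INR (S m)) in *.
    assert (0 < / N <= 1) by (split; [apply Rinv_0_lt_compat; lra|rewrite <- Rinv_1; apply Rinv_le_contravar; lra]).
    pose proof (sqrt_lt_R0 N ltac:(lra)) as S0. pose proof (sqrt_sqrt N ltac:(lra)) as SS.
    assert (L : 0 <= ln N <= 2 * sqrt N).
    { split; [rewrite <- ln_1; destruct (Req_dec N 1) as [->|]; [lra|left; apply ln_increasing; lra]|].
      rewrite <- SS at 1. rewrite ln_mult by auto. pose proof (ln_le_sub1 _ S0). lra. }
    rewrite !Rabs_mult, (Rabs_right (exp _)) by (left; apply exp_pos). rewrite ln_Rinv, Rabs_Ropp by lra.
    rewrite (Rabs_right (ln N)), (Rabs_right ((/ N) ^ S n)) by (try (apply Rle_ge, pow_le); lra).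
    assert ((/ N) ^ S n <= / N).
    { rewrite <- tech_pow_Rmult. rewrite <- (Rmult_1_r (/ N)) at 3. apply Rmult_le_compat_l; [lra|].
      rewrite <- (pow1 n). apply pow_incr. lra. }
    assert (0 <= (/ N) ^ S n) by (apply pow_le; lra).
    assert (exp (- / N) <= 1) by (rewrite <- exp_0; left; apply exp_increasing; lra). pose proof (exp_pos (- / N)).
    apply Rle_trans with (/ N * 1 * (2 * sqrt N)).
    + apply Rmult_le_compat; try lra; [apply Rmult_le_pos; lra|]. apply Rmult_le_compat; lra.
    + right. rewrite <- SS at 1. field. lra.
  - apply is_lim_seq_const.
  - replace (Finite 0) with (Rbar_mult 2 0) by (simpl; f_equal; ring). apply is_lim_seq_scal_l, lim_inv_sqrt_INR.
Qed.

Lemma lim_pow_exp_ln n : is_lim_seq (fun m => INR (S m) ^ n * exp (- INR (S m)) * ln (INR (S m))) 0.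
Proof.
  apply is_lim_seq_le_le with (fun _ => 0) (fun m => INR (S m) ^ (S n) * exp (- INR (S m))).
  - intros m. pose proof (INR_S_ge1 m) as H. set (N := INR (S m)) in *.
    assert (0 <= ln N <= N).
    { split; [rewrite <- ln_1; destruct (Req_dec N 1) as [->|]; [lra|left; apply ln_increasing; lra]|].
      pose proof (ln_le_sub1 N ltac:(lra)). lra. }
    assert (0 <= N ^ n * exp (- N)) by (apply Rmult_le_pos; [apply pow_le; lra|left; apply exp_pos]).
    split; [apply Rmult_le_pos; lra|]. rewrite <- tech_pow_Rmult.
    replace (N * N ^ n * exp (- N)) with (N ^ n * exp (- N) * N) by ring. apply Rmult_le_compat_l; lra.
  - apply is_lim_seq_const.
  - apply lim_pow_exp.
Qed.

(** Integration by parts; the derivative of the logarithm contributes the plain moment n!. *)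
Lemma hint_exp_ln_step n :
  hint (fun t => t ^ (S n) * exp (- t) * ln t) = INR (S n) * hint (fun t => t ^ n * exp (- t) * ln t) + INR (fact n).
Proof.
  destruct (dom_mono_exp_ln n) as [A D]. destruct (dom_mono_exp_ln (S n)) as [B E]. destruct (dom_mono_exp n) as [F G].
  rewrite <- hint_mono_exp. apply Rminus_diag_uniq.
  rewrite <- (hint_scal _ _ _ D), <- (hint_plus _ _ _ _ (dom_scal _ _ _ D) G).
  assert (DD := dom_minus _ _ _ _ E (dom_plus _ _ _ _ (dom_scal _ _ (INR (S n)) D) G)).
  rewrite <- (hint_minus _ _ _ _ E (dom_plus _ _ _ _ (dom_scal _ _ (INR (S n)) D) G)).
  rewrite (hint_FTC _ (fun t => - (t ^ S n * exp (- t) * ln t)) _ (- 0) (- 0) DD).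
  - ring.
  - intros t Ht. evar_last.
    + apply (is_derive_opp (fun t => t ^ S n * exp (- t) * ln t)).
      apply (is_derive_mult (fun t => t ^ S n * exp (- t)) ln).
      * apply (is_derive_mult (fun t => t ^ S n) (fun t => exp (- t))).
        -- apply (is_derive_pow (fun t => t) (S n)). apply is_derive_id.
        -- auto_derive; [exact I|reflexivity].
        -- intros; apply Rmult_comm.
      * apply is_derive_Reals, derivable_pt_lim_ln, Ht.
      * intros; apply Rmult_comm.
    + unfold opp, plus, mult, one; cbn -[INR pow ln]. unfold one; cbn -[INR pow ln]. simpl Init.Nat.pred.
      rewrite <- tech_pow_Rmult. field. lra.
  - apply (is_lim_seq_opp _ 0), lim_x_ln.
  - apply (is_lim_seq_opp _ 0), lim_pow_exp_ln.
Qed.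

(** Repeated integration by parts writes the logarithmic moment against t^(n+1) exp (-t) as (n+1)!
    (J + H_(n+1)). That density concentrates near n + 1, so J + H_(n+1) - ln (n+1) tends to 0. *)
Theorem hint_exp_ln : hint (fun t => exp (- t) * ln t) = - euler_gamma.
Proof.
  set (J := hint (fun t => exp (- t) * ln t)).
  assert (J0 : hint (fun t => t ^ 0 * exp (- t) * ln t) = J) by (apply hint_ext; intros; simpl; ring).
  assert (Jn : forall n, hint (fun t => t ^ (S n) * exp (- t) * ln t) = INR (fact (S n)) * (J + harm n)).
  { induction n as [|n IH].
    - rewrite hint_exp_ln_step, J0. unfold harm. rewrite sum_O. simpl. field.
    - rewrite hint_exp_ln_step, IH. unfold harm. rewrite sum_n_S. change (fact (S (S n))) with (S (S n) * fact (S n))%nat.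
      rewrite mult_INR. pose proof (INR_S_pos (S n)). field. lra. }
  (* the tangent inequalities of ln at n+1, integrated against t^(n+1) e^(-t) *)
  assert (Bd : forall n, ln (INR (S n)) <= J + harm n <= ln (INR (S n)) + / INR (S n)).
  { intros n. pose proof (INR_S_pos n) as HN. set (N := INR (S n)) in *.
    assert (HF : 0 < INR (fact (S n))) by apply lt_0_INR, lt_O_fact.
    destruct (dom_mono_exp_ln (S n)) as [A D]. destruct (dom_mono_exp (S n)) as [B E].
    destruct (dom_mono_exp n) as [A1 E1]. destruct (dom_mono_exp (S (S n))) as [A2 E2].
    assert (Fn : INR (fact (S n)) = N * INR (fact n)) by (change (fact (S n)) with (S n * fact n)%nat; apply mult_INR).
    assert (Fn2 : INR (fact (S (S n))) = (N + 1) * INR (fact (S n))).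
    { change (fact (S (S n))) with (S (S n) * fact (S n))%nat. rewrite mult_INR, S_INR. reflexivity. }
    assert (Hf0 : 0 < INR (fact n)) by apply lt_0_INR, lt_O_fact.
    split; apply Rmult_le_reg_l with (INR (fact (S n))); auto; rewrite <- Jn.
    - assert (DD := dom_minus _ _ _ _ (dom_scal _ _ (ln N + 1) E) (dom_scal _ _ N E1)).
      apply Rle_trans with (hint (fun t => (ln N + 1) * (t ^ S n * exp (- t)) - N * (t ^ n * exp (- t)))).
      + rewrite (hint_minus _ _ _ _ (dom_scal _ _ (ln N + 1) E) (dom_scal _ _ N E1)).
        rewrite (hint_scal _ _ _ E), (hint_scal _ _ _ E1), !hint_mono_exp. rewrite Fn. right. ring.
      + apply (hint_le _ _ _ _ DD D). intros t Ht.
        assert (0 < t ^ n * exp (- t)) by (apply Rmult_lt_0_compat; [now apply pow_lt|apply exp_pos]).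
        assert (T : 1 - / (t / N) <= ln (t / N)) by (apply ln_ge_1_sub_inv, Rdiv_lt_0_compat; lra).
        replace (ln (t / N)) with (ln t - ln N) in T by (unfold Rdiv; rewrite ln_mult, ln_Rinv by (auto; now apply Rinv_0_lt_compat); ring).
        replace (/ (t / N)) with (N / t) in T by (field; lra).
        rewrite <- tech_pow_Rmult.
        replace ((ln N + 1) * (t * t ^ n * exp (- t)) - N * (t ^ n * exp (- t)))
          with (t ^ n * exp (- t) * (t * (ln N + 1 - N / t))) by (field; lra).
        replace (t * t ^ n * exp (- t) * ln t) with (t ^ n * exp (- t) * (t * ln t)) by ring.
        apply Rmult_le_compat_l; [lra|]. apply Rmult_le_compat_l; lra.
    - assert (DD := dom_plus _ _ _ _ (dom_scal _ _ (ln N - 1) E) (dom_scal _ _ (/ N) E2)).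
      apply Rle_trans with (hint (fun t => (ln N - 1) * (t ^ S n * exp (- t)) + / N * (t ^ S (S n) * exp (- t)))).
      + apply (hint_le _ _ _ _ D DD). intros t Ht.
        assert (0 < t ^ S n * exp (- t)) by (apply Rmult_lt_0_compat; [now apply pow_lt|apply exp_pos]).
        assert (T : ln (t / N) <= t / N - 1) by (apply ln_le_sub1, Rdiv_lt_0_compat; lra).
        replace (ln (t / N)) with (ln t - ln N) in T by (unfold Rdiv; rewrite ln_mult, ln_Rinv by (auto; now apply Rinv_0_lt_compat); ring).
        rewrite <- (tech_pow_Rmult t (S n)).
        replace ((ln N - 1) * (t ^ S n * exp (- t)) + / N * (t * t ^ S n * exp (- t)))
          with (t ^ S n * exp (- t) * (ln N - 1 + t / N)) by (field; lra).
        apply Rmult_le_compat_l; lra.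
      + rewrite (hint_plus _ _ _ _ (dom_scal _ _ (ln N - 1) E) (dom_scal _ _ (/ N) E2)).
        rewrite (hint_scal _ _ _ E), (hint_scal _ _ _ E2), !hint_mono_exp. rewrite Fn2. right. field. lra. }
  assert (L1 : is_lim_seq (fun n => J + (harm n - ln (INR (S n)))) (J + euler_gamma)).
  { apply is_lim_seq_plus'; [apply is_lim_seq_const|apply euler_gamma_lim]. }
  assert (L2 : is_lim_seq (fun n => J + (harm n - ln (INR (S n)))) 0).
  { apply is_lim_seq_le_le with (fun _ => 0) (fun n => / INR (S n)).
    - intros n. specialize (Bd n). lra.
    - apply is_lim_seq_const.
    - exact lim_inv_INR_S. }
  apply is_lim_seq_unique in L1. apply is_lim_seq_unique in L2. rewrite L1 in L2. injection L2. lra.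
Qed.

(** * Values of the L-function *)

Lemma Re_sum_n (a : nat -> C) n : Re (sum_n a n) = sum_n (fun i => Re (a i)) n.
Proof.
  induction n as [|n IH]; [now rewrite !sum_O|]. rewrite sum_Sn, (sum_n_S (fun i => Re (a i))), <- IH. reflexivity.
Qed.

Lemma Im_sum_n (a : nat -> C) n : Im (sum_n a n) = sum_n (fun i => Im (a i)) n.
Proof.
  induction n as [|n IH]; [now rewrite !sum_O|]. rewrite sum_Sn, (sum_n_S (fun i => Im (a i))), <- IH. reflexivity.
Qed.

Lemma is_series_C (a : nat -> C) (l : C) :
  @is_series C_AbsRing C_NormedModule a l <->
  is_series (fun n => Re (a n)) (Re l) /\ is_series (fun n => Im (a n)) (Im l).
Proof.
  split.
  - intros H. assert (K : forall eps : posreal, eventually (fun n => Cmod (sum_n a n - l) < eps)).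
    { intros eps. apply (proj1 (filterlim_locally_ball_norm (U := C_NormedModule) (sum_n a) l) H eps). }
    split; apply is_series_lim, is_lim_seq_spec; intros eps; destruct (K eps) as [N HN]; exists N; intros n Hn;
      specialize (HN n Hn); eapply Rle_lt_trans; try exact HN.
    + rewrite <- Re_sum_n. apply (Rabs_Re_le (sum_n a n - l)).
    + rewrite <- Im_sum_n. apply (Rabs_Im_le (sum_n a n - l)).
  - intros [H1 H2]. apply is_series_lim, is_lim_seq_spec in H1. apply is_series_lim, is_lim_seq_spec in H2.
    apply (proj2 (filterlim_locally_ball_norm (U := C_NormedModule) (sum_n a) l)). intros eps.
    assert (He : 0 < eps / 2) by (destruct eps; simpl; lra).
    destruct (H1 (mkposreal _ He)) as [N1 K1]. destruct (H2 (mkposreal _ He)) as [N2 K2].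
    exists (Nat.max N1 N2). intros n Hn. specialize (K1 n ltac:(lia)). specialize (K2 n ltac:(lia)).
    cbn [pos] in K1, K2. rewrite <- Re_sum_n in K1. rewrite <- Im_sum_n in K2.
    change (Cmod (sum_n a n - l) < eps). eapply Rle_lt_trans; [apply Cmod_le_sum|].
    change (Rabs (Re (sum_n a n) - Re l) + Rabs (Im (sum_n a n) - Im l) < eps). lra.
Qed.

Lemma hintC_scale F A c : 0 < c -> domC F A -> hintC (fun t => F (c * t)) = (RtoC (/ c) * hintC F)%C.
Proof.
  intros Hc [D1 D2]. unfold hintC. apply injective_projections; simpl.
  - rewrite (hint_scale (fun t => Re (F t)) A c Hc D1). ring.
  - rewrite (hint_scale (fun t => Im (F t)) A c Hc D2). ring.
Qed.

Lemma tpow_neg_mult z N : 0 < N -> (tpow (- z) N * tpow z N = 1)%C.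
Proof.
  intros HN. rewrite <- tpow_plus. replace (- z + z)%C with (RtoC 0) by ring.
  unfold tpow, RtoC, Re, Im; simpl. rewrite !Rmult_0_l, exp_0, cos_0, sin_0, Rmult_1_l, Rmult_0_r. reflexivity.
Qed.

(** The substitution u = N t, through which the terms of the Dirichlet series arise. *)
Lemma mellin_exp_scale z N : 1 <= N -> -1 / 4 <= Re z ->
  hintC (fun t => RtoC (exp (- (N * t))) * tpow z t)%C = (RtoC (/ N) * tpow (- z) N * Mel (fun t => exp (- t)) z)%C.
Proof.
  intros HN Hz. destruct (mellin_dom _ z mellinable_exp Hz) as [[A D] _].
  set (E := fun u => (RtoC (exp (- u)) * tpow z u)%C).
  assert (DE : domC (fun t => E (N * t)) (A * ((1 + / N) / sqrt N))).
  { destruct D as [D1 D2]. split; [apply (dom_scale _ _ N ltac:(lra) D1)|apply (dom_scale _ _ N ltac:(lra) D2)]. }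
  assert (HE : hintC (fun t => RtoC (exp (- (N * t))) * tpow z t)%C = hintC (fun t => Cmult (tpow (- z) N) (E (N * t)))).
  { assert (Pt : forall t, 0 < t -> (RtoC (exp (- (N * t))) * tpow z t)%C = Cmult (tpow (- z) N) (E (N * t))).
    { intros t Ht. unfold E. rewrite tpow_mult by lra.
      replace (tpow (- z) N * (RtoC (exp (- (N * t)%R)) * (tpow z N * tpow z t)))%C
        with (RtoC (exp (- (N * t)%R)) * ((tpow (- z) N * tpow z N) * tpow z t))%C by ring.
      rewrite tpow_neg_mult by lra. ring. }
    unfold hintC. f_equal; apply hint_ext; intros t Ht; now rewrite Pt. }
  rewrite HE, (proj2 (hintC_scal _ _ (tpow (- z) N) DE)), (hintC_scale E A N ltac:(lra) D).
  unfold Mel. fold E. ring.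
Qed.

Lemma npow_neg_tpow n s : npow_neg n s = tpow (- s) (INR n).
Proof.
  unfold npow_neg, tpow. destruct s as [a b]. unfold Copp, Re, Im; simpl.
  replace (- b * ln (INR n)) with (- (b * ln (INR n))) by ring. rewrite cos_neg, sin_neg. f_equal. ring.
Qed.

Lemma tpow_neg_nat k N : 0 < N -> tpow (- RtoC (INR k)) N = RtoC (/ N ^ k).
Proof.
  intros HN. unfold tpow, RtoC, Copp, Re, Im; simpl. rewrite Ropp_0, Rmult_0_l, cos_0, sin_0, Rmult_1_r, Rmult_0_r.
  replace (- INR k * ln N) with (- (INR k * ln N)) by ring. now rewrite exp_Ropp, exp_ln_nat.
Qed.

Lemma mellinable_Psi q f g k : sine_pair q f g -> mellinable (Psi (2 * k + 1) f).
Proof.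
  intros HS. assert (HS' := HS). destruct HS' as [_ [Hf _]].
  destruct (Psi_odd_bound q f g k HS) as [A [HA HB]]. split; [intros; now apply continuous_Psi|].
  exists (4 * A). split; [lra|]. intros t Ht. apply Rle_trans with (1 := HB t Ht).
  pose proof (pow_exp_bound 1 (/ 4) t ltac:(lra) ltac:(lra)) as B.
  rewrite pow_1 in B. replace ((INR 1 / / 4) ^ 1) with 4 in B by (simpl; field). replace (/ 4 * t) with (t / 4) in B by field.
  replace (- (t / 2)) with (- (t / 4) + - (t / 4)) by field. rewrite exp_plus. pose proof (exp_pos (- (t / 4))).
  replace (A * t * (exp (- (t / 4)) * exp (- (t / 4)))) with (A * exp (- (t / 4)) * (t * exp (- (t / 4)))) by ring.
  replace (4 * A * exp (- (t / 4))) with (A * exp (- (t / 4)) * 4) by ring. apply Rmult_le_compat_l; nra.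
Qed.

(** Termwise integration: the power d^(k+1) in [Psi] and the shift of s by k combine to d^(-s) times
    Gamma (s + k + 1). The half-plane Re s >= 3 is chosen for easy domination; the identity theorem
    needs no larger one. *)
Lemma mellin_Psi_series k f s : (forall d, Rabs (f d) <= 1) -> 3 <= Re s ->
  let z := (s + RtoC (INR k))%C in
  let c := fun d => (npow_neg (S d) s * Mel (fun t => exp (- t)) z)%C in
  is_series (fun d => f (S d) * Re (c d)) (Re (Mel (Psi (k + 1) f) z)) /\
  is_series (fun d => f (S d) * Im (c d)) (Im (Mel (Psi (k + 1) f) z)).
Proof.
  intros Hf Hs z c.
  assert (Hz : Re z = Re s + INR k) by (unfold z, Re; simpl; reflexivity).
  (* The order k + 3 leaves d^(-2) against the factor d^(k+1), and Re z >= k + 3 keeps the remaining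
     power of t nonnegative. *)
  pose proof (pos_INR k) as Pk. set (p := (k + 3)%nat).
  assert (Hp : INR p = INR k + 3) by (unfold p; rewrite plus_INR; simpl; ring).
  destruct (mellin_weight (Re z - INR p) ltac:(lra)) as [K [HK HW]].
  set (M := (INR p * 2) ^ p). assert (HM : 0 < M) by (apply pow_lt; lra).
  set (F := fun d t => (RtoC (exp (- (INR (S d) * t))) * tpow z t)%C).
  assert (Bd : forall d t, 0 < t -> INR (S d) ^ (k + 1) * Cmod (F d t) <= M * K * / INR (S d) ^ 2 * wt t).
  { intros d t Ht. pose proof (INR_S_ge1 d). set (N := INR (S d)) in *. unfold F. fold N.
    rewrite Cmod_mult, Cmod_R, Cmod_tpow, Rabs_right by (left; apply exp_pos).
    assert (E : exp (- (N * t)) <= M * (/ N) ^ p * (/ t) ^ p * exp (- (t / 4))).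
    { apply Rle_trans with (exp (- (N / 2 * t)) * exp (- (t / 4))).
      - rewrite <- exp_plus. apply exp_le. nra.
      - apply Rmult_le_compat_r; [left; apply exp_pos|].
        eapply Rle_trans; [apply (exp_neg_le p); nra|]. right. unfold M.
        rewrite <- !Rpow_mult_distr. f_equal. field. lra. }
    assert (Et : (/ t) ^ p * exp (Re z * ln t) = exp ((Re z - INR p) * ln t)).
    { rewrite pow_inv, <- exp_ln_nat, <- exp_Ropp, <- exp_plus by auto. f_equal. ring. }
    specialize (HW t Ht). rewrite exp_plus in HW. pose proof (exp_pos (- (t / 4))).
    pose proof (exp_pos (Re z * ln t)). pose proof (exp_pos ((Re z - INR p) * ln t)).
    assert (1 <= exp (Rabs (ln t) / 8)) by (pose proof (exp_ineq1_le (Rabs (ln t) / 8)); pose proof (Rabs_pos (ln t)); lra).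
    assert (0 < N ^ (k + 1)) by (apply pow_lt; lra).
    assert (EN : N ^ (k + 1) * (/ N) ^ p = / N ^ 2).
    { unfold p. replace (k + 3)%nat with (k + 1 + 2)%nat by lia. rewrite (pow_add (/ N)), pow_inv, pow_inv. field. split; [lra|]. apply pow_nonzero. lra. }
    assert (0 < / N ^ 2) by (apply Rinv_0_lt_compat; nra).
    apply Rle_trans with (N ^ (k + 1) * (M * (/ N) ^ p * (/ t) ^ p * exp (- (t / 4)) * exp (Re z * ln t))).
    - apply Rmult_le_compat_l; [lra|]. apply Rmult_le_compat_r; lra.
    - replace (N ^ (k + 1) * (M * (/ N) ^ p * (/ t) ^ p * exp (- (t / 4)) * exp (Re z * ln t)))
        with (M * (N ^ (k + 1) * (/ N) ^ p) * (((/ t) ^ p * exp (Re z * ln t)) * exp (- (t / 4)))) by ring.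
      rewrite EN, Et. replace (M * K * / N ^ 2 * wt t) with (M * / N ^ 2 * (K * wt t)) by ring.
      apply Rmult_le_compat_l; [apply Rmult_le_pos; lra|]. apply Rle_trans with (2 := HW).
      apply Rmult_le_compat_r; [lra|]. nra. }
  set (a := fun d => M * K * / INR (S d) ^ 2).
  assert (Ha : ex_series a) by (apply (ex_series_scal_l (M * K) (fun d => / INR (S d) ^ 2)), ex_series_inv_sq).
  assert (Cf : forall d t, 0 < t -> continuous (fun t => Re (F d t)) t /\ continuous (fun t => Im (F d t)) t).
  { intros d t Ht. unfold F. apply (continuous_tpow (fun t => exp (- (INR (S d) * t)))); auto.
    apply (ex_derive_continuous (fun t => exp (- (INR (S d) * t)))). auto_derive. exact I. }
  assert (DC : forall d, domC (F d) (/ INR (S d) ^ (k + 1) * a d)).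
  { intros d. pose proof (INR_S_ge1 d). assert (0 < INR (S d) ^ (k + 1)) by (apply pow_lt; lra).
    apply domC_of_Cmod; try (intros; now apply Cf). intros t Ht.
    apply Rmult_le_reg_l with (INR (S d) ^ (k + 1)); [auto|]. apply Rle_trans with (1 := Bd d t Ht).
    unfold a. right. field. split; [lra|]. lra. }
  assert (Ev : forall d, hintC (F d) = (RtoC (/ INR (S d) ^ (k + 1)) * c d)%C).
  { intros d. pose proof (INR_S_ge1 d) as HN. unfold F. rewrite mellin_exp_scale by lra. unfold c.
    rewrite npow_neg_tpow. unfold z. replace (- (s + RtoC (INR k)))%C with (- s + - RtoC (INR k))%C by ring.
    rewrite tpow_plus, tpow_neg_nat by lra.
    assert (Hk : 0 < INR (S d) ^ k) by (apply pow_lt; lra).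
    replace (/ INR (S d) ^ (k + 1)) with (/ INR (S d) * / INR (S d) ^ k) by (rewrite pow_add, pow_1; field; lra).
    rewrite RtoC_mult. ring. }
  (* One argument for both components, pr being the real or the imaginary part. *)
  assert (Gen : forall (pr : C -> R) (pr_scal : forall (x : R) w, pr (RtoC x * w)%C = x * pr w)
     (Dp : forall d, dom (fun t => pr (F d t)) (/ INR (S d) ^ (k + 1) * a d))
     (Hp' : forall d, hint (fun t => pr (F d t)) = pr (hintC (F d))),
     is_series (fun d => f (S d) * pr (c d)) (hint (fun t => pr (RtoC (Psi (k + 1) f t) * tpow z t)%C))).
  { intros pr Hsc Dp Hpr.
    rewrite (hint_ext _ (fun t => Series (fun d => f (S d) * INR (S d) ^ (k + 1) * pr (F d t)))).
    - apply is_series_ext with (fun d => hint (fun t => f (S d) * INR (S d) ^ (k + 1) * pr (F d t))).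
      + intros d. rewrite (hint_scal _ _ _ (Dp d)), Hpr, Ev, Hsc.
        assert (0 < INR (S d) ^ (k + 1)) by (apply pow_lt, INR_S_pos). eqR. field. lra.
      + apply hint_Series with a; [exact Ha|]. intros d.
        assert (P1 : 0 < INR (S d) ^ (k + 1)) by (apply pow_lt, INR_S_pos).
        eapply dom_weaken; [|apply dom_scal, Dp]. rewrite Rabs_mult, (Rabs_right (INR (S d) ^ (k + 1))) by lra.
        assert (0 <= a d).
        { unfold a. apply Rmult_le_pos; [nra|left; apply Rinv_0_lt_compat, pow_lt, INR_S_pos]. }
        replace (Rabs (f (S d)) * INR (S d) ^ (k + 1) * (/ INR (S d) ^ (k + 1) * a d)) with (Rabs (f (S d)) * a d) by (field; lra).
        pose proof (Hf (S d)). pose proof (Rabs_pos (f (S d))). nra.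
    - intros t Ht. rewrite Hsc. unfold Psi. rewrite <- Series_scal_r. apply Series_ext. intros d.
      unfold F. rewrite Hsc. ring. }
  split.
  - apply (Gen Re); [intros x [u v]; unfold Re, Cmult, RtoC; simpl; ring|intros d; apply DC|reflexivity].
  - apply (Gen Im); [intros x [u v]; unfold Im, Cmult, RtoC; simpl; ring|intros d; apply DC|reflexivity].
Qed.

Lemma cdiff_shift f c z l : cdiff f (z + c)%C l -> cdiff (fun w => f (w + c)%C) z l.
Proof.
  intros H eps He. destruct (H eps He) as [d [Hd HB]]. exists d. split; auto. intros w Hw.
  replace (w - z)%C with ((w + c) - (z + c))%C in * by ring. now apply HB.
Qed.

Lemma cdiff_zero f z l r : 0 < r -> cdiff f z l -> (forall w, Cmod (w - z) < r -> f w = 0%C) -> l = 0%C.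
Proof.
  intros Hr H Hz. destruct (Ceq_dec l 0) as [E|E]; [exact E|exfalso].
  apply Cmod_gt_0 in E. destruct (H (Cmod l / 2) ltac:(lra)) as [d [Hd HB]].
  set (x := Rmin d r / 2). assert (Hx : 0 < x) by (unfold x; assert (0 < Rmin d r) by (apply Rmin_pos; auto); lra).
  assert (X1 : x < d) by (unfold x in *; pose proof (Rmin_l d r); lra).
  assert (X2 : x < r) by (unfold x in *; pose proof (Rmin_r d r); lra).
  assert (Ew : (z + RtoC x - z)%C = RtoC x) by ring.
  assert (Em : Cmod (RtoC x) = x) by (rewrite Cmod_R, Rabs_right; lra).
  specialize (HB (z + RtoC x)%C). rewrite Ew, Em in HB. specialize (HB X1).
  rewrite (Hz (z + RtoC x)%C) in HB by (rewrite Ew, Em; exact X2).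
  rewrite (Hz z) in HB by (replace (z - z)%C with (RtoC 0) by ring; rewrite Cmod_0; exact Hr).
  replace (0 - 0 - RtoC x * l)%C with (- (RtoC x * l))%C in HB by ring.
  rewrite Cmod_opp, Cmod_mult, Em in HB. nra.
Qed.

(** D (s) is L(s) Gamma(s + 2k + 1) minus the Mellin transform of w at s + 2k. It vanishes for Re s
    >= 3, hence by [identity_theorem] for Re s > - 2k - 1/4. At s = n - 2k the Gamma factor is n!,
    and the derivative at - 2k brings in Gamma'(1) = - gamma. *)
Theorem L_function_values q chi g1 g2 k Lf :
  sine_pair q (fun d => Re (chi d)) g1 -> sine_pair q (fun d => Im (chi d)) g2 -> is_L_function chi Lf ->
  let w1 := Psi (2 * k + 1) (fun d => Re (chi d)) in
  let w2 := Psi (2 * k + 1) (fun d => Im (chi d)) in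
  (forall n : nat, (RtoC (INR (fact n)) * Lf (RtoC (INR n - INR (2 * k))))%C
      = (hint (fun t => t ^ n * w1 t), hint (fun t => t ^ n * w2 t))) /\
  (forall dL, @is_derive C_AbsRing C_NormedModule Lf (RtoC (- INR (2 * k))) dL ->
     (dL - RtoC euler_gamma * Lf (RtoC (- INR (2 * k))))%C = (hint (fun t => ln t * w1 t), hint (fun t => ln t * w2 t))).
Proof.
  intros S1 S2 [HL1 HL2] w1 w2.
  assert (M1 := mellinable_Psi q _ g1 k S1). assert (M2 := mellinable_Psi q _ g2 k S2). fold w1 in M1. fold w2 in M2.
  destruct S1 as [_ [Hf1 _]]. destruct S2 as [_ [Hf2 _]].
  set (kk := RtoC (INR (2 * k))).
  set (D := fun s => (Lf s * Mel (fun t => exp (- t)) (s + kk) - (Mel w1 (s + kk) + Ci * Mel w2 (s + kk)))%C).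
  assert (Rk : forall s, Re (s + kk)%C = Re s + INR (2 * k)) by (intros; reflexivity).
  assert (HD : forall z l, - INR (2 * k) - 1 / 4 < Re z -> cdiff Lf z l ->
     cdiff D z (l * Mel (fun t => exp (- t)) (z + kk) + Lf z * Mel (fun t => exp (- t) * ln t)%R (z + kk)
        - (Mel (fun t => w1 t * ln t)%R (z + kk) + (0 * Mel w2 (z + kk) + Ci * Mel (fun t => w2 t * ln t)%R (z + kk))))%C).
  { intros z l Hz Hl. assert (Hzk : -1 / 4 < Re (z + kk)%C) by (rewrite Rk; lra).
    apply cdiff_minus.
    - apply (cdiff_mult Lf (fun s => Mel (fun t => exp (- t)) (s + kk)%C)); [exact Hl|].
      apply (cdiff_shift (Mel (fun t => exp (- t)))). apply (cdiff_Mel _ _ mellinable_exp Hzk).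
    - apply cdiff_plus.
      + apply (cdiff_shift (Mel w1)). apply (cdiff_Mel _ _ M1 Hzk).
      + apply (cdiff_mult (fun _ => Ci) (fun s => Mel w2 (s + kk)%C)); [apply cdiff_const|].
        apply (cdiff_shift (Mel w2)). apply (cdiff_Mel _ _ M2 Hzk). }
  assert (HZ : forall z, 3 <= Re z -> D z = 0%C).
  { intros z Hz. unfold D.
    destruct (mellin_Psi_series (2 * k) (fun d => Re (chi d)) z Hf1 Hz) as [A1 A2].
    destruct (mellin_Psi_series (2 * k) (fun d => Im (chi d)) z Hf2 Hz) as [B1 B2].
    fold kk in A1, A2, B1, B2. fold w1 in A1, A2. fold w2 in B1, B2.
    set (G := Mel (fun t => exp (- t)) (z + kk)) in *.
    specialize (HL2 z ltac:(lra)). apply is_series_C in HL2. destruct HL2 as [C1 C2].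
    assert (R1 : is_series (fun d => Re (chi (S d) * npow_neg (S d) z * G)%C) (Re (Lf z * G)%C)).
    { apply is_series_ext with (fun d => Re G * Re (chi (S d) * npow_neg (S d) z)%C - Im G * Im (chi (S d) * npow_neg (S d) z)%C).
      - intros d. unfold Re, Im, Cmult; simpl. eqR. ring.
      - replace (Re (Lf z * G)%C) with (Re G * Re (Lf z) - Im G * Im (Lf z)) by (unfold Re, Im, Cmult; simpl; ring).
        apply (is_series_minus (fun d => Re G * Re (chi (S d) * npow_neg (S d) z)%C) (fun d => Im G * Im (chi (S d) * npow_neg (S d) z)%C)).
        + apply (is_series_scal_l (Re G) (fun d => Re (chi (S d) * npow_neg (S d) z)%C)), C1.
        + apply (is_series_scal_l (Im G) (fun d => Im (chi (S d) * npow_neg (S d) z)%C)), C2. }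
    assert (R2 : is_series (fun d => Im (chi (S d) * npow_neg (S d) z * G)%C) (Im (Lf z * G)%C)).
    { apply is_series_ext with (fun d => Im G * Re (chi (S d) * npow_neg (S d) z)%C + Re G * Im (chi (S d) * npow_neg (S d) z)%C).
      - intros d. unfold Re, Im, Cmult; simpl. eqR. ring.
      - replace (Im (Lf z * G)%C) with (Im G * Re (Lf z) + Re G * Im (Lf z)) by (unfold Re, Im, Cmult; simpl; ring).
        apply (is_series_plus (fun d => Im G * Re (chi (S d) * npow_neg (S d) z)%C) (fun d => Re G * Im (chi (S d) * npow_neg (S d) z)%C)).
        + apply (is_series_scal_l (Im G) (fun d => Re (chi (S d) * npow_neg (S d) z)%C)), C1.
        + apply (is_series_scal_l (Re G) (fun d => Im (chi (S d) * npow_neg (S d) z)%C)), C2. }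
    assert (T1 := is_series_minus _ _ _ _ A1 B2). assert (T2 := is_series_plus _ _ _ _ A2 B1).
    assert (E1 : Re (Lf z * G)%C = Re (Mel w1 (z + kk)) - Im (Mel w2 (z + kk))).
    { rewrite <- (is_series_unique _ _ R1). apply is_series_unique in T1. change plus with Rplus in T1. change opp with Ropp in T1.
      unfold Rminus. rewrite <- T1. apply Series_ext. intros d.
      unfold Re, Im, Cmult; simpl. ring. }
    assert (E2 : Im (Lf z * G)%C = Im (Mel w1 (z + kk)) + Re (Mel w2 (z + kk))).
    { rewrite <- (is_series_unique _ _ R2). apply is_series_unique in T2. change plus with Rplus in T2.
      rewrite <- T2. apply Series_ext. intros d. unfold Re, Im, Cmult; simpl. ring. }
    apply injective_projections.
    - change (Re (Lf z * G)%C + - (Re (Mel w1 (z + kk)) + (0 * Re (Mel w2 (z + kk)) - 1 * Im (Mel w2 (z + kk)))) = 0). rewrite E1. ring.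
    - change (Im (Lf z * G)%C + - (Im (Mel w1 (z + kk)) + (0 * Im (Mel w2 (z + kk)) + 1 * Re (Mel w2 (z + kk)))) = 0). rewrite E2. ring. }
  assert (Zero : forall z, - INR (2 * k) - 1 / 4 < Re z -> D z = 0%C).
  { apply (identity_theorem D _ 3); [|exact HZ]. intros z Hz. destruct (HL1 z) as [l Hl].
    eexists. apply (HD z l Hz). now apply cdiff_of_is_derive. }
  split.
  - intros n. pose proof (pos_INR n) as Pn.
    pose proof (Zero (RtoC (INR n - INR (2 * k))) ltac:(unfold Re, RtoC; simpl; lra)) as E. unfold D in E.
    replace (RtoC (INR n - INR (2 * k)) + kk)%C with (RtoC (INR n)) in E by (unfold kk; rewrite <- RtoC_plus; f_equal; ring).
    rewrite (Mel_real _ n mellinable_exp), (Mel_real _ n M1), (Mel_real _ n M2), hint_mono_exp in E.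
    set (h1 := hint (fun t => t ^ n * w1 t)) in *. set (h2 := hint (fun t => t ^ n * w2 t)) in *.
    replace (RtoC (INR (fact n)) * Lf (RtoC (INR n - INR (2 * k))))%C with (RtoC h1 + Ci * RtoC h2)%C.
    + apply injective_projections; simpl; ring.
    + symmetry. rewrite Cmult_comm.
      replace (Lf (RtoC (INR n - INR (2 * k))) * RtoC (INR (fact n)))%C with
        ((Lf (RtoC (INR n - INR (2 * k))) * RtoC (INR (fact n)) - (RtoC h1 + Ci * RtoC h2)) + (RtoC h1 + Ci * RtoC h2))%C by ring.
      rewrite E. ring.
  - intros dL HdL. apply cdiff_of_is_derive in HdL.
    pose proof (HD (RtoC (- INR (2 * k))) dL ltac:(unfold Re, RtoC; simpl; lra) HdL) as E.
    apply (cdiff_zero D _ _ (1 / 4)) in E; [|lra|].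
    + replace (RtoC (- INR (2 * k)) + kk)%C with (RtoC (INR 0)) in E by (unfold kk; rewrite <- RtoC_plus; f_equal; simpl; ring).
      rewrite (Mel_real _ 0 mellinable_exp), hint_mono_exp in E.
      assert (Ml : forall w, Mel (fun t => w t * ln t) (RtoC (INR 0)) = RtoC (hint (fun t => ln t * w t))).
      { intros w. unfold Mel, hintC, RtoC. apply injective_projections; simpl fst; simpl snd.
        - apply hint_ext. intros t Ht. unfold tpow, Cmult, Re, Im; simpl. rewrite !Rmult_0_l, cos_0, exp_0. ring.
        - transitivity (hint (fun _ => 0)); [|apply hint_zero]. apply hint_ext. intros t Ht. unfold tpow, Cmult, Re, Im; simpl.
          rewrite !Rmult_0_l, sin_0. ring. }
      rewrite !Ml in E. rewrite (hint_ext (fun t => ln t * exp (- t)) (fun t => exp (- t) * ln t)) in E by (intros; ring).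
      rewrite hint_exp_ln in E. simpl (INR (fact 0)) in E.
      set (h1 := hint (fun t => ln t * w1 t)) in *. set (h2 := hint (fun t => ln t * w2 t)) in *.
      replace (dL - RtoC euler_gamma * Lf (RtoC (- INR (2 * k))))%C with (RtoC h1 + Ci * RtoC h2)%C.
      * apply injective_projections; simpl; ring.
      * rewrite (RtoC_opp euler_gamma) in E.
        replace (dL - RtoC euler_gamma * Lf (RtoC (- INR (2 * k))))%C with
          ((dL * 1 + Lf (RtoC (- INR (2 * k))) * - RtoC euler_gamma - (RtoC h1 + (0 * Mel w2 (RtoC (INR 0)) + Ci * RtoC h2)))
             + (RtoC h1 + Ci * RtoC h2))%C by ring.
        rewrite E. ring.
    + intros w Hw. apply Zero.
      pose proof (Rabs_Re_le (w - RtoC (- INR (2 * k)))) as B. apply Rle_lt_trans with (2 := Hw) in B.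
      unfold Re, RtoC, Cminus, Cplus, Copp in B; simpl in B. apply Rabs_def2 in B. unfold Re.
      simpl INR. simpl INR in B. lra.
Qed.

(** * Gauss sums *)

(** Sums over i < n suit the residues 0, ..., q - 1, whereas [sum_n] includes its upper index. *)
Fixpoint Csum (F : nat -> C) (n : nat) : C :=
  match n with O => RtoC 0 | S n' => (Csum F n' + F n')%C end.

Lemma Csum_sum_n F n : sum_n F n = Csum F (S n).
Proof.
  induction n as [|n IH].
  - rewrite sum_O. simpl. now rewrite Cplus_0_l.
  - rewrite sum_Sn, IH. reflexivity.
Qed.

Lemma Csum_ext F G n : (forall i, (i < n)%nat -> F i = G i) -> Csum F n = Csum G n.
Proof. induction n as [|n IH]; intros H; simpl; [reflexivity|]. rewrite IH, H; auto. Qed.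

Lemma Csum_scal c F n : Csum (fun i => c * F i)%C n = (c * Csum F n)%C.
Proof. induction n as [|n IH]; simpl; [ring|]. rewrite IH. ring. Qed.

Lemma Csum_minus F G n : Csum (fun i => F i - G i)%C n = (Csum F n - Csum G n)%C.
Proof. induction n as [|n IH]; simpl; [ring|]. rewrite IH. ring. Qed.

Lemma Csum_plus F G n : Csum (fun i => F i + G i)%C n = (Csum F n + Csum G n)%C.
Proof. induction n as [|n IH]; simpl; [ring|]. rewrite IH. ring. Qed.

Lemma Csum_zero n : Csum (fun _ => RtoC 0) n = RtoC 0.
Proof. induction n as [|n IH]; simpl; [reflexivity|]. rewrite IH. ring. Qed.

Lemma Csum_swap (F : nat -> nat -> C) m n :
  Csum (fun i => Csum (fun j => F i j) n) m = Csum (fun j => Csum (fun i => F i j) m) n.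
Proof.
  induction m as [|m IH]; simpl; [now rewrite Csum_zero|]. now rewrite IH, <- Csum_plus.
Qed.

Lemma Csum_shift F n : Csum F (S n) = (F 0%nat + Csum (fun i => F (S i)) n)%C.
Proof. induction n as [|n IH]; [simpl; ring|]. change (Csum F (S (S n))) with (Csum F (S n) + F (S n))%C. rewrite IH. simpl. ring. Qed.

Lemma Csum_single F n i0 : (i0 < n)%nat -> (forall i, (i < n)%nat -> i <> i0 -> F i = RtoC 0) -> Csum F n = F i0.
Proof.
  induction n as [|n IH]; intros Hi H; [lia|]. simpl. destruct (Nat.eq_dec i0 n) as [->|Hn].
  - rewrite (Csum_ext F (fun _ => RtoC 0)) by (intros i Hi'; apply H; lia). rewrite Csum_zero. ring.
  - rewrite IH by (try lia; intros; apply H; lia). rewrite (H n) by lia. ring.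
Qed.

Lemma Csum_list F n : Csum F n = fold_right Cplus (RtoC 0) (map F (seq 0 n)).
Proof.
  induction n as [|n IH]; [reflexivity|]. rewrite seq_S, map_app, fold_right_app. simpl. rewrite IH.
  generalize (map F (seq 0 n)) as l. induction l as [|a l IHl]; simpl; [ring|]. rewrite <- IHl. ring.
Qed.

(** An injective self-map of a finite set is a permutation. *)
Lemma Csum_reindex F p n : (forall i, (i < n)%nat -> (p i < n)%nat) ->
  (forall i j, (i < n)%nat -> (j < n)%nat -> p i = p j -> i = j) ->
  Csum (fun i => F (p i)) n = Csum F n.
Proof.
  intros Hp Hi. rewrite !Csum_list, <- (map_map p F).
  assert (P : Permutation (map p (seq 0 n)) (seq 0 n)).
  { apply NoDup_Permutation_bis.
    - assert (K : forall l, NoDup l -> (forall i, In i l -> (i < n)%nat) -> NoDup (map p l)).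
      { induction l as [|a l IHl]; intros Hn Hl; simpl; [constructor|]. inversion_clear Hn. constructor.
        - intros Q. apply in_map_iff in Q. destruct Q as [b [Q1 Q2]].
          apply Hi in Q1; [subst; contradiction| |]; apply Hl; simpl; auto.
        - apply IHl; auto. intros; apply Hl; simpl; auto. }
      apply K; [apply seq_NoDup|]. intros i Hin. apply in_seq in Hin. lia.
    - now rewrite length_map.
    - intros x Hx. apply in_map_iff in Hx. destruct Hx as [i [<- Hin]]. apply in_seq in Hin. apply in_seq. pose proof (Hp i). lia. }
  apply (Permutation_map F) in P. revert P. generalize (map F (map p (seq 0 n))) (map F (seq 0 n)). intros l1 l2 P.
  induction P; simpl; [reflexivity|now rewrite IHP|ring|congruence].
Qed.

Lemma periodic_mod {A} (F : nat -> A) q : (1 <= q)%nat -> (forall n, F (n + q)%nat = F n) -> forall n, F (n mod q) = F n.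
Proof.
  intros Hq HF n. rewrite (Nat.div_mod n q) at 2 by lia. generalize (n / q)%nat as m. intros m.
  induction m as [|m IH]; [f_equal; lia|]. rewrite IH, <- HF. f_equal. lia.
Qed.

Lemma periodic_congr {A} (F : nat -> A) q : (1 <= q)%nat -> (forall n, F (n + q)%nat = F n) ->
  forall a b i j, (a + i * q = b + j * q)%nat -> F a = F b.
Proof.
  intros Hq HF a b i j E. rewrite <- (periodic_mod F q Hq HF a), <- (periodic_mod F q Hq HF b).
  rewrite <- (Nat.Div0.mod_add a i q), E, Nat.Div0.mod_add. reflexivity.
Qed.

Lemma Csum_coprime_reindex F q n : (1 <= q)%nat -> (forall m, F (m + q)%nat = F m) -> Nat.gcd n q = 1%nat ->
  Csum (fun h => F (h * n)%nat) q = Csum F q.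
Proof.
  intros Hq HF Hn. rewrite <- (Csum_reindex F (fun h => (h * n) mod q)%nat q).
  - apply Csum_ext. intros h _. symmetry. now apply periodic_mod.
  - intros i _. apply Nat.mod_upper_bound. lia.
  - assert (K : forall i j, (i <= j)%nat -> (i < q)%nat -> (j < q)%nat -> ((i * n) mod q = (j * n) mod q)%nat -> i = j).
    { intros i j Hij Hi Hj E.
      assert (D : Nat.divide q (n * (j - i))).
      { exists (j * n / q - i * n / q)%nat. pose proof (Nat.div_mod (i * n) q ltac:(lia)). pose proof (Nat.div_mod (j * n) q ltac:(lia)).
        rewrite E in H. rewrite Nat.mul_sub_distr_r, Nat.mul_sub_distr_l. nia. }
      apply Nat.gauss in D; [|now rewrite Nat.gcd_comm]. destruct D as [c Hc]. destruct c; [lia|]. nia. }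
    intros i j Hi Hj E. destruct (Nat.le_ge_cases i j); [now apply K|symmetry; now apply K].
Qed.

Lemma Cmult_eq_reg_l (c a b : C) : (c * a = c * b)%C -> c <> RtoC 0 -> a = b.
Proof.
  intros E Hc. transitivity (/ c * (c * a))%C; [field; exact Hc|]. rewrite E. field. exact Hc.
Qed.

Definition ee (q n : nat) : C := (cos (om q n), sin (om q n)).

Lemma om_plus q a b : (1 <= q)%nat -> om q (a + b) = om q a + om q b.
Proof. intros Hq. unfold om. rewrite plus_INR. field. apply not_0_INR. lia. Qed.

Lemma ee_plus q a b : (1 <= q)%nat -> ee q (a + b) = (ee q a * ee q b)%C.
Proof. intros Hq. unfold ee, Cmult; simpl. rewrite om_plus, cos_plus, sin_plus by auto. f_equal; ring. Qed.

Lemma ee_0 q : ee q 0 = RtoC 1.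
Proof. unfold ee, om. simpl. replace (2 * PI * 0 / INR q) with 0 by (unfold Rdiv; ring). now rewrite cos_0, sin_0. Qed.

Lemma ee_q q : (1 <= q)%nat -> ee q q = RtoC 1.
Proof.
  intros Hq. unfold ee, om. replace (2 * PI * INR q / INR q) with (2 * PI) by (field; apply not_0_INR; lia).
  now rewrite cos_2PI, sin_2PI.
Qed.

Lemma ee_periodic q n : (1 <= q)%nat -> ee q (n + q) = ee q n.
Proof. intros Hq. rewrite ee_plus, ee_q by auto. ring. Qed.

Lemma ee_mult_q q n : (1 <= q)%nat -> ee q (n * q) = RtoC 1.
Proof. intros Hq. induction n as [|n IH]; [apply ee_0|]. replace (S n * q)%nat with (n * q + q)%nat by lia. now rewrite ee_periodic. Qed.

(** Modulo q the factor q - 1 acts as -1. *)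
Lemma ee_conj q n : (1 <= q)%nat -> ee q (n * (q - 1)) = Cconj (ee q n).
Proof.
  intros Hq. assert (H : (ee q (n * (q - 1)) * ee q n = 1)%C).
  { rewrite <- ee_plus by auto. replace (n * (q - 1) + n)%nat with (n * q)%nat by nia. now apply ee_mult_q. }
  assert (N : (ee q n * Cconj (ee q n) = 1)%C).
  { unfold ee, Cconj, Cmult, RtoC; simpl. pose proof (sin2_cos2 (om q n)) as E. unfold Rsqr in E. f_equal; [|ring]. lra. }
  transitivity (ee q (n * (q - 1)) * (ee q n * Cconj (ee q n)))%C; [rewrite N; ring|]. rewrite Cmult_assoc, H. ring.
Qed.

Lemma ee_neq_1 q n : (0 < n < q)%nat -> ee q n <> RtoC 1.
Proof.
  intros Hn E. injection E as E1 _. assert (P := PI_RGT_0). assert (Q : 0 < INR q) by (apply lt_0_INR; lia).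
  assert (N1 : 0 < INR n) by (apply lt_0_INR; lia). assert (N2 : INR n < INR q) by (apply lt_INR; lia).
  set (z := PI * INR n / INR q). replace (om q n) with (2 * z) in E1 by (unfold z, om; field; lra).
  rewrite cos_2a_sin in E1. assert (0 < sin z).
  { apply sin_gt_0; unfold z; [apply Rdiv_lt_0_compat; nra|]. apply Rmult_lt_reg_r with (INR q); [lra|].
    unfold Rdiv. rewrite Rmult_assoc, Rinv_l by lra. nra. }
  nra.
Qed.

Lemma ee_orthogonality q n : (0 < n < q)%nat -> Csum (fun d => ee q (d * n)) q = RtoC 0.
Proof.
  intros Hn. assert (T : forall m, ((ee q n - 1) * Csum (fun d => ee q (d * n)) m = ee q (m * n) - 1)%C).
  { induction m as [|m IH]; [simpl; rewrite ee_0; ring|]. simpl Csum. rewrite Cmult_plus_distr_l, IH.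
    replace (S m * n)%nat with (n + m * n)%nat by lia. rewrite ee_plus by lia. ring. }
  specialize (T q). replace (q * n)%nat with (n * q)%nat in T by lia. rewrite ee_mult_q in T by lia.
  assert (N := ee_neq_1 q n Hn). apply Cmult_eq_reg_l with (ee q n - 1)%C.
  - rewrite T. ring.
  - intros Z. apply N. replace (ee q n) with (ee q n - 1 + 1)%C by ring. rewrite Z. ring.
Qed.

Lemma Re_Csum F n : Re (Csum F n) = match n with O => 0 | S m => sum_n (fun i => Re (F i)) m end.
Proof. destruct n; [reflexivity|]. rewrite <- Csum_sum_n. apply Re_sum_n. Qed.

Lemma Im_Csum F n : Im (Csum F n) = match n with O => 0 | S m => sum_n (fun i => Im (F i)) m end.
Proof. destruct n; [reflexivity|]. rewrite <- Csum_sum_n. apply Im_sum_n. Qed.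

Lemma Re_Csum_ge F n i0 : (forall i, 0 <= Re (F i)) -> (i0 < n)%nat -> Re (F i0) <= Re (Csum F n).
Proof.
  intros H. assert (P : forall m, 0 <= Re (Csum F m)).
  { induction m as [|m IH]; [simpl; lra|]. change (0 <= Re (Csum F m) + Re (F m)). pose proof (H m). lra. }
  induction n as [|n IH]; intros Hi; [lia|]. change (Re (F i0) <= Re (Csum F n) + Re (F n)).
  destruct (Nat.eq_dec i0 n) as [->|]; [pose proof (P n); lra|]. pose proof (H n). specialize (IH ltac:(lia)). lra.
Qed.

Lemma RtoC_m1 : RtoC (-1) = (- RtoC 1)%C.
Proof. unfold RtoC, Copp; simpl. f_equal; ring. Qed.

(** The sum of |chi|^2 over all residues is unchanged by h -> h n, which also multiplies it by
    |chi(n)|^2, and it is nonzero because of the residue 1. *)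
Lemma character_norm q chi n : dirichlet_character q chi -> Nat.gcd n q = 1%nat -> (chi n * Cconj (chi n) = 1)%C.
Proof.
  intros [Hq [H1 [HM [HP HG]]]] Hn.
  set (F := fun h => (chi h * Cconj (chi h))%C).
  assert (E : (F n * Csum F q = Csum F q)%C).
  { rewrite <- Csum_scal. rewrite <- (Csum_coprime_reindex F q n Hq); auto.
    - apply Csum_ext. intros h _. unfold F. rewrite HM, Cmult_conj. ring.
    - intros m. unfold F. now rewrite HP. }
  assert (NZ : Csum F q <> 0%C).
  { assert (H : Re (F (1 mod q)%nat) <= Re (Csum F q)).
    { apply Re_Csum_ge; [|apply Nat.mod_upper_bound; lia]. intros i. unfold F. rewrite <- Cmod2_conj. unfold RtoC, Re; simpl fst. apply pow2_ge_0. }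
    assert (E1 : F (1 mod q)%nat = RtoC 1).
    { unfold F. rewrite (periodic_mod chi q Hq HP), H1. unfold Cmult, Cconj, RtoC; simpl. f_equal; ring. }
    rewrite E1 in H. intros Z. rewrite Z in H. simpl in H. lra. }
  change (F n = 1%C). apply Cmult_eq_reg_l with (Csum F q); [|exact NZ]. rewrite Cmult_comm, E. ring.
Qed.

Lemma character_Cmod_le q chi n : dirichlet_character q chi -> Cmod (chi n) <= 1.
Proof.
  intros HD. assert (HD' := HD). destruct HD' as [Hq [H1 [HM [HP HG]]]].
  destruct (Nat.eq_dec (Nat.gcd n q) 1) as [E|E].
  - apply (character_norm q chi n HD) in E. rewrite <- Cmod2_conj in E. injection E as E.
    pose proof (Cmod_ge_0 (chi n)). nra.
  - apply HG in E. rewrite E, Cmod_0. lra.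
Qed.

Lemma odd_character_modulus q chi : dirichlet_character q chi -> odd_character q chi -> (2 <= q)%nat.
Proof.
  intros [Hq [H1 [HM [HP HG]]]] HO. destruct (Nat.eq_dec q 1) as [->|]; [exfalso|lia].
  unfold odd_character in HO. simpl in HO. specialize (HP 0%nat). simpl in HP. rewrite H1, HO in HP.
  injection HP as E. lra.
Qed.

Lemma odd_character_reflect q chi h : dirichlet_character q chi -> odd_character q chi -> (h <= q)%nat ->
  chi (q - h)%nat = (- chi h)%C.
Proof.
  intros HD HO Hh. assert (H2 := odd_character_modulus q chi HD HO). destruct HD as [Hq [H1 [HM [HP HG]]]].
  transitivity (chi ((q - 1) * h)%nat).
  - apply (periodic_congr chi q Hq HP _ _ h 1%nat). nia.
  - rewrite HM, HO, RtoC_m1. ring.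
Qed.

(** The Gauss sum of the conjugate character at frequency d. *)
Definition twisted_gauss (q : nat) (chi : nat -> C) (d : nat) : C := Csum (fun h => Cconj (chi h) * ee q (h * d))%C q.

Lemma twisted_gauss_mul q chi n d : dirichlet_character q chi -> Nat.gcd n q = 1%nat ->
  twisted_gauss q chi (n * d) = (chi n * twisted_gauss q chi d)%C.
Proof.
  intros HD Hn. assert (HN := character_norm q chi n HD Hn). destruct HD as [Hq [H1 [HM [HP HG]]]].
  unfold twisted_gauss. rewrite <- (Csum_coprime_reindex (fun h => Cconj (chi h) * ee q (h * d))%C q n Hq); auto.
  - rewrite <- Csum_scal. apply Csum_ext. intros h _. rewrite HM, Cmult_conj, Nat.mul_assoc.
    transitivity ((chi n * Cconj (chi n)) * (Cconj (chi h) * ee q (h * n * d)))%C; [rewrite HN; ring|ring].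
  - intros m. rewrite HP, Nat.mul_add_distr_r, ee_plus by auto. rewrite (Nat.mul_comm q d), ee_mult_q by auto. ring.
Qed.

(** If g = gcd (d, q) > 1, primitivity yields some n coprime to q with n = 1 mod q / g and chi(n) <>
    1. Then n d = d mod q, so the sum equals chi(n) times itself and vanishes, as does chi(d). *)
Lemma twisted_gauss_eq q chi d : primitive_character q chi ->
  twisted_gauss q chi d = (chi d * twisted_gauss q chi 1)%C.
Proof.
  intros [HD HI]. assert (HD' := HD). destruct HD' as [Hq [H1 [HM [HP HG]]]].
  destruct (Nat.eq_dec (Nat.gcd d q) 1) as [E|E].
  - rewrite <- twisted_gauss_mul by auto. f_equal. lia.
  - assert (Z := proj2 (HG d) E). rewrite Z, Cmult_0_l.
    destruct (Nat.gcd_divide_r d q) as [M HMq]. destruct (Nat.gcd_divide_l d q) as [d' Hd].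
    set (g := Nat.gcd d q) in *. assert (g <> 0)%nat by (intros G; rewrite G in HMq; lia).
    assert (M <> 0)%nat by (intros G; rewrite G in HMq; lia).
    assert (HM' := HI M ltac:(lia) ltac:(exists g; lia) ltac:(nia)).
    unfold induced_modulus in HM'. apply not_all_ex_not in HM'. destruct HM' as [n HM'].
    apply imply_to_and in HM'. destruct HM' as [Hn HM']. apply imply_to_and in HM'. destruct HM' as [Hmod Hne].
    assert (Hn0 : (1 <= n)%nat).
    { destruct n; [|lia]. rewrite Nat.gcd_0_l in Hn. nia. }
    assert (Hj : exists j, n = (1 + M * j)%nat).
    { exists (n / M - 1 / M)%nat. pose proof (Nat.div_mod n M ltac:(lia)). pose proof (Nat.div_mod 1 M ltac:(lia)).
      pose proof (Nat.Div0.div_le_mono 1 n M Hn0). rewrite Nat.mul_sub_distr_l. nia. }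
    destruct Hj as [j Hj].
    assert (EP : twisted_gauss q chi (n * d) = twisted_gauss q chi d).
    { apply Csum_ext. intros h _. f_equal. apply (periodic_congr (ee q) q Hq (fun m => ee_periodic q m Hq) _ _ 0 (h * j * d')).
      rewrite Hj, HMq, Hd. ring. }
    rewrite twisted_gauss_mul in EP by auto.
    apply Cmult_eq_reg_l with (chi n - 1)%C.
    + replace ((chi n - 1) * twisted_gauss q chi d)%C with (chi n * twisted_gauss q chi d - twisted_gauss q chi d)%C by ring.
      rewrite EP. ring.
    + intros Q. apply Hne. replace (chi n) with (chi n - 1 + 1)%C by ring. rewrite Q. ring.
Qed.

(** The range 1, ..., q is moved to 0, ..., q - 1 by periodicity at the endpoint. *)
Lemma gauss_sum_Csum q chi : (1 <= q)%nat -> (forall n, chi (n + q)%nat = chi n) ->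
  gauss_sum q chi = Csum (fun h => chi h * ee q h)%C q.
Proof.
  intros Hq HP. unfold gauss_sum. destruct q as [|m]; [lia|]. replace (S m - 1)%nat with m by lia.
  rewrite Csum_sum_n. rewrite (Csum_shift (fun h => chi h * ee (S m) h)%C). cbv zeta.
  change (Csum (fun j => chi (S j) * ee (S m) (S j))%C (S m) = (chi 0%nat * ee (S m) 0 + Csum (fun i => chi (S i) * ee (S m) (S i)) m)%C).
  simpl Csum. rewrite <- (HP 0%nat), ee_0, ee_q by lia. change (0 + S m)%nat with (S m). ring.
Qed.

(** By [twisted_gauss_eq] the product becomes a double sum over h and d, in which orthogonality
    keeps only h = q - 1, where the character is -1. *)
Lemma gauss_sum_product q chi : primitive_character q chi -> odd_character q chi ->
  (twisted_gauss q chi 1 * gauss_sum q chi = - RtoC (INR q))%C.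
Proof.
  intros HPr HO. assert (HPr' := HPr). destruct HPr' as [HD _]. assert (H2 := odd_character_modulus q chi HD HO).
  assert (HD' := HD). destruct HD' as [Hq [H1 [HM [HP HG]]]].
  rewrite gauss_sum_Csum by auto. rewrite <- Csum_scal.
  transitivity (Csum (fun h => Csum (fun d => Cconj (chi h) * ee q (d * (h + 1)))%C q) q).
  - rewrite Csum_swap. apply Csum_ext. intros d _.
    transitivity (twisted_gauss q chi d * ee q d)%C; [rewrite (twisted_gauss_eq q chi d HPr); ring|].
    unfold twisted_gauss. rewrite Cmult_comm, <- Csum_scal. apply Csum_ext. intros h _.
    replace (d * (h + 1))%nat with (h * d + d)%nat by ring. rewrite ee_plus by auto. ring.
  - rewrite (Csum_single _ q (q - 1)) by (try lia; intros h Hh Hne; rewrite Csum_scal, ee_orthogonality by lia; ring).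
    rewrite Csum_scal, HO.
    replace (Csum (fun d => ee q (d * (q - 1 + 1))) q) with (RtoC (INR q)).
    + unfold Cconj, Cmult, Copp, RtoC; simpl. f_equal; ring.
    + replace (q - 1 + 1)%nat with q by lia. generalize q at 1 4 as n. intros n.
      induction n as [|n IH]; [reflexivity|]. simpl Csum. rewrite <- IH, ee_mult_q, S_INR, RtoC_plus by auto. reflexivity.
Qed.

Lemma gauss_sum_neq_0 q chi : primitive_character q chi -> odd_character q chi -> gauss_sum q chi <> RtoC 0.
Proof.
  intros HP HO Z. assert (E := gauss_sum_product q chi HP HO). rewrite Z, Cmult_0_r in E. injection E as E.
  destruct HP as [HD _]. apply odd_character_modulus in HO; auto. assert (0 < INR q) by (apply lt_0_INR; lia). lra.
Qed.

(** The constant - i tau / q is i / c1, where c1 = - q / tau is the Gauss sum of the conjugate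
    character. *)
Definition dual_coef (q : nat) (chi : nat -> C) (h : nat) : C :=
  (- Ci * gauss_sum q chi * RtoC (/ INR q) * Cconj (chi h))%C.

(** With G the twisted Gauss sum, oddness gives G(d) - G(-d) = 2 chi(d) G(1), and the left side is a
    sine sum; [gauss_sum_product] inverts G(1). *)
Theorem character_sine_sum q chi d : primitive_character q chi -> odd_character q chi ->
  chi d = Csum (fun h => dual_coef q chi h * RtoC (sin (INR d * om q h)))%C q.
Proof.
  intros HPr HO. assert (HPr' := HPr). destruct HPr' as [HD _]. assert (H2 := odd_character_modulus q chi HD HO).
  assert (HG := gauss_sum_product q chi HPr HO). assert (HM : forall m n, chi (m * n)%nat = (chi m * chi n)%C) by apply HD.
  set (T := gauss_sum q chi) in *. set (c1 := twisted_gauss q chi 1) in *.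
  assert (Q : RtoC (INR q) <> 0%C) by (intros Z; injection Z as Z; revert Z; apply not_0_INR; lia).
  assert (E : (2 * (chi d * c1) = Csum (fun h => 2 * (Ci * (Cconj (chi h) * RtoC (sin (INR d * om q h))))) q)%C).
  { transitivity (twisted_gauss q chi d - twisted_gauss q chi (d * (q - 1)))%C.
    - rewrite (twisted_gauss_eq q chi d HPr), (twisted_gauss_eq q chi (d * (q - 1)) HPr), HM, HO. fold c1. rewrite RtoC_m1. ring.
    - unfold twisted_gauss. rewrite <- Csum_minus. apply Csum_ext. intros h _. rewrite Nat.mul_assoc, ee_conj by lia.
      replace (INR d * om q h) with (om q (h * d)) by (unfold om; rewrite mult_INR; unfold Rdiv; ring).
      destruct (chi h) as [u v]. unfold ee, Cconj, Cminus, Cplus, Copp, Cmult, Ci, RtoC; simpl. f_equal; ring. }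
  apply Cmult_eq_reg_l with (- RtoC (INR q))%C.
  - rewrite <- HG at 1. rewrite <- Csum_scal.
    transitivity (T * / 2 * (2 * (chi d * c1)))%C; [field; intros Z; injection Z as Z; lra|]. rewrite E, <- Csum_scal. apply Csum_ext. intros h _.
    unfold dual_coef. fold T. rewrite RtoC_inv; [|now apply not_0_INR; lia]. field. exact Q.
  - intros Z. apply Q. replace (RtoC (INR q)) with (- (- RtoC (INR q)))%C by ring. rewrite Z. ring.
Qed.

Theorem character_sine_pair q chi : primitive_character q chi -> odd_character q chi ->
  sine_pair q (fun d => Re (chi d)) (fun h => Re (dual_coef q chi h)) /\
  sine_pair q (fun d => Im (chi d)) (fun h => Im (dual_coef q chi h)).
Proof.
  intros HPr HO. assert (HPr' := HPr). destruct HPr' as [HD _]. assert (H2 := odd_character_modulus q chi HD HO).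
  assert (HB := fun n => character_Cmod_le q chi n HD).
  assert (HR := fun h => odd_character_reflect q chi h HD HO).
  assert (HP : forall n, chi (n + q)%nat = chi n) by apply HD.
  assert (GP : forall j, dual_coef q chi (j + q) = dual_coef q chi j) by (intros; unfold dual_coef; now rewrite HP).
  assert (GR : forall h, (h <= q)%nat -> dual_coef q chi (q - h) = (- dual_coef q chi h)%C).
  { intros h Hh. unfold dual_coef. rewrite HR by auto. replace (Cconj (- chi h)) with (- Cconj (chi h))%C by (unfold Cconj, Copp; simpl; reflexivity). ring. }
  split; (split; [exact H2|split; [|split; [|split]]]).
  - intros d. eapply Rle_trans; [apply Rabs_Re_le|apply HB].
  - intros d. rewrite (character_sine_sum q chi d HPr HO) at 1. rewrite Re_Csum. destruct q as [|m]; [lia|].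
    replace (S m - 1)%nat with m by lia. apply sum_n_ext. intros h. unfold Re, Cmult, RtoC; simpl. ring.
  - intros j. now rewrite GP.
  - intros h Hh. now rewrite GR.
  - intros d. eapply Rle_trans; [apply Rabs_Im_le|apply HB].
  - intros d. rewrite (character_sine_sum q chi d HPr HO) at 1. rewrite Im_Csum. destruct q as [|m]; [lia|].
    replace (S m - 1)%nat with m by lia. apply sum_n_ext. intros h. unfold Im, Cmult, RtoC; simpl. ring.
  - intros j. now rewrite GP.
  - intros h Hh. now rewrite GR.
Qed.

(** * Nonvanishing at negative even integers *)

Lemma gV_le q g B m t j : (1 <= q)%nat -> (forall j, Rabs (g j) <= B) ->
  Rabs (g (S j) * V (m + 2) t (om q (S j))) <= B * (/ (om q 1 * INR (S j))) ^ (m + 2).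
Proof.
  intros Hq HB. assert (Hw := om_pos q j Hq). rewrite Rabs_mult, <- om_S by auto.
  apply Rmult_le_compat; try apply Rabs_pos; [apply HB|]. apply UV_le_x. rewrite Rabs_right; lra.
Qed.

Lemma ex_series_gV_bound q B m : (1 <= q)%nat -> ex_series (fun j => B * (/ (om q 1 * INR (S j))) ^ (m + 2)).
Proof.
  intros Hq. apply (ex_series_scal_l B (fun j => (/ (om q 1 * INR (S j))) ^ (m + 2))), ex_series_pow_inv, om_pos, Hq.
Qed.

Lemma Psi_bound q f g m : sine_pair q f g ->
  exists A, 0 < A /\ forall t, 0 < t -> Rabs (Psi (S m) f t) <= A * exp (- (t / 2)).
Proof.
  intros HS. assert (HS' := HS). destruct HS' as [Hq [Hf [_ [Hper _]]]].
  destruct (periodic_bounded g q ltac:(lia) Hper) as [B [HB0 HB]].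
  destruct (Psi_decay (S m)) as [A [HA HD]].
  set (sz := fun j => B * (/ (om q 1 * INR (S j))) ^ (m + 2)).
  assert (Hex : ex_series sz) by (apply ex_series_gV_bound; lia).
  set (M := 2 * INR (fact (S m)) * Series sz).
  assert (Hsm : forall t, 0 < t -> Rabs (Psi (S m) f t) <= M).
  { intros t Ht. rewrite (Psi_partial_fractions q f g _ t HS Ht). unfold M.
    rewrite Rabs_mult, Rabs_right by (pose proof (pos_INR (fact (S m))); lra).
    apply Rmult_le_compat_l; [pose proof (pos_INR (fact (S m))); lra|].
    apply Series_abs_le; [|exact Hex]. intros j. apply gV_le; [lia|exact HB]. }
  assert (HM : 0 <= M) by (eapply Rle_trans; [apply Rabs_pos|apply (Hsm 1); lra]).
  destruct (near_far_bound (Psi (S m) f) (fun _ => 1) M A) as [C [HC BC]]; try (intros; lra); auto.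
  - intros t Ht. rewrite Rmult_1_r. apply Hsm. lra.
  - exists C. split; [exact HC|]. intros t Ht. specialize (BC t Ht). now rewrite Rmult_1_r in BC.
Qed.

Lemma lim_mul_inv_INR_S C : is_lim_seq (fun n => C * / INR (S n)) 0.
Proof.
  replace (Finite 0) with (Rbar_mult C 0) by (simpl; f_equal; ring). apply is_lim_seq_scal_l, lim_inv_INR_S.
Qed.

Lemma lim_zero_of_bound (u : nat -> R) C : (forall n, Rabs (u n) <= C * / INR (S n)) -> is_lim_seq u 0.
Proof.
  intros H. apply is_lim_seq_abs_0, is_lim_seq_le_le with (fun _ => 0) (fun n => C * / INR (S n)).
  - intros n. split; [apply Rabs_pos|apply H].
  - apply is_lim_seq_const.
  - apply lim_mul_inv_INR_S.
Qed.

Lemma half_exp_le n : INR (S n) * exp (- (INR (S n) / 2)) <= 16 * / INR (S n).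
Proof.
  pose proof (INR_S_ge1 n). set (N := INR (S n)) in *.
  pose proof (exp_neg_le 2 (N / 2) ltac:(lra)) as B. replace ((INR 2 / (N / 2)) ^ 2) with (16 * / N * / N) in B by (simpl; field; lra).
  apply Rmult_le_compat_l with (r := N) in B; [|lra]. replace (N * (16 * / N * / N)) with (16 * / N) in B by (field; lra). exact B.
Qed.

Lemma Psi_lim_infty m f : (forall d, Rabs (f d) <= 1) ->
  is_lim_seq (fun n => Psi m f (INR (S n))) 0 /\ is_lim_seq (fun n => INR (S n) * Psi m f (INR (S n))) 0.
Proof.
  intros Hf. destruct (Psi_decay m) as [A [HA HD]].
  assert (B : forall n, INR (S n) * Rabs (Psi m f (INR (S n))) <= 16 * A * / INR (S n)).
  { intros n. pose proof (INR_S_ge1 n). pose proof (half_exp_le n). specialize (HD f (INR (S n)) Hf ltac:(lra)).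
    apply Rle_trans with (INR (S n) * (A * exp (- (INR (S n) / 2)))); [apply Rmult_le_compat_l; lra|]. nra. }
  split; apply lim_zero_of_bound with (16 * A); intros n; apply Rle_trans with (2 := B n); pose proof (INR_S_ge1 n).
  - pose proof (Rabs_pos (Psi m f (INR (S n)))). nra.
  - rewrite Rabs_mult, (Rabs_right (INR (S n))); lra.
Qed.

(** Dominated convergence in the partial fractions, which remain summable at t = 0. *)
Lemma Psi_lim_zero q f g m : sine_pair q f g ->
  is_lim_seq (fun n => Psi (S m) f (/ INR (S n)))
    (2 * INR (fact (S m)) * Series (fun j => g (S j) * V (m + 2) 0 (om q (S j)))).
Proof.
  intros HS. assert (HS' := HS). destruct HS' as [Hq [Hf [_ [Hper _]]]].
  destruct (periodic_bounded g q ltac:(lia) Hper) as [B [HB0 HB]].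
  apply is_lim_seq_ext with (fun n => 2 * INR (fact (S m)) * Series (fun j => g (S j) * V (m + 2) (/ INR (S n)) (om q (S j)))).
  - intros n. symmetry. apply Psi_partial_fractions with (1 := HS). apply Rinv_0_lt_compat, INR_S_pos.
  - apply (is_lim_seq_scal_l (fun n => Series (fun j => g (S j) * V (m + 2) (/ INR (S n)) (om q (S j))))
      (2 * INR (fact (S m))) (Series (fun j => g (S j) * V (m + 2) 0 (om q (S j))))).
    apply (tannery (fun n j => g (S j) * V (m + 2) (/ INR (S n)) (om q (S j))) _ (fun j => B * (/ (om q 1 * INR (S j))) ^ (m + 2))).
    + apply ex_series_gV_bound. lia.
    + intros n j. apply gV_le; [lia|exact HB].
    + intros j. apply (is_lim_seq_scal_l (fun n => V (m + 2) (/ INR (S n)) (om q (S j))) (g (S j)) (V (m + 2) 0 (om q (S j)))).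
      apply (is_lim_seq_continuous (fun s => V (m + 2) s (om q (S j)))); [|exact lim_inv_INR_S].
      apply continuity_pt_filterlim, (ex_derive_continuous (fun s => V (m + 2) s (om q (S j)))). eexists.
      apply (is_derive_UV_t (m + 2) 0). pose proof (om_pos q j ltac:(lia)). nra.
Qed.

(** [Psi] of index 2k + 1 is minus the derivative of that of index 2k, so the integral is the limit
    of the latter at 0. This expresses L(-2k, chi) by the dual Dirichlet series at 2k + 1, as the
    functional equation would. *)
Lemma hint_Psi_odd q f g k : sine_pair q f g -> (1 <= k)%nat ->
  hint (Psi (2 * k + 1) f)
  = 2 * INR (fact (2 * k)) * (-1) ^ k * Series (fun j => g (S j) * (/ om q (S j)) ^ (2 * k + 1)).
Proof.
  intros HS Hk. assert (HS' := HS). destruct HS' as [Hq [Hf _]].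
  destruct (dom_Psi_odd q f g k HS) as [A [D _]].
  assert (L := Psi_lim_zero q f g (2 * k - 1) HS). replace (S (2 * k - 1)) with (2 * k)%nat in L by lia.
  rewrite (hint_FTC _ (fun t => - Psi (2 * k) f t) A
    (- (2 * INR (fact (2 * k)) * Series (fun j => g (S j) * V (2 * k - 1 + 2) 0 (om q (S j))))) (- 0) D).
  - rewrite (Series_ext _ (fun j => (-1) ^ k * (g (S j) * (/ om q (S j)) ^ (2 * k + 1)))).
    + rewrite Series_scal_l. ring.
    + intros j. pose proof (om_pos q j ltac:(lia)). replace (2 * k - 1 + 2)%nat with (S (2 * k)) by lia.
      destruct (UV_zero k (om q (S j)) ltac:(lra)) as [E1 E2]. rewrite V_S, E1, E2.
      replace (2 * k + 1)%nat with (S (2 * k)) by lia. rewrite <- (tech_pow_Rmult (/ om q (S j))). field. lra.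
  - intros t Ht. evar_last; [apply (is_derive_opp (Psi (2 * k) f)), is_derive_Psi; auto|].
    replace (2 * k + 1)%nat with (S (2 * k)) by lia. change opp with Ropp. eqR. ring.
  - exact (proj1 (is_lim_seq_opp _ _) L).
  - exact (proj1 (is_lim_seq_opp _ _) (proj1 (Psi_lim_infty (2 * k) f Hf))).
Qed.

(** Two integrations by parts leave the limit of [Psi] of index 2k - 1 at 0, which vanishes because
    the index is odd. This is the trivial zero of L at 1 - 2k and the reason for delta_k. *)
Lemma hint_mul_Psi_odd q f g k : sine_pair q f g -> (1 <= k)%nat -> hint (fun t => t * Psi (2 * k + 1) f t) = 0.
Proof.
  intros HS Hk. assert (HS' := HS). destruct HS' as [Hq [Hf _]].
  destruct (dom_Psi_odd q f g k HS) as [A [_ [D _]]].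
  destruct (Psi_odd_bound q f g (k - 1) HS) as [B [HB1 HB2]]. destruct (Psi_bound q f g (2 * k - 1) HS) as [B' [HB1' HB2']].
  replace (S (2 * k - 1)) with (2 * k)%nat in HB2' by lia. replace (2 * (k - 1) + 1)%nat with (2 * k - 1)%nat in HB2 by lia.
  rewrite (hint_FTC _ (fun t => - (t * Psi (2 * k) f t + Psi (2 * k - 1) f t)) A 0 0 D); [ring| | |].
  - intros t Ht. evar_last.
    + apply (is_derive_opp (fun t => t * Psi (2 * k) f t + Psi (2 * k - 1) f t)).
      apply (is_derive_plus (fun t => t * Psi (2 * k) f t)); [|apply is_derive_Psi; auto].
      apply (is_derive_mult (fun t : R => t) (Psi (2 * k) f) t 1); [apply (is_derive_id t)|apply is_derive_Psi; auto|intros; apply Rmult_comm].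
    + replace (S (2 * k - 1)) with (2 * k)%nat by lia. replace (2 * k + 1)%nat with (S (2 * k)) by lia.
      unfold plus, opp, mult, one; cbn -[Psi]. ring.
  - apply lim_zero_of_bound with (B' + B). intros n. pose proof (INR_S_pos n) as HN. apply Rinv_0_lt_compat in HN.
    specialize (HB2 _ HN). specialize (HB2' _ HN). set (t := / INR (S n)) in *.
    assert (E : exp (- (t / 2)) <= 1) by (rewrite <- exp_0; left; apply exp_increasing; lra). pose proof (exp_pos (- (t / 2))).
    rewrite Rabs_Ropp. eapply Rle_trans; [apply Rabs_triang|]. rewrite Rabs_mult, (Rabs_right t) by lra.
    assert (Rabs (Psi (2 * k) f t) <= B') by nra.
    assert (Rabs (Psi (2 * k - 1) f t) <= B * t) by (apply Rle_trans with (1 := HB2); assert (0 < B * t) by nra; nra).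
    nra.
  - destruct (Psi_lim_infty (2 * k) f Hf) as [_ L1]. destruct (Psi_lim_infty (2 * k - 1) f Hf) as [L2 _].
    replace 0 with (- (0 + 0)) by ring. exact (proj1 (is_lim_seq_opp _ _) (is_lim_seq_plus' _ _ _ _ L1 L2)).
Qed.

(** The terms after the first add up to at most 1 / 2, by 1 / (N+1)^3 <= (1 / N - 1 / (N+1)) / 2,
    and cannot cancel the leading 1 in the real part. *)
Lemma Series_cubes_tail (c : nat -> C) p : (forall j, Cmod (c j) <= 1) -> c 1%nat = RtoC 1 ->
  (Series (fun j => Re (c (S j)) * / INR (S j) ^ (p + 3)), Series (fun j => Im (c (S j)) * / INR (S j) ^ (p + 3))) <> RtoC 0.
Proof.
  intros Hc H1 E. injection E as E _.
  set (tl := fun j => / 2 * (/ INR (S j) - / INR (S (S j)))).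
  assert (T : is_series tl (/ 2)).
  { replace (/ 2) with (/ 2 * 1) at 1 by ring. apply (is_series_scal_l (/ 2) (fun j => / INR (S j) - / INR (S (S j)))).
    apply is_series_lim. apply is_lim_seq_ext with (fun n => 1 - / INR (S (S n))).
    - intros n. induction n as [|n IH]; [rewrite sum_O; simpl; field|]. rewrite sum_n_S, <- IH. eqR. ring.
    - replace 1 with (1 - 0) at 1 by ring. apply is_lim_seq_minus'; [apply is_lim_seq_const|].
      apply -> (is_lim_seq_incr_1 (fun n => / INR (S n))). exact lim_inv_INR_S. }
  assert (Ex : ex_series tl) by (exists (/ 2); exact T).
  assert (Bd : forall j, Rabs (Re (c (S (S j))) * / INR (S (S j)) ^ (p + 3)) <= tl j).
  { intros j. pose proof (INR_S_ge1 j) as HN. unfold tl. rewrite (S_INR (S j)). set (N := INR (S j)) in *.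
    rewrite Rabs_mult. assert (C1 := Rle_trans _ _ _ (Rabs_Re_le (c (S (S j)))) (Hc (S (S j)))).
    assert (0 < (N + 1) ^ 3) by (apply pow_lt; lra). assert (1 <= (N + 1) ^ p) by (apply pow_R1_Rle; lra).
    assert (0 < / (N + 1) ^ (p + 3)) by (apply Rinv_0_lt_compat, pow_lt; lra).
    rewrite (Rabs_right (/ (N + 1) ^ (p + 3))) by lra.
    apply Rle_trans with (/ (N + 1) ^ 3).
    - apply Rle_trans with (1 * / (N + 1) ^ (p + 3)); [apply Rmult_le_compat_r; lra|]. rewrite Rmult_1_l.
      apply Rinv_le_contravar; [auto|]. rewrite pow_add. nra.
    - replace (/ 2 * (/ N - / (N + 1))) with (/ (2 * N * (N + 1))) by (field; lra).
      apply Rinv_le_contravar; nra. }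
  assert (Ex' : ex_series (fun j => Re (c (S (S j))) * / INR (S (S j)) ^ (p + 3))) by (apply (ex_series_dom _ tl); assumption).
  rewrite Series_incr_1 in E by (apply (ex_series_incr_1 (fun j => Re (c (S j)) * / INR (S j) ^ (p + 3))); exact Ex').
  rewrite H1 in E. change (INR 1) with 1 in E. change (Re (RtoC 1)) with 1 in E. rewrite pow1, Rinv_1 in E.
  assert (A := Series_abs_le _ _ Bd Ex). rewrite (is_series_unique _ _ T) in A. apply Rabs_le_between in A. match type of A with _ <= ?r <= _ => set (r0 := r) in A; change (1 * 1 + r0 = 0) in E end. lra.
Qed.

(** The value is a nonzero constant times tau(chi) times the series of the conjugate character at 2k
    + 1 >= 3, which its first term dominates. *)
Theorem L_odd_character_neg_even_neq_0 q chi k : primitive_character q chi -> odd_character q chi -> (1 <= k)%nat ->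
  (hint (Psi (2 * k + 1) (fun d => Re (chi d))), hint (Psi (2 * k + 1) (fun d => Im (chi d)))) <> RtoC 0.
Proof.
  intros HP HO Hk E. destruct (character_sine_pair q chi HP HO) as [S1 S2].
  assert (E1 := f_equal fst E). assert (E2 := f_equal snd E). unfold RtoC in E1, E2. cbn [fst snd] in E1, E2.
  rewrite (hint_Psi_odd _ _ _ k S1 Hk) in E1. rewrite (hint_Psi_odd _ _ _ k S2 Hk) in E2.
  assert (HD := proj1 HP). assert (H2 := odd_character_modulus q chi HD HO).
  assert (Fp : INR (fact (2 * k)) <> 0) by (apply not_0_INR, fact_neq_0).
  assert (Mp : (-1) ^ k <> 0) by (apply pow_nonzero; lra).
  set (c := fun j => Cconj (chi j)).
  assert (Hc : forall j, Cmod (c j) <= 1) by (intros; unfold c; rewrite Cmod_conj; now apply (character_Cmod_le q)).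
  set (lam := (- Ci * gauss_sum q chi * RtoC (/ INR q))%C).
  assert (Hw := om_pos q 0 ltac:(lia)).
  set (sr := Series (fun j => Re (c (S j)) * / INR (S j) ^ (2 * k + 1))).
  set (si := Series (fun j => Im (c (S j)) * / INR (S j) ^ (2 * k + 1))).
  assert (X : forall pr : C -> R, (forall z, Rabs (pr z) <= Cmod z) -> ex_series (fun j => pr (c (S j)) * / INR (S j) ^ (2 * k + 1))).
  { intros pr Hpr. apply (ex_series_dom _ (fun j => / INR (S j) ^ 2)); [|exact ex_series_inv_sq]. intros j.
    pose proof (INR_S_ge1 j). rewrite Rabs_mult. assert (P1 := Rle_trans _ _ _ (Hpr (c (S j))) (Hc (S j))).
    assert (0 < INR (S j) ^ 2) by (apply pow_lt; lra).
    assert (1 <= INR (S j) ^ (2 * k - 1)) by (apply pow_R1_Rle; lra).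
    assert (0 < / INR (S j) ^ (2 * k + 1)) by (apply Rinv_0_lt_compat, pow_lt; lra).
    rewrite (Rabs_right (/ _)) by lra. apply Rle_trans with (1 * / INR (S j) ^ (2 * k + 1)); [apply Rmult_le_compat_r; lra|].
    rewrite Rmult_1_l. apply Rinv_le_contravar; [auto|].
    replace (2 * k + 1)%nat with (2 + (2 * k - 1))%nat by lia. rewrite pow_add. nra. }
  assert (X1 := X Re Rabs_Re_le). assert (X2 := X Im Rabs_Im_le). clear X.
  assert (Op : forall j, (/ om q (S j)) ^ (2 * k + 1) = (/ om q 1) ^ (2 * k + 1) * / INR (S j) ^ (2 * k + 1)).
  { intros j. pose proof (INR_S_pos j). rewrite om_S, <- pow_inv, <- Rpow_mult_distr by lia. f_equal. field. lra. }
  assert (K1 : Series (fun j => Re (dual_coef q chi (S j)) * (/ om q (S j)) ^ (2 * k + 1))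
             = (/ om q 1) ^ (2 * k + 1) * (Re lam * sr - Im lam * si)).
  { unfold sr, si. rewrite <- !Series_scal_l, <- Series_minus by first [exact (ex_series_scal_l _ _ X1)|exact (ex_series_scal_l _ _ X2)].
    rewrite <- Series_scal_l. apply Series_ext. intros j. rewrite Op. unfold dual_coef. fold lam. fold (c (S j)).
    unfold Cmult, Re, Im; simpl fst; simpl snd. ring. }
  assert (K2 : Series (fun j => Im (dual_coef q chi (S j)) * (/ om q (S j)) ^ (2 * k + 1))
             = (/ om q 1) ^ (2 * k + 1) * (Re lam * si + Im lam * sr)).
  { unfold sr, si. rewrite <- !Series_scal_l, <- Series_plus by first [exact (ex_series_scal_l _ _ X1)|exact (ex_series_scal_l _ _ X2)].
    rewrite <- Series_scal_l. apply Series_ext. intros j. rewrite Op. unfold dual_coef. fold lam. fold (c (S j)).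
    unfold Cmult, Re, Im; simpl fst; simpl snd. ring. }
  rewrite K1 in E1. rewrite K2 in E2.
  assert (Wp : (/ om q 1) ^ (2 * k + 1) <> 0) by (apply pow_nonzero, Rinv_neq_0_compat; lra).
  assert (Z1 : Re lam * sr - Im lam * si = 0).
  { apply Rmult_integral in E1. destruct E1 as [E1|E1]; [exfalso; apply Rmult_integral in E1; destruct E1; nra|].
    apply Rmult_integral in E1. tauto. }
  assert (Z2 : Re lam * si + Im lam * sr = 0).
  { apply Rmult_integral in E2. destruct E2 as [E2|E2]; [exfalso; apply Rmult_integral in E2; destruct E2; nra|].
    apply Rmult_integral in E2. tauto. }
  assert (ZC : (lam * (sr, si))%C = RtoC 0).
  { apply injective_projections; [exact Z1|exact Z2]. }
  assert (NZ : (sr, si) <> RtoC 0).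
  { unfold sr, si. replace (2 * k + 1)%nat with (2 * k - 2 + 3)%nat by lia. apply Series_cubes_tail; [exact Hc|].
    unfold c. rewrite (proj1 (proj2 HD)). unfold Cconj, RtoC; simpl. now rewrite Ropp_0. }
  assert (NL : lam <> RtoC 0).
  { unfold lam. assert (INR q <> 0) by (apply not_0_INR; lia).
    repeat apply Cmult_neq_0; [|now apply gauss_sum_neq_0|].
    - intros Z. injection Z as Z. lra.
    - intros Z. injection Z as Z. revert Z. now apply Rinv_neq_0_compat. }
  now apply (Cmult_neq_0 _ _ NL NZ).
Qed.

(** * Positivity of a fourfold divisor function *)

Definition cconv (F G : nat -> C) (n : nat) : C :=
  Csum (fun x => if divb x n then F x * G (n / x)%nat else RtoC 0)%C (S n).

Lemma divb_iff d n : divb d n = true <-> (1 <= d)%nat /\ exists m, n = (d * m)%nat.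
Proof.
  unfold divb. destruct (Nat.eqb_spec d 0) as [->|Hd]; simpl; [split; [discriminate|lia]|].
  rewrite Nat.eqb_eq. split.
  - intros H. split; [lia|]. exists (n / d)%nat. pose proof (Nat.div_mod n d Hd). lia.
  - intros [_ [m ->]]. rewrite Nat.mul_comm. apply Nat.Div0.mod_mul.
Qed.

Lemma divb_mul_r d m : (1 <= d)%nat -> divb d (d * m) = true.
Proof. intros H. apply divb_iff. split; [exact H|now exists m]. Qed.

Lemma div_mul_l d m : (1 <= d)%nat -> (d * m / d = m)%nat.
Proof. intros H. rewrite Nat.mul_comm. apply Nat.div_mul. lia. Qed.

Lemma cconv_double F G n : (1 <= n)%nat ->
  cconv F G n = Csum (fun x => Csum (fun y => if (x * y =? n)%nat then F x * G y else RtoC 0)%C (S n)) (S n).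
Proof.
  intros Hn. apply Csum_ext. intros x Hx. destruct (divb x n) eqn:E.
  - apply divb_iff in E. destruct E as [Hx1 [m Hm]]. subst n. rewrite div_mul_l by auto.
    rewrite (Csum_single _ _ m).
    + now rewrite Nat.eqb_refl.
    + nia.
    + intros y _ Hy. destruct (Nat.eqb_spec (x * y) (x * m)) as [Q|Q]; [exfalso; nia|reflexivity].
  - rewrite (Csum_ext _ (fun _ => RtoC 0)); [now rewrite Csum_zero|]. intros y _.
    destruct (Nat.eqb_spec (x * y) n) as [Q|Q]; [exfalso|reflexivity].
    rewrite <- Q, divb_mul_r in E; [discriminate|nia].
Qed.

Lemma cconv_comm F G n : (1 <= n)%nat -> cconv F G n = cconv G F n.
Proof.
  intros Hn. rewrite !cconv_double, Csum_swap by auto. apply Csum_ext. intros x _. apply Csum_ext. intros y _.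
  rewrite Nat.mul_comm. destruct (x * y =? n)%nat; [ring|reflexivity].
Qed.

Lemma cconv_ext F F' G G' n : (forall x, (1 <= x <= n)%nat -> F x = F' x) -> (forall x, (1 <= x <= n)%nat -> G x = G' x) ->
  (1 <= n)%nat -> cconv F G n = cconv F' G' n.
Proof.
  intros HF HG Hn. apply Csum_ext. intros x Hx. destruct (divb x n) eqn:E; [|reflexivity].
  apply divb_iff in E. destruct E as [Hx1 [m Hm]]. subst n. rewrite div_mul_l by auto.
  rewrite HF, HG by nia. reflexivity.
Qed.

Lemma Csum_extend F n m : (n <= m)%nat -> (forall i, (n <= i < m)%nat -> F i = RtoC 0) -> Csum F m = Csum F n.
Proof.
  intros H HF. induction m as [|m IH]; [now replace n with 0%nat by lia|].
  destruct (Nat.eq_dec n (S m)) as [->|]; [reflexivity|]. simpl. rewrite IH, HF by (intros; try apply HF; lia). ring.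
Qed.

(** Dirichlet convolution with the point mass at d, which explains why it commutes with [cconv]. *)
Definition dil (d : nat) (F : nat -> C) (n : nat) : C := if divb d n then F (n / d)%nat else RtoC 0.

Lemma cconv_dil F G d n : (1 <= n)%nat -> cconv F (dil d G) n = dil d (cconv F G) n.
Proof.
  intros Hn. unfold dil at 2. destruct (divb d n) eqn:E.
  - apply divb_iff in E. destruct E as [Hd [m Hm]]. subst n. rewrite div_mul_l by auto. unfold cconv.
    rewrite (Csum_extend _ (S m) (S (d * m))).
    + apply Csum_ext. intros x _. destruct (divb x m) eqn:Ex.
      * apply divb_iff in Ex. destruct Ex as [Hx [l Hl]]. subst m. rewrite div_mul_l by auto.
        replace (d * (x * l))%nat with (x * (d * l))%nat by ring. rewrite divb_mul_r, div_mul_l by auto.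
        unfold dil. now rewrite divb_mul_r, div_mul_l by auto.
      * destruct (divb x (d * m)) eqn:Ex'; [|reflexivity]. apply divb_iff in Ex'. destruct Ex' as [Hx [l Hl]].
        rewrite Hl, div_mul_l by auto. unfold dil. destruct (divb d l) eqn:El; [exfalso|ring].
        apply divb_iff in El. destruct El as [_ [r Hr]]. subst l. assert (m = x * r)%nat by nia. subst m.
        rewrite divb_mul_r in Ex by auto. discriminate.
    + nia.
    + intros x Hx. destruct (divb x (d * m)) eqn:Ex'; [|reflexivity]. apply divb_iff in Ex'. destruct Ex' as [Hx1 [l Hl]].
      rewrite Hl, div_mul_l by auto. unfold dil. destruct (divb d l) eqn:El; [exfalso|ring].
      apply divb_iff in El. destruct El as [_ [r Hr]]. subst l. assert (m = x * r)%nat by nia. subst m. destruct r; nia.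
  - unfold cconv. rewrite (Csum_ext _ (fun _ => RtoC 0)); [apply Csum_zero|]. intros x _.
    destruct (divb x n) eqn:Ex; [|reflexivity]. apply divb_iff in Ex. destruct Ex as [Hx [l Hl]]. subst n.
    rewrite div_mul_l by auto. unfold dil. destruct (divb d l) eqn:El; [exfalso|ring].
    apply divb_iff in El. destruct El as [Hd [r Hr]]. subst l. replace (x * (d * r))%nat with (d * (x * r))%nat in E by ring.
    rewrite divb_mul_r in E by auto. discriminate.
Qed.

Lemma cconv_Csum F (c : nat -> C) (H : nat -> nat -> C) N n :
  cconv F (fun x => Csum (fun e => c e * H e x)%C N) n = Csum (fun e => c e * cconv F (H e) n)%C N.
Proof.
  unfold cconv. transitivity (Csum (fun x => Csum (fun e => c e * (if divb x n then F x * H e (n / x)%nat else RtoC 0))%C N) (S n)).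
  - apply Csum_ext. intros x _. destruct (divb x n).
    + rewrite <- Csum_scal. apply Csum_ext. intros e _. ring.
    + rewrite (Csum_ext _ (fun _ => RtoC 0)), Csum_zero; [reflexivity|]. intros; ring.
  - rewrite Csum_swap. apply Csum_ext. intros e _. now rewrite Csum_scal.
Qed.

(* [least_divisor n p] makes [p] prime; only this form of primality is used. *)
Definition least_divisor (n p : nat) : Prop :=
  (2 <= p)%nat /\ Nat.divide p n /\ forall d, (2 <= d)%nat -> Nat.divide d n -> (p <= d)%nat.

Lemma least_divisor_exists n : (2 <= n)%nat -> exists p, least_divisor n p.
Proof.
  intros Hn. assert (K : forall m, (exists p, least_divisor n p) \/ (forall d, (2 <= d <= m)%nat -> ~ Nat.divide d n)).
  { induction m as [|m [IH|IH]]; [right; intros; lia|now left|].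
    destruct (le_lt_dec 2 (S m)) as [H2|H2]; [|right; intros; lia].
    destruct (Nat.eq_dec (n mod S m) 0) as [E|E].
    - left. exists (S m). split; [exact H2|]. split; [now apply Nat.Lcm0.mod_divide|].
      intros d Hd Hdn. destruct (le_lt_dec (S m) d); [assumption|]. exfalso. apply (IH d); [lia|exact Hdn].
    - right. intros d Hd Hdn. destruct (Nat.eq_dec d (S m)) as [->|]; [|apply (IH d); [lia|exact Hdn]].
      apply E. now apply Nat.Lcm0.mod_divide. }
  destruct (K n) as [H|H]; [exact H|]. exfalso. apply (H n); [lia|apply Nat.divide_refl].
Qed.

Lemma least_divisor_euclid n p x y : least_divisor n p -> Nat.divide p (x * y) -> Nat.divide p x \/ Nat.divide p y.
Proof.
  intros [H2 [Hp Hmin]] H. pose proof (Nat.gcd_divide_l p x) as G1. pose proof (Nat.gcd_divide_r p x) as G2.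
  destruct (le_lt_dec 2 (Nat.gcd p x)) as [G|G].
  - left. specialize (Hmin _ G (Nat.divide_trans _ _ _ G1 Hp)). pose proof (Nat.divide_pos_le (Nat.gcd p x) p ltac:(lia) G1).
    replace p with (Nat.gcd p x) by lia. exact G2.
  - right. apply Nat.gauss with x; [exact H|]. destruct (Nat.gcd p x) as [|[|]] eqn:E; [|reflexivity|lia].
    apply Nat.gcd_eq_0 in E. lia.
Qed.

Lemma prime_part n p x : least_divisor n p -> (1 <= x)%nat -> exists a x', x = (p ^ a * x')%nat /\ ~ Nat.divide p x'.
Proof.
  intros HP. induction x as [x IH] using lt_wf_ind. intros Hx. destruct HP as [H2 _].
  destruct (Nat.eq_dec (x mod p) 0) as [E|E].
  - apply Nat.Lcm0.mod_divide in E. destruct E as [z Hz]. destruct (IH z ltac:(nia) ltac:(nia)) as [a [x' [H1 H3]]].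
    exists (S a), x'. split; [rewrite Hz, H1; simpl; ring|exact H3].
  - exists 0%nat, x. split; [simpl; ring|]. intros D. apply E. now apply Nat.Lcm0.mod_divide.
Qed.

Lemma divb_pow_part n p a x' e : least_divisor n p -> ~ Nat.divide p x' -> divb (p ^ e) (p ^ a * x') = (e <=? a)%nat.
Proof.
  intros [H2 _] Hx. assert (P : forall m, (1 <= p ^ m)%nat) by (intros m; pose proof (Nat.pow_nonzero p m); lia).
  destruct (Nat.leb_spec e a) as [H|H].
  - replace (p ^ a * x')%nat with (p ^ e * (p ^ (a - e) * x'))%nat; [now apply divb_mul_r|].
    rewrite Nat.mul_assoc, <- Nat.pow_add_r. do 2 f_equal. lia.
  - destruct (divb (p ^ e) (p ^ a * x')) eqn:E; [exfalso|reflexivity]. apply divb_iff in E. destruct E as [_ [m Hm]].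
    apply Hx. exists (p ^ (e - a - 1) * m)%nat. pose proof (P a).
    replace e with (a + (1 + (e - a - 1)))%nat in Hm by lia. rewrite !Nat.pow_add_r, Nat.pow_1_r in Hm.
    apply Nat.mul_cancel_l with (p ^ a)%nat; [lia|]. rewrite Hm. ring.
Qed.

(** The p-adic valuation as a sum of divisibility indicators, cut off at N, which suffices for x <=
    N. In this form its product with a function splits over the powers of p. *)
Definition pval (p N x : nat) : C := Csum (fun e => if divb (p ^ S e) x then RtoC 1 else RtoC 0) N.

Lemma pval_part n p N a x' : least_divisor n p -> ~ Nat.divide p x' -> (a <= N)%nat ->
  pval p N (p ^ a * x') = RtoC (INR a).
Proof.
  intros HP Hx Ha. unfold pval. rewrite (Csum_extend _ a N Ha).
  - rewrite (Csum_ext _ (fun _ => RtoC 1)).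
    + clear. induction a as [|a IH]; [reflexivity|]. simpl Csum. now rewrite IH, S_INR, RtoC_plus.
    + intros e He. rewrite (divb_pow_part n) by auto. now replace (S e <=? a)%nat with true by (symmetry; apply Nat.leb_le; lia).
  - intros e He. rewrite (divb_pow_part n) by auto. now replace (S e <=? a)%nat with false by (symmetry; apply Nat.leb_gt; lia).
Qed.

Lemma part_exponent_le p a x' : (2 <= p)%nat -> (1 <= p ^ a * x')%nat -> (a <= p ^ a * x')%nat.
Proof. intros H2 Hx. pose proof (Nat.pow_gt_lin_r p a H2). destruct x'; nia. Qed.

Lemma pval_mul n p N x y : least_divisor n p -> (1 <= x * y <= N)%nat ->
  pval p N (x * y) = (pval p N x + pval p N y)%C.
Proof.
  intros HP Hxy. assert (H2 : (2 <= p)%nat) by apply HP. assert (1 <= x /\ 1 <= y)%nat by nia.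
  destruct (prime_part n p x HP ltac:(lia)) as [a [x' [Hx Hx']]]. destruct (prime_part n p y HP ltac:(lia)) as [b [y' [Hy Hy']]].
  pose proof (part_exponent_le p a x' H2 ltac:(lia)). pose proof (part_exponent_le p b y' H2 ltac:(lia)).
  assert (Exy : (x * y = p ^ (a + b) * (x' * y'))%nat) by (rewrite Hx, Hy, Nat.pow_add_r; ring).
  pose proof (part_exponent_le p (a + b) (x' * y') H2 ltac:(lia)).
  rewrite Exy, Hx, Hy. rewrite !(pval_part n) by (auto; try nia; intros D; now apply (least_divisor_euclid n) in D as [D|D]).
  now rewrite plus_INR, RtoC_plus.
Qed.

(* The valuation acts on Dirichlet convolution as a derivation; [log_derivation p N F c] says that
   its logarithmic derivative on [F] is supported on powers of [p], with coefficients [c]. *)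
Definition log_derivation (p N : nat) (F c : nat -> C) : Prop :=
  forall x, (1 <= x <= N)%nat -> (pval p N x * F x = Csum (fun e => c e * dil (p ^ S e) F x) N)%C.

(** Where p^e divides x, complete multiplicativity factors F(x) as F(p^e) F(x / p^e). *)
Lemma log_derivation_mul_fun p N F : (2 <= p)%nat -> (forall x y, F (x * y)%nat = (F x * F y)%C) ->
  log_derivation p N F (fun e => F (p ^ S e)%nat).
Proof.
  intros Hp HF x Hx. unfold pval. rewrite Cmult_comm, <- Csum_scal. apply Csum_ext. intros e _. unfold dil.
  destruct (divb (p ^ S e) x) eqn:E; [|ring]. rewrite <- HF, (divb_mul_div _ _ E). ring.
Qed.

(** The valuation is additive on x = u (x / u), which gives the product rule. Dilations commute with
    convolution, so the two coefficient sequences add. *)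
Lemma log_derivation_cconv n p N F G c d : least_divisor n p ->
  log_derivation p N F c -> log_derivation p N G d ->
  log_derivation p N (cconv F G) (fun e => c e + d e)%C.
Proof.
  intros HP HF HG x Hx.
  transitivity (cconv (fun u => pval p N u * F u)%C G x + cconv F (fun u => pval p N u * G u)%C x)%C.
  - unfold cconv. rewrite <- Csum_plus, <- Csum_scal. apply Csum_ext. intros u Hu. destruct (divb u x) eqn:E; [|ring].
    pose proof (divb_mul_div _ _ E) as Em. replace (pval p N x) with (pval p N (u * (x / u))) by now rewrite Em.
    rewrite (pval_mul n) by (auto; lia). ring.
  - rewrite cconv_comm by lia.
    rewrite (cconv_ext G G (fun u => pval p N u * F u)%C (fun u => Csum (fun e => c e * dil (p ^ S e) F u)%C N))
      by (try lia; intros; try reflexivity; apply HF; lia).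
    rewrite (cconv_ext F F (fun u => pval p N u * G u)%C (fun u => Csum (fun e => d e * dil (p ^ S e) G u)%C N))
      by (try lia; intros; try reflexivity; apply HG; lia).
    rewrite !cconv_Csum, <- Csum_plus. apply Csum_ext. intros e _. rewrite !cconv_dil by lia.
    unfold dil. destruct (divb (p ^ S e) x) eqn:E; [|ring].
    rewrite (cconv_comm G F); [ring|]. apply divb_mul_div in E. destruct (x / p ^ S e)%nat; lia.
Qed.

Definition rsum (chi : nat -> C) : nat -> C := cconv (fun _ => RtoC 1) chi.

Definition rr (chi : nat -> C) : nat -> C := cconv (rsum chi) (rsum (fun n => Cconj (chi n))).

(** Strong induction. For a prime p dividing n the derivation rule reads v_p(n) rr(n) = sum_e (2 + 2
    Re chi(p^e)) rr(n / p^e), with nonnegative coefficients and smaller arguments, so Euler factors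
    need not be computed. *)
Theorem rr_nonneg chi n : (forall x y, chi (x * y)%nat = (chi x * chi y)%C) -> chi 1%nat = RtoC 1 ->
  (forall x, Cmod (chi x) <= 1) -> (1 <= n)%nat -> Im (rr chi n) = 0 /\ 0 <= Re (rr chi n).
Proof.
  intros HM H1 HB. induction n as [n IH] using lt_wf_ind. intros Hn.
  destruct (Nat.eq_dec n 1) as [->|Hn1].
  - assert (R1 : forall psi : nat -> C, psi 1%nat = RtoC 1 -> rsum psi 1 = RtoC 1).
    { intros psi Hp. unfold rsum, cconv; simpl. rewrite Hp. ring. }
    assert (E : rr chi 1 = RtoC 1).
    { unfold rr, cconv; simpl. rewrite !R1; [ring|rewrite H1; unfold Cconj, RtoC; simpl; now rewrite Ropp_0|exact H1]. }
    rewrite E. simpl. lra.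
  - destruct (least_divisor_exists n ltac:(lia)) as [p HP]. assert (H2 : (2 <= p)%nat) by apply HP.
    assert (One : log_derivation p n (fun _ => RtoC 1) (fun _ => RtoC 1)) by (apply (log_derivation_mul_fun p n (fun _ => RtoC 1) H2); intros; symmetry; apply Cmult_1_l).
    assert (D := fun psi (Hpsi : forall x y, psi (x * y)%nat = (psi x * psi y)%C) =>
      log_derivation_cconv n p n _ _ _ _ HP One
        (log_derivation_mul_fun p n psi H2 Hpsi)).
    assert (Hc : forall x y, Cconj (chi (x * y)%nat) = (Cconj (chi x) * Cconj (chi y))%C) by (intros; rewrite HM; apply Cmult_conj).
    assert (E := log_derivation_cconv n p n _ _ _ _ HP (D chi HM) (D (fun n => Cconj (chi n)) Hc) n ltac:(lia)).
    fold (rsum chi) in E. fold (rsum (fun n => Cconj (chi n))) in E. fold (rr chi) in E.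
    assert (S : forall m, let s := Csum (fun e => (RtoC 1 + chi (p ^ S e)%nat + (RtoC 1 + Cconj (chi (p ^ S e)%nat))) * dil (p ^ S e) (rr chi) n)%C m in
              Im s = 0 /\ 0 <= Re s).
    { induction m as [|m [I1 I2]]; [simpl; lra|]. cbv zeta in *. cbn [Csum].
      set (s := Csum _ m) in *. clearbody s.
      assert (Q : Im (dil (p ^ S m) (rr chi) n) = 0 /\ 0 <= Re (dil (p ^ S m) (rr chi) n)).
      { unfold dil. destruct (divb (p ^ S m) n) eqn:Ed; [|simpl; lra]. apply divb_mul_div in Ed.
        assert (2 <= p ^ S m)%nat by (simpl; pose proof (Nat.pow_nonzero p m); nia).
        apply IH; nia. }
      assert (B := Rle_trans _ _ _ (Rabs_Re_le (chi (p ^ S m)%nat)) (HB (p ^ S m)%nat)). apply Rabs_le_between in B.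
      destruct (chi (p ^ S m)%nat) as [u v]. destruct (dil (p ^ S m) (rr chi) n) as [w z]. destruct s as [s1 s2].
      unfold Re, Im, Cmult, Cplus, Cconj, RtoC in *; simpl in *. destruct Q as [-> Q]. split; [lra|]. nra. }
    specialize (S n). cbv zeta in S. rewrite <- E in S.
    assert (V : exists a, (1 <= a)%nat /\ pval p n n = RtoC (INR a)).
    { destruct (prime_part n p n HP Hn) as [a [x' [Hx Hx']]]. exists a. split.
      - destruct a; [exfalso|lia]. apply Hx'. replace x' with n by (rewrite Hx; simpl; ring). apply HP.
      - pose proof (part_exponent_le p a x' H2 ltac:(lia)). rewrite Hx at 2. apply (pval_part n); auto. lia. }
    destruct V as [a [Ha V]]. rewrite V in S. assert (1 <= INR a) by (apply (le_INR 1), Ha).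
    destruct (rr chi n) as [w z]. unfold Re, Im, Cmult, RtoC in *; simpl in *. destruct S as [S1 S2]. split; nra.
Qed.

(** * Nonvanishing at 0 *)

Lemma continuity_of_derive (G : R -> R) z l : is_derive G z l -> continuity_pt G z.
Proof. intros Hz. apply derivable_continuous_pt. exists l. now apply is_derive_Reals. Qed.

(** The mean value theorem starts from the points 1 / (n + 1), since F is controlled only on (0,
    u]. *)
Lemma bound_from_zero (F F' : R -> R) B u : 0 < u ->
  (forall z, 0 < z <= u -> is_derive F z (F' z)) -> (forall z, 0 < z <= u -> Rabs (F' z) <= B) ->
  is_lim_seq (fun n => F (/ INR (S n))) 0 -> Rabs (F u) <= B * u.
Proof.
  intros Hu HF HB L.
  assert (L2 : is_lim_seq (fun n => Rabs (F u - F (/ INR (S n)))) (Rabs (F u - 0))).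
  { apply (is_lim_seq_abs _ (Finite (F u - 0))), is_lim_seq_minus'; [apply is_lim_seq_const|exact L]. }
  rewrite Rminus_0_r in L2.
  apply (is_lim_seq_le_loc (fun n => Rabs (F u - F (/ INR (S n)))) (fun _ => B * u) (Rabs (F u)) (B * u));
    [|exact L2|apply is_lim_seq_const].
  assert (LI := lim_inv_INR_S). apply is_lim_seq_spec in LI. destruct (LI (mkposreal u Hu)) as [N HN]. exists N. intros n Hn.
  specialize (HN n Hn). cbn [pos] in HN. pose proof (INR_S_pos n) as Pn. apply Rinv_0_lt_compat in Pn.
  rewrite Rminus_0_r, Rabs_right in HN by lra. set (s := / INR (S n)) in *.
  destruct (MVT_gen F s u F') as [c [Hc Ec]].
  - intros z Hz. rewrite Rmin_left, Rmax_right in Hz by lra. apply HF. lra.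
  - intros z Hz. rewrite Rmin_left, Rmax_right in Hz by lra. eapply continuity_of_derive. apply HF. lra.
  - rewrite Rmin_left, Rmax_right in Hc by lra. rewrite Ec, Rabs_mult, (Rabs_right (u - s)) by lra.
    specialize (HB c ltac:(lra)). pose proof (Rabs_pos (F' c)). nra.
Qed.

(** The error is differentiated as a function of the right endpoint; its derivative is half a
    second-order Taylor remainder of p. *)
Lemma trapezoid_error (P p p1 p2 : R -> R) a b M : a < b ->
  (forall z, a <= z <= b -> is_derive P z (p z)) -> (forall z, a <= z <= b -> is_derive p z (p1 z)) ->
  (forall z, a <= z <= b -> is_derive p1 z (p2 z)) -> (forall z, a <= z <= b -> Rabs (p2 z) <= M) ->
  Rabs (P b - P a - (b - a) / 2 * (p a + p b)) <= M * (b - a) ^ 3.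
Proof.
  intros Hab H0 H1 H2 HM.
  set (E := fun u => P u - P a - (u - a) / 2 * (p a + p u)).
  set (E' := fun u => / 2 * (p u - p a - (u - a) * p1 u)).
  assert (HE : forall z, a <= z <= b -> is_derive E z (E' z)).
  { intros z Hz. unfold E. evar_last.
    - apply (is_derive_minus (fun u => P u - P a)).
      + apply (is_derive_minus P (fun _ => P a)); [now apply H0|apply is_derive_const].
      + apply (is_derive_mult (fun u => (u - a) / 2) (fun u => p a + p u) z (/ 2) (p1 z)); [auto_derive; [exact I|field]| |intros; apply Rmult_comm].
        evar_last; [apply (is_derive_plus (fun _ => p a) p); [apply is_derive_const|now apply H1]|]. unfold plus, zero; simpl. ring.
    - unfold E', minus, plus, opp, mult, zero; simpl. field. }
  destruct (MVT_gen E a b E') as [c [Hc Ec]].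
  - intros z Hz. rewrite Rmin_left, Rmax_right in Hz by lra. apply HE. lra.
  - intros z Hz. rewrite Rmin_left, Rmax_right in Hz by lra. eapply continuity_of_derive. apply HE. lra.
  - rewrite Rmin_left, Rmax_right in Hc by lra.
    replace (P b - P a - (b - a) / 2 * (p a + p b)) with (E b - E a) by (unfold E; field).
    rewrite Ec, Rabs_mult, (Rabs_right (b - a)) by lra.
    assert (T : Rabs (p a - p c - (a - c) * p1 c) <= M * (a - c) ^ 2).
    { apply (taylor2_bound p p1 p2); intros z Hz; rewrite Rmin_right, Rmax_left in Hz by lra; [apply H1|apply H2|apply HM]; lra. }
    assert (HM0 : 0 <= M) by (eapply Rle_trans; [apply Rabs_pos|apply (HM a); lra]).
    assert (B : Rabs (E' c) <= M * (b - a) ^ 2).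
    { unfold E'. replace (/ 2 * (p c - p a - (c - a) * p1 c)) with (- / 2 * (p a - p c - (a - c) * p1 c)) by ring.
      rewrite Rabs_mult, Rabs_left by lra. pose proof (Rabs_pos (p a - p c - (a - c) * p1 c)).
      assert ((a - c) ^ 2 <= (b - a) ^ 2) by nra. assert (M * (a - c) ^ 2 <= M * (b - a) ^ 2) by (apply Rmult_le_compat_l; lra). lra. }
    replace (M * (b - a) ^ 3) with (M * (b - a) ^ 2 * (b - a)) by ring. apply Rmult_le_compat_r; lra.
Qed.

Lemma is_series_sine_geometric t th : 0 < t ->
  is_series (fun d => exp (- (INR (S d) * t)) * sin (INR (S d) * th)) (sin th * exp t / (exp t ^ 2 - 2 * cos th * exp t + 1)).
Proof.
  intros Ht. replace (sin th * exp t / _) with ((exp (- t) * sin th - exp (- t) ^ 2 * sin 0) / (1 - 2 * cos th * exp (- t) + exp (- t) ^ 2)).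
  - apply is_series_trig_geometric; [exact Ht|apply Rabs_sin_le|].
    intros u. replace u with (u + th - th) at 3 by ring. rewrite (sin_plus (u + th) th), (sin_minus (u + th) th). ring.
  - assert (Gt : 1 < exp t) by (apply exp_gt_1; lra). rewrite sin_0, exp_Ropp.
    assert (0 < exp t ^ 2 - 2 * cos th * exp t + 1) by (pose proof (COS_bound th); nra). field. split; lra.
Qed.

(** The closed form of - sum_d f(d) exp (- d t) / d: the arctangent is the sum of exp (- d t) sin (d
    th) / d. It is the primitive of [Psi 0 f] that vanishes at infinity. *)
Definition Phi (q : nat) (g : nat -> R) (t : R) : R :=
  - sum_n (fun h => g h * atan (sin (om q h) / (exp t - cos (om q h)))) (q - 1).

Lemma Psi_0_closed q f g t : sine_pair q f g -> 0 < t ->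
  Psi 0 f t = sum_n (fun h => g h * (sin (om q h) * exp t / (exp t ^ 2 - 2 * cos (om q h) * exp t + 1))) (q - 1).
Proof.
  intros [Hq [Hf [HS _]]] Ht. apply is_series_unique.
  eapply is_series_ext; [|apply (is_series_sum_n (fun h d => g h * (exp (- (INR (S d) * t)) * sin (INR (S d) * om q h))))].
  - intros d. rewrite HS. cbv beta. rewrite pow_O, Rmult_1_l, <- sum_n_scal. apply sum_n_ext. intros h. eqR. ring.
  - intros h _. apply (is_series_scal_l (g h) (fun d => exp (- (INR (S d) * t)) * sin (INR (S d) * om q h))), is_series_sine_geometric, Ht.
Qed.

Lemma is_derive_Phi q f g t : sine_pair q f g -> 0 < t -> is_derive (Phi q g) t (Psi 0 f t).
Proof.
  intros HS Ht. rewrite (Psi_0_closed q f g t HS Ht). unfold Phi. evar_last.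
  - apply (is_derive_opp (fun t => sum_n (fun h => g h * atan (sin (om q h) / (exp t - cos (om q h)))) (q - 1))).
    apply (is_derive_sum_n (fun h t => g h * atan (sin (om q h) / (exp t - cos (om q h)))) (q - 1) t
      (fun h => - (g h * (sin (om q h) * exp t / (exp t ^ 2 - 2 * cos (om q h) * exp t + 1))))).
    intros h _. set (s := sin (om q h)). set (c := cos (om q h)).
    assert (Sc : s * s + c * c = 1) by (pose proof (sin2_cos2 (om q h)) as E; unfold Rsqr in E; exact E).
    assert (Gt : 1 < exp t) by (apply exp_gt_1; lra). assert (c <= 1) by apply COS_bound.
    clearbody s c. assert (D1 : exp t - c <> 0) by lra.
    assert (D2 : 0 < exp t ^ 2 - 2 * c * exp t + 1) by nra.
    auto_derive; [exact D1|]. unfold Rsqr.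
    replace (exp t ^ 2 - 2 * c * exp t + 1) with ((exp t - c) * (exp t - c) + s * s) by nra.
    field. repeat split; try lra; try nra.
  - rewrite (sum_n_ext _ (fun h => -1 * (g h * (sin (om q h) * exp t / (exp t ^ 2 - 2 * cos (om q h) * exp t + 1))))) by (intros; eqR; ring).
    rewrite sum_n_scal. change opp with Ropp. eqR. ring.
Qed.

Lemma om_lt q h : (1 <= h <= q - 1)%nat -> 0 < om q h < 2 * PI.
Proof.
  intros Hh. unfold om. assert (P := PI_RGT_0). assert (0 < INR h) by (apply lt_0_INR; lia). assert (INR h < INR q) by (apply lt_INR; lia).
  split; [apply Rdiv_lt_0_compat; nra|]. apply Rmult_lt_reg_r with (INR q); [lra|]. unfold Rdiv. rewrite Rmult_assoc, Rinv_l by lra. nra.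
Qed.

Lemma atan_half_angle th : 0 < th < 2 * PI -> cos th < 1 /\ atan (sin th / (1 - cos th)) = PI / 2 - th / 2.
Proof.
  intros Hth. set (u := th / 2). assert (Hu : 0 < u < PI) by (unfold u; lra).
  assert (Su : 0 < sin u) by (apply sin_gt_0; lra). assert (Eth : th = 2 * u) by (unfold u; field). clearbody u. subst th.
  rewrite cos_2a_sin, sin_2a. split; [nra|].
  replace (2 * sin u * cos u / (1 - (1 - 2 * sin u * sin u))) with (tan (PI / 2 - u)).
  - rewrite atan_tan by lra. field.
  - unfold tan. rewrite sin_shift, cos_shift. field. assert (0 < sin u * sin u) by nra. repeat split; lra.
Qed.

Lemma odd_sum_zero q (f : nat -> R) : (2 <= q)%nat -> f 0%nat = 0 -> (forall h, (h <= q)%nat -> f (q - h)%nat = - f h) ->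
  sum_n f (q - 1) = 0.
Proof.
  intros Hq Z Hodd. assert (R := sum_n_reflect f q Hq Z). rewrite (sum_n_ext_loc _ (fun h => -1 * f h)) in R.
  - rewrite sum_n_scal in R. lra.
  - intros h Hh. destruct (Nat.eqb_spec h 0) as [->|H]; [rewrite Z; eqR; ring|]. rewrite Hodd by lia. eqR. ring.
Qed.

(** At t = 0 the arctangent equals (PI - th) / 2, so the limit combines the sum of g, zero by
    oddness, with the sum of h g(h). In substance it is a component of - L(1, chi). *)
Lemma Phi_lim_zero q f g : sine_pair q f g -> sum_n (fun h => INR h * g h) (q - 1) = 0 ->
  is_lim_seq (fun n => Phi q g (/ INR (S n))) 0.
Proof.
  intros HS Hg. assert (Z := sine_pair_zero q f g HS). destruct HS as [Hq [_ [_ [_ Hodd]]]]. assert (Z1 := odd_sum_zero q g Hq Z Hodd).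
  assert (V : - sum_n (fun h => g h * (PI / 2 - om q h / 2)) (q - 1) = 0).
  { rewrite (sum_n_ext _ (fun h => PI / 2 * g h + (- (PI / INR q)) * (INR h * g h))).
    - rewrite sum_n_add, !sum_n_scal, Z1, Hg. ring.
    - intros h. unfold om. eqR. field. apply not_0_INR. lia. }
  rewrite <- V. unfold Phi.
  apply (proj1 (is_lim_seq_opp _ (Finite (sum_n (fun h => g h * (PI / 2 - om q h / 2)) (q - 1))))).
  assert (T : forall h, (h <= q - 1)%nat ->
    is_lim_seq (fun n => g h * atan (sin (om q h) / (exp (/ INR (S n)) - cos (om q h)))) (g h * (PI / 2 - om q h / 2))).
  { intros h Hh. destruct h as [|h].
    - rewrite Z, Rmult_0_l. apply (is_lim_seq_ext (fun _ => 0)); [intros; ring|apply is_lim_seq_const].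
    - destruct (atan_half_angle (om q (S h)) (om_lt q (S h) ltac:(lia))) as [C1 C2]. rewrite <- C2.
      apply (is_lim_seq_scal_l _ _ (Finite _)). rewrite <- exp_0 at 1.
      apply (is_lim_seq_continuous (fun s => atan (sin (om q (S h)) / (exp s - cos (om q (S h)))))); [|exact lim_inv_INR_S].
      apply continuity_pt_filterlim, (ex_derive_continuous (fun s => atan (sin (om q (S h)) / (exp s - cos (om q (S h)))))).
      generalize dependent (om q (S h)). intros th C1 _. auto_derive. rewrite exp_0. lra. }
  revert T. generalize (q - 1)%nat as m. induction m as [|m IH]; intros T.
  - apply (is_lim_seq_ext (fun n => g 0%nat * atan (sin (om q 0) / (exp (/ INR (S n)) - cos (om q 0))))); [intros; now rewrite sum_O|].
    rewrite sum_O. apply T. lia.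
  - apply (is_lim_seq_ext (fun n => sum_n (fun h => g h * atan (sin (om q h) / (exp (/ INR (S n)) - cos (om q h)))) m
      + g (S m) * atan (sin (om q (S m)) / (exp (/ INR (S n)) - cos (om q (S m)))))); [intros; now rewrite sum_n_S|].
    rewrite sum_n_S. apply is_lim_seq_plus'; [apply IH; intros; apply T; lia|apply T; lia].
Qed.

Lemma Phi_bound q g : exists G, 0 <= G /\ forall t, 0 < t -> Rabs (Phi q g t) <= G / t.
Proof.
  exists (sum_n (fun h => Rabs (g h)) (q - 1)). split.
  { eapply Rle_trans; [apply Rabs_pos|]. apply (sum_n_Rabs g). }
  intros t Ht. unfold Phi. rewrite Rabs_Ropp. eapply Rle_trans; [apply sum_n_Rabs|].
  unfold Rdiv. rewrite Rmult_comm, <- sum_n_scal. apply sum_n_le. intros h _.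
  rewrite Rabs_mult, Rmult_comm. apply Rmult_le_compat_r; [apply Rabs_pos|].
  assert (B : forall x, Rabs (atan x) <= Rabs x).
  { intros x. destruct (Rle_dec 0 x) as [H|H].
    - rewrite !Rabs_right; [now apply atan_le_id|lra|]. destruct H as [H| <-]; [left; rewrite <- atan_0; now apply atan_increasing|rewrite atan_0; lra].
    - rewrite <- (Rabs_Ropp x), <- (Rabs_Ropp (atan x)), <- atan_opp. rewrite !Rabs_right; [apply atan_le_id; lra|lra|].
      left. rewrite <- atan_0. apply atan_increasing. lra. }
  eapply Rle_trans; [apply B|]. pose proof (COS_bound (om q h)). pose proof (exp_ineq1_le t).
  unfold Rdiv. rewrite Rabs_mult, (Rabs_right (/ _)) by (left; apply Rinv_0_lt_compat; lra).
  pose proof (Rabs_sin_le (om q h)). pose proof (Rabs_pos (sin (om q h))).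
  rewrite <- (Rmult_1_l (/ t)). apply Rmult_le_compat; try lra; [left; apply Rinv_0_lt_compat; lra|apply Rinv_le_contravar; lra].
Qed.

Lemma lim_slope_at_zero (F : R -> R) (l : R) : F 0 = 0 -> is_derive F 0 l ->
  is_lim_seq (fun n => F (/ INR (S n)) * INR (S n)) l.
Proof.
  intros F0 HF. apply is_derive_Reals in HF. apply is_lim_seq_spec. intros eps.
  destruct (HF eps (cond_pos eps)) as [d Hd]. assert (LI := lim_inv_INR_S). apply is_lim_seq_spec in LI.
  destruct (LI d) as [N HN]. exists N. intros n Hn. specialize (HN n Hn). rewrite Rminus_0_r in HN.
  pose proof (INR_S_pos n) as Pn. assert (Pi := Rinv_0_lt_compat _ Pn).
  specialize (Hd (/ INR (S n)) ltac:(lra) HN). rewrite Rplus_0_l, F0, Rminus_0_r in Hd.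
  unfold Rdiv in Hd. rewrite Rinv_inv in Hd. exact Hd.
Qed.

Lemma Psi_0_periodic q f t : (1 <= q)%nat -> (forall d, Rabs (f d) <= 1) -> (forall n, f (n + q)%nat = f n) -> f 0%nat = 0 ->
  0 < t -> Psi 0 f t * (1 - exp (- (INR q * t))) = sum_n (fun h => f h * exp (- (INR h * t))) (q - 1).
Proof.
  intros Hq Hf Hp H0 Ht. set (a := fun d => f d * exp (- (INR d * t))).
  assert (X1 : ex_series (fun d => a (S d))).
  { apply (ex_series_ext (fun d => INR (S d) ^ 0 * exp (- (INR (S d) * t)) * f (S d))); [intros d; unfold a; eqR; ring|].
    now apply ex_series_Psi. }
  assert (X0 : ex_series a) by (apply ex_series_incr_1; exact X1).
  assert (E : Psi 0 f t = Series a).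
  { rewrite Series_incr_1 by exact X0. unfold a at 1. rewrite H0, Rmult_0_l, Rplus_0_l. apply Series_ext. intros d. unfold a. ring. }
  assert (E2 := Series_incr_n a q ltac:(lia) X0).
  rewrite (Series_ext (fun k => a (q + k)%nat) (fun k => exp (- (INR q * t)) * a k)) in E2.
  2:{ intros k. unfold a. rewrite Nat.add_comm, Hp, plus_INR, Rmult_plus_distr_r, Ropp_plus_distr, exp_plus. ring. }
  rewrite Series_scal_l in E2. rewrite E. rewrite <- sum_n_Reals in E2. replace (Init.Nat.pred q) with (q - 1)%nat in E2 by lia.
  fold a. rewrite Rmult_minus_distr_l, Rmult_1_r. rewrite E2 at 1. ring.
Qed.

(** By [Psi_0_periodic] the function is a quotient whose numerator and denominator vanish at 0, and
    the limit is the ratio of their slopes. *)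
Lemma Psi_0_lim_zero q f : (1 <= q)%nat -> (forall d, Rabs (f d) <= 1) -> (forall n, f (n + q)%nat = f n) -> f 0%nat = 0 ->
  sum_n f (q - 1) = 0 ->
  is_lim_seq (fun n => Psi 0 f (/ INR (S n))) (- sum_n (fun h => INR h * f h) (q - 1) / INR q).
Proof.
  intros Hq Hf Hp H0 Hs. assert (Q : 0 < INR q) by (apply lt_0_INR; lia).
  set (P := fun t => sum_n (fun h => f h * exp (- (INR h * t))) (q - 1)).
  assert (LP : is_lim_seq (fun n => P (/ INR (S n)) * INR (S n)) (- sum_n (fun h => INR h * f h) (q - 1))).
  { apply lim_slope_at_zero.
    - unfold P. transitivity (sum_n f (q - 1)); [|exact Hs]. apply sum_n_ext. intros h. rewrite Rmult_0_r, Ropp_0, exp_0. eqR. ring.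
    - replace (- sum_n (fun h => INR h * f h) (q - 1)) with (sum_n (fun h => -1 * (INR h * f h)) (q - 1)) by (rewrite sum_n_scal; eqR; ring).
      apply (is_derive_sum_n (fun h t => f h * exp (- (INR h * t)))). intros h _. generalize (INR h). intros N.
      auto_derive; [exact I|]. rewrite Rmult_0_r, Ropp_0, exp_0. ring. }
  assert (LQ : is_lim_seq (fun n => (1 - exp (- (INR q * / INR (S n)))) * INR (S n)) (INR q)).
  { apply (lim_slope_at_zero (fun t => 1 - exp (- (INR q * t)))).
    - rewrite Rmult_0_r, Ropp_0, exp_0. ring.
    - auto_derive; [exact I|]. rewrite Rmult_0_r, Ropp_0, exp_0. ring. }
  apply is_lim_seq_ext with (fun n => (P (/ INR (S n)) * INR (S n)) / ((1 - exp (- (INR q * / INR (S n)))) * INR (S n))).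
  - intros n. pose proof (INR_S_pos n) as Pn. assert (Pi := Rinv_0_lt_compat _ Pn).
    unfold P. rewrite <- (Psi_0_periodic q f) by auto.
    assert (exp (- (INR q * / INR (S n))) < 1) by (rewrite <- exp_0; apply exp_increasing; nra). field. lra.
  - apply is_lim_seq_div'; [exact LP|exact LQ|lra].
Qed.

(** Componentwise, the formula L(0, chi) = - (1 / q) sum_h h chi(h). *)
Lemma hint_Psi_1 q f g : sine_pair q f g -> (forall n, f (n + q)%nat = f n) -> f 0%nat = 0 -> sum_n f (q - 1) = 0 ->
  hint (Psi 1 f) = - sum_n (fun h => INR h * f h) (q - 1) / INR q /\
  is_lim_seq (fun n => Psi 0 f (/ INR (S n))) (hint (Psi 1 f)).
Proof.
  intros HS Hp H0 Hs. assert (HS' := HS). destruct HS' as [Hq [Hf _]].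
  assert (L := Psi_0_lim_zero q f ltac:(lia) Hf Hp H0 Hs). set (l := - sum_n (fun h => INR h * f h) (q - 1) / INR q) in *.
  destruct (dom_Psi_odd q f g 0 HS) as [A [D _]]. simpl (2 * 0 + 1)%nat in D.
  assert (E : hint (Psi 1 f) = l).
  { rewrite (hint_FTC _ (fun t => - Psi 0 f t) A (- l) (- 0) D); [ring| | |].
    - intros t Ht. evar_last; [apply (is_derive_opp (Psi 0 f)), is_derive_Psi; auto|]. change opp with Ropp. eqR. ring.
    - exact (proj1 (is_lim_seq_opp _ _) L).
    - exact (proj1 (is_lim_seq_opp _ _) (proj1 (Psi_lim_infty 0 f Hf))). }
  split; [exact E|]. now rewrite E.
Qed.

(** * The Lambert series of the divisor sums *)

Definition Br (f : nat -> R) (n : nat) : R := sum_n (fun x => if divb x n then f (n / x)%nat else 0) n.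

(** Division by 2 n makes the coefficients at most 1 in absolute value, so that the estimates for
    [Psi] apply to the Lambert series. *)
Definition Bn (f : nat -> R) (n : nat) : R := Br f n / (2 * INR n).

Lemma Br_bound f n : (forall d, Rabs (f d) <= 1) -> Rabs (Br f (S n)) <= 2 * INR (S n).
Proof.
  intros Hf. unfold Br. eapply Rle_trans; [apply sum_n_Rabs|].
  apply Rle_trans with (sum_n (fun _ => 1) (S n)).
  - apply sum_n_le. intros x _. destruct (divb x (S n)); [apply Hf|rewrite Rabs_R0; lra].
  - rewrite sum_n_const. rewrite (S_INR (S n)). pose proof (INR_S_ge1 n). lra.
Qed.

Lemma Bn_bound f n : (forall d, Rabs (f d) <= 1) -> Rabs (Bn f n) <= 1.
Proof.
  intros Hf. unfold Bn. destruct n as [|n].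
  - unfold Br. rewrite sum_O. simpl. unfold Rdiv. rewrite Rmult_0_l, Rabs_R0. lra.
  - pose proof (INR_S_pos n). unfold Rdiv. rewrite Rabs_mult, (Rabs_right (/ _)) by (left; apply Rinv_0_lt_compat; lra).
    apply Rmult_le_reg_r with (2 * INR (S n)); [lra|]. rewrite Rmult_assoc, Rinv_l, Rmult_1_r, Rmult_1_l by lra. now apply Br_bound.
Qed.

Definition Lam (f : nat -> R) (t : R) : R := 2 * Psi 1 (Bn f) t.

Lemma Lam_series f t : Lam f t = Series (fun n => Br f (S n) * exp (- (INR (S n) * t))).
Proof.
  unfold Lam, Psi. rewrite <- Series_scal_l. apply Series_ext. intros n. pose proof (INR_S_pos n). unfold Bn. field. lra.
Qed.

Lemma ex_series_exp_half t : 0 < t -> ex_series (fun i => exp (- (INR (S i) * (t / 2)))).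
Proof. intros Ht. exists (bose (t / 2)). apply is_series_bose. lra. Qed.

Lemma exp_mul_le t i j : 0 < t ->
  exp (- (INR (S i) * INR (S j) * t)) <= exp (- (INR (S i) * (t / 2))) * exp (- (INR (S j) * (t / 2))).
Proof.
  intros Ht. rewrite <- exp_plus. pose proof (INR_S_ge1 i). pose proof (INR_S_ge1 j).
  set (I := INR (S i)) in *. set (J := INR (S j)) in *.
  assert (K : - (I * J * t) <= - (I * (t / 2)) + - (J * (t / 2))) by (assert (0 <= (I * (J - 1) + J * (I - 1)) * t) by (apply Rmult_le_pos; nra); nra).
  destruct K as [K| ->]; [left; now apply exp_increasing|lra].
Qed.

Lemma Lam_lambert f t : (forall d, Rabs (f d) <= 1) -> 0 < t ->
  is_series (fun i => Psi 0 f (INR (S i) * t)) (Lam f t).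
Proof.
  intros Hf Ht. set (e := fun i => exp (- (INR (S i) * (t / 2)))). assert (He := ex_series_exp_half t Ht). fold e in He.
  assert (Pe : forall i, 0 <= e i) by (intros; left; apply exp_pos).
  assert (Bd : forall i j, Rabs (f (S j) * exp (- (INR (S i) * INR (S j) * t))) <= e i * e j).
  { intros i j. rewrite Rabs_mult, (Rabs_right (exp _)) by (left; apply exp_pos).
    apply Rle_trans with (2 := exp_mul_le t i j Ht). pose proof (exp_pos (- (INR (S i) * INR (S j) * t))). pose proof (Hf (S j)). nra. }
  assert (HD := is_series_divisor (fun x y => f y * exp (- (INR x * INR y * t))) e e He He Pe Pe Bd).
  assert (E : Lam f t = Series (fun i => Psi 0 f (INR (S i) * t))).
  { transitivity (Series (fun i => Series (fun j => f (S j) * exp (- (INR (S i) * INR (S j) * t))))).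
    - rewrite Lam_series. rewrite <- (is_series_unique _ _ HD). apply Series_ext. intros n. unfold Br.
      rewrite Rmult_comm, <- sum_n_scal. apply sum_n_ext. intros x. destruct (divb x (S n)) eqn:Ex; [|eqR; ring].
      rewrite <- mult_INR, (divb_mul_div _ _ Ex). eqR. ring.
    - apply Series_ext. intros i. unfold Psi. apply Series_ext. intros j.
      replace (INR (S j) * (INR (S i) * t)) with (INR (S i) * INR (S j) * t) by ring. rewrite pow_O. ring. }
  rewrite E. apply Series_correct. apply (ex_series_dom _ (fun i => e i * Series e)); [|apply (ex_series_scal_r _ _ He)].
  intros i. unfold Psi. rewrite <- Series_scal_l. apply Series_abs_le; [|apply (ex_series_scal_l _ _ He)].
  intros j. eapply Rle_trans; [|apply (Bd i j)]. right. f_equal.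
  replace (INR (S j) * (INR (S i) * t)) with (INR (S i) * INR (S j) * t) by ring. rewrite pow_O. ring.
Qed.

(* The trapezoid rule: both the integral of [Psi 0 f] and its value at 0 vanish, so its Riemann sums are small. *)
Theorem Lam_small q f g : sine_pair q f g -> is_lim_seq (fun n => Psi 0 f (/ INR (S n))) 0 ->
  sum_n (fun h => INR h * g h) (q - 1) = 0 ->
  exists C, 0 < C /\ forall t, 0 < t -> Rabs (Lam f t) <= C * t * exp (- (t / 2)).
Proof.
  intros HS L0 Hg. assert (HS' := HS). destruct HS' as [Hq [Hf _]].
  destruct (Psi_odd_bound q f g 0 HS) as [A [HA HB]]. simpl (2 * 0 + 1)%nat in HB.
  destruct (Psi_bound q f g 1 HS) as [K [HK HK2]].
  destruct (Psi_decay 1) as [A' [HA' HD]].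
  assert (E1 : forall z, 0 < z -> exp (- (z / 2)) <= 1) by (intros z Hz; rewrite <- exp_0; left; apply exp_increasing; lra).
  (* Here and in [BP], the bound O(t) for [Psi 1] is integrated once and twice from 0, where both
     limits vanish by the hypotheses. *)
  assert (B0 : forall u, 0 < u -> Rabs (Psi 0 f u) <= A * u * u).
  { intros u Hu. apply (bound_from_zero (Psi 0 f) (fun z => - Psi 1 f z)); auto.
    - intros z Hz. apply is_derive_Psi; [lra|exact Hf].
    - intros z Hz. rewrite Rabs_Ropp. eapply Rle_trans; [apply HB; lra|]. specialize (E1 z ltac:(lra)). pose proof (exp_pos (- (z / 2))).
      assert (0 < A * z) by nra. apply Rle_trans with (A * z * 1); [apply Rmult_le_compat_l; lra|nra]. }
  assert (BP : forall u, 0 < u -> Rabs (Phi q g u) <= A * u * u * u).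
  { intros u Hu. apply (bound_from_zero (Phi q g) (Psi 0 f)); auto.
    - intros z Hz. apply is_derive_Phi; [exact HS|lra].
    - intros z Hz. eapply Rle_trans; [apply B0; lra|]. assert (z * z <= u * u) by nra. nra.
    - now apply (Phi_lim_zero q f g). }
  assert (Sm : forall t, 0 < t <= 1 -> Rabs (Lam f t) <= (2 * A + 2 * K) * t).
  { intros t Ht. set (a := fun i => INR (S i) * t).
    assert (Pa : forall i, 0 < a i) by (intros i; unfold a; pose proof (INR_S_pos i); nra).
    assert (Sa : forall i, a (S i) = a i + t) by (intros i; unfold a; rewrite (S_INR (S i)); ring).
    (* The trapezoid error for [Psi 0] on one interval of length t. The errors sum to O(t^3) times
       O(1 / t), and the trapezoid sum is t Lam up to an end correction, whence Lam = O(t). *)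
    set (er := fun i => Phi q g (a (S i)) - Phi q g (a i) - t / 2 * (Psi 0 f (a i) + Psi 0 f (a (S i)))).
    assert (Ber : forall i, Rabs (er i) <= K * t ^ 3 * exp (- (INR (S i) * (t / 2)))).
    { intros i. unfold er. replace t with (a (S i) - a i) at 1 by (rewrite Sa; ring).
      eapply Rle_trans; [apply (trapezoid_error (Phi q g) (Psi 0 f) (fun z => - Psi 1 f z) (Psi 2 f) (a i) (a (S i)) (K * exp (- (a i / 2))))|].
      - rewrite Sa. lra.
      - intros z Hz. pose proof (Pa i). apply is_derive_Phi; [exact HS|lra].
      - intros z Hz. pose proof (Pa i). apply is_derive_Psi; [lra|exact Hf].
      - intros z Hz. pose proof (Pa i). evar_last; [apply (is_derive_opp (Psi 1 f)), is_derive_Psi; [lra|exact Hf]|]. change opp with Ropp. eqR. ring.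
      - intros z Hz. pose proof (Pa i). eapply Rle_trans; [apply HK2; lra|]. apply Rmult_le_compat_l; [lra|].
        apply exp_le. lra.
      - rewrite Sa. replace (a i + t - a i) with t by ring. unfold a. replace (INR (S i) * t / 2) with (INR (S i) * (t / 2)) by field. right. ring. }
    assert (Xe := ex_series_exp_half t ltac:(lra)).
    assert (Be : Rabs (Series er) <= K * t ^ 3 * bose (t / 2)).
    { rewrite <- (is_series_unique _ _ (is_series_bose (t / 2) ltac:(lra))), <- Series_scal_l.
      apply Series_abs_le; [exact Ber|apply (ex_series_scal_l _ _ Xe)]. }
    assert (LL := Lam_lambert f t Hf ltac:(lra)). change (is_series (fun i => Psi 0 f (a i)) (Lam f t)) in LL.
    assert (LS : is_series (fun i => Psi 0 f (a (S i))) (Lam f t - Psi 0 f t)).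
    { apply (is_series_incr_1 (fun i => Psi 0 f (a i))). change plus with Rplus.
      replace (Lam f t - Psi 0 f t + Psi 0 f (a 0%nat)) with (Lam f t); [exact LL|unfold a; simpl INR; rewrite Rmult_1_l; ring]. }
    assert (TS : is_series (fun i => Phi q g (a (S i)) - Phi q g (a i)) (- Phi q g t)).
    { apply is_series_lim. apply is_lim_seq_ext with (fun n => Phi q g (a (S n)) - Phi q g t).
      - intros n. induction n as [|n IH]; [rewrite sum_O; unfold a at 3; simpl INR; now rewrite Rmult_1_l|].
        rewrite sum_n_S, <- IH. eqR. ring.
      - replace (- Phi q g t) with (0 - Phi q g t) by ring. apply is_lim_seq_minus'; [|apply is_lim_seq_const].
        destruct (Phi_bound q g) as [G [HG0 HG]]. apply lim_zero_of_bound with (G / t). intros n.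
        eapply Rle_trans; [apply HG, Pa|]. unfold a. pose proof (INR_S_ge1 n). rewrite (S_INR (S n)).
        unfold Rdiv. rewrite Rinv_mult. replace (G * / t * / INR (S n)) with (G * (/ INR (S n) * / t)) by ring.
        apply Rmult_le_compat_l; [exact HG0|]. apply Rmult_le_compat_r; [left; apply Rinv_0_lt_compat; lra|]. apply Rinv_le_contravar; lra. }
    assert (ES : Series er = - Phi q g t - t / 2 * (Lam f t + (Lam f t - Psi 0 f t))).
    { apply is_series_unique. apply (is_series_minus _ _ _ _ TS).
      apply (is_series_scal_l (t / 2) (fun i => Psi 0 f (a i) + Psi 0 f (a (S i)))). now apply (is_series_plus (fun i => Psi 0 f (a i))). }
    assert (Bo : bose (t / 2) <= 2 / t).
    { eapply Rle_trans; [apply bose_le; lra|]. specialize (E1 (t / 2) ltac:(lra)). pose proof (exp_pos (- (t / 2 / 2))).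
      replace (2 / t) with (/ (t / 2) * 1) by (field; lra). apply Rmult_le_compat_l; [left; apply Rinv_0_lt_compat; lra|lra]. }
    assert (Be2 : Rabs (Series er) <= 2 * K * t * t).
    { eapply Rle_trans; [exact Be|]. replace (2 * K * t * t) with (K * t ^ 3 * (2 / t)) by (field; lra).
      apply Rmult_le_compat_l; [|exact Bo]. apply Rmult_le_pos; [lra|apply pow_le; lra]. }
    assert (EL : t * Lam f t = t / 2 * Psi 0 f t - Phi q g t - Series er) by (rewrite ES; field).
    specialize (B0 t ltac:(lra)). specialize (BP t ltac:(lra)).
    apply Rmult_le_reg_l with t; [lra|]. rewrite <- (Rabs_right t) at 1 by lra. rewrite <- Rabs_mult, EL.
    eapply Rle_trans; [apply Rabs_triang|]. eapply Rle_trans; [apply Rplus_le_compat_r, Rabs_triang|].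
    rewrite !Rabs_Ropp, Rabs_mult, (Rabs_right (t / 2)) by lra.
    assert (t / 2 * Rabs (Psi 0 f t) <= A * t * t).
    { apply Rle_trans with (t / 2 * (A * t * t)); [apply Rmult_le_compat_l; lra|]. assert (0 < A * t * t) by (repeat apply Rmult_lt_0_compat; lra). nra. }
    assert (A * t * t * t <= A * t * t) by (assert (0 < A * t * t) by (repeat apply Rmult_lt_0_compat; lra); nra). lra. }
  apply (near_far_bound _ (fun t => t) (2 * A + 2 * K) (2 * A')); try (intros; lra); [exact Sm|].
  intros t Ht. unfold Lam. rewrite Rabs_mult, Rabs_right by lra.
  specialize (HD (Bn f) t (fun n => Bn_bound f n Hf) Ht). lra.
Qed.

Definition dconv (F G : nat -> R) (n : nat) : R := sum_n (fun d => if divb d n then F d * G (n / d)%nat else 0) n.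

(** The product expands into the integrands [kb] with parameters i and j y, whose integrals depend
    only on i j; grouping by this product gives the Dirichlet square of [Br f]. *)
Theorem is_series_bessel_dconv f y : (forall d, Rabs (f d) <= 1) -> 0 < y ->
  is_series (fun m => dconv (Br f) (Br f) (S m) * hint (kb 1 (INR (S m) * y)))
    (hint (fun t => Lam f t * Lam f (y / t) / t)).
Proof.
  intros Hf Hy. destruct (kb_bound 3) as [A [HA HB]]. set (C := 4 * A * (/ y) ^ 4).
  assert (HC : 0 < C) by (unfold C; apply Rmult_lt_0_compat; [lra|apply pow_lt, Rinv_0_lt_compat, Hy]).
  set (z := fun i => / INR (S i) ^ 2).
  assert (Pz : forall i, 0 < z i) by (intros i; apply Rinv_0_lt_compat, pow_lt, INR_S_pos).
  assert (Xz : ex_series z) by exact ex_series_inv_sq.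
  set (u := fun i j t => Br f (S i) * Br f (S j) * kb (INR (S i)) (INR (S j) * y) t).
  assert (Dk : forall i j, dom (kb (INR (S i)) (INR (S j) * y)) (A * (/ INR (S i)) ^ 3 * (/ (INR (S j) * y)) ^ 4)).
  { intros i j. pose proof (INR_S_ge1 i). pose proof (INR_S_ge1 j). apply dom_kb; [lra|nra|]. intros t Ht. apply HB; auto. nra. }
  assert (Du : forall i j, dom (u i j) (C * z i * z j)).
  { intros i j. pose proof (INR_S_ge1 i) as HN. pose proof (INR_S_ge1 j) as HM.
    eapply dom_weaken; [|apply dom_scal, Dk]. rewrite Rabs_mult.
    pose proof (Br_bound f i Hf) as B1. pose proof (Br_bound f j Hf) as B2. unfold z.
    set (N := INR (S i)) in *. set (M := INR (S j)) in *.
    assert (P0 : 0 < A * (/ N) ^ 3 * (/ (M * y)) ^ 4).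
    { apply Rmult_lt_0_compat; [apply Rmult_lt_0_compat; [lra|]|]; apply pow_lt, Rinv_0_lt_compat; nra. }
    apply Rle_trans with (2 * N * (2 * M) * (A * (/ N) ^ 3 * (/ (M * y)) ^ 4)).
    - apply Rmult_le_compat_r; [lra|]. apply Rmult_le_compat; auto; apply Rabs_pos.
    - replace (2 * N * (2 * M) * (A * (/ N) ^ 3 * (/ (M * y)) ^ 4)) with (C * / N ^ 2 * / M ^ 2 * / M) by (unfold C; field; lra).
      assert (0 < C * / N ^ 2 * / M ^ 2).
      { apply Rmult_lt_0_compat; [apply Rmult_lt_0_compat; [lra|]|]; apply Rinv_0_lt_compat, pow_lt; lra. }
      assert (/ M <= 1) by (rewrite <- Rinv_1; apply Rinv_le_contravar; lra). nra. }
  assert (Xi : forall i, ex_series (fun j => C * z i * z j)) by (intros i; apply (ex_series_scal_l (C * z i) z), Xz).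
  assert (In : forall i, is_series (fun j => hint (u i j)) (hint (fun t => Series (fun j => u i j t)))).
  { intros i. apply (hint_Series (u i) (fun j => C * z i * z j)); [apply Xi|apply Du]. }
  assert (DS : forall i, dom (fun t => Series (fun j => u i j t)) (C * Series z * z i)).
  { intros i. eapply dom_weaken; [|apply (dom_Series (u i) _ (Xi i) (Du i))]. rewrite Series_scal_l. right. ring. }
  assert (Out := hint_Series (fun i t => Series (fun j => u i j t)) (fun i => C * Series z * z i)
    (ex_series_scal_l (C * Series z) z Xz) DS).
  assert (EL : hint (fun t => Lam f t * Lam f (y / t) / t) = Series (fun i => Series (fun j => hint (u i j)))).
  { rewrite (Series_ext _ _ (fun i => is_series_unique _ _ (In i))), (is_series_unique _ _ Out). apply hint_ext. intros t Ht.
    rewrite !Lam_series. unfold Rdiv. rewrite Rmult_assoc, <- Series_scal_r.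
    apply Series_ext. intros i. rewrite <- Series_scal_r, <- Series_scal_l. apply Series_ext. intros j.
    unfold u, kb. replace (INR (S j) * (y * / t)) with (INR (S j) * y / t) by (field; lra). unfold Rdiv. ring. }
  rewrite EL.
  assert (HD := is_series_divisor (fun d m => Br f d * Br f m * hint (kb (INR d) (INR m * y))) (fun i => C * PI * z i) z
    (ex_series_scal_l (C * PI) z Xz) Xz).
  specialize (HD ltac:(intros i; pose proof (Pz i); pose proof PI_RGT_0; apply Rmult_le_pos; nra) ltac:(intros i; left; apply Pz)).
  assert (Hu : forall i j, hint (u i j) = Br f (S i) * Br f (S j) * hint (kb (INR (S i)) (INR (S j) * y))).
  { intros i j. apply (hint_scal _ _ _ (Dk i j)). }
  match type of HD with ?X -> _ => assert (HX : X) end.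
  { intros i j. rewrite <- Hu. eapply Rle_trans; [apply (hint_bound _ _ (Du i j))|]. right. ring. }
  specialize (HD HX). rewrite (Series_ext _ _ (fun i => Series_ext _ _ (Hu i))).
  eapply is_series_ext; [|exact HD]. intros m. unfold dconv.
  rewrite Rmult_comm, <- sum_n_scal. apply sum_n_ext. intros d. destruct (divb d (S m)) eqn:E; [|eqR; ring].
  assert (Hd := E). apply divb_spec in Hd. destruct Hd as [Hd _]. pose proof (divb_mul_div _ _ E) as Em.
  assert (Hn : (1 <= S m / d)%nat) by (destruct (S m / d)%nat; lia).
  assert (0 < INR d) by (apply lt_0_INR; lia). assert (0 < INR (S m / d)) by (apply lt_0_INR; lia). pose proof (INR_S_pos m).
  rewrite !hint_kb by nra. rewrite <- (Rmult_assoc (INR d)), <- mult_INR, Em, Rmult_1_l. eqR. ring.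
Qed.

(** The factor t in the bound for Lam (t) cancels 1 / t, and Lam (y / t) is bounded independently of
    y since z exp (- z / 2) <= 2. *)
Lemma hint_Lam_bound f C : (forall d, Rabs (f d) <= 1) -> 0 < C ->
  (forall t, 0 < t -> Rabs (Lam f t) <= C * t * exp (- (t / 2))) ->
  exists K, forall y, 0 < y -> Rabs (hint (fun t => Lam f t * Lam f (y / t) / t)) <= K.
Proof.
  intros Hf HC HL. destruct (exp_le_wt (/ 2) ltac:(lra)) as [A [HA HE]].
  exists (2 * C * C * A * PI). intros y Hy. apply hint_bound.
  assert (CL : forall t, 0 < t -> continuous (Lam f) t).
  { intros t Ht. apply (continuous_scal_r 2 (Psi 1 (Bn f))). apply continuous_Psi; [exact Ht|]. intros d. now apply Bn_bound. }
  split.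
  - intros t Ht. unfold Rdiv. apply (continuous_mult (fun t => Lam f t * Lam f (y * / t)) (fun t => / t)).
    + apply (continuous_mult (Lam f) (fun t => Lam f (y * / t))); [now apply CL|].
      apply (continuous_comp (fun t => y * / t) (Lam f)); [|apply CL, Rdiv_lt_0_compat; lra].
      apply (ex_derive_continuous (fun t => y * / t)). auto_derive. lra.
    + apply (ex_derive_continuous (fun t => / t)). auto_derive. lra.
  - intros t Ht. assert (Hz : 0 < y / t) by now apply Rdiv_lt_0_compat.
    assert (B1 := HL t Ht). assert (B2 := HL _ Hz). set (z := y / t) in *.
    assert (Bz : Rabs (Lam f z) <= 2 * C).
    { eapply Rle_trans; [exact B2|]. pose proof (exp_ineq1_le (z / 2)) as X. pose proof (exp_pos (- (z / 2))).
      assert (E : exp (z / 2) * exp (- (z / 2)) = 1) by (rewrite <- exp_plus, Rplus_opp_r; apply exp_0).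
      assert (z * exp (- (z / 2)) <= 2) by nra. nra. }
    unfold Rdiv. rewrite !Rabs_mult, (Rabs_right (/ t)) by (left; now apply Rinv_0_lt_compat).
    specialize (HE t Ht). replace (/ 2 * t) with (t / 2) in HE by field. pose proof (exp_pos (- (t / 2))).
    apply Rle_trans with (C * t * exp (- (t / 2)) * (2 * C) * / t).
    + apply Rmult_le_compat_r; [left; now apply Rinv_0_lt_compat|]. apply Rmult_le_compat; auto; apply Rabs_pos.
    + replace (C * t * exp (- (t / 2)) * (2 * C) * / t) with (2 * C * C * exp (- (t / 2))) by (field; lra).
      rewrite (Rmult_assoc (2 * C * C)). apply Rmult_le_compat_l; nra.
Qed.

Lemma rsum_components chi n :
  rsum chi n = (Br (fun d => Re (chi d)) n, Br (fun d => Im (chi d)) n) /\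
  rsum (fun d => Cconj (chi d)) n = (Br (fun d => Re (chi d)) n, - Br (fun d => Im (chi d)) n).
Proof.
  unfold rsum, cconv. rewrite <- !Csum_sum_n. unfold Br.
  split; apply injective_projections; cbn [fst snd].
  - change fst with Re. rewrite Re_sum_n. apply sum_n_ext. intros x. destruct (divb x n); [|reflexivity]. now rewrite Cmult_1_l.
  - change snd with Im. rewrite Im_sum_n. apply sum_n_ext. intros x. destruct (divb x n); [|reflexivity]. now rewrite Cmult_1_l.
  - change fst with Re. rewrite Re_sum_n. apply sum_n_ext. intros x. destruct (divb x n); [|reflexivity]. now rewrite Cmult_1_l.
  - change snd with Im. rewrite Im_sum_n. replace (- sum_n (fun x => if divb x n then Im (chi (n / x)%nat) else 0) n)
      with (-1 * sum_n (fun x => if divb x n then Im (chi (n / x)%nat) else 0) n) by (eqR; ring).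
    rewrite <- sum_n_scal. apply sum_n_ext. intros x. destruct (divb x n).
    + rewrite Cmult_1_l, im_conj. eqR. ring.
    + simpl. eqR. ring.
Qed.

Lemma Re_rr chi n : Re (rr chi n)
  = dconv (Br (fun d => Re (chi d))) (Br (fun d => Re (chi d))) n + dconv (Br (fun d => Im (chi d))) (Br (fun d => Im (chi d))) n.
Proof.
  unfold rr, cconv, dconv. rewrite <- Csum_sum_n, Re_sum_n, <- sum_n_add. apply sum_n_ext. intros d.
  destruct (divb d n); [|simpl; eqR; ring].
  rewrite (proj1 (rsum_components chi d)), (proj2 (rsum_components chi (n / d))).
  unfold Re, Cmult; cbn [fst snd]. eqR. ring.
Qed.

(* If L(0, chi) = 0 then the Lambert series of [1 * chi] is O(t), so the Bessel series of the nonnegative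
   function [rr chi] stays bounded as y -> 0, although its first term is of size log (1 / y). *)
Theorem L_odd_character_zero_neq_0 q chi : primitive_character q chi -> odd_character q chi ->
  (hint (Psi 1 (fun d => Re (chi d))), hint (Psi 1 (fun d => Im (chi d)))) <> RtoC 0.
Proof.
  intros HP HO E. assert (E1 := f_equal fst E). assert (E2 := f_equal snd E). unfold RtoC in E1, E2. cbn [fst snd] in E1, E2.
  destruct (character_sine_pair q chi HP HO) as [S1 S2]. assert (HD := proj1 HP).
  assert (H2 := odd_character_modulus q chi HD HO). assert (HR := fun h => odd_character_reflect q chi h HD HO).
  assert (HB := fun n => character_Cmod_le q chi n HD). destruct HD as [Hq [H1 [HM [HPer HG]]]].
  assert (Z0 : chi 0%nat = RtoC 0) by (apply HG; rewrite Nat.gcd_0_l; lia).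
  set (f1 := fun d => Re (chi d)) in *. set (f2 := fun d => Im (chi d)) in *.
  assert (F1 : forall d, Rabs (f1 d) <= 1) by apply S1. assert (F2 : forall d, Rabs (f2 d) <= 1) by apply S2.
  assert (z1 : f1 0%nat = 0) by (unfold f1; now rewrite Z0). assert (z2 : f2 0%nat = 0) by (unfold f2; now rewrite Z0).
  assert (s1 : sum_n f1 (q - 1) = 0) by (apply odd_sum_zero; auto; intros h Hh; unfold f1; now rewrite HR).
  assert (s2 : sum_n f2 (q - 1) = 0) by (apply odd_sum_zero; auto; intros h Hh; unfold f2; now rewrite HR).
  destruct (hint_Psi_1 q f1 _ S1 ltac:(intros; unfold f1; now rewrite HPer) z1 s1) as [I1 L1].
  destruct (hint_Psi_1 q f2 _ S2 ltac:(intros; unfold f2; now rewrite HPer) z2 s2) as [I2 L2].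
  rewrite E1 in I1, L1. rewrite E2 in I2, L2.
  assert (Q : 0 < INR q) by (apply lt_0_INR; lia).
  assert (Nz : forall s, 0 = - s / INR q -> s = 0).
  { intros s Hs. apply (f_equal (fun x => x * INR q)) in Hs. unfold Rdiv in Hs. rewrite Rmult_assoc, Rinv_l in Hs; lra. }
  apply Nz in I1. apply Nz in I2.
  set (lam := (- Ci * gauss_sum q chi * RtoC (/ INR q))%C).
  (* Vanishing at 0 means that the sum of h chi(h) is 0. As [dual_coef] is a multiple of the
     conjugate character, its sum vanishes too, so both hypotheses of [Lam_small] follow from the
     one assumption. *)
  assert (G1 : sum_n (fun h => INR h * Re (dual_coef q chi h)) (q - 1) = 0).
  { rewrite (sum_n_ext _ (fun h => Re lam * (INR h * f1 h) + Im lam * (INR h * f2 h))).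
    - rewrite sum_n_add, !sum_n_scal, I1, I2. eqR. ring.
    - intros h. unfold dual_coef. fold lam. unfold f1, f2, Cmult, Cconj, Re, Im; simpl fst; simpl snd. eqR. ring. }
  assert (G2 : sum_n (fun h => INR h * Im (dual_coef q chi h)) (q - 1) = 0).
  { rewrite (sum_n_ext _ (fun h => Im lam * (INR h * f1 h) + - Re lam * (INR h * f2 h))).
    - rewrite sum_n_add, !sum_n_scal, I1, I2. eqR. ring.
    - intros h. unfold dual_coef. fold lam. unfold f1, f2, Cmult, Cconj, Re, Im; simpl fst; simpl snd. eqR. ring. }
  destruct (Lam_small q f1 _ S1 L1 G1) as [C1 [P1 B1]]. destruct (Lam_small q f2 _ S2 L2 G2) as [C2 [P2 B2]].
  destruct (hint_Lam_bound f1 C1 F1 P1 B1) as [K1 HK1]. destruct (hint_Lam_bound f2 C2 F2 P2 B2) as [K2 HK2].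
  assert (Rr : forall n, Re (rr chi n) = dconv (Br f1) (Br f1) n + dconv (Br f2) (Br f2) n) by exact (Re_rr chi).
  assert (Up : forall y, 0 < y <= 1 -> exp (-2) * - ln y <= K1 + K2).
  { intros y Hy. assert (T := is_series_plus _ _ _ _ (is_series_bessel_dconv f1 y F1 ltac:(lra)) (is_series_bessel_dconv f2 y F2 ltac:(lra))).
    change plus with Rplus in T.
    assert (T' : is_series (fun m => Re (rr chi (S m)) * hint (kb 1 (INR (S m) * y)))
       (hint (fun t => Lam f1 t * Lam f1 (y / t) / t) + hint (fun t => Lam f2 t * Lam f2 (y / t) / t))).
    { eapply is_series_ext; [|exact T]. intros m. rewrite Rr. eqR. ring. }
    assert (Pos : forall m, 0 <= Re (rr chi (S m)) * hint (kb 1 (INR (S m) * y))).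
    { intros m. apply Rmult_le_pos; [apply (rr_nonneg chi (S m) HM H1 HB); lia|].
      pose proof (INR_S_pos m). destruct (dom_kb_exists 1 (INR (S m) * y) Rlt_0_1 ltac:(nra)) as [A HA].
      assert (Dz := dom_scal _ _ 0 HA).
      apply Rle_trans with (hint (fun t => 0 * kb 1 (INR (S m) * y) t)); [rewrite (hint_scal _ _ _ HA); lra|].
      apply (hint_le _ _ _ _ Dz HA). intros t Ht. rewrite Rmult_0_l. unfold kb. apply Rmult_le_pos; [|left; now apply Rinv_0_lt_compat].
      apply Rmult_le_pos; left; apply exp_pos. }
    (* All terms are nonnegative, so the term n = 1 alone is bounded by the integrals. *)
    assert (Fst := sum_n_Series_le _ 0 Pos (ex_intro _ _ T')). rewrite sum_O, (is_series_unique _ _ T') in Fst.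
    assert (R1 : Re (rr chi 1) = 1).
    { assert (Br1 : forall f, Br f 1 = f 1%nat) by (intros f; unfold Br; rewrite sum_n_S, sum_O; simpl; eqR; ring).
      assert (dc1 : forall F G, dconv F G 1 = F 1%nat * G 1%nat) by (intros F G; unfold dconv; rewrite sum_n_S, sum_O; simpl; eqR; ring).
      rewrite Rr, !dc1, !Br1. unfold f1, f2. rewrite H1. simpl. ring. }
    simpl (INR 1) in Fst. rewrite R1, !Rmult_1_l in Fst. pose proof (hint_kb_lower y Hy).
    specialize (HK1 y ltac:(lra)). specialize (HK2 y ltac:(lra)). apply Rabs_le_between in HK1. apply Rabs_le_between in HK2. lra. }
  (* At y = exp (- K exp 2) the left side of [Up] equals K, which exceeds K1 + K2. *)
  set (K := Rabs (K1 + K2) + 1). pose proof (exp_pos 2). pose proof (Rabs_pos (K1 + K2)).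
  assert (Ex : exp (-2) * exp 2 = 1) by (rewrite <- exp_plus, <- exp_0; f_equal; ring).
  specialize (Up (exp (- (K * exp 2)))). rewrite ln_exp in Up.
  assert (Kp : 0 < K * exp 2) by (unfold K; nra).
  specialize (Up ltac:(split; [apply exp_pos|rewrite <- exp_0; left; apply exp_increasing; lra])).
  replace (exp (-2) * - - (K * exp 2)) with (K * (exp (-2) * exp 2)) in Up by ring. rewrite Ex in Up.
  pose proof (Rle_abs (K1 + K2)). unfold K in Up. lra.
Qed.

Lemma L_neg_even_value_neq_0 q chi k : primitive_character q chi -> odd_character q chi ->
  (hint (Psi (2 * k + 1) (fun d => Re (chi d))), hint (Psi (2 * k + 1) (fun d => Im (chi d)))) <> RtoC 0.
Proof.
  intros HP HO. destruct k as [|k].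
  - apply (L_odd_character_zero_neq_0 q chi HP HO).
  - apply (L_odd_character_neg_even_neq_0 q chi (S k) HP HO). lia.
Qed.

(** * Assembly of the formula *)

Lemma sigma_chi_components k chi n : sigma_chi k chi n
  = (sum_n (fun d => if divb d n then INR d ^ k * Re (chi d) else 0) n,
     sum_n (fun d => if divb d n then INR d ^ k * Im (chi d) else 0) n).
Proof.
  unfold sigma_chi. apply injective_projections; cbn [fst snd]; [change fst with Re|change snd with Im];
    [rewrite Re_sum_n|rewrite Im_sum_n]; apply sum_n_ext; intros d; destruct (divb d n); try reflexivity;
    unfold Re, Im, Cmult, RtoC; simpl fst; simpl snd; eqR; ring.
Qed.

(** Moving lam inside turns the conjugate character into [dual_coef], so the dual series of the two
    components is lam times the stated one. *)
Lemma sigma_bar_dual_coef q chi k n : let lam := (- Ci * gauss_sum q chi * RtoC (/ INR q))%C in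
  (lam * sigma_bar_chi k (fun j => Cconj (chi j)) n)%C
  = (sum_n (fun d => if divb d n then INR d ^ k * Re (dual_coef q chi (n / d)%nat) else 0) n,
     sum_n (fun d => if divb d n then INR d ^ k * Im (dual_coef q chi (n / d)%nat) else 0) n).
Proof.
  intros lam. unfold sigma_bar_chi. rewrite Csum_sum_n, <- Csum_scal, <- Csum_sum_n.
  apply injective_projections; cbn [fst snd]; [change fst with Re|change snd with Im];
    [rewrite Re_sum_n|rewrite Im_sum_n]; apply sum_n_ext; intros d; unfold dual_coef; fold lam; destruct (divb d n);
    unfold Re, Im, Cmult, RtoC; simpl fst; simpl snd; eqR; ring.
Qed.

Lemma Re_pair_mult_R (u v r : R) : Re ((u, v) * RtoC r)%C = u * r.
Proof. unfold Re, Cmult, RtoC; simpl. ring. Qed.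

Lemma Im_pair_mult_R (u v r : R) : Im ((u, v) * RtoC r)%C = v * r.
Proof. unfold Im, Cmult, RtoC; simpl. ring. Qed.

Lemma bessel_argument a x n : 0 < a -> 0 < x -> 2 * sqrt (INR n * (a ^ 2 * x / 4)) = a * sqrt (INR n * x).
Proof.
  intros Ha Hx. replace (INR n * (a ^ 2 * x / 4)) with ((a / 2) ^ 2 * (INR n * x)) by field.
  rewrite sqrt_mult_alt by apply pow2_ge_0. rewrite sqrt_pow2 by lra. field.
Qed.

Lemma log_constants a x : 0 < a -> 0 < x -> ln (a ^ 2 * x / 4) - ln (2 * PI) = ln x - ln (8 * PI / a ^ 2).
Proof.
  intros Ha Hx. pose proof PI_RGT_0. assert (0 < a ^ 2) by (apply pow_lt; lra).
  assert (0 < 8 * PI / a ^ 2) by (apply Rdiv_lt_0_compat; lra).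
  assert (E : ln (a ^ 2 * x / 4) + ln (8 * PI / a ^ 2) = ln (2 * PI) + ln x).
  { rewrite <- !ln_mult by (auto; try nra). f_equal. field. lra. }
  lra.
Qed.

Theorem theorem2p2 (k q : nat) (chi : nat -> C) (Lf : C -> C) (dL : C) (a x : R) :
  Nat.Even k ->
  primitive_character q chi ->
  odd_character q chi ->
  is_L_function chi Lf ->
  @is_derive C_AbsRing C_NormedModule Lf (RtoC (- INR k)) dL ->
  0 < a -> 0 < x ->
  let Lk := Lf (RtoC (- INR k)) in
  exists S2 : C,
    @is_series C_AbsRing C_NormedModule
      (fun m : nat =>
         let n := S m in
         Cmult (sigma_bar_chi k (fun j => Cconj (chi j)) n)
           (RtoC (/ (INR n) ^ (k + 1)
                  - / (INR n + a ^ 2 * INR q * x / (16 * PI ^ 2)) ^ (k + 1))))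
      S2 /\
    @is_series C_AbsRing C_NormedModule
      (fun m : nat =>
         let n := S m in
         Cmult (sigma_chi k chi n) (RtoC (K0 (a * sqrt (INR n * x)))))
      (Cplus
        (Cplus
          (Cminus
            (Cmult (RtoC ((if Nat.eqb k 0 then 1 else 0) * (2 / (a ^ 2 * x))))
                   (Lf (RtoC 1)))
            (Cmult (Cdiv Lk (RtoC 4))
                   (Cminus (Cplus (RtoC (ln (8 * PI / a ^ 2))) (Cdiv dL Lk))
                           (RtoC (2 * euler_gamma)))))
          (Cmult (Cdiv Lk (RtoC 4)) (RtoC (ln x))))
        (Cmult
          (Cmult
            (Cmult (RtoC ((-1) ^ (k / 2))) Ci)
            (RtoC (INR (fact k) * INR q ^ k / (2 * (2 * PI) ^ (k + 1)))))
          (Cmult (gauss_sum q chi) S2))).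
Proof.
  intros [kap Ek] HP HO HL HdL Ha Hx Lk.
  destruct (character_sine_pair q chi HP HO) as [SP1 SP2].
  assert (H2 := odd_character_modulus q chi (proj1 HP) HO). assert (Q : 0 < INR q) by (apply lt_0_INR; lia).
  set (f1 := fun d => Re (chi d)) in *. set (f2 := fun d => Im (chi d)) in *.
  set (g1 := fun h => Re (dual_coef q chi h)) in *. set (g2 := fun h => Im (dual_coef q chi h)) in *.
  (* This makes 2 sqrt (n y) equal to a sqrt (n x) and q y / (4 PI^2) the shift of the stated dual
     series. *)
  set (y := a ^ 2 * x / 4). pose proof PI_RGT_0 as PIpos.
  assert (Ha2 : 0 < a ^ 2) by (apply pow_lt; lra).
  assert (Hy : 0 < y) by (unfold y; apply Rdiv_lt_0_compat; nra).
  set (Y := INR q * y / (4 * PI ^ 2)).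
  assert (EY : a ^ 2 * INR q * x / (16 * PI ^ 2) = Y) by (unfold Y, y; field; lra).
  set (lam := (- Ci * gauss_sum q chi * RtoC (/ INR q))%C).
  assert (Hq0 : RtoC (INR q) <> RtoC 0) by (intros Z; injection Z as Z; lra).
  assert (NL : lam <> RtoC 0).
  { unfold lam. repeat apply Cmult_neq_0; [|now apply gauss_sum_neq_0|].
    - intros Z. injection Z as Z. lra.
    - intros Z. injection Z as Z. revert Z. apply Rinv_neq_0_compat. lra. }
  assert (Etau : gauss_sum q chi = (Ci * RtoC (INR q) * lam)%C).
  { unfold lam. rewrite RtoC_inv by lra.
    transitivity (- (Ci * Ci) * gauss_sum q chi * (RtoC (INR q) * / RtoC (INR q)))%C; [|ring].
    rewrite Cinv_r by exact Hq0. replace (Ci * Ci)%C with (RtoC (-1)) by (apply injective_projections; simpl; ring).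
    rewrite RtoC_m1. ring. }
  destruct (periodic_bounded g1 q ltac:(lia) (proj1 (proj2 (proj2 (proj2 SP1))))) as [B1 [_ HB1]].
  destruct (periodic_bounded g2 q ltac:(lia) (proj1 (proj2 (proj2 (proj2 SP2))))) as [B2 [_ HB2]].
  set (T := fun g : nat -> R => Series (fun i => Series (fun j => INR (S i) ^ k * g (S j) * dual_term k Y (S i * S j)))).
  assert (D1 := dual_series q g1 B1 k y ltac:(lia) HB1 Hy). assert (D2 := dual_series q g2 B2 k y ltac:(lia) HB2 Hy).
  cbv zeta in D1, D2. fold Y in D1, D2. fold (T g1) in D1. fold (T g2) in D2.
  (* The dual sums of the components carry the factor lam, which is removed here; that lam is
     nonzero rests on the Gauss sum being nonzero. *)
  exists (/ lam * (T g1, T g2))%C. split.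
  { assert (SC : @is_series C_AbsRing C_NormedModule
      (fun m => (lam * sigma_bar_chi k (fun j => Cconj (chi j)) (S m) * RtoC (dual_term k Y (S m)))%C) (T g1, T g2)).
    { apply is_series_C. split.
      - eapply is_series_ext; [|exact D1]. intros m. cbv beta. unfold lam. rewrite sigma_bar_dual_coef.
        rewrite Re_pair_mult_R. reflexivity.
      - eapply is_series_ext; [|exact D2]. intros m. cbv beta. unfold lam. rewrite sigma_bar_dual_coef.
        rewrite Im_pair_mult_R. reflexivity. }
    apply (is_series_scal (K := C_AbsRing) (V := C_NormedModule) (/ lam)%C) in SC.
    eapply is_series_ext; [|exact SC]. intros m. change scal with Cmult. cbv zeta. rewrite EY. unfold dual_term.
    match goal with |- ?u = ?v => change (@eq C u v) end. field. exact NL. }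
  assert (F1 : forall d, Rabs (f1 d) <= 1) by apply SP1. assert (F2 : forall d, Rabs (f2 d) <= 1) by apply SP2.
  assert (S1 := is_series_bessel_sum f1 k y F1 Hy). assert (S2 := is_series_bessel_sum f2 k y F2 Hy).
  set (H1 := hint (fun t => Psi (k + 1) f1 t * Qf (y / t))) in *. set (H2' := hint (fun t => Psi (k + 1) f2 t * Qf (y / t))) in *.
  (* The factor 1 / 2 appears because [is_series_bessel_sum] sums 2 K0. *)
  assert (SC : @is_series C_AbsRing C_NormedModule
    (fun m => (sigma_chi k chi (S m) * RtoC (K0 (a * sqrt (INR (S m) * x))))%C) (/ 2 * H1, / 2 * H2')).
  { apply is_series_C. split.
    - eapply is_series_ext; [|apply (is_series_scal_l (/ 2) _ _ S1)]. intros m. cbv beta. rewrite sigma_chi_components, <- (bessel_argument a x) by auto. fold y.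
      rewrite Re_pair_mult_R. set (K := K0 _). match goal with |- _ = ?u * K => set (U := (u : R)); change (/ 2 * (U * (2 * K)) = U * K) end. lra.
    - eapply is_series_ext; [|apply (is_series_scal_l (/ 2) _ _ S2)]. intros m. cbv beta. rewrite sigma_chi_components, <- (bessel_argument a x) by auto. fold y.
      rewrite Im_pair_mult_R. set (K := K0 _). match goal with |- _ = ?u * K => set (U := (u : R)); change (/ 2 * (U * (2 * K)) = U * K) end. lra. }
  match goal with |- is_series _ ?L => replace L with ((/ 2 * H1, / 2 * H2') : C) end; [exact SC|].
  destruct (L_function_values q chi g1 g2 kap Lf SP1 SP2 HL) as [V1 V2]. fold f1 f2 in V1, V2.
  rewrite Ek in HdL. specialize (V2 dL HdL).
  set (W1 := Psi (2 * kap + 1) f1) in *. set (W2 := Psi (2 * kap + 1) f2) in *.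
  assert (V0 := V1 0%nat). simpl (INR 0) in V0. simpl fact in V0. simpl (INR 1) in V0.
  replace (0 - INR (2 * kap)) with (- INR (2 * kap)) in V0 by ring. rewrite <- Ek in V0, V2. fold Lk in V0, V2.
  rewrite (hint_ext (fun t => t ^ 0 * W1 t) W1), (hint_ext (fun t => t ^ 0 * W2 t) W2), Cmult_1_l in V0 by (intros; simpl; ring).
  (* Needed to simplify Lk (dL / Lk) to dL, division by 0 having a default value. *)
  assert (NLk : Lk <> RtoC 0) by (rewrite V0; apply (L_neg_even_value_neq_0 q chi kap HP HO)).
  (* The integral of t w is L(1 - k), the case n = 1 of the L-values: L(1) for k = 0, and zero for k
     > 0 by [hint_mul_Psi_odd]. *)
  assert (EI : (RtoC (if Nat.eqb k 0 then 1 else 0) * Lf (RtoC 1))%C = (hint (fun t => t * W1 t), hint (fun t => t * W2 t))).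
  { destruct kap as [|kap'].
    - rewrite Ek. change (if (2 * 0 =? 0)%nat then 1 else 0) with 1. assert (V := V1 1%nat). simpl (2 * 0)%nat in V. simpl fact in V. simpl INR in V.
      rewrite Rminus_0_r in V. rewrite V. f_equal; apply hint_ext; intros t Ht; now rewrite pow_1.
    - rewrite Ek. change (if (2 * S kap' =? 0)%nat then 1 else 0) with 0. unfold W1, W2.
      rewrite (hint_mul_Psi_odd q f1 g1 (S kap') SP1), (hint_mul_Psi_odd q f2 g2 (S kap') SP2) by lia. apply Cmult_0_l. }
  assert (R1 := hint_Psi_Qf q f1 g1 kap y SP1 Hy). assert (R2 := hint_Psi_Qf q f2 g2 kap y SP2 Hy).
  rewrite <- Ek in R1, R2. fold Y in R1, R2. fold (T g1) in R1. fold (T g2) in R2. fold H1 in R1. fold H2' in R2.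
  unfold W1, W2 in V0, V2, EI. rewrite <- Ek in V0, V2, EI.
  assert (LC := log_constants a x Ha Hx). fold y in LC.
  assert (Ekk : (k / 2)%nat = kap) by (rewrite Ek, Nat.mul_comm; apply Nat.div_mul; lia). rewrite Ekk.
  set (eps := if Nat.eqb k 0 then 1 else 0) in *. set (L1 := Lf (RtoC 1)) in *.
  set (i1 := hint (fun t => t * Psi (k + 1) f1 t)) in *. set (i2 := hint (fun t => t * Psi (k + 1) f2 t)) in *.
  set (j1 := hint (fun t => ln t * Psi (k + 1) f1 t)) in *. set (j2 := hint (fun t => ln t * Psi (k + 1) f2 t)) in *.
  set (w1 := hint (Psi (k + 1) f1)) in *. set (w2 := hint (Psi (k + 1) f2)) in *.
  set (l8 := ln (8 * PI / a ^ 2)) in *. set (lx := ln x) in *. set (t1 := T g1) in *. set (t2 := T g2) in *.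
  set (sg := (-1) ^ kap) in *. set (Df := INR (fact k) * INR q ^ k / (2 * (2 * PI) ^ (k + 1))).
  assert (P2 : (2 * PI) ^ (k + 1) <> 0) by (apply pow_nonzero; lra).
  assert (EDf : INR (fact k) * (INR q / (2 * PI)) ^ (k + 1) = 2 * INR q * Df).
  { unfold Df, Rdiv. rewrite Rpow_mult_distr, pow_inv, pow_add at 1. rewrite pow_1. field. exact P2. }
  (* The same real identity holds for both components; it is the transformation formula rewritten in
     the constants of the statement. *)
  assert (EH : forall H i w j t, H = i / y + (ln y + euler_gamma - ln (2 * PI)) / 2 * w - j / 2 - sg * INR (fact k) * (INR q / (2 * PI)) ^ (k + 1) * t ->
     / 2 * H = 2 / (a ^ 2 * x) * i + (lx - l8 + euler_gamma) / 4 * w - j / 4 - sg * Df * INR q * t).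
  { intros H i w j t ->. rewrite (Rmult_assoc sg), EDf. replace (ln y + euler_gamma - ln (2 * PI)) with (lx - l8 + euler_gamma) by lra.
    unfold y. field. lra. }
  apply EH in R1. apply EH in R2. rewrite R1, R2.
  assert (N4 : RtoC 4 <> RtoC 0) by (intros Z; injection Z as Z; lra).
  replace (Cmult (Cdiv Lk (RtoC 4)) (Cminus (Cplus (RtoC l8) (Cdiv dL Lk)) (RtoC (2 * euler_gamma))))
    with ((Lk * RtoC (l8 - 2 * euler_gamma) + dL) * RtoC (/ 4))%C
    by (rewrite RtoC_minus, RtoC_inv by lra; field; repeat split; assumption).
  (* tau / lam = i q, which with the factor i of the statement becomes the real coefficient - q. *)
  replace (gauss_sum q chi * (/ lam * (t1, t2)))%C with (Ci * RtoC (INR q) * (t1, t2))%C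
    by (rewrite Etau; field; exact NL).
  replace (RtoC (eps * (2 / (a ^ 2 * x))) * L1)%C with (RtoC (2 / (a ^ 2 * x)) * (i1, i2))%C
    by (rewrite <- EI, RtoC_mult; ring).
  replace dL with ((j1, j2) + RtoC euler_gamma * Lk)%C by (rewrite <- V2; ring).
  replace (Lk / RtoC 4)%C with (Lk * RtoC (/ 4))%C by (rewrite RtoC_inv by lra; reflexivity).
  rewrite V0. clearbody i1 i2 j1 j2 w1 w2 l8 lx t1 t2 sg Df.
  set (A := 2 / (a ^ 2 * x)). clearbody A. set (qq := INR q). clearbody qq.
  apply injective_projections; unfold Cplus, Cminus, Copp, Cmult, Ci, RtoC; simpl fst; simpl snd; field.
Qed.
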